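(* Let $\Omega\subset\mathbb{R}^N$, $N\ge 2$, be a bounded domain with smooth boundary, let $\alpha>0$, and let $\phi:(0,\infty)\to(0,\infty)$ be a $C^1$ function such that: $t\phi(t)\to 0$ as $t\to 0$ and $t\phi(t)\to\infty$ as $t\to\infty$; $t\mapsto t\phi(t)$ is strictly increasing on $(0,\infty)$; and there exist $\ell,m\in(1,N)$ with $\ell-1\le (t\phi(t))'/\phi(t)\le m-1$ for all $t>0$. Let $0\le\gamma<\ell-1$, let $a\ge0$, $a\not\equiv0$, satisfy $a\,d^{-\alpha}\in L_{\widetilde\Phi}(\Omega)$, and let $0\le b\in L^\sigma(\Omega)$ for some $\sigma>\ell/(\ell-\gamma-1)$. Then the problem $$-\operatorname{div}(\phi(|\nabla u|)\nabla u)=\frac{a(x)}{u^\alpha}+b(x)u^\gamma\ \text{ in }\Omega,\qquad u>0\ \text{ in }\Omega,\qquad u=0\ \text{ on }\partial\Omega,$$ admits a weak solution $u\in W_0^{1,\Phi}(\Omega)$ such that $u\ge Cd$ in $\Omega$ for some constant $C>0$. Moreover, $u\in L^\infty(\Omega)$ if $b\in L^\infty(\Omega)$ and either $0<\alpha\le1$ and $a\in L^q(\Omega)\cap L^{\ell^*/(\ell^*+\alpha-1)}(\Omega)$, or $\alpha>1$ and $a\in L^q(\Omega)$, where $N/\ell<q\le q(\alpha+\gamma)$ and $$q(s)=\begin{cases}\ell^*/s,&0<s\le1,\\ \big(\ell^*+(\alpha-1)\ell^*/\ell\big)/s,&s>1.\end{cases}$$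
   Context: For $x\in\Omega$, $d(x)=\inf_{y\in\partial\Omega}|x-y|$. The function $s\mapsto s\phi(s)$ is extended to $\mathbb{R}$ as an odd function, and $\Phi(t)=\int_0^t s\phi(s)\,ds$, $t\in\mathbb{R}$, which is an even $N$-function; its complementary function is $\widetilde\Phi(t)=\max_{s\ge0}\{ts-\Phi(s)\}$, $t\ge0$. For an $N$-function $\Psi$, $L_\Psi(\Omega)$ is the Orlicz space with the Luxemburg norm $\|u\|_\Psi=\inf\{\lambda>0:\int_\Omega\Psi(u/\lambda)\,dx\le1\}$. $W^{1,\Phi}(\Omega)$ is the Orlicz-Sobolev space of $u\in L_\Phi(\Omega)$ with weak derivatives in $L_\Phi(\Omega)$, normed by $\|u\|_{1,\Phi}=\|u\|_\Phi+\sum_{i=1}^N\|\partial u/\partial x_i\|_\Phi$; $W_0^{1,\Phi}(\Omega)$ is the closure of $C_0^\infty(\Omega)$ in it. $\ell^*=N\ell/(N-\ell)$. A weak solution $u\in W_0^{1,\Phi}(\Omega)$ of the problem is a function with $u>0$ a.e. in $\Omega$ and $\int_\Omega\phi(|\nabla u|)\nabla u\cdot\nabla\varphi\,dx=\int_\Omega\big(\frac{a(x)}{u^\alpha}+b(x)u^\gamma\big)\varphi\,dx$ for all $\varphi\in W_0^{1,\Phi}(\Omega)$. *)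

(* Defs.v *)
From HB Require Import structures.
From mathcomp Require Import all_boot all_order all_algebra.
From mathcomp Require Import all_classical all_reals all_analysis.

Set Implicit Arguments.
Unset Strict Implicit.
Unset Printing Implicit Defensive.

Import Order.TTheory GRing.Theory Num.Theory.
Import numFieldNormedType.Exports.

Local Open Scope classical_set_scope.
Local Open Scope ring_scope.

Definition rv_display : measure_display.
Proof. exact: default_measure_display. Qed.

Section rv_measurable.
Context {R : realType} (n : nat).

Definition rv_coord (i : 'I_n) (x : 'rV[R]_n) : measurableTypeR R := x ord0 i.

Let rv_set0 : g_sigma_preimage rv_coord set0.
Proof. exact: sigma_algebra0. Qed.

Let rv_setC A : g_sigma_preimage rv_coord A -> g_sigma_preimage rv_coord (~` A).
Proof. exact: sigma_algebraC. Qed.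

Let rv_bigcup (F : _^nat) : (forall i, g_sigma_preimage rv_coord (F i)) ->
  g_sigma_preimage rv_coord (\bigcup_i (F i)).
Proof. exact: sigma_algebra_bigcup. Qed.

(* Generated by the coordinate maps, i.e. the Borel sigma-algebra. *)
HB.instance Definition _ := @isMeasurable.Build rv_display
  'rV[R]_n (g_sigma_preimage rv_coord) rv_set0 rv_setC rv_bigcup.

Lemma measurable_rv_coord (i : 'I_n) :
  measurable_fun [set: 'rV[R]_n] (rv_coord i).
Proof.
move=> _ Y mY; rewrite setTI; apply: sub_sigma_algebra => /=.
rewrite -bigcup_seq/=; exists i => /=; first by rewrite mem_index_enum.
by exists Y => //; rewrite setTI.
Qed.

Lemma measurable_fun_rvP d (T : measurableType d) (f : T -> 'rV[R]_n) :
  (forall i, measurable_fun [set: T] (rv_coord i \o f)) ->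
  measurable_fun [set: T] f.
Proof.
move=> mf.
have mfS : g_sigma_preimage (fun i => rv_coord i \o f) `<=` measurable.
  apply: smallest_sub; first exact: sigma_algebra_measurable.
  elim/big_ind: _ => [|A B sA sB|i _ _ [B mB <-]]; first exact: sub0set.
    by rewrite subUset.
  exact: mf.
move=> _ A mA; rewrite setTI.
by apply: mfS; rewrite g_sigma_preimage_comp; exists A => //; rewrite setTI.
Qed.

End rv_measurable.

Section lebesgue_rv.
Context {R : realType}.

Definition rv_cons n (p : measurableTypeR R * 'rV[R]_n) : 'rV[R]_n.+1 :=
  \row_(i < n.+1) oapp (p.2 ord0) p.1 (unlift ord0 i).

Definition rv_uncons n (x : 'rV[R]_n.+1) : measurableTypeR R * 'rV[R]_n :=
  (x ord0 ord0, \row_(i < n) x ord0 (lift ord0 i)).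

Lemma rv_consK n : cancel (@rv_cons n) (@rv_uncons n).
Proof.
move=> [x v]; rewrite /rv_uncons /rv_cons; congr pair.
  by rewrite mxE unlift_none.
by apply/rowP => i; rewrite !mxE liftK.
Qed.

Lemma measurable_rv_cons n : measurable_fun setT (@rv_cons n).
Proof.
apply: measurable_fun_rvP => i.
case: (unliftP ord0 i) => [j|] ->.
- rewrite [X in measurable_fun _ X](_ : _ = rv_coord j \o snd).
    by apply: measurableT_comp => //; exact: measurable_rv_coord.
  by apply/funext => p /=; rewrite /rv_coord /rv_cons mxE liftK.
- rewrite [X in measurable_fun _ X](_ : _ = fst) //.
  by apply/funext => p /=; rewrite /rv_coord /rv_cons mxE unlift_none.
Qed.

Lemma measurable_rv_uncons n : measurable_fun setT (@rv_uncons n).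
Proof.
apply/measurable_fun_pairP; split; first exact: (measurable_rv_coord ord0).
apply: measurable_fun_rvP => i.
rewrite [X in measurable_fun _ X](_ : _ = rv_coord (lift ord0 i)).
  exact: measurable_rv_coord.
by apply/funext => p /=; rewrite /rv_coord mxE.
Qed.

Section step.
Context n (mu : {sigma_finite_measure set 'rV[R]_n -> \bar R}).

Definition lebesgue_rvS : set 'rV[R]_n.+1 -> \bar R :=
  pushforward (@lebesgue_measure R \x mu)%E (@rv_cons n).

HB.instance Definition _ := Measure.copy lebesgue_rvS
  (measure_function_pushforward__canonical__measure_function_Measure
     (@lebesgue_measure R \x mu)%E (@measurable_rv_cons n)).

Let lebesgue_rvS_sigma_finite : sigma_finite setT lebesgue_rvS.
Proof.
have /sigma_finiteP[F [TF ndF Foo]] := sigma_finiteT (@lebesgue_measure R).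
have /sigma_finiteP[G [TG ndG Goo]] := sigma_finiteT mu.
exists (fun k => @rv_uncons n @^-1` (F k `*` G k)).
  apply/esym; rewrite -subTset => x _.
  have [k _ Fk] : (\bigcup_k F k) (rv_uncons x).1 by rewrite -TF.
  have [l _ Gl] : (\bigcup_k G k) (rv_uncons x).2 by rewrite -TG.
  exists (maxn k l) => //; split.
    by move: Fk; exact/subsetPset/ndF/leq_maxl.
  by move: Gl; exact/subsetPset/ndG/leq_maxr.
move=> k; have [mF Fk] := Foo k; have [mG Gk] := Goo k; split.
  by rewrite -[X in measurable X]setTI; apply: measurable_rv_uncons => //;
    exact: measurableX.
rewrite /lebesgue_rvS /pushforward -comp_preimage.
rewrite [X in X @^-1` _](_ : _ = id); last first.
  by apply/funext => p /=; rewrite rv_consK.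
by rewrite preimage_id product_measure1E// lte_mul_pinfty// ge0_fin_numE.
Qed.

HB.instance Definition _ := Measure_isSigmaFinite.Build _ _ _
  lebesgue_rvS lebesgue_rvS_sigma_finite.

End step.

Fixpoint lebesgue_rv n : {sigma_finite_measure set 'rV[R]_n -> \bar R} :=
  if n is k.+1 then lebesgue_rvS (lebesgue_rv k) else dirac (0 : 'rV[R]_0).

End lebesgue_rv.

Section box.
Context {R : realType}.

Lemma measurable_rv_box n (A : 'I_n -> set (measurableTypeR R)) :
  (forall i, measurable (A i)) ->
  measurable [set x : 'rV[R]_n | forall i, A i (x ord0 i)].
Proof.
move=> mA; rewrite [X in measurable X](_ : _ =
    \bigcap_(i in [set: 'I_n]) (rv_coord i @^-1` A i)).
  apply: fin_bigcap_measurable; first exact: finite_finset.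
  move=> i _; rewrite -[X in measurable X]setTI.
  exact: (measurable_rv_coord i measurableT (mA i)).
by apply/seteqP; split=> [x Ax i _|x Ax i]; exact: Ax.
Qed.

Lemma lebesgue_rv_box n (A : 'I_n -> set (measurableTypeR R)) :
  (forall i, measurable (A i)) ->
  lebesgue_rv n [set x : 'rV[R]_n | forall i, A i (x ord0 i)] =
  (\prod_(i < n) lebesgue_measure (A i))%E.
Proof.
elim: n A => [|n IHn] A mA.
  by rewrite big_ord0 /= diracE mem_set // => -[].
rewrite big_ord_recl /= -IHn //.
rewrite -product_measure1E //; last first.
  exact: (@measurable_rv_box _ (fun i => A (lift ord0 i))).
congr ((_ \x _)%E _); apply/seteqP; split=> [[x v] /= Axv|[x v] /= [Ax Av] i].
  split=> [|i]; first by have := Axv ord0; rewrite mxE unlift_none.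
  by have := Axv (lift ord0 i); rewrite mxE liftK.
by rewrite mxE; case: (unliftP ord0 i) => [j|] ->.
Qed.

End box.

Section domains.
Context {R : realType}.

Definition dotv n (x y : 'rV[R]_n) : R := \sum_(i < n) x ord0 i * y ord0 i.

(* The library norm on ['rV[R]_n] is the max norm. *)
Definition enorm n (x : 'rV[R]_n) : R := Num.sqrt (dotv x x).

Definition partial n (i : 'I_n) (f : 'rV[R]_n -> R) (x : 'rV[R]_n) : R :=
  'D_(delta_mx ord0 i) f x.

Definition grad n (f : 'rV[R]_n -> R) (x : 'rV[R]_n) : 'rV[R]_n :=
  \row_(i < n) partial i f x.

(* C^oo: all iterated partial derivatives exist and are continuous. *)
Definition smooth n (f : 'rV[R]_n -> R) : Prop :=
  forall s : seq 'I_n, let g := foldr (@partial n) f s in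
  continuous g /\ forall i x, derivable g x (delta_mx ord0 i).

Definition test_fun n (Omega : set 'rV[R]_n) (f : 'rV[R]_n -> R) : Prop :=
  smooth f /\ exists K : set 'rV[R]_n,
    [/\ compact K, K `<=` Omega & forall x, ~ K x -> f x = 0].

Definition frontier n (Omega : set 'rV[R]_n) : set 'rV[R]_n :=
  closure Omega `\` interior Omega.

Definition bounded_domain n (Omega : set 'rV[R]_n) : Prop :=
  [/\ open Omega, connected Omega, Omega !=set0 & bounded_set Omega].

(* Near each boundary point, [Omega] is, up to relabelling and reorienting the
   coordinate axes, the region above the graph of a smooth function [g] of the
   other coordinates. *)
Definition smooth_boundary n (Omega : set 'rV[R]_n) : Prop :=
  forall x0, frontier Omega x0 ->
  exists (r : R) (i : 'I_n) (b : bool) (g : 'rV[R]_n.-1 -> R),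
    [/\ 0 < r, smooth g & forall x, enorm (x - x0) < r ->
      (Omega x <-> g (col' i x) < (-1) ^+ b * x ord0 i)].

Definition dist_frontier n (Omega : set 'rV[R]_n) (x : 'rV[R]_n) : R :=
  inf [set enorm (x - y) | y in frontier Omega].

End domains.

Section spaces.
Context {R : realType}.

Definition NPhi (phi : R -> R) (t : R) : R :=
  (* odd extension of [s |-> s * phi s]; its value at [0] is [0] *)
  let h := fun s => s * phi `|s| in
  if 0 <= t then \int[lebesgue_measure]_(s in `[0, t]) h s
  else - \int[lebesgue_measure]_(s in `[t, 0]) h s.

(* Extended to negative [t] as an even function. *)
Definition complementary (Psi : R -> R) (t : R) : R :=
  sup [set `|t| * s - Psi s | s in [set s | 0 <= s]].

Context {n : nat}.
Local Notation leb := (@lebesgue_rv R n).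
Implicit Types (Omega : set 'rV[R]_n) (u v : 'rV[R]_n -> R).

Definition luxemburg Omega (Psi : R -> R) u : \bar R :=
  ereal_inf [set l%:E | l in [set l : R |
    0 < l /\ (\int[leb]_(x in Omega) (Psi (u x / l))%:E <= 1)%E]].

Definition orlicz Omega (Psi : R -> R) u : Prop :=
  measurable_fun Omega u /\ (luxemburg Omega Psi u < +oo)%E.

Definition Lp_space Omega (p : \bar R) u : Prop :=
  measurable_fun Omega u /\ finite_norm leb p (u \_ Omega).

(* Only used for [u] and [G] in an Orlicz space on a bounded set, hence in L^1,
   where both integrals converge absolutely. *)
Definition weak_grad Omega u (G : 'rV[R]_n -> 'rV[R]_n) : Prop :=
  forall (i : 'I_n) psi, test_fun Omega psi ->
  \int[leb]_(x in Omega) (u x * partial i psi x) =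
  - \int[leb]_(x in Omega) (G x ord0 i * psi x).

(* [u] is in W^{1,Psi}(Omega), with weak gradient [G]. *)
Definition W1 Omega (Psi : R -> R) u (G : 'rV[R]_n -> 'rV[R]_n) : Prop :=
  [/\ orlicz Omega Psi u, forall i, orlicz Omega Psi (fun x => G x ord0 i) &
      weak_grad Omega u G].

Definition W1_norm Omega (Psi : R -> R) u (G : 'rV[R]_n -> 'rV[R]_n) : \bar R :=
  (luxemburg Omega Psi u +
   \sum_(i < n) luxemburg Omega Psi (fun x => G x ord0 i))%E.

(* [u] is in the W^{1,Psi}-closure of the test functions, with weak gradient
   [G]. *)
Definition W10 Omega (Psi : R -> R) u (G : 'rV[R]_n -> 'rV[R]_n) : Prop :=
  W1 Omega Psi u G /\
  forall e : R, 0 < e -> exists2 psi, test_fun Omega psi &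
    (W1_norm Omega Psi (fun x => u x - psi x)%R
       (fun x => G x - grad psi x)%R < e%:E)%E.

(* Both sides of the identity are required to be absolutely convergent
   integrals, since the library integral is total. *)
Definition weak_solution Omega (phi : R -> R) (alpha gamma : R)
    (a b u : 'rV[R]_n -> R) : Prop :=
  exists G : 'rV[R]_n -> 'rV[R]_n,
  [/\ W10 Omega (NPhi phi) u G,
      {ae leb, forall x, Omega x -> 0 < u x} &
      forall psi Gpsi, W10 Omega (NPhi phi) psi Gpsi ->
      let lhs := fun x => phi (enorm (G x)) * dotv (G x) (Gpsi x) in
      let rhs := fun x => (a x / u x `^ alpha + b x * u x `^ gamma) * psi x in
      [/\ leb.-integrable Omega (EFin \o lhs),
          leb.-integrable Omega (EFin \o rhs) &
          \int[leb]_(x in Omega) lhs x = \int[leb]_(x in Omega) rhs x]].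

End spaces.

Definition sobolev_exp {R : realType} (N : nat) (l : R) : R :=
  N%:R * l / (N%:R - l).

Definition q_exp {R : realType} (N : nat) (l alpha s : R) : R :=
  let ls := sobolev_exp N l in
  if s <= 1 then ls / s else (ls + (alpha - 1) * ls / l) / s.

(* Main.v *)
Require Import Defs.
From HB Require Import structures.
From mathcomp Require Import all_boot all_order all_algebra.
From mathcomp Require Import all_classical all_reals all_analysis measurable_realfun ess_sup_inf.
From mathcomp Require Import ring lra.

(* Everything is done with modulars instead of Luxemburg norms. Since
   (l - 1) phi <= (t phi)' <= (m - 1) phi, Phi lies between powers of exponents
   l and m, and P|x - y| <= e (P|x| + P|y|) + C (midpoint gap of P at x, y), so
   that minimising sequences converge strongly and no compactness is needed.

   Positive lower bound. Let w minimise the energy for the datum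
   min(a, 1) max(w, 1)^(-alpha). Tested with (v - k - w)^+, v a paraboloid, a
   supersolution satisfies the L^1 isoperimetric inequality on sublevel sets;
   hence if w < c on a small proportion of a ball, then w >= c/4 on the half
   ball. As w is close in L^1 to a test function, such a ball exists. Positivity
   spreads over the connected domain by comparison with the barriers
   c (exp(- lam |x - z|^2) - exp(- lam rho^2)), which also yield w >= C d from the
   interior balls that the C^2 graph of the boundary provides.

   Existence. Solving -div A(Du_{k+1}) = a max(u_{k+1}, w)^(-alpha) + b u_k^gamma
   from u_0 = w gives an increasing bounded sequence; its limit is >= w, and
   a w^(-alpha) <= C a d^(-alpha) belongs to the dual of L_Phi.

   Boundedness. On {u > k}, k >= 1, the datum is at most a + |B| u^(l - 1), and
   Stampacchia's lemma applies because q > N / l. *)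

Set Implicit Arguments.
Unset Strict Implicit.
Unset Printing Implicit Defensive.

Import Order.TTheory GRing.Theory Num.Theory.
Import numFieldNormedType.Exports.

Local Open Scope classical_set_scope.
Local Open Scope ring_scope.

(** * Integrals of real-valued functions *)

(** The function Phi is not homogeneous and its modular is only quasi-subadditive, with constant
    2^m. Hence the growing weights in the completeness argument, and hence a De Giorgi iteration in
    the L^1 norm of the gradient: the paraboloid has gradient at most tau, every value of t phi(t)
    is compared with the single number h(2 tau), and this number cancels. The term a / u^alpha is
    uncontrolled until u has a lower bound. Replacing u by max(u, w) makes it a nonincreasing
    function of u, bounded by a w^(-alpha), with a concave primitive; each approximate problem is
    then variational and obeys comparison. The term b u^gamma increases with u, so it is frozen at
    the previous iterate, and the monotonicity of the iterates makes it absorbable. Inequalities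
    hold almost everywhere, whereas the barrier argument uses uncountably many balls. Constants are
    therefore kept uniform over families of balls, and exceptional sets are united over rational
    centres and radii. *)

(* Locked: otherwise unification tends to unfold failing comparisons of integrals. *)
HB.lock Definition I d (T : measurableType d) (R : realType)
  (mu : {measure set T -> \bar R}) (D : set T) (f : T -> R) : R :=
  \int[mu]_(x in D) f x.

Lemma IE d (T : measurableType d) (R : realType)
  (mu : {measure set T -> \bar R}) (D : set T) (f : T -> R) :
  I mu D f = \int[mu]_(x in D) f x.
Proof. by rewrite unlock. Qed.

Section real_integrals.
Context d (T : measurableType d) (R : realType).
Variables (mu : {measure set T -> \bar R}) (D : set T).
Hypothesis mD : measurable D.
Implicit Types (f g h : T -> R) (P Q : T -> Prop).
Local Notation I := (I mu D).

Definition aeD P := {ae mu, forall x, D x -> P x}.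
Definition L1 f := mu.-integrable D (EFin \o f).

Lemma aeDT P : (forall x, D x -> P x) -> aeD P.
Proof. by move=> h; apply: aeW => x; exact: h. Qed.

Lemma aeDS P Q : (forall x, D x -> P x -> Q x) -> aeD P -> aeD Q.
Proof. by move=> PQ; rewrite /aeD; apply: filterS => x Px Dx; apply: PQ => //; exact: Px. Qed.

Lemma aeDS2 P P' Q : (forall x, D x -> P x -> P' x -> Q x) ->
  aeD P -> aeD P' -> aeD Q.
Proof.
by move=> PQ; rewrite /aeD; apply: filterS2 => x Px Px' Dx; apply: PQ; [|exact: Px|exact: Px'].
Qed.

Lemma aeDS3 P P' P'' Q : (forall x, D x -> P x -> P' x -> P'' x -> Q x) ->
  aeD P -> aeD P' -> aeD P'' -> aeD Q.
Proof.
move=> PQ; rewrite /aeD; apply: filterS3 => x Px Px' Px'' Dx.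
by apply: PQ; [|exact: Px|exact: Px'|exact: Px''].
Qed.

Lemma aeD_nat (P : nat -> T -> Prop) :
  (forall k, aeD (P k)) -> aeD (fun x => forall k, P k x).
Proof.
move=> aP; have := negligible_bigcup aP; apply: negligibleS => x /= /not_implyP[Dx].
move=> /existsNP[k nP]; exists k => //=; exact/not_implyP.
Qed.

Lemma L1_meas f : L1 f -> measurable_fun D f.
Proof. by move=> /integrableP[/measurable_EFinP]. Qed.

Lemma L1D f g : L1 f -> L1 g -> L1 (fun x => f x + g x).
Proof.
move=> If Ig; apply: eq_integrable (integrableD mD If Ig) => // x _ /=.
Qed.

Lemma L1Z c f : L1 f -> L1 (fun x => c * f x).
Proof. by move=> If; apply: eq_integrable (integrableZl mD c If). Qed.

Lemma L1N f : L1 f -> L1 (fun x => - f x).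
Proof. by move=> /(L1Z (-1)); apply: eq_integrable => // x _ /=; rewrite mulN1r. Qed.

Lemma L1B f g : L1 f -> L1 g -> L1 (fun x => f x - g x).
Proof. by move=> If Ig; apply: L1D => //; exact: L1N. Qed.

Lemma L1_norm f : L1 f -> L1 (fun x => `|f x|).
Proof. exact: integrable_norm. Qed.

Lemma L1_0 : L1 (fun=> 0).
Proof. exact: integrable0. Qed.

Lemma L1_sum (J : Type) (s : seq J) (F : J -> T -> R) :
  (forall j, L1 (F j)) -> L1 (fun x => \sum_(j <- s) F j x).
Proof.
move=> LF; elim: s => [|j s IH].
  by apply: eq_integrable L1_0 => // x _ /=; rewrite big_nil.
by apply: eq_integrable (L1D (LF j) IH) => // x _ /=; rewrite big_cons.
Qed.

Lemma L1_ae f g : measurable_fun D f -> L1 g -> aeD (fun x => `|f x| <= g x) -> L1 f.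
Proof.
move=> mf Ig fg; apply/integrableP; split; first exact/measurable_EFinP.
have := integrableP _ _ _ (L1_norm Ig) => -[mg]; apply: le_lt_trans.
apply: ae_ge0_le_integral => //.
- by do 2 apply: measurableT_comp => //.
- by apply: measurableT_comp.
move: fg; rewrite /aeD; apply: filterS => x fg Dx /=; rewrite lee_fin normr_id.
exact: le_trans (fg Dx) (ler_norm _).
Qed.

Lemma L1_le f g : measurable_fun D f -> L1 g ->
  (forall x, D x -> `|f x| <= g x) -> L1 f.
Proof. by move=> mf Ig fg; apply: L1_ae Ig _ => //; exact: aeDT. Qed.

Lemma I_eq f g : (forall x, D x -> f x = g x) -> I f = I g.
Proof. by move=> fg; rewrite !IE; apply: eq_Rintegral => x; rewrite inE => Dx; exact: fg. Qed.

Lemma L1_eq f g : (forall x, D x -> f x = g x) -> L1 f -> L1 g.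
Proof.
by move=> fg; apply: eq_integrable => // x; rewrite inE => Dx /=; rewrite fg.
Qed.

Lemma I_D f g : L1 f -> L1 g -> I (fun x => f x + g x) = I f + I g.
Proof. by rewrite !IE; exact: RintegralD. Qed.

Lemma I_B f g : L1 f -> L1 g -> I (fun x => f x - g x) = I f - I g.
Proof. by rewrite !IE; exact: RintegralB. Qed.

Lemma I_Z c f : L1 f -> I (fun x => c * f x) = c * I f.
Proof. by move=> If; rewrite !IE; apply: RintegralZl. Qed.

Lemma I_N f : L1 f -> I (fun x => - f x) = - I f.
Proof.
by move=> If; rewrite -mulN1r -I_Z//; apply: I_eq => x _; rewrite mulN1r.
Qed.

Lemma I_0 : I (fun=> 0) = 0.
Proof. by rewrite !IE /Rintegral integral0_eq. Qed.

Lemma I_sum (J : Type) (s : seq J) (F : J -> T -> R) :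
  (forall j, L1 (F j)) -> I (fun x => \sum_(j <- s) F j x) = \sum_(j <- s) I (F j).
Proof.
move=> LF; elim: s => [|j s IH].
  by rewrite big_nil -[RHS]I_0; apply: I_eq => x _; rewrite big_nil.
rewrite big_cons -IH -I_D//; last exact: L1_sum.
by apply: I_eq => x _; rewrite big_cons.
Qed.

Lemma EFin_I f : L1 f -> (\int[mu]_(x in D) (f x)%:E)%E = (I f)%:E.
Proof. by move=> If; rewrite !IE /Rintegral fineK//; exact: integrable_fin_num. Qed.

Lemma I_ge0 f : (forall x, D x -> 0 <= f x) -> 0 <= I f.
Proof. by rewrite IE; exact: Rintegral_ge0. Qed.

Lemma I_ae f g : measurable_fun D f -> measurable_fun D g ->
  aeD (fun x => f x = g x) -> I f = I g.
Proof.
move=> mf mg fg; rewrite !IE /Rintegral; congr fine.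
apply: ae_eq_integral => //; [exact/measurable_EFinP..|].
by move: fg; rewrite /aeD; apply: filterS => x fg Dx /=; rewrite fg.
Qed.

Lemma L1_eq_ae f g : measurable_fun D g -> aeD (fun x => f x = g x) -> L1 f -> L1 g.
Proof.
move=> mg fg Lf; apply: (L1_ae mg (L1_norm Lf)).
by apply: aeDS fg => x Dx ->.
Qed.

Lemma I_ge0_ae f : L1 f -> aeD (fun x => 0 <= f x) -> 0 <= I f.
Proof.
move=> Lf f0; rewrite (@I_ae f (fun x => `|f x|)); last 3 first.
- exact: L1_meas.
- exact/L1_meas/L1_norm.
- by apply: aeDS f0 => x _ ?; rewrite ger0_norm.
exact: I_ge0.
Qed.

Lemma I_le_ae f g : L1 f -> L1 g -> aeD (fun x => f x <= g x) -> I f <= I g.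
Proof.
move=> Lf Lg fg; rewrite -subr_ge0 -I_B//; apply: I_ge0_ae; first exact: L1B.
by apply: aeDS fg => x _; rewrite subr_ge0.
Qed.

Lemma I_le f g : L1 f -> L1 g -> (forall x, D x -> f x <= g x) -> I f <= I g.
Proof. by move=> Lf Lg fg; apply: I_le_ae => //; exact: aeDT. Qed.

Lemma I_norm f : L1 f -> `|I f| <= I (fun x => `|f x|).
Proof. by rewrite !IE; exact: le_normr_Rintegral. Qed.

Lemma I_dct (F : nat -> T -> R) f g :
  (forall k, measurable_fun D (F k)) -> measurable_fun D f -> L1 g ->
  (forall k, aeD (fun x => `|F k x| <= g x)) ->
  aeD (fun x => F k x @[k --> \oo] --> f x) ->
  [/\ L1 f, forall k, L1 (F k) & I (F k) @[k --> \oo] --> I f].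
Proof.
move=> mF mf Lg Fg Ff.
have LF k : L1 (F k) by exact: L1_ae (Fg k).
have [] := @dominated_convergence _ _ _ mu D mD (fun k => EFin \o F k) (EFin \o f)
  (EFin \o g).
- by move=> k; exact/measurable_EFinP.
- exact/measurable_EFinP.
- by move: Ff; rewrite /aeD; apply: filterS => x Ff Dx; apply: cvg_EFin; [exact: nearW|exact: Ff].
- exact: Lg.
- have := aeD_nat Fg; rewrite /aeD; apply: filterS => x Fgx k Dx /=; rewrite lee_fin.
  exact: Fgx.
move=> Lf _ cI; split => //.
move: cI; rewrite /= EFin_I// => /fine_cvg.
by rewrite /comp; under eq_fun do rewrite -[fine _]/(Rintegral mu D (F _)) -IE.
Qed.

Lemma I_fatou (F : nat -> T -> R) f C :
  (forall k, L1 (F k)) -> (forall k, aeD (fun x => 0 <= F k x)) ->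
  measurable_fun D f ->
  (forall k, I (F k) <= C) -> aeD (fun x => F k x @[k --> \oo] --> f x) ->
  L1 f /\ I f <= C.
Proof.
move=> LF F0 mf FC Ff.
(* [F k] is nonnegative only almost everywhere; Fatou's lemma is applied to the absolute values,
   which have the same integrals. *)
have := @fatou _ _ _ mu D mD (fun k => EFin \o (fun x => `|F k x|)) _ _.
have mF k : measurable_fun D (EFin \o (fun x => `|F k x|)).
  exact/measurable_EFinP/L1_meas/L1_norm.
move=> /(_ mF) /(_ (fun k x _ => normr_ge0 _)).
have -> : (\int[mu]_(x in D) limn_einf (fun k => (`|F k x|)%:E) =
   \int[mu]_(x in D) (`|f x|)%:E)%E.
  apply: ae_eq_integral => //.
  - rewrite /limn_einf; apply: measurableT_comp => //.
    apply: (measurable_fun_limn_esup (f := fun k x => (- `|F k x|%:E)%E)) => k.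
    exact: measurableT_comp (mF k).
  - by apply/measurable_EFinP; exact: measurableT_comp.
  - move: Ff; rewrite /aeD; apply: filterS => x Ff Dx; have := Ff Dx => {}Ff.
    have c : ((`|F k x|)%:E : \bar R) @[k --> \oo] --> (`|f x|)%:E.
      by apply: cvg_EFin; [exact: nearW|exact: cvg_norm].
    by rewrite is_cvg_limn_einfE//; [exact/cvg_lim|apply/cvg_ex; eexists; exact: c].
move=> h.
have hC : (\int[mu]_(x in D) (`|f x|)%:E <= C%:E)%E.
  apply: le_trans h _; apply: le_trans (limn_einf_sup _) _.
  rewrite limn_esup_lim; apply: lime_le; first exact: is_cvg_esups.
  apply: nearW => k; apply: ge_ereal_sup => _ [j /= _ <-] /=.
  rewrite EFin_I; last exact: L1_norm.
  rewrite lee_fin (@I_ae _ (F j)) //; [exact/L1_meas/L1_norm|exact/L1_meas|].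
  by apply: aeDS (F0 j) => x _ ?; rewrite ger0_norm.
have Lf : L1 f.
  apply/integrableP; split; first exact/measurable_EFinP.
  by apply: le_lt_trans hC _; rewrite ltry.
split=> //; rewrite -lee_fin; apply: le_trans hC.
rewrite EFin_I; last exact: L1_norm.
by rewrite lee_fin; apply: le_trans (ler_norm _) (I_norm Lf).
Qed.

Lemma I_eq0 f : L1 f -> aeD (fun x => 0 <= f x) -> I f <= 0 -> aeD (fun x => f x = 0).
Proof.
move=> Lf f0 If0.
have mf : measurable_fun D (EFin \o f) by exact/measurable_EFinP/L1_meas.
have := @ae_eq_integral_abs _ _ _ mu D mD (EFin \o f) mf; move=> [+ _].
have -> : (\int[mu]_(x in D) `|(EFin \o f) x| = (I (fun x => `|f x|))%:E)%E.
  by rewrite -EFin_I//; exact: L1_norm.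
have -> : I (fun x => `|f x|) = I f.
  apply: I_ae; [exact/L1_meas/L1_norm|exact: L1_meas|].
  by apply: aeDS f0 => x _ ?; rewrite ger0_norm.
have -> : I f = 0 by apply/eqP; rewrite eq_le If0 I_ge0_ae.
by move=> /(_ erefl); rewrite /aeD; apply: filterS => x h Dx; have /= := h Dx => -[].
Qed.

(** By monotone convergence the sum of the series has integral at most C, so it is finite almost
    everywhere. In this way summable modulars give pointwise convergence. *)
Lemma I_series (F : nat -> T -> R) C :
  (forall k, L1 (F k)) -> (forall k x, D x -> 0 <= F k x) ->
  (forall n, \sum_(k < n) I (F k) <= C) ->
  aeD (fun x => exists M, forall n, \sum_(k < n) F k x <= M).
Proof.
move=> LF F0 FC.
have mE : measurable_fun D (fun x => \sum_(0 <= k <oo) (F k x)%:E)%E.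
  apply: (@ge0_emeasurable_sum _ _ _ D (fun k x => (F k x)%:E) xpredT).
    by move=> k x Dx _; rewrite lee_fin F0.
  by move=> k _; exact/measurable_EFinP/L1_meas.
have int_lt : (\int[mu]_(x in D) (\sum_(0 <= k <oo) (F k x)%:E) <= C%:E)%E.
  rewrite integral_nneseries//; last by move=> k; exact/measurable_EFinP/L1_meas.
  apply: lime_le.
    apply: is_cvg_nneseries => k _ _.
    by apply: integral_ge0 => x Dx; rewrite lee_fin F0.
  apply: nearW => n; rewrite big_mkord.
  under eq_bigr do rewrite EFin_I//.
  by rewrite sumEFin lee_fin.
have E0 x : D x -> (0 <= \sum_(0 <= k <oo) (F k x)%:E)%E.
  by move=> Dx; apply: nneseries_ge0 => k _ _; rewrite lee_fin F0.
have : mu.-integrable D (fun x => \sum_(0 <= k <oo) (F k x)%:E)%E.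
  apply/integrableP; split => //.
  under eq_integral => x do [rewrite inE => Dx; rewrite gee0_abs; last exact: E0].
  by apply: le_lt_trans int_lt _; rewrite ltry.
move=> /(integrable_ae mD); rewrite /aeD; apply: filterS => x fin Dx; have {}fin := fin Dx.
exists (fine (\sum_(0 <= k <oo) (F k x)%:E)%E) => n.
rewrite -lee_fin fineK// -sumEFin -(big_mkord xpredT (fun k => (F k x)%:E)).
by apply: nneseries_lim_ge => k _ _; rewrite lee_fin F0.
Qed.

End real_integrals.
Arguments aeD {d T R}.
Arguments L1 {d T R}.

(** * Lebesgue measure on row vectors *)

Section rv_measure.
Context {R : realType}.

(** The sigma-algebra is generated by the coordinates, so U has to be exhibited as a countable union
    of boxes: those with rational centre and half-side 1/(k+1) that lie in U. *)
Lemma open_rv_measurable n (U : set 'rV[R]_n) : open U -> measurable U.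
Proof.
move=> oU.
pose box (q : 'rV[rat]_n) (e : R) := [set x : 'rV[R]_n | forall i,
  `]ratr (q ord0 i) - e, ratr (q ord0 i) + e[%classic (x ord0 i)].
have mbox q e : measurable (box q e).
  apply: (measurable_rv_box (A := fun i =>
   `]ratr (q ord0 i) - e, ratr (q ord0 i) + e[%classic)) => i.
  exact: measurable_itv.
pose F j := if @unpickle ('rV[rat]_n * nat)%type j is Some p then
  if `[< box p.1 p.2.+1%:R^-1 `<=` U >] then box p.1 p.2.+1%:R^-1 else set0 else set0.
have -> : U = \bigcup_j F j.
  apply/seteqP; split => [x Ux|x [j _]]; last first.
    rewrite /F; case: unpickle => [[q k]|//] /=.
    by case: ifPn => [/asboolP|//]; exact.
  have /nbhs_ballP[e /= e0 eU] : nbhs x U by exact: open_nbhs_nbhs.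
  (* All points of a box of half-side 1/(k+1) containing x are within 2/(k+1) of x, whence the bound
     e / 2. *)
  pose k := Num.truncn (2 / e).
  have ke : k.+1%:R^-1 < e / 2.
    rewrite -[e / 2]invrK ltf_pV2 ?posrE ?invr_gt0 ?divr_gt0//.
    by rewrite invfM invrK mulrC; exact: truncnS_gt.
  have k0 : (0 : R) < k.+1%:R^-1 by rewrite invr_gt0 ltr0n.
  set e' := k.+1%:R^-1 in ke k0.
  have qP i : {q : rat | ratr q \in `](x ord0 i - e'), (x ord0 i + e')[}.
    have xx : x ord0 i - e' < x ord0 i + e' by lra.
    by apply: cid; have [q ?] := rat_in_itvoo xx; exists q.
  pose q : 'rV[rat]_n := \row_i sval (qP i).
  exists (pickle (q, k)) => //; rewrite /F pickleK /= -/e'.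
  have bx : box q e' x.
    move=> i /=; rewrite /q mxE; have := svalP (qP i); rewrite !in_itv /=; lra.
  case: ifPn => // /asboolP; apply: contra_notP => _.
  move=> y yb; apply: eU; split => // a i; rewrite ord1 /ball /=.
  have := bx i; have := yb i; rewrite /= !in_itv /= => h1 h2.
  rewrite ltr_norml; lra.
apply: bigcupT_measurable => j; rewrite /F; case: unpickle => [[q k]|//].
by case: ifP => // _; exact: mbox.
Qed.

Lemma closed_rv_measurable n (U : set 'rV[R]_n) : closed U -> measurable U.
Proof.
by move=> cU; rewrite -[U]setCK; apply: measurableC; apply: open_rv_measurable;
  exact: closed_openC.
Qed.

Lemma continuous_rv_measurable n (f : 'rV[R]_n -> R) (D : set 'rV[R]_n) :
  continuous f -> measurable_fun D f.
Proof.
move=> /continuousP cf; apply: measurable_funTS.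
apply: (measurability _ (RGenOpens.measurableE R)).
move=> _ [_ [a [b ->] <-]]; rewrite setTI; apply: open_rv_measurable.
exact/cf/interval_open.
Qed.

Lemma lebesgue_measure_shift (v : R) (A : set (measurableTypeR R)) : measurable A ->
  lebesgue_measure ((fun x => x + v) @^-1` A) = lebesgue_measure A.
Proof.
move=> mA.
have mv : measurable_fun setT (fun x : measurableTypeR R => (x + v : measurableTypeR R)).
  by apply: measurable_funD => //; exact: measurable_cst.
pose m' := measure_function_pushforward__canonical__measure_function_Measure
  (@lebesgue_measure R) mv.
apply/esym; apply: (@lebesgue_measure_unique R m') => // X.
move=> /ocitvP[->|[[a b] /= ab ->]]; first by rewrite !measure0.
rewrite /m' /= /pushforward.
have -> : (fun x => x + v) @^-1` `]a, b] = `]a - v, b - v]%classic.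
  by apply/seteqP; split => x /=; rewrite !in_itv /=; lra.
rewrite !lebesgue_measure_itv /= !lte_fin ltrD2r ab -!EFinB; congr EFin; lra.
Qed.

Lemma measurable_rv_shift n (v : 'rV[R]_n) :
  measurable_fun setT (fun x : 'rV[R]_n => x + v).
Proof.
apply: measurable_fun_rvP => i.
rewrite [X in measurable_fun _ X](_ : _ = fun x : 'rV[R]_n =>
  (rv_coord i x + v ord0 i : measurableTypeR R)).
  by apply: measurable_funD; [exact: measurable_rv_coord|exact: measurable_cst].
by apply/funext => x; rewrite /rv_coord /= mxE.
Qed.

(** Induction on the dimension: through [rv_cons] the translation becomes the product [tau] of two
    translations, and a measure that agrees with the product measure on rectangles is the product
    measure. *)
Lemma lebesgue_rv_shift n (v : 'rV[R]_n) (A : set 'rV[R]_n) : measurable A ->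
  lebesgue_rv n ((fun x => x + v) @^-1` A) = lebesgue_rv n A.
Proof.
elim: n v A => [|n IH] v A mA.
  congr (lebesgue_rv 0 _); apply/seteqP; split => x /=;
    by rewrite (_ : x + v = x)//; apply/rowP => -[].
have mB : measurable (@rv_cons R n @^-1` A).
  by rewrite -[X in measurable X]setTI; exact: measurable_rv_cons.
pose v0 := v ord0 ord0; pose v' : 'rV[R]_n := \row_i v ord0 (lift ord0 i).
pose tau (p : measurableTypeR R * 'rV[R]_n) : measurableTypeR R * 'rV[R]_n :=
  (p.1 + v0, p.2 + v').
have mtau : measurable_fun setT tau.
  apply/measurable_fun_pairP; split.
    by apply: measurable_funD => //; exact: measurable_cst.
  exact: (measurableT_comp (measurable_rv_shift v')).
pose m' := measure_function_pushforward__canonical__measure_function_Measure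
  (@lebesgue_measure R \x lebesgue_rv n)%E mtau.
rewrite /= /lebesgue_rvS /pushforward.
rewrite [RHS](@product_measure_unique _ _ _ _ R _ _ m')//; last first.
  move=> X Y mX mY; rewrite /m' /= /pushforward.
  have -> : tau @^-1` (X `*` Y) = ((fun x => x + v0) @^-1` X) `*`
    ((fun y => y + v') @^-1` Y) by apply/seteqP; split => -[x y].
  rewrite product_measure1E; last 2 first.
  - rewrite -[X in measurable X]setTI.
    have : measurable_fun setT (fun x : measurableTypeR R => (x + v0 : measurableTypeR R)).
      by apply: measurable_funD => //; exact: measurable_cst.
    by move=> /(_ measurableT X mX).
  - by rewrite -[X in measurable X]setTI; exact: (measurable_rv_shift v').
  by congr (_ * _)%E; [exact: lebesgue_measure_shift|exact: IH].
rewrite /m' /= /pushforward; congr ((_ \x _)%E _).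
apply/seteqP; split => -[x y]; rewrite /tau /=;
  rewrite (_ : rv_cons (x, y) + v = rv_cons (x + v0, y + v'))//;
  by apply/rowP => i; rewrite !mxE; case: unliftP => [j ->|->] /=; rewrite ?mxE.
Qed.

(** The source of integration by parts: by translation invariance the integral of a difference
    quotient vanishes. *)
Lemma I_shift n (f : 'rV[R]_n -> R) (v : 'rV[R]_n) :
  L1 (lebesgue_rv n) setT f ->
  L1 (lebesgue_rv n) setT (fun x => f (x + v)) /\
  I (lebesgue_rv n) setT (fun x => f (x + v)) = I (lebesgue_rv n) setT f.
Proof.
move=> Lf; pose ph (x : 'rV[R]_n) := x + v.
have mph : measurable_fun setT ph := measurable_rv_shift v.
pose m' := measure_function_pushforward__canonical__measure_function_Measure
  (lebesgue_rv n) mph.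
have mE A : measurable A -> lebesgue_rv n A = m' A.
  by move=> mA; rewrite /m' /= /pushforward lebesgue_rv_shift.
have mf := L1_meas Lf.
have L' : L1 (lebesgue_rv n) setT (fun x => f (x + v)).
  have mfph : measurable_fun setT (fun x : 'rV[R]_n => f (x + v)) by exact: measurableT_comp.
  apply/integrableP; split; first exact/measurable_EFinP.
  have /integrableP[_] := Lf; apply: le_lt_trans.
  rewrite [leRHS](@eq_measure_integral _ _ _ setT m'); last by move=> A mA _; exact: mE.
  rewrite ge0_integral_pushforward//.
  by apply: measurableT_comp => //; exact/measurable_EFinP.
split=> //; rewrite !IE /Rintegral; congr fine.
rewrite [RHS](@eq_measure_integral _ _ _ setT m'); last by move=> A mA _; exact: mE.
rewrite (@integral_pushforward _ _ _ _ _ _ mph)//.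
exact/measurable_EFinP.
Qed.

Lemma ler_rv_norm n (x : 'rV[R]_n) i : `|x ord0 i| <= `|x|.
Proof.
rewrite [`|x|]mx_normrE.
exact: (le_bigmax _ (fun ij : 'I_1 * 'I_n => `|x ij.1 ij.2|) (ord0, i)).
Qed.

Lemma lebesgue_rv_bounded n (A : set 'rV[R]_n) : measurable A -> bounded_set A ->
  (lebesgue_rv n A < +oo)%E.
Proof.
move=> mA [M [_ HM]]; have {}HM := HM (`|M| + 1).
have MM : M < `|M| + 1 by rewrite (le_lt_trans (ler_norm _))// ltrDl.
have {HM}MM := HM MM; set K : R := `|M| + 1 in MM.
pose B := [set x : 'rV[R]_n | forall i, `[-K, K]%classic (x ord0 i)].
have mI : measurable (`[-K, K]%classic : set (measurableTypeR R)) by exact: measurable_itv.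
have AB : A `<=` B.
  move=> x /MM /= xK i; rewrite /= in_itv /= -ler_norml; apply: le_trans xK.
  exact: ler_rv_norm.
have mB : measurable B by exact: (measurable_rv_box (A := fun=> `[-K, K]%classic)).
suff : (lebesgue_rv n B < +oo)%E.
  by apply: le_lt_trans; apply: le_measure; rewrite ?inE.
rewrite /B (lebesgue_rv_box (A := fun=> `[-K, K]%classic))//.
suff : (\prod_(i < n) lebesgue_measure (`[(- K)%R, K]%classic : set (measurableTypeR R)))%E
  \is a fin_num by rewrite ltey_eq => ->.
elim/big_ind : _ => [//|x y|i _]; first exact: fin_numM.
by rewrite lebesgue_measure_itv /=; case: ifP.
Qed.
End rv_measure.

(** * Smooth functions *)

Section smooth_functions.
Context {R : realType}.

(** Both difference quotients are the same function of h. Derivatives along v thus reduce to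
    functions of one variable, to which the chain rule and the mean value theorem apply. *)
Lemma is_derive_line n (f : 'rV[R]_n -> R) (x v : 'rV[R]_n) (t a : R) :
  is_derive (x + t *: v) v f a <-> is_derive t 1 (fun s => f (x + s *: v)) a.
Proof.
have E : (fun h => h^-1 *: ((f \o shift (x + t *: v)) (h *: v) - f (x + t *: v))) =
  (fun h => h^-1 *: (((fun s => f (x + s *: v)) \o shift t) (h *: (1 : R)) - f (x + t *: v))).
  apply/funext => h /=; congr (_ *: (f _ - _)).
  by rewrite [h *: 1]mulr1 scalerDl addrCA.
split=> -[d <-]; split; rewrite /derivable /derive.
- by move: d; rewrite /derivable E.
- by rewrite E.
- by rewrite E.
- by rewrite E.
Qed.

Lemma is_derive_line0 n (f : 'rV[R]_n -> R) (x v : 'rV[R]_n) (a : R) :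
  is_derive x v f a <-> is_derive (0 : R) 1 (fun s => f (x + s *: v)) a.
Proof. by rewrite -is_derive_line scale0r addr0. Qed.

Lemma is_derive_comp n (f : 'rV[R]_n -> R) (F : R -> R) (x v : 'rV[R]_n) (a b : R) :
  is_derive x v f a -> is_derive (f x) 1 F b -> is_derive x v (F \o f) (b * a).
Proof.
move=> /is_derive_line0 fa Fb; apply/is_derive_line0.
by apply: (@is_derive1_comp _ F (fun s => f (x + s *: v)));
  rewrite ?scale0r ?addr0.
Qed.

(** A recursive form of C^k. [smooth] quantifies over lists of partial derivatives, whereas this
    form lends itself to induction on k for sums, products and compositions; C^1 is the regularity
    that integration by parts uses. *)
Fixpoint Ck n k (f : 'rV[R]_n -> R) : Prop := continuous f /\
  if k is k'.+1 then forall i, (forall x, derivable f x (delta_mx ord0 i)) /\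
    Ck k' (partial i f) else True.

Lemma Ck_continuous n k (f : 'rV[R]_n -> R) : Ck k f -> continuous f.
Proof. by case: k => [|k] []. Qed.

Lemma Ck_derivable n k (f : 'rV[R]_n -> R) i x : Ck k.+1 f ->
  derivable f x (delta_mx ord0 i).
Proof. by move=> [_ /(_ i)[]]. Qed.

Lemma Ck_partial n k (f : 'rV[R]_n -> R) i : Ck k.+1 f -> Ck k (partial i f).
Proof. by move=> [_ /(_ i)[]]. Qed.

Lemma Ck_is_derive n k (f : 'rV[R]_n -> R) i x : Ck k.+1 f ->
  is_derive x (delta_mx ord0 i) f (partial i f x).
Proof. by move=> /(@Ck_derivable _ _ _ i x) d; split. Qed.

Lemma CkW n k (f : 'rV[R]_n -> R) : Ck k.+1 f -> Ck k f.
Proof.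
elim: k f => [|k IH] f [cf df]; split => // i.
by have [d1 d2] := df i; split => //; exact: IH.
Qed.

Lemma smoothP n (f : 'rV[R]_n -> R) : smooth f <-> forall k, Ck k f.
Proof.
have sp g i : smooth g -> smooth (partial i g).
  by move=> sg s; have := sg (rcons s i); rewrite foldr_rcons.
split=> [sf k|Cf s].
  elim: k f sf => [|k IH] f sf; first by split => //; have [] := sf [::].
  split=> [|i]; first by have [] := sf [::].
  by split; [have [_ d] := sf [::]; move=> x; exact: d|exact/IH/sp].
elim/last_ind : s f Cf => [|s i IH] f Cf /=.
  by split=> [|i x]; [exact: (Ck_continuous (Cf 0%N))|exact: Ck_derivable (Cf 1%N)].
by rewrite foldr_rcons; apply: IH => k; exact: Ck_partial (Cf k.+1).
Qed.

Lemma Ck_S n k (f : 'rV[R]_n -> R) (df : 'I_n -> 'rV[R]_n -> R) :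
  continuous f -> (forall i x, is_derive x (delta_mx ord0 i) f (df i x)) ->
  (forall i, Ck k (df i)) -> Ck k.+1 f.
Proof.
move=> cf dfi Cdf; split => // i; split=> [x|]; first by have [] := dfi i x.
rewrite (_ : partial i f = df i)//; apply/funext => x.
by rewrite /partial; have [] := dfi i x.
Qed.

Lemma Ck_cst n k (c : R) : Ck k (fun _ : 'rV[R]_n => c).
Proof.
elim: k c => [|k IH] c; first by split => //; exact: cst_continuous.
by apply: (Ck_S (df := fun _ _ => 0)) => //; exact: cst_continuous.
Qed.

Lemma Ck_D n k (f g : 'rV[R]_n -> R) : Ck k f -> Ck k g -> Ck k (fun x => f x + g x).
Proof.
elim: k f g => [|k IH] f g Cf Cg.
  by split=> // x; apply: (@continuousD _ _ _ f g); [exact: (Ck_continuous Cf)|exact: (Ck_continuous Cg)].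
apply: (Ck_S (df := fun i x => partial i f x + partial i g x)).
- by move=> x; apply: (@continuousD _ _ _ f g); [exact: (Ck_continuous Cf)|exact: (Ck_continuous Cg)].
- by move=> i x; apply: is_deriveD; [exact: (Ck_is_derive _ _ Cf)|exact: (Ck_is_derive _ _ Cg)].
- by move=> i; apply: IH; exact: Ck_partial.
Qed.

Lemma Ck_M n k (f g : 'rV[R]_n -> R) : Ck k f -> Ck k g -> Ck k (fun x => f x * g x).
Proof.
elim: k f g => [|k IH] f g Cf Cg.
  by split=> // x; apply: (@continuousM _ _ f g); [exact: (Ck_continuous Cf)|exact: (Ck_continuous Cg)].
apply: (Ck_S (df := fun i x => f x * partial i g x + g x * partial i f x)).
- by move=> x; apply: (@continuousM _ _ f g); [exact: (Ck_continuous Cf)|exact: (Ck_continuous Cg)].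
- by move=> i x; apply: is_deriveM; [exact: (Ck_is_derive _ _ Cf)|exact: (Ck_is_derive _ _ Cg)].
- by move=> i; apply: Ck_D; apply: IH; first [exact: Ck_partial|exact: CkW].
Qed.

Lemma Ck_Z n k c (f : 'rV[R]_n -> R) : Ck k f -> Ck k (fun x => c * f x).
Proof. by apply: Ck_M; exact: Ck_cst. Qed.

Lemma Ck_B n k (f g : 'rV[R]_n -> R) : Ck k f -> Ck k g -> Ck k (fun x => f x - g x).
Proof.
move=> Cf Cg; have := Ck_D Cf (Ck_Z (-1) Cg).
by under eq_fun do rewrite mulN1r.
Qed.

Lemma Ck_sum n k (J : Type) (s : seq J) (F : J -> 'rV[R]_n -> R) :
  (forall j, Ck k (F j)) -> Ck k (fun x => \sum_(j <- s) F j x).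
Proof.
move=> CF; elim: s => [|j s IH].
  by under eq_fun do rewrite big_nil; exact: Ck_cst.
by under eq_fun do rewrite big_cons; exact: Ck_D.
Qed.

Lemma is_derive_coord n (x v : 'rV[R]_n) i :
  is_derive x v (fun y : 'rV[R]_n => y ord0 i) (v ord0 i).
Proof.
apply/is_derive_line0; under eq_fun do rewrite !mxE.
rewrite -[X in is_derive _ _ _ X]add0r; apply: is_deriveD.
have := @is_deriveM R R id (cst (v ord0 i)) 0 1 1 0 _ _.
by rewrite scale0r add0r [_ *: 1]mulr1; apply.
Qed.

Lemma Ck_coord n k (i : 'I_n) : Ck k (fun x : 'rV[R]_n => x ord0 i).
Proof.
case: k => [|k]; first by split => //; exact: coord_continuous.
apply: (Ck_S (df := fun j _ => (delta_mx ord0 j : 'rV[R]_n) ord0 i)).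
- exact: coord_continuous.
- by move=> j x; exact: is_derive_coord.
- by move=> j; exact: Ck_cst.
Qed.

(** F is the whole sequence of derivatives of the outer function, so that the induction can pass
    from [F j] to [F j.+1]. *)
Lemma Ck_comp n k (F : nat -> R -> R) (f : 'rV[R]_n -> R) j :
  (forall j (t : R), is_derive t 1 (F j) (F j.+1 t)) -> Ck k f -> Ck k (fun x => F j (f x)).
Proof.
move=> dF; elim: k j f => [|k IH] j f Cf.
  split=> // x; apply: continuous_comp; first exact: (Ck_continuous Cf).
  by apply: differentiable_continuous; apply/derivable1_diffP; have [] := dF j (f x).
apply: (Ck_S (df := fun i x => F j.+1 (f x) * partial i f x)).
- move=> x; apply: continuous_comp; first exact: (Ck_continuous Cf).
  by apply: differentiable_continuous; apply/derivable1_diffP; have [] := dF j (f x).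
- by move=> i x; apply: (@is_derive_comp _ f (F j)) => //; exact: (Ck_is_derive _ _ Cf).
- by move=> i; apply: Ck_M; [apply: IH; exact: CkW|exact: Ck_partial].
Qed.

(** For outer functions of class C^1, such as Phi. *)
Lemma C1_comp n (F F' : R -> R) (f : 'rV[R]_n -> R) :
  (forall t : R, is_derive t 1 F (F' t)) -> continuous F' -> Ck 1 f -> Ck 1 (F \o f).
Proof.
move=> dF cF' Cf; have cF t : {for t, continuous F}.
  by apply: differentiable_continuous; apply/derivable1_diffP; have [] := dF t.
apply: (Ck_S (df := fun i x => F' (f x) * partial i f x)).
- by move=> x; apply: continuous_comp; [exact: (Ck_continuous Cf)|exact: cF].
- by move=> i x; apply: (@is_derive_comp _ f F) => //; exact: (Ck_is_derive _ _ Cf).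
- move=> i; split => // x; apply: (@continuousM _ _ (F' \o f) (partial i f));
    last exact: (Ck_continuous (Ck_partial i Cf)).
  by apply: continuous_comp; [exact: (Ck_continuous Cf)|exact: cF'].
Qed.

Lemma horner1 (s : R) : (1 : {poly R}).[s] = 1.
Proof. by rewrite -polyC1 hornerC. Qed.

Lemma horner_bound (P : {poly R}) : exists2 C, 0 <= C &
  forall s, 1 <= s -> `|P.[s]| <= C * s ^+ size P.
Proof.
exists (\sum_(i < size P) `|P`_i|); first by apply: sumr_ge0.
move=> s s1; rewrite horner_coef mulr_suml.
apply: le_trans (ler_norm_sum _ _ _) _; apply: ler_sum => i _.
rewrite normrM; apply: ler_wpM2l => //.
rewrite ger0_norm; last by rewrite exprn_ge0// (le_trans ler01).
by apply: ler_weXn2l => //; exact: ltnW.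
Qed.

(** The exponential of e s is the power k + 1 of X = exp(e s / (k + 1)), and X is at least 1 and at
    least e s / (k + 1). *)
Lemma expR_pow_bound (e : R) k s : 0 < e -> 0 <= s ->
  s ^+ k * expR (- (e * s)) <= (k.+1%:R / e) ^+ k.
Proof.
move=> e0 s0; rewrite expRN ler_pdivrMr ?expR_gt0//.
have -> : expR (e * s) = expR (e * s / k.+1%:R) ^+ k.+1.
  by rewrite -expRM_natl mulrCA divff ?mulr1// pnatr_eq0.
have h : e * s / k.+1%:R <= expR (e * s / k.+1%:R).
  by apply: le_trans (expR_ge1Dx _); rewrite lerDr.
have h0 : 0 <= e * s / k.+1%:R by rewrite divr_ge0// mulr_ge0// ltW.
apply: (@le_trans _ _ ((k.+1%:R / e) ^+ k * (e * s / k.+1%:R) ^+ k)).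
  rewrite -exprMn (_ : k.+1%:R / e * (e * s / k.+1%:R) = s)//.
  have : (k.+1%:R : R) != 0 by rewrite pnatr_eq0.
  by move: k.+1%:R => K K0; field; rewrite K0 lt0r_neq0.
apply: ler_wpM2l; first by rewrite exprn_ge0// divr_ge0// ltW.
apply: (@le_trans _ _ (expR (e * s / k.+1%:R) ^+ k)); first by apply: lerXn2r => //; rewrite nnegrE expR_ge0.
apply: ler_weXn2l => //; apply: le_trans (expR_ge1Dx _) => //.
by rewrite lerDl.
Qed.

(* The smooth functions P(1/t) exp(-e/t), extended by 0 to t <= 0; their class
   is closed under differentiation. *)
Definition flat_exp (e : R) (P : {poly R}) (t : R) : R :=
  if 0 < t then P.[t^-1] * expR (- (e * t^-1)) else 0.

Definition flat_exp_deriv (e : R) (P : {poly R}) : {poly R} :=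
  e *: ('X^2 * P) - 'X^2 * P^`().

Lemma flat_exp_bound e P : 0 < e -> exists C, forall t, t <= 1 ->
  `|flat_exp e P t| <= C * t ^+ 2.
Proof.
move=> e0; have [C C0 HC] := horner_bound P.
(* The exponent exceeds [size P] by two: the two additional powers of 1/t become the factor t^2 of
   the bound. *)
pose K := ((size P).+3%:R / e) ^+ (size P).+2.
have K0 : 0 <= K by rewrite exprn_ge0// divr_ge0// ltW.
have HK s (s0 : 0 <= s) : s ^+ (size P).+2 * expR (- (e * s)) <= K.
  exact: expR_pow_bound.
clearbody K; exists (C * K) => t t1.
rewrite /flat_exp; case: ltP => t0; last first.
  by rewrite normr0 mulr_ge0 ?sqr_ge0// mulr_ge0.
have s1 : 1 <= t^-1 by rewrite invf_ge1.
have s0 := lt_le_trans ltr01 s1.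
rewrite normrM (ger0_norm (expR_ge0 _)).
apply: (@le_trans _ _ (C * t^-1 ^+ size P * expR (- (e * t^-1)))).
  by apply: ler_wpM2r; [exact: expR_ge0|exact: HC].
rewrite -!mulrA; apply: ler_wpM2l => //.
have := HK t^-1 (ltW s0); rewrite exprS exprS mulrA -expr2 => h.
have -> : t^-1 ^+ size P * expR (- (e * t^-1)) =
    t^-1 ^+ 2 * t^-1 ^+ size P * expR (- (e * t^-1)) * t ^+ 2.
  have tt : t^-1 ^+ 2 * t ^+ 2 = 1 by rewrite -exprMn mulVf ?lt0r_neq0// expr1n.
  move: (t^-1 ^+ size P) (expR _) => A B; rewrite -[LHS]mulr1 -tt; ring.
by apply: ler_wpM2r; [exact: sqr_ge0|].
Qed.

Lemma is_derive_quadratic (g : R -> R) C :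
  (forall t, `|t| <= 1 -> `|g t| <= C * t ^+ 2) -> is_derive (0 : R) 1 g (0 : R).
Proof.
move=> gC; have g0 : g 0 = 0.
  have := gC 0; rewrite normr0 ler01 => /(_ isT).
  by rewrite expr0n mulr0 normr_le0 => /eqP.
suff c : (fun h => h^-1 *: ((g \o shift 0) (h *: (1 : R)) - g 0)) @ 0^' --> (0 : R).
  by split; [apply: cvgP c|exact: cvg_lim c].
apply/cvgr0Pnorm_lt => e e0; near=> h.
rewrite /= g0 subr0 addr0 [_ *: 1]mulr1 [_ *: _]mulrC normrM normfV.
have h0 : h != 0 by near: h; exact: nbhs_dnbhs_neq.
have h1 : `|h| <= 1.
  by near: h; exact: dnbhs0_le.
have he : `|h| < e / (`|C| + 1).
  by near: h; apply: dnbhs0_lt; rewrite divr_gt0// ltr_wpDl.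
rewrite ltr_pdivrMr ?normr_gt0//; apply: le_lt_trans (gC h h1) _.
rewrite -[h ^+ 2]ger0_norm ?sqr_ge0// normrX expr2 mulrA.
rewrite ltr_pM2r ?normr_gt0//.
apply: le_lt_trans (_ : (`|C| + 1) * `|h| < e); last by rewrite mulrC -ltr_pdivlMr// ltr_wpDl.
by apply: ler_wpM2r => //; rewrite (le_trans (ler_norm C))// lerDl.
Unshelve. all: by end_near.
Qed.

Lemma is_derive_flat_exp e P (t : R) : 0 < e ->
  is_derive t 1 (flat_exp e P) (flat_exp e (flat_exp_deriv e P) t).
Proof.
move=> e0; case: (ltgtP t 0) => t0.
- rewrite {2}/flat_exp ltNge (ltW t0) /=.
  apply: (near_eq_is_derive _ (is_derive_cst 0 t 1)).
  near=> s; rewrite /flat_exp ltNge le_eqVlt; suff -> : s < 0 by rewrite orbT.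
  by near: s; exact: lt_nbhsl.
- have h : is_derive t 1 (fun s => P.[s^-1] * expR (- (e * s^-1)))
    (flat_exp e (flat_exp_deriv e P) t).
    have hV : is_derive t 1 (fun s : R => s^-1) (- t ^- 2).
      have := @is_deriveV R id t 1 1 (lt0r_neq0 t0) _.
      by rewrite [_ *: 1]mulr1; apply.
    have hP := is_derive1_comp (is_derive_poly P t^-1) hV.
    have hE : is_derive t 1 (fun s : R => - (e * s^-1)) (- (e * - t ^- 2)).
      by apply: is_deriveN; exact: (@is_deriveZ _ _ _ _ e).
    have hX := @is_derive1_comp _ expR (fun s => - (e * s^-1)) t _ _
      (is_derive_expR _) hE.
    apply: is_derive_eq (is_deriveM hP hX) _.
    rewrite /flat_exp t0 /flat_exp_deriv !hornerE /= /comp.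
    have sE (a b : R) : a *: b = a * b by [].
    rewrite !sE; move: (expR _) P.[_] (_^`().[_]) => A B C.
    by field; exact: lt0r_neq0.
  apply: (near_eq_is_derive _ h).
  near=> s; rewrite /flat_exp; suff -> : 0 < s by [].
  by near: s; exact: lt_nbhsr.
- rewrite t0 {2}/flat_exp ltxx.
  have [C HC] := flat_exp_bound P e0.
  by apply: (@is_derive_quadratic _ C) => s /ler_normlW; exact: HC.
Unshelve. all: by end_near.
Qed.

Lemma flat_exp_chain e P : 0 < e -> exists F : nat -> R -> R,
  F 0%N = flat_exp e P /\ forall j (t : R), is_derive t 1 (F j) (F j.+1 t).
Proof.
move=> e0; exists (fun j => flat_exp e (iter j (flat_exp_deriv e) P)); split=> // j t.
exact: is_derive_flat_exp.
Qed.

(* A smooth approximation of the positive part, vanishing on t <= 0. *)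
Definition pos_approx (e t : R) : R := t * flat_exp e 1 t.
Definition pos_approx' (e t : R) : R :=
  if 0 < t then expR (- (e * t^-1)) * (1 + e * t^-1) else 0.

Lemma pos_approx_Ck n k (f : 'rV[R]_n -> R) e : 0 < e -> Ck k f ->
  Ck k (pos_approx e \o f).
Proof.
move=> e0 Cf; apply: Ck_M => //; have [F [<- dF]] := flat_exp_chain 1 e0.
exact: Ck_comp.
Qed.

Lemma is_derive_pos_approx e (t : R) : 0 < e ->
  is_derive t 1 (pos_approx e) (pos_approx' e t).
Proof.
move=> e0; have h := is_deriveM (is_derive_id t 1) (is_derive_flat_exp 1 t e0).
apply: is_derive_eq h _; have sE (a b : R) : a *: b = a * b by [].
rewrite !sE /pos_approx' /flat_exp; case: ltP => t0 /=; last by rewrite !(mulr0,mul0r) addr0.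
rewrite /flat_exp_deriv derivC mulr0 subr0 mulr1 !hornerE /=.
by move: (expR _) => A; field; exact: lt0r_neq0.
Qed.

Lemma continuous_pos_approx' e : 0 < e -> continuous (pos_approx' e).
Proof.
move=> e0 t; have -> : pos_approx' e = fun t => flat_exp e (1 + e *: 'X) t.
  apply/funext => s; rewrite /pos_approx' /flat_exp; case: ltP => // s0.
  by rewrite !hornerE mulrC.
apply: differentiable_continuous; apply/derivable1_diffP.
by have [] := is_derive_flat_exp (1 + e *: 'X) t e0.
Qed.

Lemma pos_approx_le0 e t : t <= 0 -> pos_approx e t = 0.
Proof. by move=> t0; rewrite /pos_approx /flat_exp ltNge t0 mulr0. Qed.

Lemma pos_approx'_le0 e t : t <= 0 -> pos_approx' e t = 0.
Proof. by move=> t0; rewrite /pos_approx' ltNge t0. Qed.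

(** With s = e / t the value is (1 + s) exp(- s), at most 1 because 1 + s <= exp s. So the smooth
    truncation enlarges no gradient. *)
Lemma pos_approx'_bound e t : 0 < e -> 0 <= pos_approx' e t <= 1.
Proof.
move=> e0; rewrite /pos_approx'; case: ltP => t0; last by rewrite lexx ler01.
have et : 0 <= e * t^-1 by rewrite mulr_ge0 ?invr_ge0// ltW.
rewrite mulr_ge0 ?expR_ge0 ?addr_ge0//=.
by rewrite expRN mulrC ler_pdivrMr ?expR_gt0// mul1r expR_ge1Dx.
Qed.

Lemma pos_approx_bound e t : 0 < e -> 0 <= pos_approx e t <= Num.max t 0.
Proof.
move=> e0; rewrite /pos_approx /flat_exp; case: ltP => t0; last by rewrite mulr0 lexx.
rewrite horner1 mul1r; have et : 0 <= e * t^-1 by rewrite mulr_ge0 ?invr_ge0// ltW.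
rewrite mulr_ge0 ?expR_ge0 ?(ltW t0)//= ler_piMr ?(ltW t0)//.
by rewrite -expR0 ler_expR oppr_le0.
Qed.

Lemma expR_small_cvg t : expR (- (k.+1%:R^-1 * t)) @[k --> \oo] --> (1 : R).
Proof.
rewrite -[X in _ --> X](_ : expR (- (0 * t)) = 1); last by rewrite mul0r oppr0 expR0.
apply: continuous_cvg; first exact: continuous_expR.
by apply: cvgN; apply: cvgM; [exact: cvg_harmonic|exact: cvg_cst].
Qed.

Lemma pos_approx_cvg t : pos_approx k.+1%:R^-1 t @[k --> \oo] --> Num.max t 0.
Proof.
rewrite /pos_approx /flat_exp; case: ltP => t0; last by rewrite mulr0; exact: cvg_cst.
under eq_fun do rewrite horner1 mul1r.
by have := cvgM (cvg_cst t) (expR_small_cvg t^-1); rewrite mulr1; apply.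
Qed.

Lemma pos_approx'_cvg (t : R) :
  pos_approx' k.+1%:R^-1 t @[k --> \oo] --> ((0 < t)%R%:R : R).
Proof.
rewrite /pos_approx'; case: ltP => t0 /=; last exact: cvg_cst.
have h : 1 + k.+1%:R^-1 * t^-1 @[k --> \oo] --> 1 + 0 * t^-1.
  apply: cvgD; first exact: cvg_cst.
  by apply: cvgM; [exact: cvg_harmonic|exact: cvg_cst].
by have := cvgM (expR_small_cvg t^-1) h; rewrite mul0r addr0 mulr1; apply.
Qed.

End smooth_functions.

(** * The N-function Phi *)

Section monotone.
Context {R : realType}.

Lemma eq_ler (x y : R) : x = y -> x <= y.
Proof. by move->. Qed.

Lemma ge0_incr (F dF : R -> R) (a b : R) : a <= b -> continuous F ->
  (forall x : R, a < x < b -> is_derive x 1 F (dF x) /\ 0 <= dF x) -> F a <= F b.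
Proof.
move=> ab cF dF0; apply: (@ger0_derive1_le_cc _ F a b) => //.
- by move=> x; rewrite in_itv /= => /dF0[[]].
- by move=> x; rewrite in_itv /= => /dF0[[_ <-]]; rewrite derive1E.
- exact: continuous_subspaceT.
- by rewrite in_itv /= lexx.
- by rewrite in_itv /= lexx ab.
Qed.

Lemma ge0_incr_cc (F dF : R -> R) (a b : R) : a <= b ->
  (forall x : R, a <= x <= b -> is_derive x 1 F (dF x) /\ 0 <= dF x) -> F a <= F b.
Proof.
move=> ab dF0; apply: (@ger0_derive1_le_cc _ F a b) => //.
- by move=> x; rewrite in_itv /= => /andP[/ltW x1 /ltW x2]; have [|[]] := dF0 x;
    rewrite ?x1 ?x2.
- move=> x; rewrite in_itv /= => /andP[/ltW x1 /ltW x2]; have [|[_ <-]] := dF0 x;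
    by rewrite ?x1 ?x2// derive1E.
- by apply: derivable_within_continuous => x; rewrite in_itv /= => /dF0[[]].
- by rewrite in_itv /= lexx.
- by rewrite in_itv /= lexx ab.
Qed.

End monotone.

Section growth.
Context {R : realType}.

(** Conditions that do not mention the dimension: the same lemmas are applied later to power
    functions of large exponent, on which Sobolev's inequality rests. *)
Definition admissible (l m : R) (phi : R -> R) : Prop :=
  [/\ forall t : R, 0 < t -> 0 < phi t,
      forall t : R, 0 < t -> derivable phi t 1 /\ {for t, continuous (derive1 phi)},
      t * phi t @[t --> 0^'+] --> (0 : R) /\
        (forall s t : R, 0 < s -> s < t -> s * phi s < t * phi t),
      1 < l &
      forall t : R, 0 < t -> l - 1 <= derive1 (fun s => s * phi s) t / phi t <= m - 1].

Variables (l m : R) (phi : R -> R).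
Hypothesis adm : admissible l m phi.

Let phi_gt0 : forall t : R, 0 < t -> 0 < phi t. Proof. by case: adm. Qed.
Let phi_C1 : forall t : R, 0 < t ->
  derivable phi t 1 /\ {for t, continuous (derive1 phi)}. Proof. by case: adm. Qed.
Let phi_0 : t * phi t @[t --> 0^'+] --> (0 : R). Proof. by case: adm => ? ? []. Qed.
Let phi_incr : forall s t : R, 0 < s -> s < t -> s * phi s < t * phi t.
Proof. by case: adm => ? ? []. Qed.
Let l1 : 1 < l. Proof. by case: adm. Qed.
Let phi_lm : forall t : R, 0 < t ->
  l - 1 <= derive1 (fun s => s * phi s) t / phi t <= m - 1. Proof. by case: adm. Qed.

Lemma l_gt1 : 1 < l. Proof. exact: l1. Qed.

(* The odd extension of [s * phi s], i.e. the derivative of [NPhi phi]. *)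
Definition hphi (t : R) : R := t * phi `|t|.
Local Notation h := hphi.
Local Notation P := (NPhi phi).

Lemma lm_le : l <= m.
Proof. by have /andP[a b] := phi_lm ltr01; have := le_trans a b; rewrite lerD2r. Qed.

Lemma hphi0 : h 0 = 0. Proof. by rewrite /h mul0r. Qed.

Lemma hphiN t : h (- t) = - h t. Proof. by rewrite /h normrN mulNr. Qed.

Lemma hphi_gt0 t : 0 < t -> 0 < h t.
Proof. by move=> t0; rewrite /h mulr_gt0// phi_gt0// normr_gt0 gt_eqF. Qed.

Lemma hphi_ge0 t : 0 <= t -> 0 <= h t.
Proof. by rewrite le_eqVlt => /orP[/eqP<-|/hphi_gt0/ltW //]; rewrite hphi0. Qed.

Lemma hphi_ltr s t : s < t -> h s < h t.
Proof.
have pos a b : 0 <= a -> a < b -> h a < h b.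
  rewrite le_eqVlt => /orP[/eqP<-|a0] ab; first by rewrite hphi0 hphi_gt0.
  have b0 := lt_trans a0 ab; rewrite /h !gtr0_norm//; exact: phi_incr.
move=> st; have [s0|s0] := leP 0 s; first exact: pos.
have [t0|t0] := ltP 0 t.
  by apply: (@lt_trans _ _ 0); [rewrite -oppr_gt0 -hphiN hphi_gt0// oppr_gt0|exact: hphi_gt0].
by rewrite -ltrN2 -!hphiN; apply: pos; rewrite ?oppr_ge0// ltrN2.
Qed.

Lemma hphi_le s t : s <= t -> h s <= h t.
Proof. by rewrite le_eqVlt => /orP[/eqP->//|/hphi_ltr/ltW]. Qed.

Definition dhphi (t : R) : R := derive1 (fun s => s * phi s) t.

Lemma is_derive_hphi (t : R) : 0 < t -> is_derive t 1 h (dhphi t).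
Proof.
move=> t0; have [dp _] := phi_C1 t0.
have d : derivable (fun s : R => s * phi s) t 1.
  by apply: derivableM; [exact: derivable_id|exact: dp].
have hd : is_derive t 1 (fun s : R => s * phi s) (dhphi t).
  by split; [exact: d|rewrite /dhphi derive1E].
apply: (near_eq_is_derive _ hd); near=> s; rewrite /h gtr0_norm//.
by near: s; exact: lt_nbhsr.
Unshelve. all: by end_near.
Qed.

Lemma continuous_hphi : continuous h.
Proof.
have pos (t : R) : 0 < t -> {for t, continuous h}.
  move=> t0; apply: differentiable_continuous; apply/derivable1_diffP.
  by have [] := is_derive_hphi t0.
have oddc (t : R) : {for - t, continuous h} -> {for t, continuous h}.
  move=> ct; have -> : h = (fun s => - h (- s)).
    by apply/funext => s; rewrite hphiN opprK.
  apply: continuousN; apply: (@continuous_comp _ _ _ -%R h) => //.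
  exact: opp_continuous.
have r0 : h t @[t --> 0^'+] --> h 0.
  rewrite hphi0; apply: cvg_trans phi_0; apply: near_eq_cvg; near=> s.
  by rewrite /h gtr0_norm//; near: s; exact: nbhs_right_gt.
move=> t; case: (ltgtP t 0) => [t0|t0|->].
- by apply: oddc; apply: pos; rewrite oppr_gt0.
- exact: pos.
apply/left_right_continuousP; split => //.
rewrite -[X in _ --> X]opprK -hphiN oppr0.
have -> : h = (fun s => - h (- s)) by apply/funext => s; rewrite hphiN opprK.
rewrite oppr0; apply: cvgN.
rewrite -[X in X^'-]oppr0; apply/cvg_at_leftNP; rewrite oppr0.
rewrite (_ : _ \o _ = h)//; last by apply/funext => s /=; rewrite opprK.
by rewrite oppr0 -hphiN oppr0.
Unshelve. all: by end_near.
Qed.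

Let L1h (a b : R) : (@lebesgue_measure R).-integrable `[a, b] (EFin \o h).
Proof.
apply: continuous_compact_integrable; first exact: segment_compact.
exact/continuous_subspaceT/continuous_hphi.
Qed.

(** Integrating from - K, to the left of t, unites the two branches of [NPhi] in one formula, to
    which the fundamental theorem of calculus applies. *)
Lemma NPhiE (K t : R) : 0 < K -> - K < t ->
  P t = \int[lebesgue_measure]_(s in `[- K, t]) h s -
        \int[lebesgue_measure]_(s in `[- K, 0]) h s.
Proof.
move=> K0 Kt; rewrite /NPhi; case: leP => t0.
  rewrite Rintegral_itvB //; last by rewrite bnd_simp ltW// oppr_lt0.
  rewrite Rintegral_itv_obnd_cbnd//.
  by apply: integrableS (L1h 0 t) => //; apply: subset_itv_oc_cc.
rewrite -opprB; congr (- _); rewrite Rintegral_itvB //; [|by rewrite bnd_simp ltW..].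
rewrite Rintegral_itv_obnd_cbnd//.
by apply: integrableS (L1h t 0) => //; apply: subset_itv_oc_cc.
Qed.

Lemma is_derive_NPhi (t : R) : is_derive t 1 P (h t).
Proof.
pose K : R := `|t| + 1.
have K0 : 0 < K by rewrite ltr_wpDl.
have Kt : - K < t by rewrite ltrNl (le_lt_trans (ler_norm _))// normrN ltrDl.
have tt1 : t < t + 1 by rewrite ltrDl.
have [d1 d2] := @continuous_FTC1_closed R h (- K) t (t + 1) tt1 (L1h _ _) Kt
  (@continuous_hphi t).
have := is_deriveB (DeriveDef d1 erefl)
  (is_derive_cst (\int[lebesgue_measure]_(s in `[- K, 0]) h s) t 1).
rewrite subr0 -derive1E d2 => hd.
apply: (near_eq_is_derive _ hd); near=> s.
by rewrite (NPhiE K0)//; near: s; exact: lt_nbhsr.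
Unshelve. all: by end_near.
Qed.

Lemma continuous_NPhi : continuous P.
Proof.
move=> t; apply: differentiable_continuous; apply/derivable1_diffP.
by have [] := is_derive_NPhi t.
Qed.

Lemma NPhi0 : P 0 = 0.
Proof. by rewrite /NPhi lexx set_itv1 Rintegral_set1. Qed.

Lemma NPhi_convex s t : P s + h s * (t - s) <= P t.
Proof.
have [st|ts] := leP s t.
  have := @ge0_incr _ (fun x => P x - h s * x) (fun x => h x - h s) s t st.
  have c : continuous (fun x => P x - h s * x).
    move=> x; apply: (@continuousB _ _ _ P (fun x => h s * x)); first exact: continuous_NPhi.
    exact: mulrl_continuous.
  move=> /(_ c) H; suff : P s - h s * s <= P t - h s * t by rewrite mulrBr; lra.
  apply: H => x /andP[sx xt]; split; last by rewrite subr_ge0 hphi_le// ltW.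
  rewrite -[X in h x - X](mulr1 (h s)); by apply: is_deriveB; exact: is_derive_NPhi.
have := @ge0_incr _ (fun x => h s * x - P x) (fun x => h s - h x) t s (ltW ts).
have c : continuous (fun x => h s * x - P x).
  move=> x; apply: (@continuousB _ _ _ (fun x => h s * x) P); last exact: continuous_NPhi.
  exact: mulrl_continuous.
move=> /(_ c) H; suff : h s * t - P t <= h s * s - P s by rewrite mulrBr; lra.
apply: H => x /andP[sx xt]; split; last by rewrite subr_ge0 hphi_le// ltW.
rewrite -[X in X - h x](mulr1 (h s)); by apply: is_deriveB; exact: is_derive_NPhi.
Qed.

Lemma NPhi_ge0 t : 0 <= P t.
Proof. by have := NPhi_convex 0 t; rewrite hphi0 NPhi0 mul0r addr0. Qed.

Lemma NPhi_even t : P (- t) = P t.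
Proof.
have d (x : R) : is_derive x 1 (fun x => P (- x) - P x) (0 : R).
  have -> : 0 = h (- x) * - 1 - h x by rewrite hphiN mulrN1 opprK subrr.
  apply: is_deriveB; last exact: is_derive_NPhi.
  by apply: (@is_derive1_comp _ P -%R); exact: is_derive_NPhi.
have : P (- t) - P t = P (- 0) - P 0 by apply: (@is_derive_0_is_cst _ _ _ _ d).
by rewrite oppr0 subrr => /eqP; rewrite subr_eq0 => /eqP.
Qed.

Lemma NPhi_norm t : P `|t| = P t.
Proof. by case: (ler0P t) => //; rewrite NPhi_even. Qed.

Lemma NPhi_le s t : 0 <= s -> s <= t -> P s <= P t.
Proof.
move=> s0 st; apply: le_trans (NPhi_convex s t).
by rewrite lerDl mulr_ge0 ?subr_ge0// hphi_ge0.
Qed.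

Lemma NPhi_le_norm s t : `|s| <= `|t| -> P s <= P t.
Proof. by move=> st; rewrite -(NPhi_norm s) -(NPhi_norm t); exact: NPhi_le. Qed.

Lemma dhphi_bound t : 0 < t -> (l - 1) * h t <= t * dhphi t <= (m - 1) * h t.
Proof.
move=> t0; have := phi_lm t0; have p0 := phi_gt0 t0.
rewrite ler_pdivlMr// ler_pdivrMr// -/(dhphi t) /h gtr0_norm// => /andP[a b].
by apply/andP; split; rewrite mulrCA ler_pM2l.
Qed.

Let ch_id : continuous (fun x : R => x * h x).
Proof.
by move=> x; apply: (@continuousM _ _ id h); [exact: cvg_id|exact: continuous_hphi].
Qed.

(** The growth condition, integrated: the difference x h(x) - l P(x) vanishes at 0 and has
    derivative x h'(x) - (l - 1) h(x). The same argument with m gives the upper bound. *)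
Lemma NPhi_th_low t : 0 <= t -> l * P t <= t * h t.
Proof.
move=> t0; have := @ge0_incr _ (fun x => x * h x - l * P x)
  (fun x => x * dhphi x + h x - l * h x) 0 t t0.
have c : continuous (fun x : R => x * h x - l * P x).
  move=> x; apply: (@continuousB _ _ _ (fun x : R => x * h x) (fun x => l * P x)).
    exact: ch_id.
  by apply: continuousM; [exact: cst_continuous|exact: continuous_NPhi].
move=> /(_ c) H.
suff : 0 * h 0 - l * P 0 <= t * h t - l * P t.
  by rewrite mul0r NPhi0 mulr0 subr0 subr_ge0.
apply: H => x /andP[x0 xt]; have := dhphi_bound x0; split; last by lra.
apply: is_deriveB.
  have := is_deriveM (is_derive_id x 1) (is_derive_hphi x0).
  by rewrite [h x *: 1]mulr1.
exact: (@is_deriveZ _ _ _ P l _ _ _ (is_derive_NPhi x)).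
Qed.

Lemma NPhi_th_up t : 0 <= t -> t * h t <= m * P t.
Proof.
move=> t0; have := @ge0_incr _ (fun x => m * P x - x * h x)
  (fun x => m * h x - (x * dhphi x + h x)) 0 t t0.
have c : continuous (fun x => m * P x - x * h x).
  move=> x; apply: (@continuousB _ _ _ (fun x => m * P x) (fun x : R => x * h x)); last exact: ch_id.
  by apply: continuousM; [exact: cst_continuous|exact: continuous_NPhi].
move=> /(_ c) H.
suff : m * P 0 - 0 * h 0 <= m * P t - t * h t.
  by rewrite mul0r NPhi0 mulr0 subr0 subr_ge0.
apply: H => x /andP[x0 xt]; have := dhphi_bound x0; split; last by lra.
apply: is_deriveB.
  exact: (@is_deriveZ _ _ _ P m _ _ _ (is_derive_NPhi x)).
have := is_deriveM (is_derive_id x 1) (is_derive_hphi x0).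
by rewrite [h x *: 1]mulr1.
Qed.

(** The sign of this derivative is that of x t h(x t) - p P(x t). For p = l the quotient of P(x t)
    by x^p increases in x, for p = m it decreases; these are the two power bounds for P. *)
Let is_derive_scale p t (x : R) : 0 < x ->
  is_derive x 1 (fun x => P (x * t) * x `^ (- p))
    (x `^ (- p - 1) * (x * t * h (x * t) - p * P (x * t))).
Proof.
move=> x0.
have d1 : is_derive x 1 (fun x => P (x * t)) (h (x * t) * t).
  apply: (@is_derive1_comp _ P (fun x => x * t)); first exact: is_derive_NPhi.
  have := @is_deriveM _ _ id (cst t) x 1 1 0 _ _.
  by rewrite scaler0 add0r [t *: 1]mulr1; apply.
apply: is_derive_eq (is_deriveM d1 (is_derive1_powR (- p) x0)) _.
have sE (a b : R) : a *: b = a * b by [].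
rewrite !sE; have -> : x `^ (- p) = x `^ (- p - 1) * x.
  by rewrite -[X in _ * X]powRr1 ?ltW// -powRD ?subrK// (gt_eqF x0) implybT.
move: (x `^ _) (P _) (h _) => A B C; ring.
Qed.

Lemma NPhi_scale_low lam t : 1 <= lam -> lam `^ l * P t <= P (lam * t).
Proof.
move=> lam1; wlog t0 : t / 0 <= t => [H|].
  rewrite -(NPhi_norm t) -(NPhi_norm (lam * t)) normrM (ger0_norm (le_trans ler01 lam1)).
  exact: H.
have lam0 := lt_le_trans ltr01 lam1.
have := @ge0_incr_cc _ (fun x => P (x * t) * x `^ (- l)) _ 1 lam lam1 _.
move=> /(_ (fun x => x `^ (- l - 1) * (x * t * h (x * t) - l * P (x * t)))).
rewrite mul1r powR1 mulr1 powRN ler_pdivlMr ?powR_gt0// mulrC; apply.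
move=> x /andP[x1 _]; have x0 := lt_le_trans ltr01 x1; split; first exact: is_derive_scale.
by rewrite mulr_ge0 ?powR_ge0// subr_ge0 NPhi_th_low// mulr_ge0// ltW.
Qed.

Lemma NPhi_scale_up lam t : 1 <= lam -> P (lam * t) <= lam `^ m * P t.
Proof.
move=> lam1; wlog t0 : t / 0 <= t => [H|].
  rewrite -(NPhi_norm t) -(NPhi_norm (lam * t)) normrM (ger0_norm (le_trans ler01 lam1)).
  exact: H.
have lam0 := lt_le_trans ltr01 lam1.
suff : - (P (1 * t) * 1 `^ (- m)) <= - (P (lam * t) * lam `^ (- m)).
  by rewrite mul1r powR1 mulr1 powRN lerN2 ler_pdivrMr ?powR_gt0// [P t * _]mulrC.
apply: (@ge0_incr_cc _ (fun x => - (P (x * t) * x `^ (- m)))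
  (fun x => - (x `^ (- m - 1) * (x * t * h (x * t) - m * P (x * t)))) 1 lam lam1).
move=> x /andP[x1 _]; have x0 := lt_le_trans ltr01 x1; split.
  by apply: is_deriveN; exact: is_derive_scale.
by rewrite -mulrN mulr_ge0 ?powR_ge0// opprB subr_ge0 NPhi_th_up// mulr_ge0// ltW.
Qed.

Lemma NPhi_contract lam t : 0 <= lam -> lam <= 1 -> P (lam * t) <= lam `^ l * P t.
Proof.
rewrite le_eqVlt => /orP[/eqP<- _|lam0 lam1].
  by rewrite mul0r NPhi0 mulr_ge0 ?powR_ge0// NPhi_ge0.
have i1 : 1 <= lam^-1 by rewrite invf_ge1.
have := NPhi_scale_low (lam * t) i1; rewrite mulKf ?gt_eqF//.
rewrite -(ler_pM2l (powR_gt0 l lam0)) mulrA -powRM ?invr_ge0 ?(ltW lam0)//.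
by rewrite mulfV ?gt_eqF// powR1 mul1r.
Qed.

Lemma NPhi_gt0 t : t != 0 -> 0 < P t.
Proof.
move=> t0; rewrite lt_neqAle NPhi_ge0 andbT eq_sym; apply/negP => /eqP P0.
have := NPhi_convex (`|t| / 2) `|t|; rewrite NPhi_norm P0.
have := NPhi_ge0 (`|t| / 2); have t2 : 0 < `|t| / 2 by rewrite divr_gt0// normr_gt0.
have := hphi_gt0 t2; move: (h _) (P _) => A B A0 B0.
rewrite leNgt => /negP; apply; rewrite ltr_wpDl// mulr_gt0//; lra.
Qed.

(** The substitute for the triangle inequality of the norm; the constant comes from doubling the
    larger argument. *)
Lemma NPhi_add s t : P (s + t) <= 2 `^ m * (P s + P t).
Proof.
wlog st : s t / `|s| <= `|t| => [H|].
  have [/H//|/ltW/H] := leP `|s| `|t|; by rewrite addrC (addrC (P t)).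
apply: (@le_trans _ _ (P (2 * t))).
  apply: NPhi_le_norm; rewrite (le_trans (ler_normD _ _))// normrM ger0_norm//; lra.
apply: (le_trans (NPhi_scale_up _ _)); first by rewrite ler1n.
by rewrite ler_pM2l ?powR_gt0// lerDr NPhi_ge0.
Qed.

Lemma NPhi_power t : 0 <= t -> t `^ l * P 1 <= P t + P 1.
Proof.
move=> t0; have [t1|t1] := leP 1 t.
  by have := NPhi_scale_low 1 t1; rewrite mulr1 => /le_trans; apply; rewrite lerDl NPhi_ge0.
apply: (@le_trans _ _ (P 1)); last by rewrite lerDr NPhi_ge0.
rewrite ler_piMl ?NPhi_ge0//.
have : t `^ l <= 1 `^ l; last by rewrite powR1.
by apply: ge0_ler_powR; rewrite ?nnegrE ?(ltW t1)// ltW// (lt_trans ltr01).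
Qed.

(* [t <= tau + tau / P tau * P t], in a division-free form *)
Lemma NPhi_linear tau t : 0 < tau -> 0 <= t -> t * P tau <= tau * (P tau + P t).
Proof.
move=> tau0 t0; have [tt|tt] := leP t tau.
  rewrite (le_trans (ler_wpM2r (NPhi_ge0 _) tt))// ler_pM2l// lerDl NPhi_ge0//.
have i1 : 1 <= t / tau by rewrite ler_pdivlMr// mul1r ltW.
have := NPhi_scale_low tau i1; rewrite divfK ?gt_eqF// => H.
apply: (@le_trans _ _ (tau * P t)); last by rewrite ler_pM2l// lerDr NPhi_ge0.
rewrite -ler_pdivrMl//; apply: le_trans H; rewrite mulrA [tau^-1 * t]mulrC.
rewrite ler_wpM2r ?NPhi_ge0// -{1}[t / tau]powRr1 ?(le_trans ler01 i1)//.
by apply: ler_powR => //; exact: ltW.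
Qed.

(** If t <= d s, then h(s) t <= d s h(s) <= d m P(s). Otherwise s < t / d, and h(s) t <= h(t / d) t
    is bounded by a multiple of P(t). The choice of d makes the first case cost at most e P(s). *)
Lemma hphi_young e : 0 < e -> exists2 C, 0 <= C & forall s t, 0 <= s -> 0 <= t ->
  h s * t <= e * P s + C * P t.
Proof.
move=> e0; have m0 : 0 < m := lt_trans ltr01 (lt_le_trans l1 lm_le).
pose d := Num.min 1 (e / m).
have d0 : 0 < d by rewrite lt_min ltr01 divr_gt0.
exists (d^-1 * (m * d^-1 `^ m)).
  by rewrite !mulr_ge0 ?invr_ge0 ?powR_ge0 ?(ltW d0) ?(ltW m0).
move=> s t s0 t0; have [ts|ts] := leP t (d * s).
  apply: (@le_trans _ _ (e * P s)); last first.
    by rewrite lerDl !mulr_ge0 ?NPhi_ge0 ?invr_ge0 ?powR_ge0// ltW.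
  apply: (@le_trans _ _ (d * (s * h s))).
    by rewrite mulrA [leRHS]mulrC ler_wpM2l ?hphi_ge0.
  apply: (@le_trans _ _ (d * (m * P s))); first by rewrite ler_pM2l// NPhi_th_up.
  rewrite mulrA ler_wpM2r ?NPhi_ge0// -ler_pdivlMr//.
  by rewrite /d ge_min lexx orbT.
apply: (@le_trans _ _ (d^-1 * (m * d^-1 `^ m) * P t)); last by rewrite lerDr mulr_ge0 ?NPhi_ge0// ltW.
have std : s <= d^-1 * t by rewrite ler_pdivlMl// ltW.
apply: (@le_trans _ _ (h (d^-1 * t) * t)); first by rewrite ler_wpM2r// hphi_le.
have -> : h (d^-1 * t) * t = d * (d^-1 * t * h (d^-1 * t)).
  by move: (h _) => A; field; exact: lt0r_neq0.
have dt0 : 0 <= d^-1 * t by rewrite mulr_ge0 // invr_ge0 ltW.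
have d1 : 1 <= d^-1 by rewrite invf_ge1// /d ge_min lexx.
apply: (@le_trans _ _ (1 * (m * P (d^-1 * t)))).
  apply: ler_pM; rewrite ?(ltW d0)//; [|by rewrite /d ge_min lexx|exact: NPhi_th_up].
  by rewrite mulr_ge0 // hphi_ge0.
rewrite mul1r -!mulrA; apply: (@le_trans _ _ (m * (d^-1 `^ m * P t))).
  by rewrite ler_pM2l//; exact: NPhi_scale_up.
by rewrite ler_peMl// !mulr_ge0 ?powR_ge0 ?NPhi_ge0// ltW.
Qed.

Lemma m_gt0 : 0 < m. Proof. exact: lt_trans ltr01 (lt_le_trans l1 lm_le). Qed.

(** The lower growth bound at the level of the derivative h; it is the source of the uniform
    convexity in [midpoint_gap]. *)
Lemma hphi_scale lam t : 1 <= lam -> 0 < t -> lam `^ (l - 1) * h t <= h (lam * t).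
Proof.
move=> lam1 t0; have lam0 := lt_le_trans ltr01 lam1.
have := @ge0_incr_cc _ (fun x => h (x * t) * x `^ (- (l - 1))) _ 1 lam lam1 _.
move=> /(_ (fun x => x `^ (- (l - 1) - 1) * (x * t * dhphi (x * t) - (l - 1) * h (x * t)))).
rewrite mul1r powR1 mulr1 powRN ler_pdivlMr ?powR_gt0// mulrC; apply.
move=> x /andP[x1 _]; have x0 := lt_le_trans ltr01 x1; split; last first.
  have /andP[H _] := dhphi_bound (mulr_gt0 x0 t0).
  by rewrite mulr_ge0 ?powR_ge0// subr_ge0.
have d1 : is_derive x 1 (fun x => h (x * t)) (dhphi (x * t) * t).
  apply: (@is_derive1_comp _ h (fun x => x * t)); first exact/is_derive_hphi/mulr_gt0.
  have := @is_deriveM _ _ id (cst t) x 1 1 0 _ _.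
  by rewrite scaler0 add0r [t *: 1]mulr1; apply.
apply: is_derive_eq (is_deriveM d1 (is_derive1_powR (- (l - 1)) x0)) _.
have sE (a b : R) : a *: b = a * b by [].
rewrite !sE; have -> : x `^ (- (l - 1)) = x `^ (- (l - 1) - 1) * x.
  by rewrite -[X in _ * X]powRr1 ?ltW// -powRD ?subrK// (gt_eqF x0) implybT.
move: (x `^ _) (dhphi _) (h _) => A B C; ring.
Qed.

(** [sup] takes a default value on unbounded sets, so boundedness has to be proved before
    [complementary] can satisfy Young's inequality. *)
Lemma complementary_bounded (t : R) :
  has_sup ([set `|t| * s - P s | s in [set s | 0 <= s]] : set R).
Proof.
split; first by exists (`|t| * 0 - P 0), 0 => //=.
have P1 := NPhi_gt0 (oner_neq0 R).
(* Chosen so that |t| tau <= P tau; then [NPhi_linear] gives |t| s <= P tau + P s for every s >=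
   0. *)
pose tau := Num.max 1 ((`|t| / P 1) `^ ((l - 1)^-1)).
have tau1 : 1 <= tau by rewrite le_max lexx.
have tau0 := lt_le_trans ltr01 tau1.
have l10 : 0 < l - 1 by rewrite subr_gt0.
have tau_t : `|t| <= tau `^ (l - 1) * P 1.
  rewrite -ler_pdivrMr//; apply: (@le_trans _ _ (((`|t| / P 1) `^ ((l - 1)^-1)) `^ (l - 1))).
    by rewrite -powRrM mulVf ?gt_eqF// powRr1// divr_ge0// ltW.
  by apply: ge0_ler_powR; rewrite ?nnegrE ?powR_ge0 ?(ltW l10) ?(ltW tau0)// le_max lexx orbT.
have tP : `|t| * tau <= P tau.
  have := NPhi_scale_low 1 tau1; rewrite mulr1; apply: le_trans.
  rewrite (_ : tau `^ l = tau `^ (l - 1) * tau); last first.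
    by rewrite -[X in _ * X]powRr1 ?ltW// -powRD ?subrK// (gt_eqF tau0) implybT.
  by rewrite mulrAC ler_pM2r.
exists (P tau) => _ [s /= s0 <-]; rewrite lerBlDr.
have Pt := NPhi_gt0 (lt0r_neq0 tau0).
rewrite -(ler_pM2r Pt) -mulrA; apply: (@le_trans _ _ (`|t| * (tau * (P tau + P s)))).
  by rewrite ler_wpM2l// NPhi_linear.
rewrite mulrA mulrC ler_wpM2l// addr_ge0// NPhi_ge0//.
Qed.

Lemma complementary_young t s : 0 <= s -> `|t| * s <= complementary P t + P s.
Proof.
move=> s0; rewrite -lerBlDr; apply: sup_ubound; last by exists s.
by have [] := complementary_bounded t.
Qed.

Lemma complementary_ge0 t : 0 <= complementary P t.
Proof. by have := complementary_young t (lexx 0); rewrite NPhi0 mulr0 addr0. Qed.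

Lemma complementary_le s t : `|s| <= `|t| -> complementary P s <= complementary P t.
Proof.
move=> st; apply: ge_sup; first by have [] := complementary_bounded s.
move=> _ [r /= r0 <-]; rewrite lerBlDr; apply: le_trans (complementary_young t r0).
exact: ler_wpM2r.
Qed.

(** Dual to [NPhi_scale_low]: if mu^(l - 1) = lam, the substitution s = mu r bounds lam |t| s - P s
    by mu^l (|t| r - P r). *)
Lemma complementary_scale lam t : 1 <= lam ->
  complementary P (lam * t) <= lam `^ (l / (l - 1)) * complementary P t.
Proof.
move=> lam1; have lam0 := lt_le_trans ltr01 lam1.
have l10 : 0 < l - 1 by rewrite subr_gt0.
pose mu := lam `^ (l - 1)^-1.
have mu1 : 1 <= mu by rewrite -(powRr0 lam); apply: ler_powR => //; rewrite invr_ge0 ltW.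
have mu0 := lt_le_trans ltr01 mu1.
have mul : mu `^ l = lam `^ (l / (l - 1)) by rewrite /mu -powRrM mulrC.
have lmu : lam * mu = mu `^ l.
  rewrite mul /mu -{1}[lam]powRr1 ?ltW// -powRD; last by rewrite (gt_eqF lam0) implybT.
  by congr (_ `^ _); field; rewrite gt_eqF.
apply: ge_sup; first by have [] := complementary_bounded (lam * t).
move=> _ [s /= s0 <-]; rewrite -mul.
have -> : s = mu * (s / mu) by rewrite mulrCA mulfV ?mulr1// gt_eqF.
set r := s / mu; have r0 : 0 <= r by rewrite divr_ge0// ltW.
rewrite normrM (ger0_norm (ltW lam0)).
apply: (@le_trans _ _ (mu `^ l * (`|t| * r - P r))); last first.
  by rewrite ler_pM2l ?powR_gt0// lerBlDr complementary_young.
rewrite mulrBr lerB ?NPhi_scale_low//.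
by rewrite -lmu; apply: eq_ler; ring.
Qed.

End growth.

(** * Euclidean inner product and norm *)

Section euclidean.
Context {R : realType} {n : nat}.
Implicit Types x y z : 'rV[R]_n.

Lemma dotvC x y : dotv x y = dotv y x.
Proof. by apply: eq_bigr => i _; rewrite mulrC. Qed.

Lemma dotvDl x y z : dotv (x + y) z = dotv x z + dotv y z.
Proof. by rewrite /dotv -big_split; apply: eq_bigr => i _; rewrite mxE mulrDl. Qed.

Lemma dotvDr x y z : dotv z (x + y) = dotv z x + dotv z y.
Proof. by rewrite dotvC dotvDl !(dotvC z). Qed.

Lemma dotvZl a x y : dotv (a *: x) y = a * dotv x y.
Proof. by rewrite /dotv mulr_sumr; apply: eq_bigr => i _; rewrite mxE mulrA. Qed.

Lemma dotvZr a x y : dotv x (a *: y) = a * dotv x y.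
Proof. by rewrite dotvC dotvZl dotvC. Qed.

Lemma dotvNl x y : dotv (- x) y = - dotv x y.
Proof. by rewrite -scaleN1r dotvZl mulN1r. Qed.

Lemma dotvNr x y : dotv x (- y) = - dotv x y.
Proof. by rewrite dotvC dotvNl dotvC. Qed.

Lemma dotvBl x y z : dotv (x - y) z = dotv x z - dotv y z.
Proof. by rewrite dotvDl dotvNl. Qed.

Lemma dotvBr x y z : dotv z (x - y) = dotv z x - dotv z y.
Proof. by rewrite dotvDr dotvNr. Qed.

Lemma dotv_ge0 x : 0 <= dotv x x.
Proof. by apply: sumr_ge0 => i _; rewrite -expr2 sqr_ge0. Qed.

Lemma enorm_ge0 x : 0 <= enorm x.
Proof. exact: sqrtr_ge0. Qed.

Lemma enorm_sqr x : enorm x ^+ 2 = dotv x x.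
Proof. by rewrite sqr_sqrtr// dotv_ge0. Qed.

Lemma coord_le_enorm x i : `|x ord0 i| <= enorm x.
Proof.
rewrite -sqrtr_sqr ler_sqrt ?dotv_ge0// /dotv (bigD1 i)//= -expr2 lerDl.
by apply: sumr_ge0 => j _; rewrite -expr2 sqr_ge0.
Qed.

Lemma enorm_eq0 x : enorm x = 0 -> x = 0.
Proof.
move=> x0; apply/rowP => i; rewrite mxE; apply/eqP; rewrite -normr_le0 -x0.
exact: coord_le_enorm.
Qed.

Lemma enorm0 : enorm (0 : 'rV[R]_n) = 0.
Proof. by rewrite /enorm /dotv big1 ?sqrtr0// => i _; rewrite mxE mul0r. Qed.

Lemma enormZ a x : enorm (a *: x) = `|a| * enorm x.
Proof.
by rewrite /enorm dotvZl dotvZr mulrA -expr2 sqrtrM ?sqr_ge0// sqrtr_sqr.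
Qed.

Lemma enormN x : enorm (- x) = enorm x.
Proof. by rewrite -scaleN1r enormZ normrN1 mul1r. Qed.

Lemma cauchy_schwarz x y : `|dotv x y| <= enorm x * enorm y.
Proof.
suff H : dotv x y ^+ 2 <= (enorm x * enorm y) ^+ 2.
  by rewrite -[leRHS]ger0_norm ?mulr_ge0 ?enorm_ge0// -ler_sqr ?nnegrE// !real_normK ?num_real.
rewrite exprMn !enorm_sqr.
have [y0|y0] := eqVneq (dotv y y) 0.
  have : y = 0 by apply: enorm_eq0; rewrite /enorm y0 sqrtr0.
  by move=> ->; rewrite -(scale0r 0) !dotvZr !mul0r expr0n mulr0.
have yp : 0 < dotv y y by rewrite lt_neqAle eq_sym y0 dotv_ge0.
have := dotv_ge0 (dotv y y *: x - dotv x y *: y).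
rewrite !(dotvBl,dotvBr,dotvZl,dotvZr) (dotvC y x).
set a := dotv x x; set b := dotv x y; set c := dotv y y in yp *.
rewrite (_ : _ - _ = c * (a * c - b ^+ 2)); last by ring.
by rewrite pmulr_rge0// subr_ge0.
Qed.

Lemma dotv_le x y : dotv x y <= enorm x * enorm y.
Proof. exact: le_trans (ler_norm _) (cauchy_schwarz x y). Qed.

Lemma enormD x y : enorm (x + y) <= enorm x + enorm y.
Proof.
rewrite -[leRHS]ger0_norm ?addr_ge0 ?enorm_ge0// -[leLHS]ger0_norm ?enorm_ge0//.
rewrite -ler_sqr ?nnegrE// !real_normK ?num_real// enorm_sqr.
rewrite dotvDl !dotvDr sqrrD !enorm_sqr (dotvC y x).
have := dotv_le x y; lra.
Qed.

Lemma enormB x y : enorm (x - y) <= enorm x + enorm y.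
Proof. by rewrite (le_trans (enormD _ _))// enormN. Qed.

Lemma enormBC x y : enorm (x - y) = enorm (y - x).
Proof. by rewrite -enormN opprB. Qed.

Lemma enorm_le_sum x : enorm x <= \sum_i `|x ord0 i|.
Proof.
have s0 : 0 <= \sum_i `|x ord0 i| by apply: sumr_ge0.
rewrite -[leRHS]ger0_norm// -[leLHS]ger0_norm ?enorm_ge0//.
rewrite -ler_sqr ?nnegrE// !real_normK ?num_real// enorm_sqr expr2 mulr_suml.
apply: ler_sum => i _; apply: le_trans (ler_norm _) _; rewrite normrM.
by apply: ler_wpM2l => //; rewrite (bigD1 i)//= lerDl sumr_ge0.
Qed.

Lemma parallelogram x y :
  enorm (x + y) ^+ 2 + enorm (x - y) ^+ 2 = 2 * (enorm x ^+ 2 + enorm y ^+ 2).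
Proof. rewrite !enorm_sqr !(dotvDl,dotvDr,dotvNl,dotvNr) (dotvC y x); ring. Qed.

End euclidean.

Lemma powR_contract {R : realType} (x p : R) : 0 <= x <= 1 -> 1 <= p -> x `^ p <= x.
Proof.
move=> /andP[]; rewrite le_eqVlt => /orP[/eqP<- _ p1|x0 x1 p1].
  by rewrite powR0// gt_eqF// (lt_le_trans ltr01).
by rewrite -[leRHS]powRr1 ?(ltW x0)//; apply: ger_powR => //; rewrite x0.
Qed.

(** * Uniform convexity of Phi(|x|) and monotonicity of its gradient *)

Section monotone_field.
Context {R : realType} {n : nat} (l m : R) (phi : R -> R).
Hypothesis adm : admissible l m phi.
Local Notation h := (hphi phi).
Local Notation P := (NPhi phi).
Implicit Types x y z : 'rV[R]_n.

Definition Afield x : 'rV[R]_n := phi (enorm x) *: x.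

Lemma Afield_self x : dotv (Afield x) x = enorm x * h (enorm x).
Proof.
rewrite /Afield dotvZl -enorm_sqr /h ger0_norm ?enorm_ge0//; ring.
Qed.

Lemma Afield_bound x y : `|dotv (Afield x) y| <= h (enorm x) * enorm y.
Proof.
(* The value of [phi] at 0 is arbitrary, but it multiplies the zero vector. *)
have [->|x0] := eqVneq x 0.
  rewrite /Afield scaler0 -(scale0r 0) dotvZl mul0r normr0.
  by rewrite mulr_ge0 ?enorm_ge0// (hphi_ge0 adm) ?enorm_ge0.
have p0 : 0 < enorm x.
  by rewrite lt_neqAle enorm_ge0 andbT eq_sym; apply: contra_neq x0; exact: enorm_eq0.
have f0 : 0 < phi (enorm x) by case: adm => + _ _ _ _; apply.
rewrite /Afield dotvZl normrM (gtr0_norm f0) /h (ger0_norm (enorm_ge0 x)).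
rewrite [enorm x * _]mulrC -mulrA ler_pM2l//; exact: cauchy_schwarz.
Qed.

Lemma Afield_convex x y : P (enorm x) + dotv (Afield x) (y - x) <= P (enorm y).
Proof.
apply: le_trans (NPhi_convex adm (enorm x) (enorm y)).
rewrite lerD2l dotvBr Afield_self mulrBr [h _ * enorm x]mulrC lerD2r.
exact: le_trans (ler_norm _) (Afield_bound x y).
Qed.

Definition Mono x y := dotv (Afield x - Afield y) (x - y).
(** The quantity through which all strong convergence is proved. Its integral is small for two
    almost minimisers ([J_mid]) and, being bounded by [Mono], for two weak solutions with close
    data; [Dmid_unif] turns this into closeness of the gradients. *)
Definition Dmid x y := (P (enorm x) + P (enorm y)) / 2 - P (enorm (2^-1 *: (x + y))).

Lemma DmidC x y : Dmid x y = Dmid y x.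
Proof. by rewrite /Dmid (addrC x) (addrC (P (enorm x))). Qed.

(** The convexity inequalities based at x and at y, both evaluated at the midpoint and averaged,
    even give a quarter of [Mono]. *)
Lemma Dmid_le_Mono x y : Dmid x y <= Mono x y.
Proof.
rewrite /Dmid /Mono; set z := 2^-1 *: (x + y).
have zx : z - x = - 2^-1 *: (x - y).
  by apply/rowP => i; rewrite !mxE; field.
have zy : z - y = 2^-1 *: (x - y) by apply/rowP => i; rewrite !mxE; field.
have := Afield_convex x z; have := Afield_convex y z.
rewrite zx zy dotvBl !dotvZr.
have M0 : 0 <= dotv (Afield x) (x - y) - dotv (Afield y) (x - y).
  have := Afield_convex x y; have := Afield_convex y x.
  by rewrite -(opprB x y) dotvNr; move: (dotv _ _) (dotv _ _) (P _) (P _) => a b c d; lra.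
move: M0; move: (dotv _ _) (dotv _ _) (P _) (P _) (P _) => A B C D E; lra.
Qed.

Lemma Mono_ge0 x y : 0 <= Mono x y.
Proof.
have := Afield_convex x y; have := Afield_convex y x.
by rewrite -(opprB x y) dotvNr /Mono dotvBl; move: (dotv _ _) (dotv _ _) (P _) (P _) => a b c d; lra.
Qed.

Lemma NPhi_enormD x y : P (enorm (x + y)) <= 2 `^ m * (P (enorm x) + P (enorm y)).
Proof.
apply: le_trans (NPhi_add adm _ _); apply: (NPhi_le adm); first exact: enorm_ge0.
exact: enormD.
Qed.

Lemma Dmid_ge0 x y : 0 <= Dmid x y.
Proof.
rewrite /Dmid; set z := 2^-1 *: (x + y).
have xz : x - z = 2^-1 *: (x - y) by apply/rowP => i; rewrite !mxE; field.
have yz : y - z = - 2^-1 *: (x - y) by apply/rowP => i; rewrite !mxE; field.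
have := Afield_convex z x; have := Afield_convex z y.
rewrite xz yz !dotvZr.
by move: (P _) (P (enorm y)) (P (enorm x)) (dotv _ _) => A B C D; lra.
Qed.

(** In [midpoint_gap] the two factors bound (h nu - h mu) / h nu and (r - nu) / r from below. *)
Definition gap_coef (om : R) := (1 - (1 + (1 - om) / 4) `^ (- (l - 1))) * ((1 - om) / 4).

Lemma gap_coef_gt0 om : om < 1 -> 0 < gap_coef om.
Proof.
move=> om1; have l1 := l_gt1 adm; rewrite /gap_coef mulr_gt0 //; last lra.
rewrite subr_gt0 powRN invf_lt1; last by rewrite powR_gt0//; lra.
have : 1 `^ (l - 1) < (1 + (1 - om) / 4) `^ (l - 1); last by rewrite powR1.
by apply: gt0_ltr_powR; rewrite ?nnegrE; lra.
Qed.

(** Let mu be the midpoint of r and s, and nu that of r and mu. The tangent at nu evaluated at r and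
    the tangent at mu evaluated at nu and at s add up to a gap of at least (h nu - h mu)(r - nu).
    Since nu / mu >= 1 + (1 - om) / 4, [hphi_scale] bounds h nu - h mu below by a fraction of h
    nu. *)
Lemma midpoint_gap om r s : om < 1 -> 0 < r -> 0 <= s -> s <= om * r ->
  gap_coef om * (2 `^ (- m) * P r) <= P r + P s - 2 * P ((r + s) / 2).
Proof.
move=> om1 r0 s0 sr; have l1 := l_gt1 adm.
have [mu muE] : {mu | mu = (r + s) / 2} by exists ((r + s) / 2).
have [nu nuE] : {nu | nu = (r + mu) / 2} by exists ((r + mu) / 2).
have [k kE] : {k | k = 1 - om} by exists (1 - om).
have k0 : 0 < k by lra.
have omE : om = 1 - k by lra.
rewrite omE in sr; rewrite /gap_coef -muE omE subKr; clear om om1 kE omE.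
have mu0 : 0 < mu by lra.
have nu0 : 0 < nu by lra.
have sr' : s <= r by nra.
have rnu : k / 4 * r <= r - nu by nra.
have E := NPhi_convex adm.
have E1 := E nu r; have E2 := E mu nu; have E3 := E mu s; clear E.
have numu : 1 + k / 4 <= nu / mu.
  have mur : k * mu <= k * r by rewrite ler_pM2l//; lra.
  by rewrite ler_pdivlMr//; lra.
have hnu0 := hphi_gt0 adm nu0.
have Hh : (1 - (1 + k / 4) `^ (- (l - 1))) * h nu <= h nu - h mu.
  have q1 : 1 <= nu / mu by apply: le_trans numu; rewrite lerDl divr_ge0// ltW.
  have := hphi_scale adm q1 mu0; rewrite divfK ?gt_eqF// => H.
  have k4 : 0 < 1 + k / 4 by rewrite addr_gt0// divr_gt0.
  rewrite mulrBl mul1r lerD2l lerN2 powRN mulrC ler_pdivlMr ?powR_gt0//.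
  apply: le_trans H; rewrite mulrC ler_wpM2r ?(hphi_ge0 adm) ?(ltW mu0)//.
  apply: ge0_ler_powR; rewrite ?nnegrE ?(ltW k4)//; first by rewrite subr_ge0 ltW.
  by rewrite (le_trans ler01).
have c0 : 0 < 1 - (1 + k / 4) `^ (- (l - 1)).
  have := @gap_coef_gt0 (1 - k); rewrite /gap_coef subKr => c0.
  have /c0 {c0} : 1 - k < 1 by rewrite ltrBlDr ltrDl.
  by rewrite pmulr_lgt0// divr_gt0.
have hnur : 2 `^ (- m) * P r <= h nu * r.
  apply: (@le_trans _ _ (P (r / 2))).
    rewrite powRN mulrC ler_pdivrMr ?powR_gt0// mulrC.
    rewrite -{1}[r](_ : 2 * (r / 2) = r); last by field.
    by apply: (NPhi_scale_up adm); rewrite ler1n.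
  apply: (@le_trans _ _ (P nu)).
    by apply: (NPhi_le adm); [rewrite divr_ge0// ltW|lra].
  apply: (@le_trans _ _ (l * P nu)).
    by rewrite ler_peMl ?(NPhi_ge0 adm)// ltW.
  apply: (le_trans (NPhi_th_low adm (ltW nu0))).
  by rewrite mulrC ler_pM2l//; lra.
have Dge : (h nu - h mu) * (r - nu) <= P r + P s - 2 * P mu.
  have nm : nu - mu = r - nu by lra.
  have sm : s - mu = - 2 * (r - nu) by lra.
  rewrite nm in E2; rewrite sm in E3; move: E1 E2 E3; rewrite mulrBl.
  clear; move: (r - nu) (h nu) (h mu) (P r) (P s) (P mu) (P nu) => a A B C D E F; lra.
apply: le_trans Dge; move: Hh; set c1 := 1 - _ in c0 * => Hh.
apply: (@le_trans _ _ (c1 * (k / 4) * (h nu * r))).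
  by apply: ler_wpM2l => //; rewrite mulr_ge0 ?(ltW c0)// divr_ge0// ltW.
apply: (@le_trans _ _ (c1 * h nu * (k / 4 * r))); first by apply: eq_ler; ring.
apply: ler_pM => //; first by rewrite mulr_ge0 ?(ltW c0) ?(ltW hnu0).
by rewrite mulr_ge0 ?(ltW r0)// divr_ge0// ltW.
Qed.

Lemma Dmid_far om x y : om < 1 -> 0 < enorm x -> enorm y <= om * enorm x ->
  gap_coef om * 2 `^ (- m) / 2 * P (enorm x) <= Dmid x y.
Proof.
move=> om1 x0 yx; have := midpoint_gap om1 x0 (enorm_ge0 y) yx.
have : P (enorm (2^-1 *: (x + y))) <= P ((enorm x + enorm y) / 2).
  apply: (NPhi_le adm); first exact: enorm_ge0.
  rewrite enormZ ger0_norm ?invr_ge0// mulrC ler_pM2r ?invr_gt0//.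
  exact: enormD.
rewrite /Dmid; move: (P (enorm (2^-1 *: (x + y)))) (P (_ / 2)) (P (enorm x)) (P (enorm y)) (gap_coef _) (2 `^ _).
clear; move=> a b c d e f; lra.
Qed.

(** For vectors of comparable length but far apart, the parallelogram law shortens the midpoint to
    at most th |x|. Convexity then gives P(midpoint) <= th P|x|, while P|y| >= th P|x| by the upper
    scaling bound, whence the exponent 1/m. *)
Lemma Dmid_near d x y : 0 < d -> d <= 1 -> enorm y <= enorm x ->
  d * enorm x <= enorm (x - y) ->
  let th := Num.sqrt (1 - d ^+ 2 / 4) in th `^ m^-1 * enorm x <= enorm y ->
  (1 - th) / 2 * P (enorm x) <= Dmid x y.
Proof.
move=> d0 d1 yx xy th yom; have l1 := l_gt1 adm; have m0 := m_gt0 adm.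
have th2 : 0 < 1 - d ^+ 2 / 4 by nra.
have th0 : 0 < th by rewrite sqrtr_gt0.
have thE : th ^+ 2 = 1 - d ^+ 2 / 4 by rewrite sqr_sqrtr// ltW.
have th1 : th < 1 by rewrite ltNge; apply/negP => h1; nra.
have midth : enorm (2^-1 *: (x + y)) <= th * enorm x.
  have pl := parallelogram x y.
  have q : (d * enorm x) ^+ 2 <= enorm (x - y) ^+ 2.
    by rewrite ler_sqr ?nnegrE ?enorm_ge0 ?mulr_ge0 ?enorm_ge0// ltW.
  have q2 : enorm y ^+ 2 <= enorm x ^+ 2 by rewrite ler_sqr ?nnegrE ?enorm_ge0.
  rewrite -ler_sqr ?nnegrE ?mulr_ge0 ?(ltW th0) ?enorm_ge0// exprMn thE.
  rewrite enormZ exprMn ger0_norm ?invr_ge0//.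
  move: pl q q2; rewrite !exprMn; clear.
  move: (enorm _ ^+ 2) (enorm _ ^+ 2) (enorm _ ^+ 2) (enorm _ ^+ 2) (d ^+ 2) => A B C D E.
  lra.
have Pmid : P (enorm (2^-1 *: (x + y))) <= th * P (enorm x).
  apply: (le_trans (NPhi_le adm (enorm_ge0 _) midth)).
  apply: (le_trans (NPhi_contract adm _ (ltW th0) (ltW th1))).
  rewrite ler_wpM2r ?(NPhi_ge0 adm)//.
  by apply: powR_contract; rewrite ?(ltW th0) ?(ltW th1) ?(ltW l1).
have Ps : th * P (enorm x) <= P (enorm y).
  move: yom; set om := th `^ m^-1.
  have om0 : 0 < om by rewrite powR_gt0.
  have omm : om `^ m = th by rewrite /om -powRrM mulVf ?gt_eqF// powRr1// ltW.
  have om1 : om <= 1.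
    have : th `^ m^-1 <= 1 `^ m^-1; last by rewrite powR1.
    by apply: ge0_ler_powR; rewrite ?nnegrE ?invr_ge0 ?(ltW m0) ?(ltW th0) ?(ltW th1).
  have i1 : 1 <= om^-1 by rewrite invf_ge1.
  have := NPhi_scale_up adm (om * enorm x) i1; rewrite mulKf ?gt_eqF// => H yom.
  apply: (@le_trans _ _ (P (om * enorm x))); last first.
    by apply: (NPhi_le adm) yom; rewrite mulr_ge0 ?enorm_ge0// ltW.
  rewrite -omm; rewrite -(ler_pM2l (powR_gt0 m om0)) in H; apply: le_trans H _.
  by rewrite mulrA -powRM ?invr_ge0 ?(ltW om0)// mulfV ?gt_eqF// powR1 mul1r.
rewrite /Dmid; move: Pmid Ps; clear.
by move: (P _) (P _) (P _) => A B C; lra.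
Qed.

(* Uniform convexity of the modular. *)
Lemma Dmid_unif e : 0 < e -> exists2 C, 0 <= C & forall x y,
  P (enorm (x - y)) <= e * (P (enorm x) + P (enorm y)) + C * Dmid x y.
Proof.
move=> e0; have l1 := l_gt1 adm; have m0 := m_gt0 adm.
(* Three regimes for |y| <= |x|. If |x - y| <= d |x|, the term e P|x| suffices. Otherwise either the
   lengths differ by the factor th^(1/m), which is the case of [Dmid_far], or they are comparable
   and [Dmid_near] applies. *)
pose d := Num.min 1 e; have d0 : 0 < d by rewrite lt_min ltr01.
have d1 : d <= 1 by rewrite ge_min lexx.
have dle : d <= e by rewrite ge_min lexx orbT.
pose th := Num.sqrt (1 - d ^+ 2 / 4).
have th1 : th < 1.
  rewrite -sqrtr1 /th ltr_sqrt// ltrBlDr ltrDl divr_gt0// exprn_gt0//.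
have om1 : th `^ m^-1 < 1.
  have : th `^ m^-1 < 1 `^ m^-1; last by rewrite powR1.
  by apply: gt0_ltr_powR; rewrite ?nnegrE ?invr_gt0 ?sqrtr_ge0.
pose c := Num.min (gap_coef (th `^ m^-1) * 2 `^ (- m) / 2) ((1 - th) / 2).
have c0 : 0 < c.
  rewrite lt_min; apply/andP; split; last by rewrite divr_gt0// subr_gt0.
  rewrite divr_gt0//; apply: mulr_gt0; last by rewrite powR_gt0.
  exact: gap_coef_gt0.
exists (2 `^ m / c); first by rewrite divr_ge0 ?powR_ge0// ltW.
move=> x y; wlog yx : x y / enorm y <= enorm x.
  move=> H; have [/H//|/ltW/H] := leP (enorm y) (enorm x).
  by rewrite enormBC DmidC [P (enorm y) + _]addrC.
have Dm := Dmid_ge0 x y.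
have r0 : 0 <= enorm x := enorm_ge0 x.
have [xy|xy] := leP (enorm (x - y)) (d * enorm x).
  apply: (@le_trans _ _ (e * P (enorm x))); last first.
    rewrite mulrDr -addrA lerDl addr_ge0 ?mulr_ge0 ?(ltW e0) ?(NPhi_ge0 adm)//.
    by rewrite invr_ge0 ltW.
  apply: (le_trans (NPhi_le adm (enorm_ge0 _) xy)).
  apply: (le_trans (NPhi_contract adm (enorm x) (ltW d0) d1)).
  rewrite ler_wpM2r ?(NPhi_ge0 adm)//; apply: le_trans dle.
  by apply: powR_contract; rewrite ?(ltW d0) ?d1 ?(ltW l1).
have rp : 0 < enorm x.
  rewrite lt_neqAle r0 andbT; apply/eqP => r00; move: xy; rewrite -r00 mulr0 ltNge.
  by rewrite (le_trans (enormB _ _))// -r00 add0r r00.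
suff Dc : c * P (enorm x) <= Dmid x y.
  apply: (@le_trans _ _ (2 `^ m / c * Dmid x y)); last first.
    by rewrite lerDr mulr_ge0 ?(ltW e0)// addr_ge0 ?(NPhi_ge0 adm).
  apply: (@le_trans _ _ (2 `^ m * P (enorm x))); last first.
    by rewrite -mulrA ler_pM2l ?powR_gt0// mulrC ler_pdivlMr// mulrC.
  apply: le_trans (NPhi_scale_up adm (enorm x) _) => //; last by rewrite ler1n.
  apply: (NPhi_le adm (enorm_ge0 _)); apply: le_trans (enormB _ _) _.
  by rewrite mulr_natl mulr2n lerD2l.
have [sr|sr] := leP (enorm y) (th `^ m^-1 * enorm x).
  apply: le_trans (Dmid_far om1 rp sr).
  by rewrite ler_wpM2r ?(NPhi_ge0 adm)// /c ge_min lexx.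
apply: le_trans (Dmid_near d0 d1 yx (ltW xy) (ltW sr)).
by rewrite ler_wpM2r ?(NPhi_ge0 adm)// /c ge_min lexx orbT.
Qed.

End monotone_field.

(** * Integration by parts *)

Section calculus.
Context {R : realType} {n : nat}.
Local Notation leb := (@lebesgue_rv R n).
Implicit Types (f g : 'rV[R]_n -> R).

Lemma L1_restrict (Om : set 'rV[R]_n) f : measurable Om ->
  (forall x, ~ Om x -> f x = 0) -> L1 leb Om f <-> L1 leb setT f.
Proof.
move=> mO f0; rewrite /L1 (integrable_mkcond (EFin \o f) mO).
suff -> : (EFin \o f) \_ Om = EFin \o f by [].
by apply/funext => x; rewrite patchE; case: ifPn => // /negP; rewrite inE => /f0 /= ->.
Qed.

Lemma I_restrict (Om : set 'rV[R]_n) f :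
  (forall x, ~ Om x -> f x = 0) -> I leb Om f = I leb setT f.
Proof.
move=> f0; rewrite !IE Rintegral_mkcond; congr Rintegral; apply/funext => x.
by rewrite patchE; case: ifPn => // /negP; rewrite inE => /f0 ->.
Qed.

Lemma measurable_rv_ball M : measurable [set x : 'rV[R]_n | `|x| <= M].
Proof.
apply: closed_rv_measurable.
rewrite (_ : mkset _ = (fun x : 'rV[R]_n => `|x|) @^-1` [set y : R | y <= M])//.
by apply: preimage_closed => [x _|]; [exact: norm_continuous|exact: closed_le].
Qed.

Definition bsupp f := exists M, forall x, M < `|x| -> f x = 0.

Lemma rv_ball_bounded M : bounded_set [set x : 'rV[R]_n | `|x| <= M].
Proof.
by exists M; split; [exact: num_real|move=> K MK x /= /le_trans; apply; exact: ltW].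
Qed.

Lemma bsupp_bounded f : continuous f -> bsupp f -> exists2 C, 0 <= C & forall x, `|f x| <= C.
Proof.
move=> cf [M fM].
have cK : compact [set x : 'rV[R]_n | `|x| <= M].
  apply: bounded_closed_compact; first exact: rv_ball_bounded.
  rewrite (_ : mkset _ = (fun x : 'rV[R]_n => `|x|) @^-1` [set y : R | y <= M])//.
  by apply: preimage_closed => [x _|]; [exact: norm_continuous|exact: closed_le].
have /compact_bounded[B [_ HB]] := continuous_compact (continuous_subspaceT cf) cK.
have := HB (`|B| + 1) _; rewrite (le_lt_trans (ler_norm _)) ?ltrDl// => /(_ isT) H.
exists (`|B| + 1) => [|x]; first by rewrite addr_ge0.
have [xM|xM] := leP `|x| M; first by apply: H; exists x.
by rewrite fM// normr0 addr_ge0.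
Qed.

Lemma L1_bounded (Om : set 'rV[R]_n) f (C : R) : measurable Om -> bounded_set Om ->
  measurable_fun Om f -> (forall x, Om x -> `|f x| <= C) -> L1 leb Om f.
Proof.
move=> mO bO mf fC; apply: measurable_bounded_integrable => //.
  exact: lebesgue_rv_bounded.
by exists C; split; [exact: num_real|move=> K CK x Ox; apply: le_trans (fC x Ox) _; exact: ltW].
Qed.

Lemma L1_bsupp f : continuous f -> bsupp f -> L1 leb setT f.
Proof.
move=> cf bf; have [C C0 fC] := bsupp_bounded cf bf; have [M fM] := bf.
apply/(@L1_restrict [set x | `|x| <= M]); first exact: measurable_rv_ball.
  by move=> x /negP; rewrite -ltNge => /fM.
apply: (@L1_bounded _ _ C) => //; [exact: measurable_rv_ball|exact: rv_ball_bounded|].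
exact: continuous_rv_measurable.
Qed.

Lemma nbhs_line (x v : 'rV[R]_n) (A : set 'rV[R]_n) : nbhs x A ->
  \forall t \near (0 : R), A (x + t *: v).
Proof.
have c : x + t *: v @[t --> (0 : R)] --> x.
  have := @cvgD _ 'rV[R]_n _ (nbhs (0 : R)) _ (fun=> x) (fun t => t *: v) x (0 *: v).
  by rewrite scale0r addr0; apply; [exact: cvg_cst|rewrite -[X in _ --> X](scale0r v);
    apply: cvgZr_tmp; exact: cvg_id].
exact: c.
Qed.

Lemma bsupp_partial f i : bsupp f -> bsupp (partial i f).
Proof.
move=> [M fM]; exists M => x Mx; rewrite /partial.
have eB : nbhs x [set y : 'rV[R]_n | M < `|y|].
  apply: open_nbhs_nbhs; split => //.
  rewrite (_ : mkset _ = (fun x : 'rV[R]_n => `|x|) @^-1` [set y : R | M < y])//.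
  by apply: open_comp => [y _|]; [exact: norm_continuous|exact: open_gt].
apply: (@derive_val _ _ _ _ _ _ (0 : R)); apply/is_derive_line0.
apply: (near_eq_is_derive _ (is_derive_cst (0 : R) (0 : R) 1)).
by apply: filterS (nbhs_line (delta_mx ord0 i) eB) => t Bt; rewrite /= fM.
Qed.

Lemma lipschitz_dir f i (C : R) (x : 'rV[R]_n) (t : R) : Ck 1 f -> (forall x, `|partial i f x| <= C) ->
  0 <= t -> `|f (x + t *: delta_mx ord0 i) - f x| <= C * t.
Proof.
move=> Cf fC t0.
have d (s : R) : is_derive s 1 (fun s : R => f (x + s *: delta_mx ord0 i))
    (partial i f (x + s *: delta_mx ord0 i)).
  by apply/is_derive_line; exact: (Ck_is_derive i _ Cf).
have [|c _] := @MVT_segment _ (fun s : R => f (x + s *: delta_mx ord0 i))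
  (fun s => partial i f (x + s *: delta_mx ord0 i)) 0 t t0 (fun s _ => d s).
  by apply: derivable_within_continuous => s _; have [] := d s.
rewrite scale0r addr0 subr0 => ->; rewrite normrM (ger0_norm t0).
exact: ler_wpM2r.
Qed.

(** The difference quotients have integral 0 by translation invariance. The mean value theorem
    bounds them by a constant on a fixed ball, so the derivative inherits this by dominated
    convergence. *)
Lemma int_partial0 f i : Ck 1 f -> bsupp f ->
  L1 leb setT (partial i f) /\ I leb setT (partial i f) = 0.
Proof.
move=> Cf bf.
have cp : continuous (partial i f) := Ck_continuous (Ck_partial i Cf).
have bp := bsupp_partial i bf.
have cf := Ck_continuous Cf.
have Lp := L1_bsupp cp bp; split => //.
have [C C0 pC] := bsupp_bounded cp bp.
have [M fM] := bf.
pose e : 'rV[R]_n := delta_mx ord0 i.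
pose h (k : nat) : R := k.+1%:R^-1.
have h0 k : 0 < h k by rewrite invr_gt0.
have h1 k : h k <= 1 by rewrite invf_le1// ler1n.
pose q k x := (h k)^-1 * (f (x + h k *: e) - f x).
have Lf := L1_bsupp cf bf.
have Lq k : L1 leb setT (q k).
  by apply: L1Z => //; apply: L1B => //; exact: (I_shift _ Lf).1.
have Iq k : I leb setT (q k) = 0.
  have [L1s Is] := I_shift (h k *: e) Lf.
  by rewrite I_Z ?I_B ?Is ?subrr ?mulr0//; exact: L1B.
(* All steps [h k] are at most 1, so every quotient vanishes outside the support enlarged by the
   norm of the direction. *)
pose g x := C * \1_[set x : 'rV[R]_n | `|x| <= M + `|e|] x.
have Lg : L1 leb setT g.
  apply/(@L1_restrict [set x | `|x| <= M + `|e|]); first exact: measurable_rv_ball.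
    by move=> x nx; rewrite /g indicE memNset// mulr0.
  have : L1 leb [set x | `|x| <= M + `|e|] (fun=> C); last first.
    by apply: (L1_eq (measurable_rv_ball _)) => x xB; rewrite /g indicE mem_set// mulr1.
  apply: (@L1_bounded _ _ C) => //; [exact: measurable_rv_ball|exact: rv_ball_bounded|].
  by move=> x _; rewrite ger0_norm.
have [] := @I_dct _ _ _ leb setT measurableT q (partial i f) g.
- by move=> k; exact: (L1_meas (Lq k)).
- exact: (L1_meas Lp).
- exact: Lg.
- move=> k; apply: aeDT => x _; rewrite /q normrM gtr0_norm ?invr_gt0//.
  have [xM|xM] := leP `|x| (M + `|e|).
    rewrite /g indicE mem_set// mulr1 ler_pdivrMl// mulrC.
    by apply: lipschitz_dir => //; exact: ltW.
  rewrite (fM x); last by apply: le_lt_trans xM; rewrite lerDl.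
  rewrite (fM (x + _)) ?subrr ?normr0 ?mulr0//.
    by rewrite /g mulr_ge0// indicE.
  rewrite -(opprK (h k *: e)); apply: lt_le_trans (lerB_normD _ _).
  rewrite normrN normrN normrZ ltrBrDr; apply: le_lt_trans xM.
  by rewrite lerD2l ler_piMl// ger0_norm// ltW.
- apply: aeDT => x _; have d : derivable f x e by exact: (Ck_derivable Cf).
  have /cvgr_dnbhsP/(_ h) H : h^-1 *: ((f \o shift x) (h *: e) - f x) @[h --> 0^'] -->
    partial i f x by exact: d.
  have /H : (forall k, h k != 0) /\ h k @[k --> \oo] --> (0 : R).
    by split=> [k|]; [rewrite gt_eqF|exact: cvg_harmonic].
  have -> : (fun k => q k x) = (fun k => (h k)^-1 *: ((f \o shift x) (h k *: e) - f x)).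
    by apply/funext => k; rewrite /q /= (addrC x).
  by [].
move=> _ _ c; have -> : I leb setT (partial i f) = lim (I leb setT (q k) @[k --> \oo]).
  by apply/esym/cvg_lim.
under eq_fun do rewrite Iq; exact: lim_cst.
Qed.

Lemma test_bsupp (Om : set 'rV[R]_n) f : test_fun Om f -> bsupp f.
Proof.
move=> [_ [K [cK _ Kf]]]; have [M [_ HM]] := compact_bounded cK.
exists (`|M| + 1) => x xM; apply: Kf => Kx.
have := HM (`|M| + 1) _ x Kx; rewrite (le_lt_trans (ler_norm _)) ?ltrDl// => /(_ isT) /=.
by rewrite leNgt xM.
Qed.

Lemma test_Ck (Om : set 'rV[R]_n) f k : test_fun Om f -> Ck k f.
Proof. by move=> [/smoothP]. Qed.

Lemma test_out (Om : set 'rV[R]_n) f x : test_fun Om f -> ~ Om x -> f x = 0.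
Proof. by move=> [_ [K [_ KO Kf]]] nO; apply: Kf => /KO. Qed.

Lemma test_partial_out (Om : set 'rV[R]_n) f i x : test_fun Om f -> ~ Om x ->
  partial i f x = 0.
Proof.
move=> [_ [K [cK KO Kf]]] nO.
have cK' : closed K by apply: compact_closed => //; exact: norm_hausdorff.
have eB : nbhs x (~` K).
  by apply: open_nbhs_nbhs; split; [exact: closed_openC|move=> /KO].
apply: (@derive_val _ _ _ _ _ _ (0 : R)); apply/is_derive_line0.
apply: (near_eq_is_derive _ (is_derive_cst (0 : R) (0 : R) 1)).
by apply: filterS (nbhs_line (delta_mx ord0 i) eB) => t Bt; rewrite /= Kf.
Qed.

Lemma partialM f g i x : Ck 1 f -> Ck 1 g ->
  partial i (fun x => f x * g x) x = f x * partial i g x + g x * partial i f x.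
Proof.
move=> Cf Cg; apply: (@derive_val _ _ _ _ _ _ _).
by apply: is_deriveM; [exact: (Ck_is_derive i x Cf)|exact: (Ck_is_derive i x Cg)].
Qed.

Lemma bsuppM f g : bsupp g -> bsupp (fun x => f x * g x).
Proof. by move=> [M gM]; exists M => x /gM ->; rewrite mulr0. Qed.

Lemma int_by_parts (Om : set 'rV[R]_n) f g i : measurable Om -> Ck 1 f -> test_fun Om g ->
  [/\ L1 leb Om (fun x => f x * partial i g x),
      L1 leb Om (fun x => partial i f x * g x) &
      I leb Om (fun x => f x * partial i g x) = - I leb Om (fun x => partial i f x * g x)].
Proof.
move=> mO Cf tg; have Cg := test_Ck 1 tg; have bg := test_bsupp tg.
have [L I0] := int_partial0 i (Ck_M Cf Cg) (bsuppM f bg).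
have o1 x : ~ Om x -> f x * partial i g x = 0 by move=> /(test_partial_out i tg) ->; rewrite mulr0.
have o2 x : ~ Om x -> partial i f x * g x = 0 by move=> /(test_out tg) ->; rewrite mulr0.
have cont2 (u v : 'rV[R]_n -> R) : continuous u -> continuous v -> continuous (fun x => u x * v x).
  by move=> cu cv x; apply: (@continuousM _ _ u v); [exact: cu|exact: cv].
have L1a : L1 leb setT (fun x => f x * partial i g x).
  apply: L1_bsupp; last exact/bsuppM/bsupp_partial.
  by apply: cont2; [exact: (Ck_continuous Cf)|exact: (Ck_continuous (Ck_partial i Cg))].
have L1b : L1 leb setT (fun x => partial i f x * g x).
  apply: L1_bsupp; last exact: bsuppM.
  by apply: cont2; [exact: (Ck_continuous (Ck_partial i Cf))|exact: (Ck_continuous Cg)].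
split; [by apply/L1_restrict|by apply/L1_restrict|].
rewrite !I_restrict//; apply/eqP; rewrite -subr_eq0 opprK -I_D//; apply/eqP.
rewrite -[RHS]I0; apply: I_eq => x _; rewrite partialM//; congr (_ + _).
exact: mulrC.
Qed.

End calculus.

(** * The space W_0^{1,Phi} in modular form *)

Section test_functions.
Context {R : realType} {n : nat} (Om : set 'rV[R]_n).
Implicit Types (f g : 'rV[R]_n -> R).

Lemma partialD f g i x : Ck 1 f -> Ck 1 g ->
  partial i (fun x => f x + g x) x = partial i f x + partial i g x.
Proof.
move=> Cf Cg; apply: (@derive_val _ _ _ _ _ _ _).
by apply: is_deriveD; [exact: (Ck_is_derive i x Cf)|exact: (Ck_is_derive i x Cg)].
Qed.

Lemma partial_cst (c : R) i x : partial i (fun _ : 'rV[R]_n => c) x = 0.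
Proof. exact: (@derive_val _ _ _ _ _ _ _ (is_derive_cst c x (delta_mx ord0 i))). Qed.

Lemma partialZ c f i x : Ck 1 f -> partial i (fun x => c * f x) x = c * partial i f x.
Proof.
by move=> Cf; rewrite partialM//; [rewrite partial_cst mulr0 addr0|exact: Ck_cst].
Qed.

Lemma partial_comp (F : R -> R) (F' : R) f i x : Ck 1 f -> is_derive (f x) 1 F F' ->
  partial i (F \o f) x = F' * partial i f x.
Proof.
move=> Cf dF; apply: (@derive_val _ _ _ _ _ _ _).
by apply: is_derive_comp dF; exact: (Ck_is_derive i x Cf).
Qed.

Lemma gradD f g x : Ck 1 f -> Ck 1 g ->
  grad (fun x => f x + g x) x = grad f x + grad g x.
Proof. by move=> Cf Cg; apply/rowP => i; rewrite !mxE partialD. Qed.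

Lemma gradZ c f x : Ck 1 f -> grad (fun x => c * f x) x = c *: grad f x.
Proof. by move=> Cf; apply/rowP => i; rewrite !mxE partialZ. Qed.

Lemma grad_comp (F : R -> R) (F' : R) f x : Ck 1 f -> is_derive (f x) 1 F F' ->
  grad (F \o f) x = F' *: grad f x.
Proof. by move=> Cf dF; apply/rowP => i; rewrite !mxE (partial_comp i Cf dF). Qed.

Lemma test_funD f g : test_fun Om f -> test_fun Om g -> test_fun Om (fun x => f x + g x).
Proof.
move=> tf tg; split; first by apply/smoothP => k; apply: Ck_D; [exact: test_Ck tf|exact: test_Ck tg].
have [_ [K [cK KO Kf]]] := tf; have [_ [K' [cK' KO' Kg]]] := tg.
exists (K `|` K'); split; first exact: compactU.
  by move=> x [/KO|/KO'].
by move=> x /not_orP[/Kf -> /Kg ->]; rewrite addr0.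
Qed.

Lemma test_funZ c f : test_fun Om f -> test_fun Om (fun x => c * f x).
Proof.
move=> tf; split; first by apply/smoothP => k; apply: Ck_Z; exact: test_Ck tf.
have [_ [K [cK KO Kf]]] := tf; exists K; split => // x /Kf ->; exact: mulr0.
Qed.

Lemma test_fun0 : test_fun Om (fun=> 0).
Proof.
split; first by apply/smoothP => k; exact: Ck_cst.
by exists set0; split => //; exact: compact0.
Qed.

Lemma test_fun_approx f e k : 0 < e -> 0 <= k -> test_fun Om f ->
  test_fun Om (fun x => pos_approx e (f x - k)).
Proof.
move=> e0 k0 tf; split.
  apply/smoothP => j; apply: (@pos_approx_Ck _ _ _ (fun x => f x - k)) => //.
  by apply: Ck_B; [exact: test_Ck tf|exact: Ck_cst].
have [_ [K [cK KO Kf]]] := tf; exists K; split => // x /Kf ->.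
by rewrite pos_approx_le0// sub0r oppr_le0.
Qed.

Lemma grad_approx f e k x : 0 < e -> Ck 1 f ->
  grad (fun x => pos_approx e (f x - k)) x = pos_approx' e (f x - k) *: grad f x.
Proof.
move=> e0 Cf; have Ck1 : Ck 1 (fun x => f x - k) by apply: Ck_B => //; exact: Ck_cst.
rewrite -[LHS]/(grad (pos_approx e \o (fun x => f x - k)) x).
rewrite (grad_comp Ck1 (is_derive_pos_approx _ e0)); congr (_ *: _).
rewrite (@gradD f (fun=> - k))//; last exact: Ck_cst.
by apply/rowP => i; rewrite !mxE partial_cst addr0.
Qed.

End test_functions.

Section vector_measurability.
Context {R : realType} {n : nat} (Om : set 'rV[R]_n).
Implicit Types (u : 'rV[R]_n -> R) (G H : 'rV[R]_n -> 'rV[R]_n).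

Definition vmeas G := forall i, measurable_fun Om (fun x => G x ord0 i).

Lemma vmeasD G H : vmeas G -> vmeas H -> vmeas (fun x => G x + H x).
Proof.
move=> mG mH i; rewrite (_ : (fun x => _) = (fun x => G x ord0 i + H x ord0 i)).
  exact: measurable_funD.
by apply/funext => x; rewrite mxE.
Qed.

Lemma vmeasM u G : measurable_fun Om u -> vmeas G -> vmeas (fun x => u x *: G x).
Proof.
move=> mu mG i; rewrite (_ : (fun x => _) = (fun x => u x * G x ord0 i)).
  exact: measurable_funM.
by apply/funext => x; rewrite mxE.
Qed.

Lemma vmeasZ c G : vmeas G -> vmeas (fun x => c *: G x).
Proof. by move=> mG; apply: vmeasM => //; exact: measurable_cst. Qed.

Lemma vmeasN G : vmeas G -> vmeas (fun x => - G x).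
Proof. by move=> /(vmeasZ (-1)) h i; have := h i; under eq_fun do rewrite scaleN1r. Qed.

Lemma vmeasB G H : vmeas G -> vmeas H -> vmeas (fun x => G x - H x).
Proof. by move=> mG mH; apply: vmeasD => //; exact: vmeasN. Qed.

Lemma vmeas_dotv G H : vmeas G -> vmeas H -> measurable_fun Om (fun x => dotv (G x) (H x)).
Proof.
move=> mG mH; rewrite /dotv.
by apply: (@measurable_sum _ _ _ _ _ _ (fun i x => G x ord0 i * H x ord0 i)) => i;
  exact: measurable_funM.
Qed.

Lemma vmeas_enorm G : vmeas G -> measurable_fun Om (fun x => enorm (G x)).
Proof.
move=> mG; have ms : measurable_fun setT (@Num.sqrt R).
  by apply: continuous_measurable_fun; exact: sqrt_continuous.
by apply: (measurableT_comp ms); exact: vmeas_dotv.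
Qed.

Lemma vmeas_grad (psi : 'rV[R]_n -> R) : Ck 1 psi -> vmeas (grad psi).
Proof.
move=> Cp i; rewrite (_ : (fun x => _) = partial i psi); last by apply/funext => x; rewrite mxE.
by apply: continuous_rv_measurable; exact: (Ck_continuous (Ck_partial i Cp)).
Qed.

End vector_measurability.

Section sobolev.
Context {R : realType} {n : nat} (Om : set 'rV[R]_n) (l m : R) (phi : R -> R).
Hypothesis adm : admissible l m phi.
Hypothesis dom : open Om /\ bounded_set Om.
Local Notation h := (hphi phi).
Local Notation P := (NPhi phi).
Local Notation leb := (@lebesgue_rv R n).
Implicit Types (u v : 'rV[R]_n -> R) (G H : 'rV[R]_n -> 'rV[R]_n).

Let oO : open Om. Proof. by case: dom. Qed.
Let bO : bounded_set Om. Proof. by case: dom. Qed.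
Let mO : measurable Om. Proof. exact: open_rv_measurable. Qed.

Definition modu u G x := P (u x) + P (enorm (G x)).

Lemma modu_ge0 u G x : 0 <= modu u G x.
Proof. by rewrite addr_ge0// (NPhi_ge0 adm). Qed.

Lemma meas_NPhi u : measurable_fun Om u -> measurable_fun Om (fun x => P (u x)).
Proof.
move=> mu; apply: measurableT_comp mu; apply: continuous_measurable_fun.
exact: (continuous_NPhi adm).
Qed.

Lemma meas_modu u G : measurable_fun Om u -> vmeas Om G -> measurable_fun Om (modu u G).
Proof.
move=> mu mG; apply: measurable_funD; apply: meas_NPhi => //; exact: vmeas_enorm.
Qed.

(* Modular convergence, equivalent to norm convergence: see [W0_W10] and [W10_W0]. *)
Definition W0 u G : Prop :=
  [/\ measurable_fun Om u, vmeas Om G & forall e, 0 < e -> exists psi,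
    [/\ test_fun Om psi,
        L1 leb Om (modu (fun x => u x - psi x) (fun x => G x - grad psi x)) &
        I leb Om (modu (fun x => u x - psi x) (fun x => G x - grad psi x)) < e]].

Lemma modu_add u v G H x :
  modu (fun x => u x + v x) (fun x => G x + H x) x <= 2 `^ m * (modu u G x + modu v H x).
Proof.
rewrite /modu; have := NPhi_add adm (u x) (v x); have := NPhi_enormD adm (G x) (H x).
move: (2 `^ m) (P _) (P _) (P _) (P _) (P _) (P _) => A B C D E F K; lra.
Qed.

Lemma test_modu psi : test_fun Om psi -> L1 leb Om (modu psi (grad psi)).
Proof.
move=> tp; have Cp := test_Ck 1 tp; have bp := test_bsupp tp.
have mp : measurable_fun Om psi by apply: continuous_rv_measurable; exact: (Ck_continuous Cp).
have [C C0 pC] := bsupp_bounded (Ck_continuous Cp) bp.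
have Ci i := bsupp_bounded (Ck_continuous (Ck_partial i Cp)) (bsupp_partial i bp).
pose K i := projT1 (cid2 (Ci i)).
have KP i x : `|partial i psi x| <= K i by rewrite /K; case: (cid2 (Ci i)) => ? ? /= ->.
apply: (@L1_bounded _ _ Om _ (P C + P (\sum_i K i))) => //.
  by apply: meas_modu => //; exact: vmeas_grad.
move=> x _; rewrite ger0_norm ?modu_ge0//; apply: lerD.
  by apply: (NPhi_le_norm adm); rewrite [leRHS]ger0_norm.
apply: (NPhi_le adm); first exact: enorm_ge0.
apply: le_trans (enorm_le_sum _) _; apply: ler_sum => i _.
by rewrite mxE.
Qed.

Lemma L1_modu_le u v w G H K : measurable_fun Om u -> vmeas Om G ->
  L1 leb Om (modu v H) -> L1 leb Om (modu w K) ->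
  (forall x, Om x -> modu u G x <= 2 `^ m * (modu v H x + modu w K x)) ->
  L1 leb Om (modu u G) /\
  I leb Om (modu u G) <= 2 `^ m * (I leb Om (modu v H) + I leb Om (modu w K)).
Proof.
move=> mu mG Lv Lw le.
have Lb : L1 leb Om (fun x => 2 `^ m * (modu v H x + modu w K x)).
  by apply: L1Z => //; exact: L1D.
have Lu : L1 leb Om (modu u G).
  apply: (L1_le mO _ Lb); first exact: meas_modu.
  by move=> x Ox; rewrite ger0_norm ?modu_ge0// le.
split=> //; apply: le_trans (I_le mO Lu Lb le) _.
by rewrite I_Z; [rewrite I_D|exact: mO|exact: L1D].
Qed.

Lemma L1_modu_add u v G H : measurable_fun Om u -> vmeas Om G ->
  measurable_fun Om v -> vmeas Om H ->
  L1 leb Om (modu u G) -> L1 leb Om (modu v H) ->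
  L1 leb Om (modu (fun x => u x + v x) (fun x => G x + H x)) /\
  I leb Om (modu (fun x => u x + v x) (fun x => G x + H x)) <=
   2 `^ m * (I leb Om (modu u G) + I leb Om (modu v H)).
Proof.
move=> mu mG mv mH Lu Lv; apply: L1_modu_le => //; first exact: measurable_funD.
  exact: vmeasD.
by move=> x _; exact: modu_add.
Qed.

Lemma W0_meas u G : W0 u G -> measurable_fun Om u. Proof. by case. Qed.
Lemma W0_vmeas u G : W0 u G -> vmeas Om G. Proof. by case. Qed.

Lemma test_meas psi : test_fun Om psi -> measurable_fun Om psi.
Proof.
by move=> tp; apply: continuous_rv_measurable; exact: (Ck_continuous (test_Ck 0 tp)).
Qed.

Lemma test_vmeas psi : test_fun Om psi -> vmeas Om (grad psi).
Proof. by move=> tp; apply: vmeas_grad; exact: (test_Ck 1 tp). Qed.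

Lemma W0_test psi : test_fun Om psi -> W0 psi (grad psi).
Proof.
move=> tp; split; [exact: test_meas|exact: test_vmeas|move=> e e0; exists psi].
have -> : modu (fun x => psi x - psi x) (fun x => grad psi x - grad psi x) = fun=> 0.
  by apply/funext => x; rewrite /modu !subrr enorm0 NPhi0 addr0.
by split=> //; [exact: L1_0|rewrite I_0].
Qed.

Lemma W0_modu u G : W0 u G -> L1 leb Om (modu u G).
Proof.
move=> [mu mG /(_ 1 ltr01)[psi [tp L _]]].
have := L1_modu_add _ _ (test_meas tp) (test_vmeas tp) L (test_modu tp).
move=> [||+ _].
- by apply: measurable_funB => //; exact: test_meas.
- by apply: vmeasB => //; exact: test_vmeas.
by apply: (L1_eq mO) => x _; rewrite /modu !subrK.
Qed.

Lemma W0_L1u u G : W0 u G -> L1 leb Om (fun x => P (u x)).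
Proof.
move=> Wu; apply: (L1_le mO _ (W0_modu Wu)); first by apply: meas_NPhi; case: Wu.
by move=> x _; rewrite ger0_norm ?(NPhi_ge0 adm)// lerDl (NPhi_ge0 adm).
Qed.

Lemma W0_L1G u G : W0 u G -> L1 leb Om (fun x => P (enorm (G x))).
Proof.
move=> Wu; apply: (L1_le mO _ (W0_modu Wu)).
  by apply: meas_NPhi; apply: vmeas_enorm; case: Wu.
by move=> x _; rewrite ger0_norm ?(NPhi_ge0 adm)// lerDr (NPhi_ge0 adm).
Qed.

Lemma W0_closed u G : measurable_fun Om u -> vmeas Om G ->
  (forall e, 0 < e -> exists v H, [/\ W0 v H,
     L1 leb Om (modu (fun x => u x - v x) (fun x => G x - H x)) &
     I leb Om (modu (fun x => u x - v x) (fun x => G x - H x)) < e]) -> W0 u G.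
Proof.
move=> mu mG W; split => // e e0.
have p0 : 0 < 2 `^ m :> R by rewrite powR_gt0.
have d0 : 0 < e / (2 * 2 `^ m) by rewrite divr_gt0// mulr_gt0.
have [v [H [[mv mH Wv] Luv Iuv]]] := W _ d0.
have [psi [tp Lvp Ivp]] := Wv _ d0; exists psi.
have mp := test_meas tp; have mgp := test_vmeas tp.
have := L1_modu_add _ _ _ _ Luv Lvp.
move=> [||||L IL]; [exact: measurable_funB|exact: vmeasB|exact: measurable_funB|exact: vmeasB|].
have Eu : (fun x => u x - v x + (v x - psi x)) = (fun x => u x - psi x).
  by apply/funext => x; rewrite addrA subrK.
have EG : (fun x => G x - H x + (H x - grad psi x)) = (fun x => G x - grad psi x).
  by apply/funext => x; rewrite addrA subrK.
rewrite Eu EG in L IL; split=> //; apply: le_lt_trans IL _.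
have -> : e = 2 `^ m * (e / (2 * 2 `^ m) + e / (2 * 2 `^ m)) by field; rewrite gt_eqF.
by rewrite (ltr_pM2l p0); apply: ltrD; [exact: Iuv|exact: Ivp].
Qed.

Lemma W0D u v G H : W0 u G -> W0 v H -> W0 (fun x => u x + v x) (fun x => G x + H x).
Proof.
move=> [mu mG Wu] [mv mH Wv]; split; [exact: measurable_funD|exact: vmeasD|move=> e e0].
have p0 : 0 < 2 `^ m :> R by rewrite powR_gt0.
have d0 : 0 < e / (2 * 2 `^ m) by rewrite divr_gt0// mulr_gt0.
have [psi [tp Lp Ip]] := Wu _ d0; have [chi [tc Lc Ic]] := Wv _ d0.
exists (fun x => psi x + chi x).
have mp := test_meas tp; have mgp := test_vmeas tp.
have mc := test_meas tc; have mgc := test_vmeas tc.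
have := L1_modu_add _ _ _ _ Lp Lc.
move=> [||||L IL]; [exact: measurable_funB|exact: vmeasB|exact: measurable_funB|exact: vmeasB|].
have Eu : (fun x => u x - psi x + (v x - chi x)) = (fun x => u x + v x - (psi x + chi x)).
  by apply/funext => x; rewrite opprD addrACA.
have EG : (fun x => G x - grad psi x + (H x - grad chi x)) =
   (fun x => G x + H x - grad (fun x => psi x + chi x) x).
  apply/funext => x; rewrite gradD; last 2 first.
  - exact: test_Ck tp.
  - exact: test_Ck tc.
  by rewrite opprD addrACA.
rewrite Eu EG in L IL; split=> //; first exact: test_funD.
apply: le_lt_trans IL _.
have -> : e = 2 `^ m * (e / (2 * 2 `^ m) + e / (2 * 2 `^ m)) by field; rewrite gt_eqF.
by rewrite (ltr_pM2l p0); apply: ltrD; [exact: Ip|exact: Ic].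
Qed.

Lemma modu_scale c u G x :
  modu (fun x => c * u x) (fun x => c *: G x) x <= (1 + `|c|) `^ m * modu u G x.
Proof.
have c1 : 1 <= 1 + `|c| by rewrite lerDl.
have H t : P (c * t) <= (1 + `|c|) `^ m * P t.
  apply: le_trans (NPhi_scale_up adm t c1); apply: (NPhi_le_norm adm).
  by rewrite !normrM ler_wpM2r// [leRHS]ger0_norm ?addr_ge0// lerDr.
rewrite /modu mulrDr; apply: lerD => //.
by rewrite enormZ -(NPhi_norm adm) normrM normr_id -normrM (NPhi_norm adm).
Qed.

Lemma W0Z c u G : W0 u G -> W0 (fun x => c * u x) (fun x => c *: G x).
Proof.
move=> [mu mG Wu]; split; [|exact: vmeasZ|move=> e e0].
  by apply: measurable_funM => //; exact: measurable_cst.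
have p0 : 0 < (1 + `|c|) `^ m by rewrite powR_gt0// ltr_pwDl.
have [psi [tp Lp Ip]] := Wu _ (divr_gt0 e0 p0); exists (fun x => c * psi x).
have mp := test_meas tp; have mgp := test_vmeas tp.
have Eu : (fun x => c * u x - c * psi x) = (fun x => c * (u x - psi x)).
  by apply/funext => x; rewrite mulrBr.
have EG : (fun x => c *: G x - grad (fun x => c * psi x) x) = (fun x => c *: (G x - grad psi x)).
  by apply/funext => x; rewrite gradZ ?scalerBr//; exact: test_Ck tp.
have L : L1 leb Om (modu (fun x => c * (u x - psi x)) (fun x => c *: (G x - grad psi x))).
  apply: (L1_le mO _ (L1Z mO ((1 + `|c|) `^ m) Lp)).
    apply: meas_modu; last by apply: vmeasZ; apply: vmeasB.
    by apply: measurable_funM; [exact: measurable_cst|exact: measurable_funB].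
  by move=> x _; rewrite ger0_norm ?modu_ge0// modu_scale.
rewrite Eu EG; split=> //; first exact: test_funZ.
apply: (@le_lt_trans _ _ ((1 + `|c|) `^ m *
  I leb Om (modu (fun x => u x - psi x) (fun x => G x - grad psi x)))).
  rewrite -I_Z//; apply: (I_le mO L); first exact: L1Z.
  by move=> x _; exact: modu_scale.
by rewrite -ltr_pdivlMl// mulrC.
Qed.

Lemma W0B u v G H : W0 u G -> W0 v H -> W0 (fun x => u x - v x) (fun x => G x - H x).
Proof.
move=> Wu /(W0Z (-1)) Wv; have := W0D Wu Wv.
by under eq_fun do rewrite mulN1r; under [X in W0 _ X]eq_fun do rewrite scaleN1r.
Qed.

Lemma W0_0 : W0 (fun=> 0) (fun=> 0).
Proof.
have := W0_test (test_fun0 Om); congr W0; apply/funext => x.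
by apply/rowP => i; rewrite !mxE partial_cst.
Qed.

Lemma cvg_series_terms (a : nat -> R) M : (forall k, 0 <= a k) ->
  (forall N, \sum_(k < N) a k <= M) -> a k @[k --> \oo] --> (0 : R).
Proof.
move=> a0 aM; apply: cvg_series_cvg_0; apply: nondecreasing_is_cvgn.
  by apply: nondecreasing_series => k _ _; exact: a0.
by exists M => _ [N _ <-] /=; rewrite /series /= big_mkord.
Qed.

Lemma NPhi_cvg0 (s : nat -> R) : P (s k) @[k --> \oo] --> (0 : R) ->
  s k @[k --> \oo] --> (0 : R).
Proof.
move=> Ps; apply/cvgr0Pnorm_lt => e e0.
have Pe : 0 < P e by apply: (NPhi_gt0 adm); rewrite gt_eqF.
have /cvgr0Pnorm_lt/(_ _ Pe) := Ps; apply: filterS => k.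
rewrite (ger0_norm (NPhi_ge0 adm _)) => Pk; rewrite ltNge; apply/negP => es.
have : P e <= P (s k) by apply: (NPhi_le_norm adm); rewrite (ger0_norm (ltW e0)).
by rewrite leNgt Pk.
Qed.

(** The bounds 2^(- k) are summable, so the series of modulars converges almost everywhere and its
    terms tend to 0. *)
Lemma modu_cvg0 (F : nat -> 'rV[R]_n -> R) (H : nat -> 'rV[R]_n -> 'rV[R]_n) :
  (forall k, L1 leb Om (modu (F k) (H k))) ->
  (forall k, I leb Om (modu (F k) (H k)) <= 2^-1 ^+ k) ->
  aeD leb Om (fun x => F k x @[k --> \oo] --> (0 : R) /\
                       enorm (H k x) @[k --> \oo] --> (0 : R)).
Proof.
move=> LF IF.
have S N : \sum_(k < N) I leb Om (modu (F k) (H k)) <= 2.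
  apply: (@le_trans _ _ (\sum_(k < N) 2^-1 ^+ k)); first exact: ler_sum.
  rewrite -(big_mkord xpredT (fun k => 2^-1 ^+ k)).
  have -> : \sum_(0 <= k < N) 2^-1 ^+ k = 2 - 2 * 2^-1 ^+ N :> R.
    elim: N => [|N IH]; first by rewrite big_nil expr0 mulr1 subrr.
    by rewrite big_nat_recr//= IH exprS; field.
  by rewrite gerBl mulr_ge0// exprn_ge0.
have := I_series mO LF (fun k x _ => modu_ge0 (F k) (H k) x) S.
apply: aeDS => x Ox [M HM].
have c := cvg_series_terms (fun k => modu_ge0 (F k) (H k) x) HM.
split; apply: NPhi_cvg0.
  apply: (squeeze_cvgr _ (cvg_cst 0) c); apply: nearW => k.
  by rewrite (NPhi_ge0 adm) /modu lerDl (NPhi_ge0 adm).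
apply: (squeeze_cvgr _ (cvg_cst 0) c); apply: nearW => k.
by rewrite (NPhi_ge0 adm) /modu lerDr (NPhi_ge0 adm).
Qed.

Lemma cvg_of_sub0 (a : nat -> R) c :
  c - a k @[k --> \oo] --> (0 : R) -> a k @[k --> \oo] --> c.
Proof.
move=> h; have -> : a = (fun k => c - (c - a k)) by apply/funext => k; ring.
by rewrite -[X in _ --> X](subr0 c); apply: cvgB => //; exact: cvg_cst.
Qed.

Lemma pow2_gt0 k : 0 < 2^-1 ^+ k :> R.
Proof. by rewrite exprn_gt0// invr_gt0. Qed.

Lemma pow2_cvg0 : 2^-1 ^+ k @[k --> \oo] --> (0 : R).
Proof. by apply: cvg_expr; rewrite ger0_norm ?invr_ge0// invf_lt1 ?ltr1n. Qed.

Lemma enorm_cvg0 (F : nat -> 'rV[R]_n) (G : 'rV[R]_n) :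
  enorm (G - F k) @[k --> \oo] --> (0 : R) ->
  forall i, F k ord0 i @[k --> \oo] --> G ord0 i.
Proof.
move=> c i.
have h : G ord0 i - F k ord0 i @[k --> \oo] --> (0 : R).
  apply/norm_cvg0P; apply: (squeeze_cvgr _ (cvg_cst 0) c); apply: nearW => k.
  by rewrite normr_ge0; have := coord_le_enorm (G - F k) i; rewrite !mxE.
exact: cvg_of_sub0 h.
Qed.

(** Test functions with error 2^(- k) converge almost everywhere as a whole sequence, so that no
    subsequence has to be carried along. *)
Lemma W0_seq u G : W0 u G -> exists psi : nat -> 'rV[R]_n -> R,
  [/\ forall k, test_fun Om (psi k),
      forall k, L1 leb Om (modu (fun x => u x - psi k x) (fun x => G x - grad (psi k) x)),
      I leb Om (modu (fun x => u x - psi k x) (fun x => G x - grad (psi k) x)) @[k --> \oo] --> (0 : R) &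
      aeD leb Om (fun x => psi k x @[k --> \oo] --> u x /\
         forall i, grad (psi k) x ord0 i @[k --> \oo] --> G x ord0 i)].
Proof.
move=> [mu mG W]; pose psi k := projT1 (cid (W _ (pow2_gt0 k))).
have H k := projT2 (cid (W _ (pow2_gt0 k))); exists psi.
have tp k : test_fun Om (psi k) by have [] := H k.
have Lp k : L1 leb Om (modu (fun x => u x - psi k x) (fun x => G x - grad (psi k) x)).
  by have [] := H k.
have Ip k : I leb Om (modu (fun x => u x - psi k x) (fun x => G x - grad (psi k) x)) <= 2^-1 ^+ k.
  by have [_ _ /ltW] := H k.
split=> //.
  apply: (squeeze_cvgr _ (cvg_cst 0) pow2_cvg0); apply: nearW => k.
  by rewrite Ip andbT I_ge0// => x _; exact: modu_ge0.
have := modu_cvg0 Lp Ip; apply: aeDS => x _ [c1 c2]; split; last exact: enorm_cvg0.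
exact: cvg_of_sub0 c1.
Qed.

Lemma W0_cvg u G (v : nat -> 'rV[R]_n -> R) (H : nat -> 'rV[R]_n -> 'rV[R]_n) : measurable_fun Om u -> vmeas Om G ->
  (forall k, W0 (v k) (H k)) ->
  (forall k, L1 leb Om (modu (fun x => u x - v k x) (fun x => G x - H k x))) ->
  I leb Om (modu (fun x => u x - v k x) (fun x => G x - H k x)) @[k --> \oo] --> (0 : R) ->
  W0 u G.
Proof.
move=> mu mG W L c; apply: W0_closed => // e e0.
have /cvgr0Pnorm_lt/(_ _ e0) [N _ /(_ N (leqnn N))] := c.
move=> HN; exists (v N), (H N); split; [exact: W|exact: L|].
exact: le_lt_trans (ler_norm _) HN.
Qed.

(** The form in which membership in W0 is passed to limits: pointwise convergence with an integrable
    majorant for the modular of the differences. *)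
Lemma W0_dct u G (v : nat -> 'rV[R]_n -> R) (H : nat -> 'rV[R]_n -> 'rV[R]_n) g : measurable_fun Om u -> vmeas Om G ->
  (forall k, W0 (v k) (H k)) -> L1 leb Om g ->
  (forall k, aeD leb Om (fun x => modu (fun x => u x - v k x) (fun x => G x - H k x) x <= g x)) ->
  aeD leb Om (fun x => v k x @[k --> \oo] --> u x /\
     enorm (G x - H k x) @[k --> \oo] --> (0 : R)) ->
  W0 u G /\ I leb Om (modu (fun x => u x - v k x) (fun x => G x - H k x)) @[k --> \oo] --> (0 : R).
Proof.
move=> mu mG W Lg le c.
pose F k := modu (fun x => u x - v k x) (fun x => G x - H k x).
have mF k : measurable_fun Om (F k).
  apply: meas_modu; first by apply: measurable_funB => //; case: (W k).
  by apply: vmeasB => //; case: (W k).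
have leF k : aeD leb Om (fun x => `|F k x| <= g x).
  by have := le k; apply: aeDS => x _; rewrite ger0_norm// modu_ge0.
have cF : aeD leb Om (fun x => F k x @[k --> \oo] --> (0 : R)).
  move: c; apply: aeDS => x _ [c1 c2].
  have P0 : P 0 = 0 by exact: NPhi0.
  rewrite -[X in _ --> X](addr0 0) -{1}P0 -{2}P0; apply: cvgD.
    apply: continuous_cvg; first exact: (continuous_NPhi adm).
    by rewrite -[X in _ --> X](subrr (u x)); apply: cvgB => //; exact: cvg_cst.
  by apply: continuous_cvg; first exact: (continuous_NPhi adm).
have m0 : measurable_fun Om (fun _ : 'rV[R]_n => 0 : R) by exact: measurable_cst.
have [_ LF IF] := I_dct mO mF m0 Lg leF cF.
rewrite I_0 in IF; split; last exact: IF.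
exact: (W0_cvg mu mG W).
Qed.

End sobolev.

(** * Positive parts in W0 *)

Section truncation.
Context {R : realType} {n : nat} (Om : set 'rV[R]_n) (l m : R) (phi : R -> R).
Hypothesis adm : admissible l m phi.
Hypothesis dom : open Om /\ bounded_set Om.
Local Notation P := (NPhi phi).
Local Notation leb := (@lebesgue_rv R n).
Local Notation W0 := (W0 Om phi).
Local Notation modu := (modu phi).
Implicit Types (u v : 'rV[R]_n -> R) (G H : 'rV[R]_n -> 'rV[R]_n).

Let oO : open Om. Proof. by case: dom. Qed.
Let bO : bounded_set Om. Proof. by case: dom. Qed.
Let mO : measurable Om. Proof. exact: open_rv_measurable. Qed.

Lemma pos_approx_lip e (s t : R) : 0 < e -> `|pos_approx e s - pos_approx e t| <= `|s - t|.
Proof.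
move=> e0; wlog st : s t / s <= t => [H|].
  by have [/H//|/ltW/H] := leP s t; rewrite distrC (distrC t).
have [c _ E] : exists2 c, c \in `[s, t] & pos_approx e t - pos_approx e s = pos_approx' e c * (t - s).
  apply: MVT_segment => //; first by move=> x _; exact: is_derive_pos_approx.
  by apply: derivable_within_continuous => x _; have [] := is_derive_pos_approx x e0.
rewrite distrC E normrM (distrC s) ler_piMl//.
by have /andP[a b] := pos_approx'_bound c e0; rewrite ger0_norm.
Qed.

Lemma cvg_scale_diff (a : nat -> R) (b : R) (G : 'rV[R]_n) : a j @[j --> \oo] --> b ->
  enorm (b *: G - a j *: G) @[j --> \oo] --> (0 : R).
Proof.
move=> c; have -> : (fun j => enorm (b *: G - a j *: G)) = (fun j => `|b - a j| * enorm G).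
  by apply/funext => j; rewrite -scalerBl enormZ.
rewrite -[X in _ --> X](mul0r (enorm G)); apply: cvgM; last exact: cvg_cst.
apply/norm_cvg0P; rewrite -[X in _ --> X](subrr b).
by apply: cvgB; [exact: cvg_cst|exact: c].
Qed.

Lemma continuous_pos_approx e : 0 < e -> continuous (@pos_approx R e).
Proof.
move=> e0 t; apply: differentiable_continuous; apply/derivable1_diffP.
by have [] := is_derive_pos_approx t e0.
Qed.

(** The error of the gradients splits into [pos_approx'] times G - grad psi, small with the modular,
    and the coefficient difference [dl] times G, small by dominated convergence. As k >= 0,
    truncated test functions keep their compact support. *)
Lemma W0_pos_approx e k v G : 0 < e -> 0 <= k -> W0 v G ->
  W0 (fun x => pos_approx e (v x - k)) (fun x => pos_approx' e (v x - k) *: G x).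
Proof.
move=> e0 k0 Wv; have [psi [tp Lp Ip aep]] := W0_seq adm dom Wv.
have mv := W0_meas Wv; have mG := W0_vmeas Wv.
pose w j x := pos_approx e (psi j x - k).
pose H j x := pos_approx' e (psi j x - k) *: grad (psi j) x.
have tw j : test_fun Om (w j) by exact: test_fun_approx.
have Ww j : W0 (w j) (H j).
  have -> : H j = grad (w j).
    by apply/funext => x; rewrite /w grad_approx//; exact: test_Ck (tp j).
  exact: W0_test.
have mfv (F : R -> R) : continuous F -> measurable_fun Om (fun x => F (v x - k)).
  move=> cF; apply: (measurableT_comp (continuous_measurable_fun cF)).
  by apply: measurable_funB => //; exact: measurable_cst.
have mfp j (F : R -> R) : continuous F -> measurable_fun Om (fun x => F (psi j x - k)).
  move=> cF; apply: (measurableT_comp (continuous_measurable_fun cF)).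
  by apply: measurable_funB; [exact: (test_meas (tp j))|exact: measurable_cst].
have cpa := continuous_pos_approx e0; have cpa' := continuous_pos_approx' e0.
pose dl j x := pos_approx' e (v x - k) - pos_approx' e (psi j x - k).
have mdl j : measurable_fun Om (dl j) by apply: measurable_funB; [exact: mfv|exact: mfp].
have dl1 j x : `|dl j x| <= 1.
  have := pos_approx'_bound (v x - k) e0; have := pos_approx'_bound (psi j x - k) e0.
  by rewrite ler_norml /dl; lra.
pose g j x := P (`|dl j x| * enorm (G x)).
have LG := W0_L1G adm dom Wv.
have mg j : measurable_fun Om (g j).
  apply: (meas_NPhi adm); apply: measurable_funM; first exact: measurableT_comp.
  exact: vmeas_enorm.
have [_ Lg Ig] : [/\ L1 leb Om (fun=> 0), forall j, L1 leb Om (g j) &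
    I leb Om (g j) @[j --> \oo] --> I leb Om (fun=> 0)].
  apply: (I_dct mO mg _ LG); first exact: measurable_cst.
  - move=> j; apply: aeDT => x _; rewrite ger0_norm ?(NPhi_ge0 adm)//.
    apply: (NPhi_le adm); first by rewrite mulr_ge0// enorm_ge0.
    by rewrite ler_piMl// enorm_ge0.
  - apply: aeDS aep => x _ [c1 _].
    rewrite -[X in _ --> X](NPhi0 phi); apply: continuous_cvg; first exact: (continuous_NPhi adm).
    rewrite -[X in _ --> X](mul0r (enorm (G x))); apply: cvgM; last exact: cvg_cst.
    apply/norm_cvg0P; rewrite -[X in _ --> X](subrr (pos_approx' e (v x - k))).
    apply: cvgB; first exact: cvg_cst.
    apply: continuous_cvg; first exact: cpa'.
    by apply: cvgB => //; exact: cvg_cst.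
rewrite I_0 in Ig.
have mW : measurable_fun Om (fun x => pos_approx e (v x - k)) by exact: mfv.
have mWG : vmeas Om (fun x => pos_approx' e (v x - k) *: G x).
  by apply: vmeasM => //; exact: mfv.
pose D j := modu (fun x => pos_approx e (v x - k) - w j x)
  (fun x => pos_approx' e (v x - k) *: G x - H j x).
pose B j x := (1 + 2 `^ m) * (modu (fun x => v x - psi j x) (fun x => G x - grad (psi j) x) x + g j x).
have p0 : 0 < 2 `^ m :> R by rewrite powR_gt0.
have LB j : L1 leb Om (B j) by apply: L1Z => //; apply: L1D => //; exact: Lp.
have DB j x : D j x <= B j x.
  have d1 : P (pos_approx e (v x - k) - w j x) <= P (v x - psi j x).
    apply: (NPhi_le_norm adm); apply: le_trans (pos_approx_lip _ _ e0) _.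
    by rewrite (_ : v x - k - (psi j x - k) = v x - psi j x)//; ring.
  have d2 : P (enorm (pos_approx' e (v x - k) *: G x - H j x)) <=
    2 `^ m * (P (enorm (G x - grad (psi j) x)) + g j x).
    rewrite (_ : _ - _ = pos_approx' e (psi j x - k) *: (G x - grad (psi j) x) + dl j x *: G x);
      last by apply/rowP => i; rewrite /dl /H !mxE; ring.
    apply: (le_trans (NPhi_enormD adm _ _)); rewrite (ler_pM2l p0); apply: lerD.
      apply: (NPhi_le adm); first exact: enorm_ge0.
      rewrite enormZ ler_piMl ?enorm_ge0//.
      by have /andP[a b] := pos_approx'_bound (psi j x - k) e0; rewrite ger0_norm.
    by rewrite enormZ.
  have g0 : 0 <= g j x := NPhi_ge0 adm _.
  have a0 : 0 <= P (enorm (G x - grad (psi j) x)) := NPhi_ge0 adm _.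
  have b0 : 0 <= P (v x - psi j x) := NPhi_ge0 adm _.
  rewrite /D /B /modu; move: d1 d2 g0 a0 b0 p0; clear.
  by move: (2 `^ m) (P _) (P _) (P _) (P _) (g j x) => p a b c d f; nra.
have LD j : L1 leb Om (D j).
  apply: (L1_le mO _ (LB j)); last by move=> x _; rewrite ger0_norm ?(modu_ge0 adm).
  apply: (meas_modu adm); first by apply: measurable_funB => //; exact: test_meas.
  by apply: vmeasB => //; exact: (W0_vmeas (Ww j)).
apply: (W0_cvg adm dom mW mWG Ww LD).
apply: (@squeeze_cvgr _ _ _ _ (fun=> 0) (fun j => I leb Om (B j))).
- apply: nearW => j; apply/andP; split.
    by apply: I_ge0 => x _; exact: (modu_ge0 adm).
  by apply: (I_le mO (LD j) (LB j)) => x _; exact: DB.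
- exact: cvg_cst.
- have EB j : I leb Om (B j) = (1 + 2 `^ m) * (I leb Om (modu (fun x => v x - psi j x)
      (fun x => G x - grad (psi j) x)) + I leb Om (g j)).
    by rewrite I_Z//; [rewrite I_D//; exact: Lp|apply: L1D => //; exact: Lp].
  rewrite (funext EB).
  rewrite -[X in _ --> X](mulr0 (1 + 2 `^ m)); apply: cvgM; first exact: cvg_cst.
  by rewrite -[X in _ --> X](addr0 0); exact: cvgD.
Qed.

(** [pos_approx'] is 0 for t <= 0, so the gradients converge to the strict indicator times G, and
    nothing has to be known about G on the level set where v = k. *)
Lemma W0_trunc k v G : 0 <= k -> W0 v G ->
  W0 (fun x => Num.max (v x - k) 0) (fun x => (k < v x)%R%:R *: G x).
Proof.
move=> k0 Wv; have mv := W0_meas Wv; have mG := W0_vmeas Wv.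
pose e (j : nat) : R := j.+1%:R^-1; have e0 j : 0 < e j by rewrite invr_gt0.
have W j := W0_pos_approx (e0 j) k0 Wv.
have mk : measurable_fun Om (fun x => v x - k).
  by apply: measurable_funB => //; exact: measurable_cst.
have c1 x : pos_approx (e j) (v x - k) @[j --> \oo] --> Num.max (v x - k) 0.
  exact: pos_approx_cvg.
have c2 x : pos_approx' (e j) (v x - k) @[j --> \oo] --> ((k < v x)%R%:R : R).
  by rewrite -subr_gt0; exact: pos_approx'_cvg.
have mmax : measurable_fun Om (fun x => Num.max (v x - k) 0).
  by apply: measurable_maxr => //; exact: measurable_cst.
have mind : measurable_fun Om (fun x => (k < v x)%R%:R : R).
  apply: measurableT_comp => //; apply: measurable_fun_ltr => //; exact: measurable_cst.
apply: (proj1 (W0_dct adm dom mmax (vmeasM mind mG) W (W0_modu adm dom Wv) _ _)).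
- move=> j; apply: aeDT => x _; apply: lerD.
    apply: (NPhi_le_norm adm).
    have /andP[a b] := pos_approx_bound (v x - k) (e0 j).
    rewrite ger0_norm ?subr_ge0//; apply: (@le_trans _ _ (Num.max (v x - k) 0)).
      by rewrite gerBl.
    rewrite ge_max normr_ge0 andbT; apply: le_trans (ler_norm _).
    by rewrite gerBl.
  apply: (NPhi_le adm); first exact: enorm_ge0.
  rewrite -scalerBl enormZ ler_piMl ?enorm_ge0//.
  have /andP[a b] := pos_approx'_bound (v x - k) (e0 j).
  by rewrite ler_norml; case: (k < v x) => /=; lra.
- apply: aeDT => x _; split; first exact: c1.
  by apply: cvg_scale_diff; exact: c2.
Qed.

(** For smooth v that exceeds the level k inside K only, without being itself in W0: the paraboloids
    and the barriers. *)
Lemma W0_trunc_smooth k (v : 'rV[R]_n -> R) (K : set 'rV[R]_n) :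
  smooth v -> compact K -> K `<=` Om -> (forall x, ~ K x -> v x <= k) ->
  W0 (fun x => Num.max (v x - k) 0) (fun x => (k < v x)%R%:R *: grad v x).
Proof.
move=> sv cK KO vk; have Cv : forall j, Ck j v by apply/smoothP.
pose e (j : nat) : R := j.+1%:R^-1; have e0 j : 0 < e j by rewrite invr_gt0.
have W j : W0 (fun x => pos_approx (e j) (v x - k)) (fun x => pos_approx' (e j) (v x - k) *: grad v x).
  have tw : test_fun Om (fun x => pos_approx (e j) (v x - k)).
    split; last by exists K; split => // x nK; rewrite pos_approx_le0// subr_le0 vk.
    apply/smoothP => i; apply: (@pos_approx_Ck _ _ _ (fun x => v x - k)) => //.
    by apply: Ck_B => //; exact: Ck_cst.
  have := W0_test phi tw; congr W0; apply/funext => x.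
  by rewrite grad_approx.
have cv := Ck_continuous (Cv 0%N).
have mv : measurable_fun Om v by exact: continuous_rv_measurable.
have mG : vmeas Om (grad v) by exact: vmeas_grad.
have mk : measurable_fun Om (fun x => v x - k).
  by apply: measurable_funB => //; exact: measurable_cst.
have mmax : measurable_fun Om (fun x => Num.max (v x - k) 0).
  by apply: measurable_maxr => //; exact: measurable_cst.
have mind : measurable_fun Om (fun x => (k < v x)%R%:R : R).
  apply: measurableT_comp => //; apply: measurable_fun_ltr => //; exact: measurable_cst.
have bK : bounded_set K := compact_bounded cK.
have [C C0 HC] : exists2 C, 0 <= C & forall x, K x -> `|v x| <= C /\ enorm (grad v x) <= C.
  have bd (f : 'rV[R]_n -> R) : continuous f -> exists2 C, 0 <= C & forall x, K x -> `|f x| <= C.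
    move=> cf; have /compact_bounded[B [_ HB]] := continuous_compact (continuous_subspaceT cf) cK.
    have := HB (`|B| + 1) _; rewrite (le_lt_trans (ler_norm _)) ?ltrDl// => /(_ isT) H.
    by exists (`|B| + 1) => [|x Kx]; [rewrite addr_ge0|apply: H; exists x].
  have [C0 C00 HC0] := bd v cv.
  have Ci i := bd _ (Ck_continuous (Ck_partial i (Cv 1%N))).
  pose B i := projT1 (cid2 (Ci i)).
  have BP i x : K x -> `|partial i v x| <= B i by rewrite /B; case: (cid2 (Ci i)) => ? ? /= H /H.
  have B0 i : 0 <= B i by rewrite /B; case: (cid2 (Ci i)).
  exists (C0 + \sum_i B i) => [|x Kx]; first by rewrite addr_ge0// sumr_ge0.
  split; first by rewrite (le_trans (HC0 x Kx))// lerDl sumr_ge0.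
  apply: le_trans (enorm_le_sum _) _; apply: ler_wpDl => //; apply: ler_sum => i _.
  by rewrite mxE BP.
have Lg : L1 leb Om (fun=> P (C + `|k|) + P C).
  apply: (@L1_bounded _ _ Om _ (P (C + `|k|) + P C)) => //.
  by move=> x _; rewrite ger0_norm// addr_ge0// (NPhi_ge0 adm).
apply: (proj1 (W0_dct adm dom mmax (vmeasM mind mG) W Lg _ _)).
- move=> j; apply: aeDT => x _; apply: lerD.
    apply: (NPhi_le_norm adm).
    have /andP[a b] := pos_approx_bound (v x - k) (e0 j).
    rewrite ger0_norm ?subr_ge0//; apply: (@le_trans _ _ (Num.max (v x - k) 0)).
      by rewrite gerBl.
    rewrite [leRHS]ger0_norm ?addr_ge0// ge_max addr_ge0// andbT.
    have [xK|xK] := pselect (K x); last by rewrite (@le_trans _ _ 0) ?subr_le0 ?vk// addr_ge0.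
    have [vC _] := HC x xK; rewrite (le_trans (ler_norm _))//.
    by rewrite (le_trans (ler_normB _ _))// lerD2r.
  have [xK|xK] := pselect (K x); last first.
    rewrite pos_approx'_le0 ?subr_le0 ?vk// scale0r subr0.
    by rewrite ltNge vk// scale0r enorm0 NPhi0 (NPhi_ge0 adm).
  apply: (NPhi_le adm); first exact: enorm_ge0.
  rewrite -scalerBl enormZ; have [_ gC] := HC x xK; apply: le_trans gC.
  rewrite ler_piMl ?enorm_ge0//.
  have /andP[a b] := pos_approx'_bound (v x - k) (e0 j).
  by rewrite ler_norml; case: (k < v x) => /=; lra.
- apply: aeDT => x _; split; first exact: pos_approx_cvg.
  by apply: cvg_scale_diff; rewrite -subr_gt0; exact: pos_approx'_cvg.
Qed.

End truncation.

(** The upper limit is measurable whether or not the sequence converges, and it agrees with the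
    limit wherever that exists. *)
Lemma lim_measurable d (T : measurableType d) (R : realType) (D : set T)
    (f : nat -> T -> R) : measurable D -> (forall k, measurable_fun D (f k)) ->
  exists2 g, measurable_fun D g &
    forall x (c : R), f k x @[k --> \oo] --> c -> g x = c.
Proof.
move=> mD mf; exists (fun x => fine (limn_esup (fun k => (f k x)%:E))).
  apply: (measurableT_comp (fine_measurable measurableT)).
  by apply: measurable_fun_limn_esup => k; exact/measurable_EFinP.
move=> x c fc; have fc' : (f k x)%:E @[k --> \oo] --> c%:E.
  by apply: cvg_EFin; [exact: nearW|exact: fc].
rewrite is_cvg_limn_esupE; last by apply/cvg_ex; exists c%:E.
by rewrite (cvg_lim _ fc').
Qed.

(** * Poincare's inequality and completeness of W0 *)

Section completeness.
Context {R : realType} {n : nat} (Om : set 'rV[R]_n) (l m : R) (phi : R -> R).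
Hypothesis adm : admissible l m phi.
Hypothesis dom : open Om /\ bounded_set Om.
Local Notation h := (hphi phi).
Local Notation P := (NPhi phi).
Local Notation leb := (@lebesgue_rv R n).
Local Notation W0 := (W0 Om phi).
Local Notation modu := (modu phi).
Implicit Types (u v : 'rV[R]_n -> R) (G H : 'rV[R]_n -> 'rV[R]_n).

Let oO : open Om. Proof. by case: dom. Qed.
Let bO : bounded_set Om. Proof. by case: dom. Qed.
Let mO : measurable Om. Proof. exact: open_rv_measurable. Qed.

Lemma bounded_coord (A : set 'rV[R]_n) : bounded_set A ->
  exists2 D, 0 < D & forall x i, A x -> `|x ord0 i| <= D.
Proof.
move=> [M [_ HM]]; exists (`|M| + 1) => [|x i Ax]; first by rewrite ltr_wpDl.
apply: le_trans (ler_rv_norm x i) _; apply: HM => //.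
by rewrite (le_lt_trans (ler_norm _))// ltrDl.
Qed.

(** The integral of the i-th derivative of x_i P(psi) vanishes. As |x_i| <= D on Om, Young's
    inequality bounds the term x_i h(psi) times the derivative of psi by half of P(psi), which is
    absorbed, plus a multiple of P|grad psi|. *)
Lemma poincare_test (i : 'I_n) : exists2 C, 0 <= C & forall psi, test_fun Om psi ->
  I leb Om (fun x => P (psi x)) <= C * I leb Om (fun x => P (enorm (grad psi x))).
Proof.
have [D D0 HD] := bounded_coord bO.
have e0 : 0 < (2 * D)^-1 by rewrite invr_gt0 mulr_gt0.
have [C C0 HC] := hphi_young adm e0.
exists (2 * D * C) => [|psi tp]; first by rewrite !mulr_ge0// ltW.
have Cp : Ck 1 psi by exact: test_Ck _ tp.
pose f := fun x : 'rV[R]_n => x ord0 i * P (psi x).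
have CP : Ck 1 (fun x => P (psi x)).
  exact: (C1_comp (is_derive_NPhi adm) (continuous_hphi adm) Cp).
have Cc : Ck 1 (fun x : 'rV[R]_n => x ord0 i) by exact: Ck_coord.
have Cf : Ck 1 f by exact: Ck_M.
have bf : bsupp f.
  have [M HM] := test_bsupp tp; exists M => x /HM px.
  by rewrite /f px (NPhi0 phi) mulr0.
have [_ I0] := int_partial0 i Cf bf.
have pf x : partial i f x = x ord0 i * (h (psi x) * partial i psi x) + P (psi x).
  rewrite /f partialM// (partial_comp _ Cp (is_derive_NPhi adm (psi x))).
  have dc : is_derive x (delta_mx ord0 i) (fun y : 'rV[R]_n => y ord0 i) 1.
    by have := is_derive_coord x (delta_mx ord0 i) i; rewrite mxE !eqxx.
  by rewrite /partial (@derive_val _ _ _ _ _ _ _ dc) mulr1.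
rewrite -(I_restrict (Om := Om)) in I0; last first.
  move=> x nx; rewrite pf (test_out tp nx) (test_partial_out i tp nx).
  by rewrite !mulr0 (NPhi0 phi) addr0.
have Lpsi := test_modu adm dom tp.
have Wp := W0_test phi tp.
have LP := W0_L1u adm dom Wp; have LG := W0_L1G adm dom Wp.
pose g (x : 'rV[R]_n) := x ord0 i * (h (psi x) * partial i psi x).
have gle x : Om x -> `|g x| <= 2^-1 * P (psi x) + D * C * P (enorm (grad psi x)).
  move=> Ox; have xD := HD x i Ox.
  have hN : `|h (psi x)| = h `|psi x|.
    have [p0|p0] := leP 0 (psi x).
      by rewrite !ger0_norm// (hphi_ge0 adm).
    rewrite [in RHS]ltr0_norm// hphiN ltr0_norm//.
    by rewrite -oppr_gt0 -hphiN (hphi_gt0 adm)// oppr_gt0.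
  have gi : `|partial i psi x| <= enorm (grad psi x).
    by have := coord_le_enorm (grad psi x) i; rewrite mxE.
  have h0 : 0 <= h `|psi x| by rewrite (hphi_ge0 adm).
  have := HC `|psi x| (enorm (grad psi x)) (normr_ge0 _) (enorm_ge0 _).
  rewrite (NPhi_norm adm) => H1.
  rewrite /g normrM normrM hN.
  apply: (@le_trans _ _ (D * (h `|psi x| * enorm (grad psi x)))).
    by apply: ler_pM => //; [rewrite mulr_ge0|exact: ler_wpM2l].
  apply: (@le_trans _ _ (D * ((2 * D)^-1 * P (psi x) + C * P (enorm (grad psi x))))).
    by rewrite ler_pM2l.
  by rewrite mulrDr !mulrA invfM mulrCA mulfV ?mulr1// gt_eqF.
have mg : measurable_fun Om g.
  have -> : g = fun x => partial i f x - P (psi x) by apply/funext => x; rewrite pf addrK.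
  apply: measurable_funB; apply: continuous_rv_measurable; last exact: (Ck_continuous CP).
  exact: (Ck_continuous (Ck_partial i Cf)).
have LB : L1 leb Om (fun x => 2^-1 * P (psi x) + D * C * P (enorm (grad psi x))).
  by apply: L1D => //; exact: L1Z.
have Lg := L1_le mO mg LB gle.
have E : I leb Om g + I leb Om (fun x => P (psi x)) = 0.
  by rewrite -I_D// -[RHS]I0; apply: I_eq => x _; rewrite pf.
have B : - I leb Om g <= 2^-1 * I leb Om (fun x => P (psi x)) +
    D * C * I leb Om (fun x => P (enorm (grad psi x))).
  rewrite -I_N// -!I_Z// -I_D//; [|exact: L1Z|exact: L1Z].
  apply: (I_le mO) => //; first exact: L1N.
  by move=> x Ox; rewrite (le_trans _ (gle x Ox))// -normrN ler_norm.
by rewrite -(mulrA 2); move: E B; clear; move: (I _ _ _) (I _ _ _) (I _ _ _) (D * C) => *; nra.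
Qed.

Lemma poincare (i : 'I_n) : exists2 C, 0 <= C & forall u G, W0 u G ->
  I leb Om (fun x => P (u x)) <= C * I leb Om (fun x => P (enorm (G x))).
Proof.
have [C C0 HC] := poincare_test i; have K0 : 0 < 2 `^ m :> R by rewrite powR_gt0.
exists (2 `^ m * (C * 2 `^ m)) => [|u G W]; first by rewrite !mulr_ge0// ltW.
have [mu mG Wa] := W; apply/ler_addgt0Pr => e e0.
set K := 2 `^ m in K0 *.
(* The approximation error enters with factor K through u itself and with factor K C K through the
   gradient. *)
pose d := e / (K + K * C * K + 1).
have d0 : 0 < d by rewrite divr_gt0// ltr_wpDl// addr_ge0 ?mulr_ge0// ltW.
have [psi [tp Lp Ip]] := Wa d d0.
have Wp := W0_test phi tp.
have LPu := W0_L1u adm dom W; have LPG := W0_L1G adm dom W.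
have LPp := W0_L1u adm dom Wp; have LGp := W0_L1G adm dom Wp.
have H1 : I leb Om (fun x => P (u x)) <=
    K * (I leb Om (modu (fun x => u x - psi x) (fun x => G x - grad psi x)) + I leb Om (fun x => P (psi x))).
  rewrite -I_D// -I_Z//; last exact: L1D.
  apply: (I_le mO LPu); first exact: (L1Z mO K (L1D mO Lp LPp)).
  move=> x _; have := NPhi_add adm (u x - psi x) (psi x).
  rewrite subrK => /le_trans; apply; rewrite -/K (ler_pM2l K0); apply: lerD => //.
  by rewrite /modu lerDl (NPhi_ge0 adm).
have H2 : I leb Om (fun x => P (enorm (grad psi x))) <=
    K * (I leb Om (fun x => P (enorm (G x))) + I leb Om (modu (fun x => u x - psi x) (fun x => G x - grad psi x))).
  rewrite -I_D// -I_Z//; last exact: L1D.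
  apply: (I_le mO LGp); first exact: (L1Z mO K (L1D mO LPG Lp)).
  move=> x _; have := NPhi_enormD adm (G x) (grad psi x - G x).
  rewrite addrC subrK => /le_trans; apply; rewrite -/K (ler_pM2l K0); apply: lerD => //.
  by rewrite /modu enormBC lerDr (NPhi_ge0 adm).
have H3 := HC _ tp.
have H4 : (K + K * C * K) * d <= e.
  have q0 : 0 < K + K * C * K + 1 by rewrite ltr_wpDl// addr_ge0 ?mulr_ge0// ltW.
  by rewrite /d mulrCA ler_piMr ?(ltW e0)// ler_pdivrMr// mul1r lerDl.
move: H1 H2 H3 (ltW Ip) H4; move: (K0) (C0); clear.
move: (I _ _ _) (I _ _ _) (I _ _ _) (I _ _ _) (I _ _ _) => a b c p q K0 C0 H1 H2 H3 H5 H4.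
have K0' := ltW K0.
apply: (le_trans H1); apply: (@le_trans _ _ (K * (d + C * (K * (a + d))))); last first.
  by move: H4; lra.
rewrite (ler_pM2l K0); apply: lerD => //; apply: (le_trans H3); apply: ler_wpM2l => //.
by apply: (le_trans H2); rewrite (ler_pM2l K0); apply: lerD.
Qed.

Lemma NPhi_cauchy (a : nat -> R) (K M : R) : 1 < K ->
  (forall j d, P (a (j + d)%N - a j) <= K ^- j * M) -> cvg (a k @[k --> \oo]).
Proof.
move=> K1 H; apply: cauchy_cvg; apply/cauchy_exP => e e0.
have Pe : 0 < P e by rewrite (NPhi_gt0 adm)// gt_eqF.
have : K ^- k * M @[k --> \oo] --> (0 : R).
  rewrite -[X in _ --> X](mul0r M); apply: cvgM; last exact: cvg_cst.
  under eq_fun do rewrite -exprVn; apply: cvg_expr.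
  by rewrite ger0_norm ?invr_ge0 ?(ltW (lt_trans ltr01 K1))// invf_lt1// (lt_trans ltr01 K1).
move/cvgrPdist_lt => /(_ _ Pe)[J _ HJ].
exists (a J); exists J => // k /= Jk; rewrite /ball/= distrC ltNge; apply/negP => le.
have := H J (k - J)%N; rewrite subnKC// => /(le_lt_trans)/(_ (_ : _ < P e)).
have := HJ J (leqnn _); rewrite sub0r normrN => /(le_lt_trans (ler_norm _)) h1 /(_ h1).
by rewrite ltNge (NPhi_le_norm adm)// (gtr0_norm e0).
Qed.

Lemma enorm_cvgP (F : nat -> 'rV[R]_n) (G : 'rV[R]_n) :
  (forall i, F k ord0 i @[k --> \oo] --> G ord0 i) ->
  enorm (G - F k) @[k --> \oo] --> (0 : R).
Proof.
move=> H; apply: (@squeeze_cvgr _ _ _ _ (fun=> 0) (fun k => \sum_i `|G ord0 i - F k ord0 i|)).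
- apply: nearW => k; rewrite enorm_ge0/=; apply: (le_trans (enorm_le_sum _)).
  by apply: ler_sum => i _; rewrite !mxE.
- exact: cvg_cst.
- rewrite [X in _ --> X](_ : 0 = \sum_(i < n) (0 : R)); last by rewrite big1.
  apply: (@cvg_big _ _ +%R 0 xpredT) => [|i _]; first exact: add_continuous.
  apply/norm_cvg0P.
  rewrite -[X in _ --> X](subrr (G ord0 i)); apply: cvgB; first exact: cvg_cst.
  exact: H.
Qed.

(** Each use of the quasi-triangle inequality costs a factor K, so the increments of a rapidly
    convergent subsequence are weighted by powers of K. The sum S of the weighted series is finite
    almost everywhere, integrable, and majorises all differences at once. *)
Lemma W0_complete (v : nat -> 'rV[R]_n -> R) (H : nat -> 'rV[R]_n -> 'rV[R]_n) :
  (forall k, W0 (v k) (H k)) ->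
  (forall e, 0 < e -> exists N, forall i j, (N <= i)%N -> (N <= j)%N ->
     I leb Om (modu (fun x => v i x - v j x) (fun x => H i x - H j x)) < e) ->
  exists u G (s : nat -> nat) S, [/\ W0 u G, forall k, (k <= s k)%N, L1 leb Om S,
    forall k, aeD leb Om (fun x => modu (fun x => u x - v (s k) x) (fun x => G x - H (s k) x) x <= S x) &
    aeD leb Om (fun x => v (s k) x @[k --> \oo] --> u x /\
      enorm (G x - H (s k) x) @[k --> \oo] --> (0 : R))].
Proof.
move=> W CS; set K := 2 `^ m : R.
have K1 : 1 < K by rewrite (@lt_le_trans _ _ 2) ?ltr1n// -[leLHS]powRr1// ler_powR ?ler1n// (le_trans (ltW (l_gt1 adm)) (lm_le adm)).
have K0 : 0 < K := lt_trans ltr01 K1.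
(* The power of K cancels the weight of the k-th increment, and the power of 1/2 makes the weighted
   series summable. *)
pose c k := K ^- k.+1 * 2^-1 ^+ k.+1.
have c0 k : 0 < c k by rewrite mulr_gt0 ?invr_gt0 ?exprn_gt0// invr_gt0.
have /choice[N HN] : forall k, exists N, forall i j, (N <= i)%N -> (N <= j)%N ->
  I leb Om (modu (fun x => v i x - v j x) (fun x => H i x - H j x)) < c k by move=> k; exact: CS.
(* Summing the thresholds makes [s] nondecreasing, while s k is still at least N k and at least
   k. *)
pose s k := (\sum_(i < k.+1) N i + k)%N.
have sN k : (N k <= s k)%N by rewrite /s big_ord_recr/= -addnA addnCA leq_addr.
have sS k : (s k <= s k.+1)%N by rewrite /s [in leqRHS]big_ord_recr/= addnS -addnA ltnW// ltnS leq_add2l leq_addl.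
pose V k := v (s k); pose Q k := H (s k).
have WV k : W0 (V k) (Q k) by exact: W.
pose dl k := modu (fun x => V k.+1 x - V k x) (fun x => Q k.+1 x - Q k x).
have Ldl k : L1 leb Om (dl k) by apply: (W0_modu adm dom); exact: (W0B adm dom).
have Idl k : I leb Om (dl k) <= c k.
  by apply/ltW/HN => //; exact: leq_trans (sN k) (sS k).
pose F k x := K ^+ k.+1 * dl k x.
have F0 k x : 0 <= F k x by rewrite mulr_ge0 ?exprn_ge0 ?(ltW K0)// (modu_ge0 adm).
have LF k : L1 leb Om (F k) by exact: L1Z.
have sumF M : \sum_(k < M) I leb Om (F k) <= 1.
  apply: (@le_trans _ _ (\sum_(k < M) 2^-1 ^+ k.+1)).
    apply: ler_sum => k _; rewrite I_Z//.
    have Kk : 0 < K ^+ k.+1 by rewrite exprn_gt0.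
    apply: (le_trans (ler_wpM2l (ltW Kk) (Idl k))).
    by rewrite /c mulrA mulfV ?mul1r// gt_eqF.
  have -> : \sum_(k < M) 2^-1 ^+ k.+1 = 1 - 2^-1 ^+ M :> R.
    elim: M => [|M IH]; first by rewrite big_ord0 expr0 subrr.
    by rewrite big_ord_recr/= IH exprS; field.
  by rewrite gerBl exprn_ge0.
pose T M x := \sum_(k < M) F k x.
have LT M : L1 leb Om (T M) by exact: L1_sum.
have T0 M x : 0 <= T M x by exact: sumr_ge0.
have IT M : I leb Om (T M) <= 1 by rewrite /T I_sum.
have ser := I_series mO LF (fun k x _ => F0 k x) sumF.
have [S mS HS] := lim_measurable mO (fun M => L1_meas (LT M)).
have ndT x : nondecreasing_seq (fun M => T M x).
  by apply/nondecreasing_seqP => M; rewrite /T big_ord_recr/= lerDl.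
have cT : aeD leb Om (fun x => T M x @[M --> \oo] --> S x).
  apply: aeDS ser => x _ [M HM].
  have cv : cvg (T M x @[M --> \oo]).
    by apply: nondecreasing_is_cvgn => //; exists M => _ [k _ <-]; exact: HM.
  by rewrite (HS x _ cv).
have [LS _] : L1 leb Om S /\ I leb Om S <= 1.
  by apply: (I_fatou mO LT _ mS IT cT) => k; apply: aeDT.
have TS : aeD leb Om (fun x => forall M, T M x <= S x).
  apply: aeDS cT => x _ cx M; rewrite -(cvg_lim _ cx)//.
  by apply: (nondecreasing_cvgn_le (ndT x)); apply/cvg_ex; exists (S x).
(* Increments are split off from the left, so the one of index j + i meets the factor K at most i +
   1 times; this is its weight in F divided by K^j. *)
have tele x d : forall j, modu (fun x => V (j + d)%N x - V j x) (fun x => Q (j + d)%N x - Q j x) x <=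
    K ^- j * \sum_(j <= i < j + d) F i x.
  elim: d => [|d IH] j.
    rewrite addn0 big_geq// mulr0 /modu !subrr enorm0 (NPhi0 phi) addr0 //.
  have := modu_add adm (fun x => V j.+1 x - V j x) (fun x => V (j.+1 + d)%N x - V j.+1 x)
     (fun x => Q j.+1 x - Q j x) (fun x => Q (j.+1 + d)%N x - Q j.+1 x) x.
  have -> : (fun x => V j.+1 x - V j x + (V (j.+1 + d)%N x - V j.+1 x)) = (fun x => V (j + d.+1)%N x - V j x).
    by apply/funext => y; rewrite addSnnS; ring.
  have -> : (fun x => Q j.+1 x - Q j x + (Q (j.+1 + d)%N x - Q j.+1 x)) = (fun x => Q (j + d.+1)%N x - Q j x).
    by apply/funext => y; rewrite addSnnS addrC subrKA.
  move=> /le_trans; apply.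
  rewrite big_ltn ?addnS ?ltnS ?leq_addr// -/K.
  have IHj := IH j.+1; rewrite addSn in IHj.
  apply: (@le_trans _ _ (K * (dl j x + K ^- j.+1 * \sum_(j.+1 <= i < (j + d).+1) F i x))).
    by rewrite (ler_pM2l K0); apply: lerD.
  apply: eq_ler; rewrite /F exprS; field.
  by rewrite expf_neq0 ?gt_eqF.
have teleS : aeD leb Om (fun x => forall j d,
    modu (fun x => V (j + d)%N x - V j x) (fun x => Q (j + d)%N x - Q j x) x <= K ^- j * S x).
  apply: aeDS TS => x _ TS j d; apply: (le_trans (tele x d j)).
  rewrite ler_pM2l ?invr_gt0 ?exprn_gt0//; apply: le_trans (TS (j + d)%N).
  rewrite /T -(big_mkord xpredT (fun i => F i x)) [leRHS](@big_cat_nat _ _ _ j)//= ?leq_addr//.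
  by rewrite lerDr sumr_ge0.
have mV k : measurable_fun Om (V k) := W0_meas (WV k).
have mQ k i : measurable_fun Om (fun x => Q k x ord0 i) := W0_vmeas (WV k) i.
have [u mu Hu] := lim_measurable mO mV.
have /choice[g Hg] : forall i, exists g, measurable_fun Om g /\
    forall x (c : R), Q k x ord0 i @[k --> \oo] --> c -> g x = c.
  by move=> i; have [g ? ?] := lim_measurable mO (fun k => mQ k i); exists g.
pose G x : 'rV[R]_n := \row_i g i x.
have cvg_ae : aeD leb Om (fun x => V k x @[k --> \oo] --> u x /\
   enorm (G x - Q k x) @[k --> \oo] --> (0 : R)).
  apply: aeDS teleS => x Ox tS.
  have cV : cvg (V k x @[k --> \oo]).
    apply: (NPhi_cauchy K1 (M := S x)) => j d; apply: le_trans (tS j d).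
    by rewrite /modu lerDl (NPhi_ge0 adm).
  have cQ i : cvg (Q k x ord0 i @[k --> \oo]).
    apply: (NPhi_cauchy K1 (M := S x)) => j d; apply: le_trans (tS j d).
    apply: (@le_trans _ _ (P (enorm (Q (j + d)%N x - Q j x)))); last first.
      by rewrite /modu lerDr (NPhi_ge0 adm).
    apply: (NPhi_le_norm adm); rewrite [leRHS]ger0_norm ?enorm_ge0//.
    by have := coord_le_enorm (Q (j + d)%N x - Q j x) i; rewrite !mxE.
  split; first by rewrite (Hu x _ cV).
  by apply: enorm_cvgP => i; rewrite mxE; have [_ E] := Hg i; rewrite (E _ _ (cQ i)); exact: cQ.
have mG : vmeas Om G.
  by move=> i; have [mg _] := Hg i; congr measurable_fun: mg; apply/funext => x; rewrite mxE.
have bd k : aeD leb Om (fun x => modu (fun x => u x - V k x) (fun x => G x - Q k x) x <= S x).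
  apply: aeDS3 (teleS) (cvg_ae) (TS) => x _ tS [cV cQ] TSx.
  have S0 : 0 <= S x := le_trans (T0 0%N x) (TSx 0%N).
  have cN : enorm (Q (k + d)%N x - Q k x) @[d --> \oo] --> enorm (G x - Q k x).
    apply: cvg_of_sub0; apply/norm_cvg0P; apply: (@squeeze_cvgr _ _ _ _ (fun=> 0) (fun d => enorm (G x - Q (d + k)%N x))).
    - apply: nearW => d; rewrite normr_ge0/= addnC.
      have e1 := enormD (Q (d + k)%N x - G x) (G x - Q k x).
      have e2 := enormD (G x - Q (d + k)%N x) (Q (d + k)%N x - Q k x).
      rewrite !subrKA (enormBC (Q (d + k)%N x) (G x)) in e1 e2.
      by rewrite ler_norml; move: e1 e2; clear; move: (enorm _) (enorm _) (enorm _) => a b c; lra.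
    - exact: cvg_cst.
    - by rewrite (cvg_shiftn k (fun j => enorm (G x - Q j x))).
  have c1 : modu (fun x => V (k + d)%N x - V k x) (fun x => Q (k + d)%N x - Q k x) x @[d --> \oo] -->
     modu (fun x => u x - V k x) (fun x => G x - Q k x) x.
    apply: cvgD; apply: continuous_cvg => //.
    - exact: (continuous_NPhi adm).
    - apply: cvgB; last exact: cvg_cst.
      rewrite (_ : (fun d => V (k + d)%N x) = fun d => V (d + k)%N x); last by apply/funext => d; rewrite addnC.
      by rewrite (cvg_shiftn k (fun j => V j x)).
    - exact: (continuous_NPhi adm).
  apply: (cvgr_to_le c1); apply: nearW => d; apply: (le_trans (tS k d)).
  by rewrite ler_piMl// invf_le1 ?exprn_gt0// exprn_ege1// ltW.
have [WuG _] := W0_dct adm dom mu mG WV LS bd cvg_ae.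
exists u, G, s, S; split => // k.
by rewrite /s leq_addl.
Qed.

End completeness.

(** * Weak solutions *)

Lemma cauchy_arith {R : realType} (C B D e p t a b c d f : R) : 0 <= C -> 0 <= D ->
  0 < p -> 0 < t ->
  p * ((C + 1) * (2 * B + 1)) = e / 2 -> t * ((C + 1) * (D + 1)) = e / 2 ->
  f <= C * d -> d <= p * (c + b) + D * a -> c <= B -> b <= B -> a < t -> f + d < e.
Proof.
move=> C0 D0 p0 t0 Ep Et H1 H2 h1 h2 h3.
have C1 : 0 < C + 1 by rewrite ltr_wpDl.
apply: (@le_lt_trans _ _ ((C + 1) * (p * (2 * B) + D * t))).
  apply: (@le_trans _ _ ((C + 1) * d)); first by lra.
  rewrite (ler_pM2l C1); apply: (le_trans H2); apply: lerD; last by apply: ler_wpM2l => //; exact: ltW.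
  by rewrite (ler_pM2l p0); lra.
have x1 : 0 < p * (C + 1) by rewrite mulr_gt0.
have x2 : 0 < t * (C + 1) by rewrite mulr_gt0.
have E1 : (C + 1) * (p * (2 * B) + D * t) = e - p * (C + 1) - t * (C + 1).
  have -> : e = p * ((C + 1) * (2 * B + 1)) + t * ((C + 1) * (D + 1)) by rewrite Ep Et; field.
  by ring.
by rewrite E1; lra.
Qed.

Section weak_form.
Context {R : realType} {n : nat} (Om : set 'rV[R]_n) (l m : R) (phi : R -> R).
Hypothesis adm : admissible l m phi.
Hypothesis dom : open Om /\ bounded_set Om.
Local Notation h := (hphi phi).
Local Notation P := (NPhi phi).
Local Notation leb := (@lebesgue_rv R n).
Local Notation W0 := (W0 Om phi).
Local Notation modu := (modu phi).
Local Notation A := (Afield phi).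
Implicit Types (x y z : 'rV[R]_n) (u v psi kap ka f : 'rV[R]_n -> R) (G H : 'rV[R]_n -> 'rV[R]_n).

Let oO : open Om. Proof. by case: dom. Qed.
Let mO : measurable Om. Proof. exact: open_rv_measurable. Qed.

(** [phi] is constrained on positive numbers only. Written with h and a power, the field is a
    composition of functions that are measurable on the whole line. *)
Lemma Afield_dotvE x y : dotv (A x) y = h (enorm x) * enorm x `^ (-1) * dotv x y.
Proof.
rewrite /Afield dotvZl; have [->|x0] := eqVneq x 0.
  by rewrite -(scale0r (0 : 'rV[R]_n)) !dotvZl !mul0r !mulr0.
have e0 : 0 < enorm x.
  by rewrite lt_neqAle enorm_ge0 andbT eq_sym; apply/eqP => /enorm_eq0/eqP; exact/negP.
by rewrite /hphi (ger0_norm (ltW e0)) powR_inv1 ?(ltW e0)// [enorm x * _]mulrC mulfK// gt_eqF.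
Qed.

Lemma meas_hphi u : measurable_fun Om u -> measurable_fun Om (fun x => h (u x)).
Proof.
by move=> mu; apply: (measurableT_comp (continuous_measurable_fun (continuous_hphi adm))).
Qed.

Lemma meas_Afield G H : vmeas Om G -> vmeas Om H -> measurable_fun Om (fun x => dotv (A (G x)) (H x)).
Proof.
move=> mG mH; rewrite (_ : (fun x => _) = fun x => h (enorm (G x)) * enorm (G x) `^ (-1) * dotv (G x) (H x)); last first.
  by apply/funext => x; rewrite Afield_dotvE.
have mE := vmeas_enorm mG.
apply: measurable_funM; last exact: vmeas_dotv.
apply: measurable_funM; first exact: meas_hphi.
exact: (measurableT_comp (measurable_powR (-1)) mE).
Qed.

Lemma enorm_lip (x y : 'rV[R]_n) : `|enorm x - enorm y| <= enorm (x - y).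
Proof.
have e1 := enormD (x - y) y; have e2 := enormD (y - x) x.
rewrite !subrK (enormBC y x) in e1 e2.
by rewrite ler_norml; move: (enorm _) (enorm _) (enorm _) e1 e2 => a b c e1 e2; lra.
Qed.

Lemma enorm_cvg (F : nat -> 'rV[R]_n) (G : 'rV[R]_n) :
  enorm (G - F k) @[k --> \oo] --> (0 : R) -> enorm (F k) @[k --> \oo] --> enorm G.
Proof.
move=> c; apply: cvg_of_sub0; apply/norm_cvg0P.
apply: (@squeeze_cvgr _ _ _ _ (fun=> 0) (fun k => enorm (G - F k))) c; last exact: cvg_cst.
by apply: nearW => k; rewrite normr_ge0 enorm_lip.
Qed.

Lemma dotv_cvg (F : nat -> 'rV[R]_n) (G z : 'rV[R]_n) :
  enorm (G - F k) @[k --> \oo] --> (0 : R) -> dotv (F k) z @[k --> \oo] --> dotv G z.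
Proof.
move=> c; apply: cvg_of_sub0; apply/norm_cvg0P.
apply: (@squeeze_cvgr _ _ _ _ (fun=> 0) (fun k => enorm (G - F k) * enorm z)).
- by apply: nearW => k; rewrite normr_ge0/= -dotvBl cauchy_schwarz.
- exact: cvg_cst.
- by rewrite -[X in _ --> X](mul0r (enorm z)); apply: cvgM; [exact: c|exact: cvg_cst].
Qed.

Lemma Afield_cvg (F : nat -> 'rV[R]_n) (G z : 'rV[R]_n) :
  enorm (G - F k) @[k --> \oo] --> (0 : R) -> dotv (A (F k)) z @[k --> \oo] --> dotv (A G) z.
Proof.
move=> c; have ce := enorm_cvg c.
(* Continuity of [phi] serves for G different from 0; at G = 0 the bound h|F k| |z| takes its place,
   and h is continuous at 0. *)
have [G0|G0] := eqVneq G 0; last first.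
  have e0 : 0 < enorm G.
    by rewrite lt_neqAle enorm_ge0 andbT eq_sym; apply/eqP => /enorm_eq0/eqP; exact/negP.
  rewrite /Afield (_ : (fun k => _) = fun k => phi (enorm (F k)) * dotv (F k) z); last first.
    by apply/funext => k; rewrite dotvZl.
  rewrite dotvZl; apply: cvgM; last exact: dotv_cvg.
  apply: (continuous_cvg _ _ ce); apply: differentiable_continuous; apply/derivable1_diffP.
  by have [_ dphi _ _ _] := adm; have [d _] := dphi _ e0; exact: d.
rewrite G0 enorm0 in ce; rewrite G0 [X in _ --> X](_ : _ = 0); last first.
  by rewrite Afield_dotvE enorm0 hphi0 !mul0r.
apply/norm_cvg0P.
apply: (@squeeze_cvgr _ _ _ _ (fun=> 0) (fun k => h (enorm (F k)) * enorm z)).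
- by apply: nearW => k; rewrite normr_ge0/= (Afield_bound adm).
- exact: cvg_cst.
- rewrite -[X in _ --> X](mul0r (enorm z)) -(hphi0 phi); apply: cvgM; last exact: cvg_cst.
  by apply: (continuous_cvg _ _ ce); exact: (continuous_hphi adm).
Qed.

Lemma L1_hphi u v : measurable_fun Om u -> measurable_fun Om v ->
  (forall x, 0 <= u x) -> (forall x, 0 <= v x) ->
  L1 leb Om (fun x => P (u x)) -> L1 leb Om (fun x => P (v x)) ->
  L1 leb Om (fun x => h (u x) * v x).
Proof.
move=> mu mv u0 v0 Lu Lv; have [C C0 HC] := hphi_young adm ltr01.
apply: (L1_le mO (g := fun x => 1 * P (u x) + C * P (v x))).
- by apply: measurable_funM => //; exact: meas_hphi.
- by apply: (L1D mO); exact: (L1Z mO).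
- by move=> x _; rewrite ger0_norm; [exact: HC|apply: mulr_ge0 => //; exact: (hphi_ge0 adm)].
Qed.

Lemma L1_Afield G H : vmeas Om G -> vmeas Om H ->
  L1 leb Om (fun x => P (enorm (G x))) -> L1 leb Om (fun x => P (enorm (H x))) ->
  L1 leb Om (fun x => dotv (A (G x)) (H x)).
Proof.
move=> mG mH LG LH; have mE := vmeas_enorm mG; have mE' := vmeas_enorm mH.
apply: (L1_le mO (meas_Afield mG mH) (L1_hphi mE mE' _ _ LG LH)) => *; try exact: enorm_ge0.
exact: (Afield_bound adm).
Qed.

Lemma L1_P_D u v : measurable_fun Om u -> measurable_fun Om v ->
  L1 leb Om (fun x => P (u x)) -> L1 leb Om (fun x => P (v x)) ->
  L1 leb Om (fun x => P (u x + v x)).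
Proof.
move=> mu mv Lu Lv; apply: (L1_le mO (g := fun x => 2 `^ m * (P (u x) + P (v x)))).
- by apply: (meas_NPhi adm); exact: measurable_funD.
- by apply: (L1Z mO); exact: (L1D mO).
- by move=> x _; rewrite ger0_norm ?(NPhi_ge0 adm)// (NPhi_add adm).
Qed.

(* The elements of the dual of L_Phi, seen through a Young inequality with an
   arbitrarily small constant. *)
Definition dualw (kap : 'rV[R]_n -> R) := measurable_fun Om kap /\
  forall e, 0 < e -> exists2 g, L1 leb Om g &
    aeD leb Om (fun x => 0 <= kap x /\ forall s, kap x * `|s| <= e * P s + g x).

Lemma dualw_ge0 kap : dualw kap -> aeD leb Om (fun x => 0 <= kap x).
Proof. by move=> [_ /(_ _ ltr01)[g _]]; apply: aeDS => x _ []. Qed.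

Lemma dualw_le kap ka : measurable_fun Om ka -> aeD leb Om (fun x => 0 <= ka x <= kap x) ->
  dualw kap -> dualw ka.
Proof.
move=> mk le [mkap D]; split=> // e /D[g Lg Hg]; exists g => //.
apply: aeDS2 le Hg => x _ /andP[k0 kk] [_ H]; split=> // s; apply: le_trans (H s).
exact: ler_wpM2r.
Qed.

Lemma dualwD kap ka : dualw kap -> dualw ka -> dualw (fun x => kap x + ka x).
Proof.
move=> [mk D] [mk' D']; split=> [|e e0]; first exact: measurable_funD.
have e2 : 0 < e / 2 by rewrite divr_gt0.
have [g Lg Hg] := D _ e2; have [g' Lg' Hg'] := D' _ e2.
exists (fun x => g x + g' x); first exact: (L1D mO).
apply: aeDS2 Hg Hg' => x _ [k0 H] [k0' H']; split=> [|s]; first exact: addr_ge0.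
by have := H s; have := H' s; rewrite mulrDl; move: (kap x * _) (ka x * _) (P s) => p q r; lra.
Qed.

Lemma dualw_L1 kap u f : dualw kap -> L1 leb Om (fun x => P (u x)) -> measurable_fun Om f ->
  aeD leb Om (fun x => `|f x| <= kap x * `|u x|) -> L1 leb Om f.
Proof.
move=> [mk /(_ _ ltr01)[g Lg Hg]] Lu mf Hf.
apply: (L1_ae mO mf (L1D mO Lu Lg)); apply: aeDS2 Hg Hf => x _ [_ H] fx.
by apply: (le_trans fx); have := H (u x); rewrite mul1r.
Qed.

Definition ws u G (f : 'rV[R]_n -> R) := W0 u G /\ forall psi H, W0 psi H ->
  [/\ L1 leb Om (fun x => dotv (A (G x)) (H x)), L1 leb Om (fun x => f x * psi x) &
      I leb Om (fun x => dotv (A (G x)) (H x)) = I leb Om (fun x => f x * psi x)].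

Lemma W0_LA u v G H : W0 u G -> W0 v H -> L1 leb Om (fun x => dotv (A (G x)) (H x)).
Proof.
move=> Wu Wv; apply: L1_Afield; [exact: (W0_vmeas Wu)|exact: (W0_vmeas Wv)|
  exact: (W0_L1G adm dom Wu)|exact: (W0_L1G adm dom Wv)].
Qed.

Lemma Dmid_L1 u v G H : W0 u G -> W0 v H ->
  L1 leb Om (fun x => Dmid phi (G x) (H x)) /\
  I leb Om (fun x => Dmid phi (G x) (H x)) =
  (I leb Om (fun x => P (enorm (G x))) + I leb Om (fun x => P (enorm (H x)))) / 2 -
   I leb Om (fun x => P (enorm (2^-1 *: (G x + H x)))).
Proof.
move=> Wu Wv; have LG := W0_L1G adm dom Wu; have LH := W0_L1G adm dom Wv.
have LM := W0_L1G adm dom (W0Z adm dom 2^-1 (W0D adm dom Wu Wv)).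
have L2 := L1Z mO 2^-1 (L1D mO LG LH).
have E : (fun x => Dmid phi (G x) (H x)) =
    fun x => 2^-1 * (P (enorm (G x)) + P (enorm (H x))) - P (enorm (2^-1 *: (G x + H x))).
  by apply/funext => x; rewrite /Dmid mulrC.
by rewrite E (I_B mO L2 LM) (I_Z mO)// ?(I_D mO)// 1?mulrC; [split => //; exact: (L1B mO)|exact: (L1D mO)].
Qed.

(** With energies at most B, [Dmid_unif] bounds the modular of the gradient difference by 2 p B + D
    times the integrated gap; p is fixed small before the gap is made small, and Poincare's
    inequality adds the functions themselves. *)
Lemma W0_Dmid_cauchy (i0 : 'I_n) (v : nat -> 'rV[R]_n -> R) (H : nat -> 'rV[R]_n -> 'rV[R]_n) B :
  (forall k, W0 (v k) (H k)) ->
  (forall k, I leb Om (fun x => P (enorm (H k x))) <= B) ->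
  (forall e, 0 < e -> exists N, forall i j, (N <= i)%N -> (N <= j)%N ->
     I leb Om (fun x => Dmid phi (H i x) (H j x)) < e) ->
  exists u G (s : nat -> nat) S, [/\ W0 u G, forall k, (k <= s k)%N, L1 leb Om S,
    forall k, aeD leb Om (fun x => modu (fun x => u x - v (s k) x) (fun x => G x - H (s k) x) x <= S x) &
    aeD leb Om (fun x => v (s k) x @[k --> \oo] --> u x /\
      enorm (G x - H (s k) x) @[k --> \oo] --> (0 : R))].
Proof.
move=> W HB CS; apply: (W0_complete adm dom W) => e e0.
have [C C0 HC] := poincare adm dom i0.
have B0 : 0 <= B by apply: le_trans (HB 0%N); apply: I_ge0 => x _; exact: (NPhi_ge0 adm).
have q0 : 0 < (C + 1) * (2 * B + 1) by rewrite mulr_gt0// ltr_wpDl// mulr_ge0.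
have [p p0 Ep] : exists2 p, 0 < p & p * ((C + 1) * (2 * B + 1)) = e / 2.
  by exists (e / 2 / ((C + 1) * (2 * B + 1))); [rewrite !divr_gt0|rewrite (mulfVK (lt0r_neq0 q0))].
have [D D0 HD] := Dmid_unif (n := n) adm p0.
have r0 : 0 < (C + 1) * (D + 1) by rewrite mulr_gt0// ltr_wpDl.
have [t t0 Et] : exists2 t, 0 < t & t * ((C + 1) * (D + 1)) = e / 2.
  by exists (e / 2 / ((C + 1) * (D + 1))); [rewrite !divr_gt0|rewrite (mulfVK (lt0r_neq0 r0))].
have [N HN] := CS _ t0; exists N => i j Ni Nj.
have Wd := W0B adm dom (W i) (W j).
have Lu := W0_L1u adm dom Wd; have LG := W0_L1G adm dom Wd.
have LGi := W0_L1G adm dom (W i); have LGj := W0_L1G adm dom (W j).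
have [LD _] := Dmid_L1 (W i) (W j).
rewrite (I_D mO Lu LG).
have H2 : I leb Om (fun x => P (enorm (H i x - H j x))) <=
   p * (I leb Om (fun x => P (enorm (H i x))) + I leb Om (fun x => P (enorm (H j x)))) +
   D * I leb Om (fun x => Dmid phi (H i x) (H j x)).
  have Ls := L1D mO LGi LGj.
  rewrite -(I_D mO LGi LGj) -(I_Z mO p Ls) -(I_Z mO D LD) -(I_D mO (L1Z mO p Ls) (L1Z mO D LD)).
  by apply: (I_le mO LG (L1D mO (L1Z mO p Ls) (L1Z mO D LD))) => x _; exact: HD.
exact: (cauchy_arith C0 D0 p0 t0 Ep Et (HC _ _ Wd) H2 (HB i) (HB j) (HN i j Ni Nj)).
Qed.

End weak_form.

(** * Minimisers of the energy and their equation *)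

Section minimisation.
Context {R : realType} {n : nat} (Om : set 'rV[R]_n) (l m : R) (phi : R -> R).
Hypothesis adm : admissible l m phi.
Hypothesis dom : open Om /\ bounded_set Om.
Local Notation h := (hphi phi).
Local Notation P := (NPhi phi).
Local Notation leb := (@lebesgue_rv R n).
Local Notation W0 := (W0 Om phi).
Local Notation modu := (modu phi).
Local Notation A := (Afield phi).
Implicit Types (x y z : 'rV[R]_n) (u v psi : 'rV[R]_n -> R) (G H : 'rV[R]_n -> 'rV[R]_n).

Let oO : open Om. Proof. by case: dom. Qed.
Let mO : measurable Om. Proof. exact: open_rv_measurable. Qed.

Variables (i0 : 'I_n) (K f : 'rV[R]_n -> R -> R) (kap : 'rV[R]_n -> R).
Hypothesis dk : dualw Om phi kap.
Hypothesis mK : forall u, measurable_fun Om u -> measurable_fun Om (fun x => K x (u x)).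
Hypothesis mf : forall u, measurable_fun Om u -> measurable_fun Om (fun x => f x (u x)).
(* [K x] is a concave primitive of the nonincreasing function [f x]. *)
Hypothesis Kf : aeD leb Om (fun x => [/\ K x 0 = 0,
  forall s t, K x s <= K x t + f x t * (s - t),
  forall t, `|f x t| <= kap x & continuous (f x)]).

Let K_lip : aeD leb Om (fun x => forall s t, `|K x s - K x t| <= kap x * `|s - t|).
Proof.
apply: aeDS Kf => x _ [_ c b _] s t.
have H s1 t1 : K x s1 - K x t1 <= kap x * `|s1 - t1|.
  rewrite lerBlDl; apply: (le_trans (c s1 t1)); rewrite lerD2l.
  by rewrite (le_trans (ler_norm _))// normrM ler_wpM2r.
by rewrite ler_norml H andbT lerNl opprB distrC.
Qed.

Let L1_K u G : W0 u G -> L1 leb Om (fun x => K x (u x)).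
Proof.
move=> W; apply: (dualw_L1 dom dk (W0_L1u adm dom W) (mK (W0_meas W))).
apply: aeDS2 K_lip Kf => x _ H [K0 _ _ _].
by have := H (u x) 0; rewrite K0 !subr0.
Qed.

Let L1_f u G v H : W0 u G -> W0 v H -> L1 leb Om (fun x => f x (u x) * v x).
Proof.
move=> Wu Wv; apply: (dualw_L1 dom dk (W0_L1u adm dom Wv)).
  by apply: measurable_funM; [exact: mf (W0_meas Wu)|exact: W0_meas Wv].
by apply: aeDS Kf => x _ [_ _ H' _]; rewrite normrM ler_wpM2r.
Qed.

Let J u G := I leb Om (fun x => P (enorm (G x))) - I leb Om (fun x => K x (u x)).

Let coercive : exists C, forall u G, W0 u G ->
  I leb Om (fun x => P (enorm (G x))) <= 2 * (J u G + C).
Proof.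
have [C C0 HC] := poincare adm dom i0.
(* With C the constant of Poincare's inequality, this multiple of the modular of u is at most half
   of the gradient energy. *)
have e0 : 0 < (2 * (C + 1))^-1 by rewrite invr_gt0 mulr_gt0// ltr_wpDl.
have [_ /(_ _ e0)[g Lg Hg]] := dk.
exists (I leb Om g) => u G W.
have Lu := W0_L1u adm dom W; have LG := W0_L1G adm dom W; have LK := L1_K W.
have B : I leb Om (fun x => K x (u x)) <=
    (2 * (C + 1))^-1 * I leb Om (fun x => P (u x)) + I leb Om g.
  have L1' := L1Z mO (2 * (C + 1))^-1 Lu.
  rewrite -(I_Z mO _ Lu) -(I_D mO L1' Lg).
  apply: (I_le_ae mO LK (L1D mO L1' Lg)).
  apply: aeDS3 K_lip Kf Hg => x _ H1 [K0 _ _ _] [_ H2].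
  have := H1 (u x) 0; rewrite K0 !subr0 => H3.
  by rewrite (le_trans (ler_norm _))// (le_trans H3)// H2.
have Pc := HC _ _ W.
have a0 : 0 <= I leb Om (fun x => P (enorm (G x))) by apply: I_ge0 => x _; exact: (NPhi_ge0 adm).
rewrite /J; set a := I leb Om (fun x => P (enorm _)) in Pc a0 *.
set b := I leb Om (fun x => P (u x)) in B Pc.
set c := I leb Om (fun x => K x _) in B *.
set d := I leb Om g in B *.
have B2 : (2 * (C + 1))^-1 * b <= 2^-1 * a.
  rewrite ler_pdivrMl ?mulr_gt0 ?ltr_wpDl//; apply: (le_trans Pc).
  by clearbody a; lra.
by clearbody a b c d; lra.
Qed.

Let J_lower : exists c, forall u G, W0 u G -> c <= J u G.
Proof.
have [C HC] := coercive; exists (- C) => u G W.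
have a0 : 0 <= I leb Om (fun x => P (enorm (G x))) by apply: I_ge0 => x _; exact: (NPhi_ge0 adm).
by have := le_trans a0 (HC _ _ W); lra.
Qed.

Let Jset := [set r | exists u G, W0 u G /\ r = J u G].

Let Jset_inf : has_inf Jset.
Proof.
split; first by exists (J (fun=> 0) (fun=> 0)), (fun=> 0), (fun=> 0); split => //; exact: W0_0.
by have [c Hc] := J_lower; exists c => _ [u [G [W ->]]]; exact: Hc.
Qed.

(** The midpoint of u and v has energy at least the infimum. As K is concave, the excess of the mean
    energy over it contains the whole integrated midpoint gap. *)
Let J_mid u v G H : W0 u G -> W0 v H ->
  I leb Om (fun x => Dmid phi (G x) (H x)) <= (J u G + J v H) / 2 - inf Jset.
Proof.
move=> Wu Wv; have [LD ->] := Dmid_L1 adm dom Wu Wv.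
have Wm := W0Z adm dom 2^-1 (W0D adm dom Wu Wv).
have Jm : inf Jset <= J (fun x => 2^-1 * (u x + v x)) (fun x => 2^-1 *: (G x + H x)).
  apply: (ge_inf (proj2 Jset_inf)).
  by exists (fun x => 2^-1 * (u x + v x)), (fun x => 2^-1 *: (G x + H x)).
have LKu := L1_K Wu; have LKv := L1_K Wv; have LKm := L1_K Wm.
have Km : I leb Om (fun x => K x (u x)) + I leb Om (fun x => K x (v x)) <=
    2 * I leb Om (fun x => K x (2^-1 * (u x + v x))).
  rewrite -(I_D mO LKu LKv) -(I_Z mO 2 LKm).
  apply: (I_le_ae mO (L1D mO LKu LKv) (L1Z mO 2 LKm)).
  apply: aeDS Kf => x _ [_ c _ _].
  by have := c (u x) (2^-1 * (u x + v x)); have := c (v x) (2^-1 * (u x + v x)); lra.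
move: Jm Km; rewrite /J; set a1 := I _ _ _; set a2 := I _ _ _; set a3 := I _ _ _; set a4 := I _ _ _.
set a5 := I _ _ _; set a6 := I _ _ _; set a7 := inf _.
by clearbody a1 a2 a3 a4 a5 a6 a7; lra.
Qed.

(** A minimising sequence is Cauchy by [J_mid], so it converges strongly and the energy passes to
    the limit. Testing with psi and - psi turns the one-sided inequality [half] into the
    equation. *)
Lemma minimize : exists u G, ws Om phi u G (fun x => f x (u x)).
Proof.
have J_seq k : exists uG : ('rV[R]_n -> R) * ('rV[R]_n -> 'rV[R]_n),
    W0 uG.1 uG.2 /\ J uG.1 uG.2 < inf Jset + k.+1%:R^-1.
  have k0 : 0 < k.+1%:R^-1 :> R by rewrite invr_gt0.
  have [_ [u [G [W ->]]] lt] := inf_adherent k0 Jset_inf.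
  by exists (u, G).
have [s Hs] := choice J_seq.
pose v k := (s k).1; pose H k := (s k).2.
have W k : W0 (v k) (H k) by have [] := Hs k.
have Jk k : J (v k) (H k) < inf Jset + k.+1%:R^-1 by have [] := Hs k.
have [C HC] := coercive.
have kle1 k : k.+1%:R^-1 <= 1 :> R by rewrite invf_le1// ler1n.
have HB k : I leb Om (fun x => P (enorm (H k x))) <= 2 * (inf Jset + 1 + C).
  apply: (le_trans (HC _ _ (W k))); rewrite ler_pM2l// lerD2r (le_trans (ltW (Jk k)))//.
  by rewrite lerD2l.
have CS e : 0 < e -> exists N, forall i j, (N <= i)%N -> (N <= j)%N ->
    I leb Om (fun x => Dmid phi (H i x) (H j x)) < e.
  move=> e0; pose N := Num.truncn e^-1; exists N => i j Ni Nj.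
  have le k : (N <= k)%N -> k.+1%:R^-1 < e.
    move=> Nk; rewrite -[ltRHS]invrK ltf_pV2 ?posrE ?invr_gt0//.
    by rewrite (lt_le_trans (truncnS_gt _))// ler_nat.
  apply: (le_lt_trans (J_mid (W i) (W j))).
  have := Jk i; have := Jk j; have := le i Ni; have := le j Nj.
  by move: (J _ _) (J _ _) (inf _) (i.+1%:R^-1) (j.+1%:R^-1) => a b c d f'; lra.
have [u [G [sg [S [WuG sgk LS bd cv]]]]] := W0_Dmid_cauchy adm dom i0 W HB CS.
exists u, G; split => //.
have Lu := W0_L1u adm dom WuG; have LG := W0_L1G adm dom WuG.
have mu := W0_meas WuG; have mG := W0_vmeas WuG.
have mv k := W0_meas (W k); have mH k := W0_vmeas (W k).
have K0 : 0 < 2 `^ m :> R by rewrite powR_gt0.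
have cG : I leb Om (fun x => P (enorm (H (sg k) x))) @[k --> \oo] --> I leb Om (fun x => P (enorm (G x))).
  have LB := L1Z mO (2 `^ m) (L1D mO LG LS).
  have D1 k : aeD leb Om (fun x => `|P (enorm (H (sg k) x))| <= 2 `^ m * (P (enorm (G x)) + S x)).
    apply: aeDS (bd k) => x _ B; rewrite ger0_norm ?(NPhi_ge0 adm)//.
    have := NPhi_enormD adm (G x) (H (sg k) x - G x); rewrite addrC subrK.
    move=> /le_trans; apply; rewrite (ler_pM2l K0) lerD2l (le_trans _ B)// enormBC.
    by rewrite /modu lerDr (NPhi_ge0 adm).
  have D2 : aeD leb Om (fun x => P (enorm (H (sg k) x)) @[k --> \oo] --> P (enorm (G x))).
    apply: aeDS cv => x _ [_ c]; apply: (continuous_cvg _ _ (enorm_cvg c)).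
    exact: (continuous_NPhi adm).
  by have [_ _ c] := I_dct mO (fun k => meas_NPhi adm (vmeas_enorm (mH (sg k)))) (meas_NPhi adm (vmeas_enorm mG)) LB D1 D2.
have [_ /(_ _ ltr01)[g Lg Hg]] := dk.
have cK : I leb Om (fun x => K x (v (sg k) x)) @[k --> \oo] --> I leb Om (fun x => K x (u x)).
  have LB := L1D mO (L1Z mO (2 `^ m) (L1D mO Lu LS)) Lg.
  have D1 k : aeD leb Om (fun x => `|K x (v (sg k) x)| <= 2 `^ m * (P (u x) + S x) + g x).
    apply: aeDS3 (bd k) (aeDS2 (fun x _ a b => conj a b) K_lip Kf) Hg => x _ B [H1 [K00 _ _ _]] [_ H2].
    have := H1 (v (sg k) x) 0; rewrite K00 !subr0 => H3; apply: (le_trans H3).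
    apply: (le_trans (H2 _)); rewrite lerD2r mul1r.
    have := NPhi_add adm (u x) (v (sg k) x - u x); rewrite addrC subrK.
    move=> /le_trans; apply; rewrite (ler_pM2l K0) lerD2l (le_trans _ B)//.
    by rewrite -(NPhi_even adm) opprB /modu lerDl (NPhi_ge0 adm).
  have D2 : aeD leb Om (fun x => K x (v (sg k) x) @[k --> \oo] --> K x (u x)).
    apply: aeDS2 cv K_lip => x _ [c _] H1; apply: cvg_of_sub0; apply/norm_cvg0P.
    apply: (@squeeze_cvgr _ _ _ _ (fun=> 0) (fun k => kap x * `|u x - v (sg k) x|)).
    + by apply: nearW => k; rewrite normr_ge0 H1.
    + exact: cvg_cst.
    + rewrite -[X in _ --> X](mulr0 (kap x)); apply: cvgM; first exact: cvg_cst.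
      apply/norm_cvg0P; rewrite -[X in _ --> X](subrr (u x)).
      by apply: cvgB; [exact: cvg_cst|exact: c].
  by have [_ _ c] := I_dct mO (fun k => mK (mv (sg k))) (mK mu) LB D1 D2.
have Jle : J u G <= inf Jset.
  apply/ler_addgt0Pr => e e0.
  have c : J (v (sg k)) (H (sg k)) @[k --> \oo] --> J u G by apply: cvgB.
  apply: (cvgr_to_le c); near=> k.
  apply: (le_trans (ltW (Jk _))); rewrite lerD2l.
  apply: (@le_trans _ _ k.+1%:R^-1); first by rewrite lef_pV2 ?posrE// ler_nat ltnS.
  by apply/ltW; near: k; exact: near_infty_natSinv_lt (PosNum e0).
have Jmin w Q : W0 w Q -> J u G <= J w Q.
  by move=> Ww; apply: (le_trans Jle); apply: (ge_inf (proj2 Jset_inf)); exists w, Q.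
(* The tangent inequalities are taken at the perturbed point, so that J(u + t psi) - J(u) <= t I(F
   k) follows without differentiating J; dominated convergence then lets t tend to 0. *)
have half psi Q : W0 psi Q -> 0 <= I leb Om (fun x => dotv (A (G x)) (Q x) - f x (u x) * psi x).
  move=> Wp; have mp := W0_meas Wp; have mQ := W0_vmeas Wp.
  have LP := W0_L1u adm dom Wp; have LQ := W0_L1G adm dom Wp.
  pose t k : R := k.+1%:R^-1.
  have t0 k : 0 < t k by rewrite invr_gt0.
  have Wt k : W0 (fun x => u x + t k * psi x) (fun x => G x + t k *: Q x).
    exact: (W0D adm dom WuG (W0Z adm dom _ Wp)).
  pose F k x := dotv (A (G x + t k *: Q x)) (Q x) - f x (u x + t k * psi x) * psi x.
  have LA k := W0_LA adm dom (Wt k) Wp.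
  have Lf k := L1_f (Wt k) Wp.
  have LF k : L1 leb Om (F k) by exact: (L1B mO (LA k) (Lf k)).
  have F0 k : 0 <= I leb Om (F k).
    have LGt := W0_L1G adm dom (Wt k); have LKt := L1_K (Wt k); have LKu := L1_K WuG.
    have := Jmin _ _ (Wt k); rewrite /J -subr_ge0 => J0.
    rewrite -(pmulr_rge0 _ (t0 k)) -(I_Z mO _ (LF k)); apply: (le_trans J0).
    rewrite -(I_B mO LGt LKt) -(I_B mO LG LKu) -(I_B mO (L1B mO LGt LKt) (L1B mO LG LKu)).
    apply: (I_le_ae mO (L1B mO (L1B mO LGt LKt) (L1B mO LG LKu)) (L1Z mO _ (LF k))).
    apply: aeDS Kf => x _ [_ c _ _].
    have c1 := c (u x) (u x + t k * psi x).
    have := Afield_convex adm (G x + t k *: Q x) (G x).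
    rewrite opprD addNKr dotvNr dotvZr => c2.
    by rewrite /F; move: (t k) c1 c2 => tk c1 c2; lra.
  have [C1 C10 HC1] := hphi_young adm ltr01.
  have mE := vmeas_enorm mG; have mE' := vmeas_enorm mQ.
  have Lh : L1 leb Om (fun x => h (enorm (G x) + enorm (Q x)) * enorm (Q x)).
    apply: (L1_hphi adm dom _ mE' _ _ _ LQ); try by move=> *; rewrite ?addr_ge0 ?enorm_ge0.
      exact: measurable_funD.
    exact: (L1_P_D adm dom mE mE' LG LQ).
  have Lk : L1 leb Om (fun x => kap x * `|psi x|).
    apply: (dualw_L1 dom dk LP).
      by apply: measurable_funM; [by case: dk|exact: measurableT_comp].
    by apply: aeDS (dualw_ge0 dk) => x _ k0; rewrite ger0_norm// mulr_ge0.
  have tc : t k @[k --> \oo] --> (0 : R) by exact: cvg_harmonic.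
  have mF0 : measurable_fun Om (fun x => dotv (A (G x)) (Q x) - f x (u x) * psi x).
    apply: measurable_funB; first exact: (meas_Afield adm).
    by apply: measurable_funM => //; exact: mf.
  have D1 k : aeD leb Om (fun x => `|F k x| <= h (enorm (G x) + enorm (Q x)) * enorm (Q x) + kap x * `|psi x|).
    apply: aeDS Kf => x _ [_ _ b _].
    apply: (le_trans (ler_normB _ _)); apply: lerD.
      apply: (le_trans (Afield_bound adm _ _)); apply: ler_wpM2r; first exact: enorm_ge0.
      apply: (hphi_le adm); apply: (le_trans (enormD _ _)); rewrite lerD2l enormZ.
      by rewrite (ger0_norm (ltW (t0 k))) ler_piMl ?enorm_ge0// kle1.
    by rewrite normrM ler_wpM2r.
  have D2 : aeD leb Om (fun x => F k x @[k --> \oo] --> dotv (A (G x)) (Q x) - f x (u x) * psi x).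
    apply: aeDS Kf => x _ [_ _ _ cf]; apply: cvgB.
      apply: (Afield_cvg adm); rewrite (_ : (fun k => _) = fun k => t k * enorm (Q x)); last first.
        by apply/funext => k; rewrite opprD addNKr enormN enormZ ger0_norm// ltW.
      by rewrite -[X in _ --> X](mul0r (enorm (Q x))); apply: cvgM; [exact: tc|exact: cvg_cst].
    apply: cvgM; last exact: cvg_cst.
    apply: (continuous_cvg _ (cf _)); rewrite -[X in _ --> X]addr0 -(mul0r (psi x)).
    by apply: cvgD; [exact: cvg_cst|apply: cvgM; [exact: tc|exact: cvg_cst]].
  have [_ _ c] := I_dct mO (fun k => L1_meas (LF k)) mF0 (L1D mO Lh Lk) D1 D2.
  by apply: (cvgr_to_ge c); apply: nearW => k; exact: F0.
move=> psi Q Wp; have LA := W0_LA adm dom WuG Wp; have Lf := L1_f WuG Wp.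
split => //; have h1 := half _ _ Wp; have := half _ _ (W0Z adm dom (-1) Wp).
have -> : (fun x => dotv (A (G x)) (-1 *: Q x) - f x (u x) * (-1 * psi x)) =
   fun x => - (dotv (A (G x)) (Q x) - f x (u x) * psi x).
  by apply/funext => x; rewrite dotvZr; ring.
rewrite (I_N mO (L1B mO LA Lf)) oppr_ge0 => h2; move: h1 h2.
by rewrite (I_B mO LA Lf) => h1 h2; apply/eqP; rewrite -subr_eq0 eq_le h1 h2.
Unshelve. all: by end_near.
Qed.

End minimisation.

(** * Concave primitive of the truncated singular term *)

Section singular_term.
Context {R : realType} (alpha : R).
Hypothesis a0 : 0 < alpha.

(** The primitive of t^(- alpha) that vanishes at 1; for alpha = 1 it is the logarithm. *)
Definition sing_prim (t : R) : R :=
  if alpha == 1 then ln t else (t `^ (1 - alpha) - 1) / (1 - alpha).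

Lemma is_derive_sing_prim (t : R) : 0 < t -> is_derive t 1 sing_prim (t `^ (- alpha)).
Proof.
move=> t0; rewrite /sing_prim; case: eqP => [->|/eqP a1].
  rewrite powR_inv1 ?ltW//; exact: is_derive1_ln.
have c0 : 1 - alpha != 0 by rewrite subr_eq0 eq_sym.
have d := is_derive1_powR (1 - alpha) t0.
rewrite (_ : (fun t : R => _) = fun t : R => (1 - alpha)^-1 * (t `^ (1 - alpha) - 1)); last first.
  by apply/funext => s; rewrite mulrC.
rewrite (_ : t `^ (- alpha) = (1 - alpha)^-1 *: (((1 - alpha) * t `^ (1 - alpha - 1)) - 0)); last first.
  by rewrite subr0 /GRing.scale/= mulKf//; congr (_ `^ _); lra.
apply: is_deriveZ; exact: is_deriveB.
Qed.

Lemma sing_prim_concave (s t : R) : 1 <= s -> 1 <= t ->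
  sing_prim s <= sing_prim t + t `^ (- alpha) * (s - t).
Proof.
move=> s1 t1; pose F c (x : R) := c * (sing_prim t + t `^ (- alpha) * (x - t) - sing_prim x).
have dF c (x : R) : 1 <= x -> is_derive x 1 (F c) (c * (t `^ (- alpha) - x `^ (- alpha))).
  move=> x1; have x0 : 0 < x by apply: lt_le_trans x1.
  have d := is_derive_sing_prim x0.
  have d2 : is_derive x 1 (fun x : R => t `^ (- alpha) * (x - t)) (t `^ (- alpha)).
    rewrite -[X in is_derive _ _ _ X]mulr1 -[X in _ * X]subr0; apply: is_deriveZ; exact: is_deriveB.
  have d3 : is_derive x 1 (fun x : R => sing_prim t + t `^ (- alpha) * (x - t)) (t `^ (- alpha)).
    rewrite -[X in is_derive _ _ _ X]add0r; exact: is_deriveD.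
  by apply: is_deriveZ; exact: is_deriveB.
have mono (x y : R) : 1 <= x -> x <= y -> y `^ (- alpha) <= x `^ (- alpha).
  move=> x1 xy; have x0 : 0 < x := lt_le_trans ltr01 x1.
  rewrite !powRN lef_pV2 ?posrE ?powR_gt0 ?(lt_le_trans x0 xy)//.
  by apply: ge0_ler_powR => //; rewrite ?nnegrE ?(ltW a0) ?(ltW x0) ?(le_trans (ltW x0) xy).
rewrite -subr_ge0; have [st|ts] := leP s t.
  have := @ge0_incr_cc _ (F (-1)) (fun x => -1 * (t `^ (- alpha) - x `^ (- alpha))) s t st.
  have H (x : R) : s <= x <= t -> is_derive x 1 (F (-1)) (-1 * (t `^ (- alpha) - x `^ (- alpha))) /\
      0 <= -1 * (t `^ (- alpha) - x `^ (- alpha)).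
    move=> /andP[sx xt]; split; first by apply: dF; exact: le_trans sx.
    by rewrite mulN1r opprB subr_ge0 mono// (le_trans s1).
  move=> /(_ H); rewrite /F subrr mulr0 addr0 subrr mulr0 mulN1r oppr_le0; exact.
have := @ge0_incr_cc _ (F 1) (fun x => 1 * (t `^ (- alpha) - x `^ (- alpha))) t s (ltW ts).
have H (x : R) : t <= x <= s -> is_derive x 1 (F 1) (1 * (t `^ (- alpha) - x `^ (- alpha))) /\
    0 <= 1 * (t `^ (- alpha) - x `^ (- alpha)).
  move=> /andP[sx xt]; split; first by apply: dF; exact: le_trans sx.
  by rewrite mul1r subr_ge0 mono.
move=> /(_ H); rewrite /F subrr mulr0 addr0 subrr mulr0 mul1r; exact.
Qed.

(** The concave primitive of [dsing_cap] vanishing at 0: linear up to 1, and from there on the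
    primitive of t^(- alpha). *)
Definition sing_cap (t : R) : R := Num.min t 1 + sing_prim (Num.max t 1).
Definition dsing_cap (t : R) : R := Num.max t 1 `^ (- alpha).

Lemma sing_prim1 : sing_prim 1 = 0.
Proof. by rewrite /sing_prim; case: ifP => _; rewrite ?ln1// powR1 subrr mul0r. Qed.

Lemma dsing_cap_bound t : 0 <= dsing_cap t <= 1.
Proof.
rewrite /dsing_cap powR_ge0 powRN invf_le1 ?powR_gt0 ?lt_max ?ltr01 ?orbT//.
rewrite -[leLHS](powRr0 (Num.max t 1)); apply: ler_powR; last exact: ltW.
by rewrite le_max lexx orbT.
Qed.

Lemma sing_cap_concave s t : sing_cap s <= sing_cap t + dsing_cap t * (s - t).
Proof.
have /andP[k0 k1] := dsing_cap_bound t; move: k0 k1; rewrite /sing_cap /dsing_cap.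
have [s1|/ltW s1] := leP s 1; have [t1|/ltW t1] := leP t 1; rewrite ?sing_prim1 ?powR1.
- by move=> _ _; lra.
- have := sing_prim_concave (lexx 1) t1; rewrite sing_prim1.
  by move: (t `^ _) (sing_prim t) => k q; nra.
- by have := sing_prim_concave s1 (lexx 1); rewrite sing_prim1 powR1 => h1 _ _; lra.
- by have := sing_prim_concave s1 t1 => h1 _ _; lra.
Qed.

Lemma sing_cap_lip s t : `|sing_cap s - sing_cap t| <= `|s - t|.
Proof.
have H s1 t1 : sing_cap s1 - sing_cap t1 <= `|s1 - t1|.
  have /andP[k0 k1] := dsing_cap_bound t1.
  rewrite lerBlDl; apply: (le_trans (sing_cap_concave s1 t1)); rewrite lerD2l.
  by rewrite (le_trans (ler_norm _))// normrM (ger0_norm k0) ler_piMl.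
by rewrite ler_norml H andbT lerNl opprB distrC.
Qed.

Lemma continuous_sing_cap : continuous sing_cap.
Proof.
move=> t; apply/cvgrPdist_lt => e e0; near=> s.
apply: (le_lt_trans (sing_cap_lip _ _)); near: s; exact: cvgr_dist_lt.
Unshelve. all: by end_near.
Qed.

Lemma continuous_powR_pos (p t : R) : 0 < t -> {for t, continuous (fun s : R => s `^ p)}.
Proof.
move=> t0; apply: differentiable_continuous; apply/derivable1_diffP.
by have [] := is_derive1_powR p t0.
Qed.

Lemma continuous_max_powR (w p : R) : 0 < w -> continuous (fun t : R => Num.max t w `^ p).
Proof.
move=> w0 t; apply: (@continuous_comp _ _ _ (fun t : R => Num.max t w) (fun s : R => s `^ p)).
  by apply: (@continuous_max _ _ id (cst w) t); [exact: cvg_id|exact: cst_continuous].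
by apply: continuous_powR_pos; rewrite lt_max w0 orbT.
Qed.

Lemma max_powR_anti (w s t p : R) : 0 < w -> 0 <= p -> s <= t ->
  Num.max t w `^ (- p) <= Num.max s w `^ (- p).
Proof.
move=> w0 p0 st; have m0 x : 0 < Num.max x w by rewrite lt_max w0 orbT.
rewrite !powRN lef_pV2 ?posrE ?powR_gt0//.
apply: ge0_ler_powR => //; rewrite ?nnegrE ?(ltW (m0 _))//.
by rewrite ge_max !le_max st lexx !orbT.
Qed.

Lemma max_powR_le (w t p : R) : 0 < w -> 0 <= p -> Num.max t w `^ (- p) <= w `^ (- p).
Proof.
move=> w0 p0; rewrite !powRN lef_pV2 ?posrE ?powR_gt0// ?lt_max ?w0 ?orbT//.
by apply: ge0_ler_powR => //; rewrite ?nnegrE ?(ltW w0) ?le_max ?(ltW w0) ?lexx ?orbT.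
Qed.

(** Scaling turns the threshold 1 into w: this factor w^(1 - alpha) makes w^(1 - alpha) sing_cap(t /
    w) a primitive of max(t, w)^(- alpha). *)
Lemma dsing_cap_scale (w t : R) : 0 < w ->
  w `^ (1 - alpha) * dsing_cap (t / w) / w = Num.max t w `^ (- alpha).
Proof.
move=> w0; have -> : Num.max t w = Num.max (t / w) 1 * w.
  by rewrite maxr_pMl ?ltW// divfK ?gt_eqF// mul1r.
have -> : w `^ (1 - alpha) = w * w `^ (- alpha).
  by rewrite powRD; [rewrite powRr1// ltW|rewrite (gt_eqF w0) implybT].
rewrite (powRM (- alpha) (_ : 0 <= Num.max (t / w) 1) (ltW w0)) ?le_max ?ler01 ?orbT// /dsing_cap.
by rewrite mulrAC [w * _]mulrC mulfK ?gt_eqF// mulrC.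
Qed.

End singular_term.

(** * Regularised problem and comparison principle *)

Section comparison.
Context {R : realType} {n : nat} (Om : set 'rV[R]_n) (l m : R) (phi : R -> R).
Hypothesis adm : admissible l m phi.
Hypothesis dom : open Om /\ bounded_set Om.
Local Notation P := (NPhi phi).
Local Notation leb := (@lebesgue_rv R n).
Local Notation W0 := (W0 Om phi).
Local Notation ws := (ws Om phi).
Local Notation A := (Afield phi).
Variable i0 : 'I_n.
Implicit Types (x y z : 'rV[R]_n) (u v w psi a b f r : 'rV[R]_n -> R) (G H : 'rV[R]_n -> 'rV[R]_n).

Let oO : open Om. Proof. by case: dom. Qed.
Let mO : measurable Om. Proof. exact: open_rv_measurable. Qed.

Lemma meas_powR u p : measurable_fun Om u -> measurable_fun Om (fun x => u x `^ p).
Proof. by move=> mu; exact: (measurableT_comp (measurable_powR p) mu). Qed.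

Lemma meas_max u v : measurable_fun Om u -> measurable_fun Om v ->
  measurable_fun Om (fun x => Num.max (u x) (v x)).
Proof. exact: measurable_maxr. Qed.

(** The threshold w bounds the singular datum by a w^(- alpha), an element of the dual of L_Phi, and
    keeps it nonincreasing in u; so its primitive is concave and [minimize] applies. *)
Lemma exist_ws alpha a r w : 0 < alpha -> measurable_fun Om a -> measurable_fun Om r ->
  measurable_fun Om w -> aeD leb Om (fun x => [/\ 0 <= a x, 0 <= r x & 0 < w x]) ->
  dualw Om phi (fun x => a x * w x `^ (- alpha) + r x) ->
  exists u G, ws u G (fun x => a x * Num.max (u x) (w x) `^ (- alpha) + r x).
Proof.
move=> al ma mh mw ae dk.
pose K (x : 'rV[R]_n) t := a x * (w x `^ (1 - alpha) * sing_cap alpha (t * w x `^ (-1))) + r x * t.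
pose f (x : 'rV[R]_n) t := a x * Num.max t (w x) `^ (- alpha) + r x.
have mwi := meas_powR (-1) mw.
have mK u : measurable_fun Om u -> measurable_fun Om (fun x => K x (u x)).
  move=> mu; apply: measurable_funD; last exact: measurable_funM.
  apply: measurable_funM => //; apply: measurable_funM; first exact: meas_powR.
  apply: (measurableT_comp (continuous_measurable_fun (continuous_sing_cap al))).
  exact: measurable_funM.
have mf u : measurable_fun Om u -> measurable_fun Om (fun x => f x (u x)).
  move=> mu; apply: measurable_funD => //; apply: measurable_funM => //.
  by apply: meas_powR; exact: meas_max.
apply: (minimize adm dom i0 dk mK mf).
apply: aeDS ae => x _ [a0 b0 w0].
have E t : t * w x `^ (-1) = t / w x by rewrite powR_inv1 ?ltW.
split.
- by rewrite /K mulr0 mul0r /sing_cap (min_idPl _) ?ler01// (max_idPr _) ?ler01// sing_prim1 !addr0 !mulr0.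
- move=> s t; rewrite /K /f !E.
  have H : a x * (w x `^ (1 - alpha) * sing_cap alpha (s / w x)) <= a x *
      (w x `^ (1 - alpha) * sing_cap alpha (t / w x) + Num.max t (w x) `^ (- alpha) * (s - t)).
    apply: ler_wpM2l => //; rewrite -(dsing_cap_scale alpha t w0).
    have := ler_wpM2l (powR_ge0 (w x) (1 - alpha)) (sing_cap_concave al (s / w x) (t / w x)).
    rewrite -mulrBl => /le_trans; apply; apply: eq_ler; ring.
  rewrite (mulrDr (a x) (_ * sing_cap _ _)) in H; move: H.
  by move: (sing_cap alpha (s / w x)) (sing_cap alpha (t / w x)) (Num.max t (w x)) => p q z H; lra.
- move=> t; rewrite /f ger0_norm ?addr_ge0 ?mulr_ge0 ?powR_ge0// lerD2r ler_wpM2l//.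
  by apply: max_powR_le => //; exact: ltW.
- move=> t; apply: cvgD; last exact: cvg_cst.
  by apply: cvgM; [exact: cvg_cst|exact: continuous_max_powR].
Qed.

(** Strict monotonicity as a consequence of uniform convexity: Dmid <= Mono <= 0, so [Dmid_unif]
    bounds the left side by e (P|x| + P|y|) for every e > 0. *)
Lemma Mono_eq0 x y : Mono phi x y <= 0 -> P (enorm (x - y)) = 0.
Proof.
move=> M0; apply/eqP; rewrite eq_le (NPhi_ge0 adm) andbT.
apply/ler_addgt0Pr => e e0; rewrite add0r.
pose s := P (enorm x) + P (enorm y) + 1.
have s0 : 0 < s by rewrite ltr_wpDl// addr_ge0// (NPhi_ge0 adm).
have [C C0 H] := Dmid_unif (n := n) adm (divr_gt0 e0 s0).
apply: (le_trans (H x y)); apply: (@le_trans _ _ (e / s * s + C * 0)).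
  apply: lerD; first by apply: ler_wpM2l; [rewrite ltW// divr_gt0|rewrite /s lerDl].
  by apply: ler_wpM2l => //; exact: le_trans (Dmid_le_Mono adm x y) M0.
by rewrite mulr0 addr0 divfK// gt_eqF.
Qed.

Lemma ws_W0 u G f : ws u G f -> W0 u G. Proof. by case. Qed.

Lemma ws_0 : ws (fun=> 0) (fun=> 0) (fun=> 0).
Proof.
split => [|psi H W]; first exact: W0_0.
have -> : (fun x => dotv (A 0) (H x)) = fun=> 0.
  by apply/funext => x; rewrite Afield_dotvE enorm0 hphi0 !mul0r.
have -> : (fun x => 0 * psi x) = fun=> 0 by apply/funext => x; rewrite mul0r.
by split => //; exact: L1_0.
Qed.

Lemma ws_Mono u v G H f g : ws u G f -> ws v H g ->
  L1 leb Om (fun x => Mono phi (G x) (H x)) /\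
  I leb Om (fun x => Mono phi (G x) (H x)) = I leb Om (fun x => (f x - g x) * (u x - v x)).
Proof.
move=> [Wu Eu] [Wv Ev]; have Wd := W0B adm dom Wu Wv.
have [L1a L1b E1] := Eu _ _ Wd; have [L2a L2b E2] := Ev _ _ Wd.
have -> : (fun x => Mono phi (G x) (H x)) = fun x => dotv (A (G x)) (G x - H x) - dotv (A (H x)) (G x - H x).
  by apply/funext => x; rewrite /Mono dotvBl.
have -> : (fun x => (f x - g x) * (u x - v x)) = fun x => f x * (u x - v x) - g x * (u x - v x).
  by apply/funext => x; rewrite mulrBl.
by rewrite (I_B mO L1a L2a) (I_B mO L1b L2b) E1 E2; split => //; exact: (L1B mO).
Qed.

(** Both equations are tested with the positive part of u - v. The data make the right side at most
    0, and the left side is the integral of [Mono] over the set where u > v; so the gradient of the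
    test function vanishes, and Poincare's inequality concludes. The data are compared on that set
    only, hence they may depend on u and v. *)
Lemma comparison u v G H f g : ws u G f -> ws v H g ->
  aeD leb Om (fun x => v x < u x -> f x <= g x) -> aeD leb Om (fun x => u x <= v x).
Proof.
move=> [Wu Eu] [Wv Ev] fg; have Wd := W0B adm dom Wu Wv.
have Wz := W0_trunc adm dom (lexx 0) Wd.
set z := fun x => Num.max _ 0 in Wz; set Q := fun x => _ *: _ in Wz.
have [L1a L1b E1] := Eu _ _ Wz; have [L2a L2b E2] := Ev _ _ Wz.
have LM := L1B mO L1a L2a.
have I0 : I leb Om (fun x => dotv (A (G x)) (Q x) - dotv (A (H x)) (Q x)) <= 0.
  rewrite (I_B mO L1a L2a) E1 E2 -(I_B mO L1b L2b) -(I_0 leb Om).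
  apply: (I_le_ae mO (L1B mO L1b L2b)); first exact: L1_0.
  apply: aeDS fg => x _ fg.
  rewrite -mulrBl /z subr0; have [d0|d0] := leP (u x - v x) 0; first by rewrite mulr0.
  by apply: mulr_le0_ge0; [rewrite subr_le0; apply: fg; rewrite -subr_gt0|exact: ltW].
have MQ x : dotv (A (G x)) (Q x) - dotv (A (H x)) (Q x) = (0 < u x - v x)%R%:R * Mono phi (G x) (H x).
  by rewrite -dotvBl /Q dotvZr.
have z0 : aeD leb Om (fun x => P (enorm (Q x)) = 0).
  apply: aeDS (I_eq0 mO LM _ I0); last first.
    by apply: aeDT => x _; rewrite MQ mulr_ge0// (Mono_ge0 adm).
  move=> x _; rewrite MQ /Q; case: (0 < _)%R => [|_]; last by rewrite scale0r enorm0 (NPhi0 phi).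
  by rewrite mul1r scale1r => M0; apply: Mono_eq0; rewrite M0.
have [C C0 HC] := poincare adm dom i0.
have := HC _ _ Wz; have LQ := W0_L1G adm dom Wz; have Lz := W0_L1u adm dom Wz.
have -> : I leb Om (fun x => P (enorm (Q x))) = 0.
  rewrite -(I_0 leb Om); apply: (I_ae mO (L1_meas LQ)) => //.
rewrite mulr0 => Iz.
have Pz0 : aeD leb Om (fun x => 0 <= P (z x)) by apply: aeDT => x _; exact: (NPhi_ge0 adm).
have ae := I_eq0 mO Lz Pz0 Iz.
apply: aeDS ae => x _; rewrite /z subr0 => Pz; rewrite -subr_le0 leNgt; apply/negP => d0; move: Pz.
rewrite (max_idPl (ltW d0)) => Pd.
by have := NPhi_gt0 adm (lt0r_neq0 d0); rewrite Pd ltxx.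
Qed.

Lemma ws_ge0 u G f : ws u G f -> aeD leb Om (fun x => 0 <= f x) -> aeD leb Om (fun x => 0 <= u x).
Proof. by move=> E f0; apply: (comparison ws_0 E); apply: aeDS f0. Qed.

End comparison.

Lemma aeDI d (T : measurableType d) (R : realType) (mu : {measure set T -> \bar R})
    (D : set T) (P Q : T -> Prop) :
  aeD mu D P -> aeD mu D Q -> aeD mu D (fun x => P x /\ Q x).
Proof. exact: aeDS2. Qed.

(** Young's inequality with exponents l / (gam + 1) and l / (l - gam - 1), the first factor being
    scaled by k so that its coefficient becomes e. *)
Lemma young_powR {R : realType} (l gam e : R) : 0 <= gam -> gam < l - 1 -> 0 < e ->
  exists2 C, 0 <= C & forall b r : R, 0 <= b -> 0 <= r ->
   b * r `^ (gam + 1) <= e * r `^ l + C * b `^ (l / (l - gam - 1)).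
Proof.
move=> g0 gl e0; have g1 : 0 < gam + 1 by lra.
have l0 : 0 < l by lra.
have d0 : 0 < l - gam - 1 by lra.
set q := l / (l - gam - 1); pose p := l / (gam + 1).
have p0 : 0 < p by rewrite divr_gt0.
have q0 : 0 < q by rewrite divr_gt0.
have pq : p^-1 + q^-1 = 1 by rewrite /p /q; field; rewrite !gt_eqF.
have ep : 0 < e * p by rewrite mulr_gt0.
pose k := (e * p) `^ p^-1; have k0 : 0 < k by rewrite powR_gt0.
have ki : 0 <= k^-1 by rewrite invr_ge0 ltW.
exists (k^-1 `^ q / q) => [|b r b0 r0]; first by rewrite divr_ge0 ?powR_ge0// ltW.
have r1 := powR_ge0 r (gam + 1).
have := conjugate_powR (mulr_ge0 (ltW k0) r1) (mulr_ge0 b0 ki) p0 q0 pq.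
rewrite (powRM _ (ltW k0) r1) (powRM _ b0 ki) -!powRrM (mulVf (lt0r_neq0 p0)) powRr1 ?(ltW ep)//.
rewrite (_ : (gam + 1) * p = l); last by rewrite /p mulrCA (mulfV (lt0r_neq0 g1)) mulr1.
have -> : k * r `^ (gam + 1) * (b / k) = b * r `^ (gam + 1) by field; rewrite gt_eqF.
have -> : e * p * r `^ l / p = e * r `^ l by field; rewrite gt_eqF.
by rewrite -mulrA [b `^ q * _]mulrC.
Qed.

(** * Monotone iteration *)

Section iteration.
Context {R : realType} {n : nat} (Om : set 'rV[R]_n) (l m : R) (phi : R -> R).
Hypothesis adm : admissible l m phi.
Hypothesis dom : open Om /\ bounded_set Om.
Local Notation P := (NPhi phi).
Local Notation leb := (@lebesgue_rv R n).
Local Notation W0 := (W0 Om phi).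
Local Notation ws := (ws Om phi).
Local Notation A := (Afield phi).
Local Notation modu := (modu phi).
Variable i0 : 'I_n.
Implicit Types (x y z : 'rV[R]_n) (u v w psi a b f g r : 'rV[R]_n -> R) (G H : 'rV[R]_n -> 'rV[R]_n).

Let oO : open Om. Proof. by case: dom. Qed.
Let bO : bounded_set Om. Proof. by case: dom. Qed.
Let mO : measurable Om. Proof. exact: open_rv_measurable. Qed.

Lemma L1_cst (c : R) : L1 leb Om (fun=> c).
Proof. by apply: (L1_bounded (C := `|c|)) => //; exact: measurable_cst. Qed.

(** This is where gam < l - 1 makes b u^gam a lower-order term. With r = max(t, s) the product t^gam
    s is at most r^(gam + 1); [NPhi_power] bounds r^l by P r, and P r <= P t + P s. *)
Lemma b_young gam e : 0 <= gam -> gam < l - 1 -> 0 < e ->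
  exists2 C, 0 <= C & forall b t s : R, 0 <= b -> 0 <= t -> 0 <= s ->
   b * t `^ gam * s <= e * (P t + P s + 1) + C * b `^ (l / (l - gam - 1)).
Proof.
move=> g0 gl e0; have P1 : 0 < P 1 by rewrite (NPhi_gt0 adm)// oner_eq0.
(* The bound by e serves the additive constant, and the bound by e P(1) the term in P r. *)
pose e' := Num.min e (e * P 1); have e'0 : 0 < e' by rewrite lt_min e0 mulr_gt0.
have [C C0 H] := young_powR g0 gl e'0; exists C => // b t s b0 t0 s0.
pose r := Num.max t s; have r0 : 0 <= r by rewrite le_max t0.
have tr : t <= r by rewrite le_max lexx.
have sr : s <= r by rewrite le_max lexx orbT.
have rg : t `^ gam * s <= r `^ (gam + 1).
  have [r00|rp] := eqVneq r 0.
    have -> : s = 0 by apply/eqP; rewrite eq_le s0 andbT -r00.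
    by rewrite mulr0 powR_ge0.
  rewrite powRD ?rp ?implybT// powRr1// ler_pM ?powR_ge0//.
  by apply: ge0_ler_powR.
rewrite -mulrA; apply: (le_trans (ler_wpM2l b0 rg)); apply: (le_trans (H _ _ b0 r0)).
rewrite lerD2r.
have Pr : P r <= P t + P s.
  by rewrite /r; have [ts|st] := leP t s; rewrite ?lerDl ?lerDr (NPhi_ge0 adm).
have := NPhi_power adm r0; rewrite -ler_pdivlMr// => rl.
apply: (@le_trans _ _ (e' * ((P r + P 1) / P 1))); first by rewrite ler_pM2l.
have e1 : e' <= e by rewrite ge_min lexx.
have e2 : e' / P 1 <= e by rewrite ler_pdivrMr// ge_min lexx orbT.
rewrite mulrDl mulfV ?gt_eqF// mulrDr mulr1 mulrA mulrAC.
have Pr0 : 0 <= P r := NPhi_ge0 adm _.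
have h1 : e' / P 1 * P r <= e * (P t + P s).
  by apply: ler_pM => //; rewrite divr_ge0 ?ltW.
by rewrite (mulrDr e (_ + _)) mulr1; exact: lerD.
Qed.

Lemma dualw_powR gam b u : 0 <= gam -> gam < l - 1 ->
  measurable_fun Om b -> aeD leb Om (fun x => 0 <= b x) ->
  L1 leb Om (fun x => b x `^ (l / (l - gam - 1))) ->
  measurable_fun Om u -> aeD leb Om (fun x => 0 <= u x) -> L1 leb Om (fun x => P (u x)) ->
  dualw Om phi (fun x => b x * u x `^ gam).
Proof.
move=> g0 gl mb b0 Lb mu u0 Lu; split.
  by apply: measurable_funM => //; exact: meas_powR.
move=> e e0; have [C C0 H] := b_young g0 gl e0.
exists (fun x => e * (P (u x) + 1) + C * b x `^ (l / (l - gam - 1))).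
  apply: (L1D mO); last exact: (L1Z mO).
  by apply: (L1Z mO); apply: (L1D mO) => //; exact: L1_cst.
apply: aeDS2 b0 u0 => x _ b0 u0; split; first by rewrite mulr_ge0// powR_ge0.
move=> s; apply: (le_trans (H _ _ _ b0 u0 (normr_ge0 s))).
by rewrite (NPhi_norm adm); apply: eq_ler; ring.
Qed.

(** The increments of P(v k) are nonnegative and telescope, so their integrals add up to at most B.
    Almost everywhere P(v k) is therefore bounded in k, and the monotone sequence v k converges. *)
Lemma incr_bounded_cvg (v : nat -> 'rV[R]_n -> R) B :
  (forall k, measurable_fun Om (v k)) -> (forall k, L1 leb Om (fun x => P (v k x))) ->
  (forall k, I leb Om (fun x => P (v k x)) <= B) ->
  aeD leb Om (fun x => forall k, 0 <= v k x <= v k.+1 x) ->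
  exists u, [/\ measurable_fun Om u, L1 leb Om (fun x => P (u x)),
    aeD leb Om (fun x => v k x @[k --> \oo] --> u x) &
    aeD leb Om (fun x => forall k, v k x <= u x)].
Proof.
move=> mv Lv Bv inc.
pose F k x := `|P (v k.+1 x) - P (v k x)|.
have LF k : L1 leb Om (F k) by exact: (L1_norm (L1B mO (Lv k.+1) (Lv k))).
have P0 k : 0 <= I leb Om (fun x => P (v k x)) by apply: I_ge0 => x _; exact: (NPhi_ge0 adm).
have IF k : I leb Om (F k) = I leb Om (fun x => P (v k.+1 x)) - I leb Om (fun x => P (v k x)).
  rewrite -(I_B mO (Lv k.+1) (Lv k)); apply: (I_ae mO (L1_meas (LF k)) (L1_meas (L1B mO (Lv k.+1) (Lv k)))).
  apply: aeDS inc => x _ inc; rewrite /F ger0_norm// subr_ge0.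
  by have /andP[a b] := inc k; exact: (NPhi_le adm).
have SF N : \sum_(k < N) I leb Om (F k) <= B.
  under eq_bigr do rewrite IF.
  rewrite -(big_mkord xpredT (fun k => I leb Om (fun x => P (v k.+1 x)) - I leb Om (fun x => P (v k x)))).
  by rewrite telescope_sumr//; have := Bv N; have := P0 0%N; lra.
have ser := I_series mO LF (fun k x _ => normr_ge0 _) SF.
have [u mu Hu] := lim_measurable mO mv.
have cv : aeD leb Om (fun x => v k x @[k --> \oo] --> u x).
  apply: aeDS2 inc ser => x _ inc [M HM].
  have PM k : P (v k x) <= P (v 0%N x) + M.
    rewrite -lerBlDl; apply: le_trans (HM k).
    rewrite -(big_mkord xpredT (fun k => F k x)).
    elim: k => [|k IH]; first by rewrite big_nil subrr.
    rewrite big_nat_recr//=; have := ler_norm (P (v k.+1 x) - P (v k x)).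
    by move: IH; rewrite /F; move: (\sum_(_ <= _ < _) _) `|_| => p q; lra.
  have ndv : nondecreasing_seq (fun k => v k x).
    by apply/nondecreasing_seqP => k; have /andP[] := inc k.
  have cvx : cvg (v k x @[k --> \oo]).
    apply: nondecreasing_is_cvgn => //.
    have P1 : 0 < P 1 by rewrite (NPhi_gt0 adm)// oner_eq0.
    exists ((1 * (P 1 + (P (v 0%N x) + M))) / P 1) => _ [k _ <-].
    have /andP[k0 _] := inc k; rewrite ler_pdivlMr//.
    apply: (le_trans (NPhi_linear adm ltr01 k0)); rewrite !mul1r lerD2l; exact: PM.
  by rewrite (Hu x _ cvx).
have LP := I_fatou mO Lv (fun k => aeDT leb (fun x _ => NPhi_ge0 adm (v k x))) (meas_NPhi adm mu) Bv.
exists u; split => //.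
- apply: (proj1 (LP _)); apply: aeDS cv => x _ c; apply: (continuous_cvg _ _ c).
  exact: (continuous_NPhi adm).
- apply: aeDS2 cv inc => x _ c inc k; rewrite -(cvg_lim _ c)//.
  apply: nondecreasing_cvgn_le; last by apply/cvg_ex; exists (u x).
  by apply/nondecreasing_seqP => j; have /andP[] := inc j.
Qed.

Theorem singular_solution alpha gam a b w Gw fw : 0 < alpha -> 0 <= gam -> gam < l - 1 ->
  measurable_fun Om a -> measurable_fun Om b ->
  aeD leb Om (fun x => [/\ 0 <= a x, 0 <= b x & 0 < w x]) ->
  L1 leb Om (fun x => b x `^ (l / (l - gam - 1))) ->
  ws w Gw fw -> aeD leb Om (fun x => fw x <= a x * w x `^ (- alpha)) ->
  dualw Om phi (fun x => a x * w x `^ (- alpha)) ->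
  exists u G, ws u G (fun x => a x * u x `^ (- alpha) + b x * u x `^ gam) /\
    aeD leb Om (fun x => w x <= u x).
Proof.
move=> al g0 gl ma mb ae Lb Ew fwa dk.
have mw := W0_meas (ws_W0 Ew).
have a0 : aeD leb Om (fun x => 0 <= a x) by apply: aeDS ae => x _ [].
have b0 : aeD leb Om (fun x => 0 <= b x) by apply: aeDS ae => x _ [].
have w0 : aeD leb Om (fun x => 0 < w x) by apply: aeDS ae => x _ [].
pose rhs u v x := a x * Num.max (u x) (w x) `^ (- alpha) + b x * v x `^ gam.
pose good (s : ('rV[R]_n -> R) * ('rV[R]_n -> 'rV[R]_n)) :=
  W0 s.1 s.2 /\ aeD leb Om (fun x => w x <= s.1 x).
have step (s : {s | good s}) : exists s' : {s | good s},
    ws (sval s').1 (sval s').2 (rhs (sval s').1 (sval s).1).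
  case: s => -[v Q] [/= Wv wv].
  have v0 : aeD leb Om (fun x => 0 <= v x).
    by apply: aeDS2 w0 wv => x _ a1 a2; exact: le_trans (ltW a1) a2.
  have dv := dualw_powR g0 gl mb b0 Lb (W0_meas Wv) v0 (W0_L1u adm dom Wv).
  have mbv : measurable_fun Om (fun x => b x * v x `^ gam) by case: dv.
  have ae' : aeD leb Om (fun x => [/\ 0 <= a x, 0 <= b x * v x `^ gam & 0 < w x]).
    by apply: aeDS ae => x _ [? ? ?]; split => //; rewrite mulr_ge0// powR_ge0.
  have [u [G Eu]] := exist_ws adm dom i0 al ma mbv mw ae' (dualwD dom dk dv).
  have wu : aeD leb Om (fun x => w x <= u x).
    (* Where the new iterate is below w, its truncated singular term is a w^(- alpha), which
       majorises the datum of w. *)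
    apply: (comparison adm dom i0 Ew Eu); apply: aeDS2 ae' fwa => x _ [_ r0 _] fx ux.
    by apply: (le_trans fx); rewrite (max_idPr (ltW ux)) lerDl.
  by exists (exist _ (u, G) (conj (ws_W0 Eu) wu)).
have [F HF] := choice step.
pose st k := iter k F (exist good (w, Gw) (conj (ws_W0 Ew) (aeDT leb (fun x _ => lexx (w x))))).
pose v k := (sval (st k)).1; pose H k := (sval (st k)).2.
have Wk k : W0 (v k) (H k) by have [] := svalP (st k).
have wk k : aeD leb Om (fun x => w x <= v k x) by have [] := svalP (st k).
have Ek k : ws (v k.+1) (H k.+1) (rhs (v k.+1) (v k)) by exact: HF.
have inc k : aeD leb Om (fun x => v k x <= v k.+1 x).
  elim: k => [|k IH]; first exact: wk.
  apply: (comparison adm dom i0 (Ek k) (Ek k.+1)).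
  apply: aeDS3 ae IH (wk k) => x _ [ax bx wx] i1 wv lt.
  apply: lerD; apply: ler_wpM2l => //.
    by apply: max_powR_anti => //; exact: ltW.
  by apply: ge0_ler_powR => //; rewrite nnegrE ?(le_trans (ltW wx))// (le_trans wv).
have v0 k : aeD leb Om (fun x => 0 <= v k x).
  by apply: aeDS2 w0 (wk k) => x _ a1 a2; exact: le_trans (ltW a1) a2.
have [B HB] : exists B, forall k, I leb Om (fun x => P (enorm (H k.+1 x))) <= B.
  have [C C0 HC] := poincare adm dom i0.
  (* Three terms e P(v k.+1) arise: one from the singular part and two from [b_young], where P(v k)
     <= P(v k.+1) is used. By Poincare's inequality they cost at most half of the gradient
     energy. *)
  pose e : R := (6 * (C + 1))^-1.
  have C1 : 0 < C + 1 by rewrite ltr_wpDl.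
  have e0 : 0 < e by rewrite invr_gt0 mulr_gt0.
  have [_ /(_ _ e0)[g Lg Hg]] := dk.
  have [D D0 HD] := b_young g0 gl e0.
  pose M := I leb Om (fun x => g x + (e + D * b x `^ (l / (l - gam - 1)))).
  have LM : L1 leb Om (fun x => g x + (e + D * b x `^ (l / (l - gam - 1)))).
    by apply: (L1D mO) => //; apply: (L1D mO); [exact: L1_cst|exact: (L1Z mO)].
  exists (2 * M) => k.
  have [LA Lf E] := proj2 (Ek k) _ _ (Wk k.+1).
  have LG := W0_L1G adm dom (Wk k.+1); have Lu := W0_L1u adm dom (Wk k.+1).
  have h1 : I leb Om (fun x => P (enorm (H k.+1 x))) <= I leb Om (fun x => dotv (A (H k.+1 x)) (H k.+1 x)).
    apply: (I_le mO LG LA) => x _; rewrite Afield_self.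
    apply: le_trans (NPhi_th_low adm (enorm_ge0 _)).
    by rewrite ler_peMl ?(NPhi_ge0 adm)// ltW// (l_gt1 adm).
  have h2 : I leb Om (fun x => rhs (v k.+1) (v k) x * v k.+1 x) <=
      3 * e * I leb Om (fun x => P (v k.+1 x)) + M.
    rewrite -(I_Z mO _ Lu) -(I_D mO (L1Z mO _ Lu) LM).
    apply: (I_le_ae mO Lf (L1D mO (L1Z mO _ Lu) LM)).
    apply: aeDS3 (aeDI ae Hg) (aeDI (inc k) (v0 k)) (wk k.+1).
    move=> x _ [[ax bx wx] [_ Hgx]] [ik vk] wv; rewrite /rhs mulrDl.
    have vk1 : 0 <= v k.+1 x := le_trans vk ik.
    have q1 : a x * Num.max (v k.+1 x) (w x) `^ (- alpha) * v k.+1 x <= e * P (v k.+1 x) + g x.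
      apply: le_trans (Hgx (v k.+1 x)); rewrite ger0_norm// ler_wpM2r// ler_wpM2l//.
      by apply: max_powR_le => //; exact: ltW.
    have q2 := HD (b x) (v k x) (v k.+1 x) bx vk vk1.
    have q3 : e * P (v k x) <= e * P (v k.+1 x) by rewrite ler_pM2l//; exact: (NPhi_le adm).
    by move: q1 q2 q3; move: (_ * v k.+1 x) (_ * v k.+1 x) (P _) (P _) (D * _) => *; lra.
  have h3 := HC _ _ (Wk k.+1).
  have h4 : 3 * e * I leb Om (fun x => P (v k.+1 x)) <= 2^-1 * I leb Om (fun x => P (enorm (H k.+1 x))).
    have X0 : 0 <= I leb Om (fun x => P (enorm (H k.+1 x))) by apply: I_ge0 => x _; exact: (NPhi_ge0 adm).
    apply: (@le_trans _ _ (3 * e * ((C + 1) * I leb Om (fun x => P (enorm (H k.+1 x)))))).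
      by rewrite ler_pM2l ?mulr_gt0// (le_trans h3)// mulrDl mul1r lerDl.
    by apply: eq_ler; rewrite /e; field; rewrite gt_eqF.
  by move: h1 h2 h4; rewrite E; move: (I _ _ _) (I _ _ _) (3 * e * _) => p q r; lra.
have [Cp Cp0 HCp] := poincare adm dom i0.
have HB2 k : I leb Om (fun x => P (v k.+1 x)) <= Cp * B.
  by apply: (le_trans (HCp _ _ (Wk k.+1))); apply: ler_wpM2l.
have incA : aeD leb Om (fun x => forall k, 0 <= v k.+1 x <= v k.+2 x).
  apply: aeDS2 (aeD_nat (fun k => inc k.+1)) (v0 1%N) => x _ i1 v1 k; rewrite i1 andbT.
  by elim: k => // k IH; exact: le_trans IH (i1 k).
have [u [mu Lu cu vu]] := incr_bounded_cvg (fun k => W0_meas (Wk k.+1)) (fun k => W0_L1u adm dom (Wk k.+1)) HB2 incA.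
have wu : aeD leb Om (fun x => w x <= u x).
  by apply: aeDS2 (wk 1%N) vu => x _ a1 /(_ 0%N); exact: le_trans.
have u0 : aeD leb Om (fun x => 0 <= u x).
  by apply: aeDS2 wu w0 => x _ a1 a2; exact: le_trans (ltW a2) a1.
(* The sum is one fixed element of the dual of L_Phi that majorises the right-hand sides of all
   equations. *)
have du := dualwD dom dk (dualw_powR g0 gl mb b0 Lb mu u0 Lu).
set kap := fun x => _ + _ in du.
have kap0 := dualw_ge0 du.
(* The limit u was built from the sequence [v k.+1], so v <= u is at hand from index 1 on, and the
   right-hand sides are compared from index 2 on. *)
have rhs_le k : aeD leb Om (fun x => 0 <= rhs (v k.+2) (v k.+1) x <= kap x).
  apply: aeDS3 ae vu (v0 k.+1) => x _ [ax bx wx] vux vk.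
  rewrite addr_ge0 ?mulr_ge0 ?powR_ge0//=; apply: lerD; apply: ler_wpM2l => //.
    by apply: max_powR_le => //; exact: ltW.
  by apply: ge0_ler_powR => //; rewrite nnegrE// (le_trans vk).
have Lkd k : L1 leb Om (fun x => kap x * `|u x - v k.+1 x|).
  apply: (dualw_L1 dom du (u := u) Lu).
    apply: measurable_funM; first by case: du.
    apply: measurableT_comp => //; apply: measurable_funB => //; exact: W0_meas (Wk k.+1).
  apply: aeDS3 kap0 vu (v0 k.+1) => x _ k0 vux vk; rewrite normrM normr_id ger0_norm// ler_wpM2l//.
  by rewrite [X in X <= _]ger0_norm ?subr_ge0// [X in _ <= X]ger0_norm ?(le_trans vk)// gerBl.
have dec : I leb Om (fun x => kap x * `|u x - v k.+1 x|) @[k --> \oo] --> (0 : R).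
  have D1 k : aeD leb Om (fun x => `|kap x * `|u x - v k.+1 x| | <= kap x * `|u x|).
    apply: aeDS3 kap0 vu (v0 k.+1) => x _ k0 vux vk; rewrite normrM normr_id ger0_norm// ler_wpM2l//.
    by rewrite [X in X <= _]ger0_norm ?subr_ge0// [X in _ <= X]ger0_norm ?(le_trans vk)// gerBl.
  have D2 : aeD leb Om (fun x => kap x * `|u x - v k.+1 x| @[k --> \oo] --> (0 : R)).
    apply: aeDS cu => x _ c; rewrite -[X in _ --> X](mulr0 (kap x)); apply: cvgM; first exact: cvg_cst.
    apply/norm_cvg0P; rewrite -[X in _ --> X](subrr (u x)).
    by apply: cvgB; [exact: cvg_cst|exact: c].
  have mk0 : measurable_fun Om (fun=> 0 : R) by exact: measurable_cst.
  have Lku : L1 leb Om (fun x => kap x * `|u x|).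
    apply: (dualw_L1 dom du (u := u) Lu).
      by apply: measurable_funM; [by case: du|exact: measurableT_comp].
    by apply: aeDS kap0 => x _ k0; rewrite normrM normr_id ger0_norm.
  have [_ _] := I_dct mO (fun k => L1_meas (Lkd k)) mk0 Lku D1 D2.
  by rewrite I_0.
have Wk2 k := Wk k.+2.
have CS e : 0 < e -> exists N, forall i j, (N <= i)%N -> (N <= j)%N ->
    I leb Om (fun x => Dmid phi (H i.+2 x) (H j.+2 x)) < e.
  move=> e0; have e2 : 0 < e / 2 by rewrite divr_gt0.
  move/cvgrPdist_lt : dec => /(_ _ e2)[N _ HN]; exists N => i j Ni Nj.
  (* The equations express the integral of [Mono] through the difference of the data times v i.+2 -
     v j.+2. The integrand is at most kap times the sum of the distances to u, whose integral tends
     to 0 by [dec]. *)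
  have [LM E] := ws_Mono adm dom (Ek i.+1) (Ek j.+1).
  have [LD _] := Dmid_L1 adm dom (Wk2 i) (Wk2 j).
  apply: (@le_lt_trans _ _ (I leb Om (fun x => Mono phi (H i.+2 x) (H j.+2 x)))).
    by apply: (I_le mO LD LM) => x _; exact: (Dmid_le_Mono adm).
  have Ls := L1D mO (Lkd i.+1) (Lkd j.+1).
  apply: (@le_lt_trans _ _ (I leb Om (fun x => kap x * `|u x - v i.+2 x| + kap x * `|u x - v j.+2 x|))).
    have Lr : L1 leb Om (fun x => (rhs (v i.+2) (v i.+1) x - rhs (v j.+2) (v j.+1) x) * (v i.+2 x - v j.+2 x)).
      have Wd := W0B adm dom (Wk2 i) (Wk2 j).
      have [_ La _] := proj2 (Ek i.+1) _ _ Wd; have [_ Lb' _] := proj2 (Ek j.+1) _ _ Wd.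
      by apply: (L1_eq mO _ (L1B mO La Lb')) => x _; rewrite mulrBl.
    rewrite E; apply: (I_le_ae mO Lr Ls).
    apply: aeDS3 (rhs_le i) (rhs_le j) kap0 => x _ /andP[r1 r2] /andP[r3 r4] k0.
    apply: (le_trans (ler_norm _)); rewrite normrM -mulrDr; apply: ler_pM => //.
      by rewrite ler_norml; move: r1 r2 r3 r4; move: (rhs _ _ x) (rhs _ _ x) (kap x) => *; lra.
    rewrite (_ : v i.+2 x - v j.+2 x = (u x - v j.+2 x) - (u x - v i.+2 x)); last by ring.
    by rewrite [leRHS]addrC; exact: ler_normB.
  rewrite (I_D mO (Lkd i.+1) (Lkd j.+1)).
  have q1 := HN _ (leqW Ni); have q2 := HN _ (leqW Nj).
  rewrite /= !sub0r !normrN in q1 q2.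
  have := ler_norm (I leb Om (fun x => kap x * `|u x - v i.+2 x|)).
  have := ler_norm (I leb Om (fun x => kap x * `|u x - v j.+2 x|)).
  by move: q1 q2; move: (I _ _ _) (I _ _ _) => p q; lra.
have [u' [G [s [S [Wu sk LS bd cv]]]]] := W0_Dmid_cauchy adm dom i0 Wk2 (fun k => HB k.+1) CS.
have s_oo : s @ \oo --> \oo.
  by move=> E [N _ HN]; exists N => // k Nk; apply: HN; exact: leq_trans (sk k).
(* u is the monotone limit and u' the limit in W0; along the subsequence they coincide. *)
have uu' : aeD leb Om (fun x => u x = u' x).
  apply: aeDS2 cu cv => x _ c [c' _].
  have c1 : v (s k).+2 x @[k --> \oo] --> u x.
    have c2 : v k.+2 x @[k --> \oo] --> u x by rewrite -(cvg_shiftS (fun k => v k.+1 x)) in c.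
    exact: (cvg_comp _ _ s_oo c2).
  exact: (cvg_unique _ c1 c').
exists u', G; split; last by apply: aeDS2 wu uu' => x _ a1 <-.
split => // psi Q Wp.
have LA := W0_LA adm dom Wu Wp.
have LP := W0_L1u adm dom Wp; have LQ := W0_L1G adm dom Wp; have LG := W0_L1G adm dom Wu.
have K0 : 0 < 2 `^ m :> R by rewrite powR_gt0.
have mp := W0_meas Wp; have mQ := W0_vmeas Wp; have mG := W0_vmeas Wu.
have c1 : I leb Om (fun x => dotv (A (H (s k).+2 x)) (Q x)) @[k --> \oo] --> I leb Om (fun x => dotv (A (G x)) (Q x)).
  have [C C0 HC] := hphi_young adm ltr01.
  have LB := L1D mO (L1Z mO (2 `^ m) (L1D mO LG LS)) (L1Z mO C LQ).
  have D1 k : aeD leb Om (fun x => `|dotv (A (H (s k).+2 x)) (Q x)| <= 2 `^ m * (P (enorm (G x)) + S x) + C * P (enorm (Q x))).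
    apply: aeDS (bd k) => x _ Bx; apply: (le_trans (Afield_bound adm _ _)).
    apply: (le_trans (HC _ _ (enorm_ge0 _) (enorm_ge0 _))); rewrite lerD2r mul1r.
    have := NPhi_enormD adm (G x) (H (s k).+2 x - G x); rewrite addrC subrK.
    move=> /le_trans; apply; rewrite (ler_pM2l K0) lerD2l (le_trans _ Bx)// enormBC.
    by rewrite /modu lerDr (NPhi_ge0 adm).
  have D2 : aeD leb Om (fun x => dotv (A (H (s k).+2 x)) (Q x) @[k --> \oo] --> dotv (A (G x)) (Q x)).
    by apply: aeDS cv => x _ [_ c]; exact: (Afield_cvg adm).
  by have [_ _ c] := I_dct mO (fun k => meas_Afield adm (W0_vmeas (Wk2 (s k))) mQ) (meas_Afield adm mG mQ) LB D1 D2.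
have mu' := W0_meas Wu.
have [Lf _ c2] : [/\ L1 leb Om (fun x => (a x * u' x `^ (- alpha) + b x * u' x `^ gam) * psi x),
   forall k, L1 leb Om (fun x => rhs (v (s k).+2) (v (s k).+1) x * psi x) &
   I leb Om (fun x => rhs (v (s k).+2) (v (s k).+1) x * psi x) @[k --> \oo] -->
   I leb Om (fun x => (a x * u' x `^ (- alpha) + b x * u' x `^ gam) * psi x)].
  have Lk : L1 leb Om (fun x => kap x * `|psi x|).
    apply: (dualw_L1 dom du LP).
      by apply: measurable_funM; [by case: du|exact: measurableT_comp].
    by apply: aeDS kap0 => x _ k0; rewrite normrM normr_id ger0_norm.
  apply: (I_dct mO _ _ Lk).
  - move=> k; have [_ L _] := proj2 (Ek (s k).+1) _ _ Wp; exact: L1_meas L.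
  - apply: measurable_funM => //; apply: measurable_funD; apply: measurable_funM => //; exact: meas_powR.
  - move=> k; apply: aeDS (rhs_le (s k)) => x _ /andP[r1 r2].
    by rewrite normrM (ger0_norm r1) ler_wpM2r.
  - apply: aeDS3 (aeDI cu wu) uu' w0 => x _ [c wux] <- wx.
    have ux := lt_le_trans wx wux.
    have e2 : v (s k).+2 x @[k --> \oo] --> u x.
      have c2 : v k.+2 x @[k --> \oo] --> u x by rewrite -(cvg_shiftS (fun k => v k.+1 x)) in c.
      exact: (cvg_comp _ _ s_oo c2).
    have e1 : v (s k).+1 x @[k --> \oo] --> u x by exact: (cvg_comp _ _ s_oo c).
    apply: cvgM; last exact: cvg_cst.
    rewrite -[X in a x * X `^ _](max_idPl wux).
    apply: cvgD; apply: cvgM; try exact: cvg_cst.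
      have cm : {for u x, continuous (fun t : R => Num.max t (w x) `^ (- alpha))}.
        exact: continuous_max_powR.
      exact: (continuous_cvg _ cm e2).
    have cm : {for u x, continuous (fun t : R => t `^ gam)} by exact: continuous_powR_pos.
    exact: (continuous_cvg _ cm e1).
split => //; rewrite (_ : (fun k => I leb Om (fun x => dotv _ _)) =
    fun k => I leb Om (fun x => rhs (v (s k).+2) (v (s k).+1) x * psi x)) in c1; last first.
  by apply/funext => k; have [_ _ ->] := proj2 (Ek (s k).+1) _ _ Wp.
exact: (cvg_unique _ c1 c2).
Qed.

End iteration.

(** * Sobolev inequalities *)

Section fubini_hoelder.
Context {R : realType}.

Lemma I_fubini1 d1 d2 (T1 : measurableType d1) (T2 : measurableType d2)
    (m1 : {sigma_finite_measure set T1 -> \bar R})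
    (m2 : {sigma_finite_measure set T2 -> \bar R}) (f : T1 * T2 -> R) :
  L1 (m1 \x m2)%E setT f -> (forall x, L1 m2 setT (fun y => f (x, y))) ->
  L1 m1 setT (fun x => I m2 setT (fun y => f (x, y))) /\
  I (m1 \x m2)%E setT f = I m1 setT (fun x => I m2 setT (fun y => f (x, y))).
Proof.
move=> Lf Ls; have E x : fubini_F m2 (EFin \o f) x = (I m2 setT (fun y => f (x, y)))%:E.
  by rewrite /fubini_F -(EFin_I measurableT (Ls x)).
have L : L1 m1 setT (fun x => I m2 setT (fun y => f (x, y))).
  by have := integrable_fubini_F Lf; rewrite (funext E).
split; first exact: L.
apply: EFin_inj; rewrite -(EFin_I measurableT Lf) -(EFin_I measurableT L) -(integral12_prod_meas1 Lf).
by apply: eq_integral => x _; rewrite E.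
Qed.

Lemma I_fubini2 d1 d2 (T1 : measurableType d1) (T2 : measurableType d2)
    (m1 : {sigma_finite_measure set T1 -> \bar R})
    (m2 : {sigma_finite_measure set T2 -> \bar R}) (f : T1 * T2 -> R) :
  L1 (m1 \x m2)%E setT f -> (forall y, L1 m1 setT (fun x => f (x, y))) ->
  L1 m2 setT (fun y => I m1 setT (fun x => f (x, y))) /\
  I (m1 \x m2)%E setT f = I m2 setT (fun y => I m1 setT (fun x => f (x, y))).
Proof.
move=> Lf Ls; have E y : fubini_G m1 (EFin \o f) y = (I m1 setT (fun x => f (x, y)))%:E.
  by rewrite /fubini_G -(EFin_I measurableT (Ls y)).
have mf : measurable_fun setT (EFin \o f) by have /integrableP[] := Lf.
have mG := measurable_fubini_G Lf; rewrite (funext E) in mG.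
have L : L1 m2 setT (fun y => I m1 setT (fun x => f (x, y))).
  apply/integrableP; split; first exact: mG.
  apply: le_lt_trans ((integrable21ltyP m1 m2 mf).1 Lf).
  apply: ge0_le_integral => //.
  - exact: measurableT_comp.
  - apply: (@measurable_fun_fubini_tonelli_G _ _ _ _ _ m1 (abse \o (EFin \o f))) => //=.
    exact: measurableT_comp.
  - move=> y _; apply: (@le_trans _ _ (I m1 setT (fun x => `|f (x, y)|))%:E).
      rewrite /= lee_fin; exact: (I_norm measurableT (Ls y)).
    by rewrite -(EFin_I measurableT (L1_norm (Ls y))).
split; first exact: L.
apply: EFin_inj; rewrite -(EFin_I measurableT Lf) -(EFin_I measurableT L) -(integral21_prod_meas1 Lf).
by apply: eq_integral => x _; rewrite E.
Qed.

(** Young's inequality at the scales a = A^(-1/p) and b = B^(-1/q), for which its right side is 1/p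
    + 1/q = 1. *)
Lemma hoelder_arith (p q A B X : R) : 0 < p -> 0 < q -> p^-1 + q^-1 = 1 -> 0 < A -> 0 < B ->
  (forall a b, 0 < a -> 0 < b -> a * b * X <= a `^ p / p * A + b `^ q / q * B) ->
  X <= A `^ p^-1 * B `^ q^-1.
Proof.
move=> p0 q0 pq A0 B0.
pose a := (A `^ p^-1)^-1; pose b := (B `^ q^-1)^-1.
have a0 : 0 < a by rewrite invr_gt0 powR_gt0.
have b0 : 0 < b by rewrite invr_gt0 powR_gt0.
have Ea : a `^ p = A^-1.
  by rewrite /a -powRN -powRrM mulNr mulVf ?gt_eqF// powR_inv1// ltW.
have Eb : b `^ q = B^-1.
  by rewrite /b -powRN -powRrM mulNr mulVf ?gt_eqF// powR_inv1// ltW.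
move=> /(_ a b a0 b0); rewrite Ea Eb (mulrAC A^-1) (mulrAC B^-1) !mulVf ?gt_eqF// !mul1r pq.
by rewrite /a /b -invfM mulrC ler_pdivrMr ?mul1r// mulr_gt0// powR_gt0.
Qed.

Lemma I_hoelder d (T : measurableType d) (mu : {measure set T -> \bar R}) (D : set T)
    (p q : R) (F G : T -> R) : measurable D -> 0 < p -> 0 < q -> p^-1 + q^-1 = 1 ->
  measurable_fun D F -> measurable_fun D G ->
  (forall x, 0 <= F x) -> (forall x, 0 <= G x) ->
  L1 mu D (fun x => F x `^ p) -> L1 mu D (fun x => G x `^ q) ->
  L1 mu D (fun x => F x * G x) /\
  I mu D (fun x => F x * G x) <= I mu D (fun x => F x `^ p) `^ p^-1 * I mu D (fun x => G x `^ q) `^ q^-1.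
Proof.
move=> mD p0 q0 pq mF mG F0 G0 LF LG.
have young a b x : 0 <= a -> 0 <= b -> a * F x * (b * G x) <= a `^ p / p * F x `^ p + b `^ q / q * G x `^ q.
  move=> a0 b0; apply: (le_trans (conjugate_powR (mulr_ge0 a0 (F0 x)) (mulr_ge0 b0 (G0 x)) p0 q0 pq)).
  by rewrite !powRM//; apply: eq_ler; ring.
have mFG : measurable_fun D (fun x => F x * G x) by exact: measurable_funM.
have LFG : L1 mu D (fun x => F x * G x).
  apply: (L1_le mD mFG (L1D mD (L1Z mD (1 `^ p / p) LF) (L1Z mD (1 `^ q / q) LG))) => x _.
  rewrite ger0_norm ?mulr_ge0//; have := young 1 1 x ler01 ler01; by rewrite !mul1r.
split=> //; set A := I _ _ (fun x => F x `^ p); set B := I _ _ (fun x => G x `^ q).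
have A0 : 0 <= A by apply: I_ge0 => x _; exact: powR_ge0.
have B0 : 0 <= B by apply: I_ge0 => x _; exact: powR_ge0.
have zero (H : T -> R) r : 0 < r -> measurable_fun D H -> L1 mu D (fun x => H x `^ r) -> I mu D (fun x => H x `^ r) = 0 ->
    aeD mu D (fun x => H x = 0).
  move=> r0 mH LH IH; have := I_eq0 mD LH (aeDT mu (fun x _ => powR_ge0 (H x) r)) (eq_ler IH).
  by apply: aeDS => x _ /eqP; rewrite powR_eq0 => /andP[/eqP].
have [A00|Ap] := eqVneq A 0.
  rewrite A00 powR0 ?invr_eq0 ?gt_eqF// mul0r -(I_0 mu D); apply: eq_ler.
  apply: (I_ae mD mFG); first exact: measurable_cst.
  by apply: aeDS (zero F p p0 mF LF A00) => x _ ->; rewrite mul0r.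
have [B00|Bp] := eqVneq B 0.
  rewrite B00 (powR0 (x := q^-1)) ?invr_eq0 ?gt_eqF// mulr0 -(I_0 mu D); apply: eq_ler.
  apply: (I_ae mD mFG); first exact: measurable_cst.
  by apply: aeDS (zero G q q0 mG LG B00) => x _ ->; rewrite mulr0.
have Ap' : 0 < A by rewrite lt_neqAle eq_sym Ap.
have Bp' : 0 < B by rewrite lt_neqAle eq_sym Bp.
apply: (hoelder_arith p0 q0 pq Ap' Bp') => a b a0 b0.
have L2 := L1D mD (L1Z mD (a `^ p / p) LF) (L1Z mD (b `^ q / q) LG).
rewrite -(I_Z mD _ LFG) /A /B -(I_Z mD _ LF) -(I_Z mD _ LG) -(I_D mD (L1Z mD _ LF) (L1Z mD _ LG)).
apply: (I_le mD (L1Z mD _ LFG) L2) => x _.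
apply: le_trans (young a b x (ltW a0) (ltW b0)); apply: eq_ler; ring.
Qed.

End fubini_hoelder.

Lemma continuous_coord_scale {R : realType} n k (v : 'rV[R]_k) (i : 'I_n) :
  continuous (fun y : 'rV[R]_n => y ord0 i *: v).
Proof.
move=> y; apply: (@continuous_comp _ _ _ (fun y : 'rV[R]_n => y ord0 i) (fun t : R => t *: v)).
  exact: coord_continuous.
by move=> t; apply: cvgZr_tmp; exact: cvg_id.
Qed.

Lemma continuous_rvD {R : realType} n k (f g : 'rV[R]_n -> 'rV[R]_k) :
  continuous f -> continuous g -> continuous (fun x => f x + g x).
Proof.
move=> cf cg x; apply: (@cvgD _ _ _ (nbhs x) (nbhs_filter x)); [exact: cf|exact: cg].
Qed.

Lemma continuous_rv_sum {R : realType} n k (J : finType) (f : J -> 'rV[R]_n -> 'rV[R]_k) :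
  (forall i, continuous (f i)) -> continuous (fun x => \sum_i f i x).
Proof.
move=> cf; elim: (index_enum _) => [|i r IH].
  rewrite (_ : (fun x => _) = fun=> 0); last by apply/funext => x; rewrite big_nil.
  by move=> x; exact: (@cvg_cst _ _ _ (nbhs x) (nbhs_filter x)).
rewrite (_ : (fun x => _) = fun x => f i x + \sum_(i <- r) f i x); last first.
  by apply/funext => x; rewrite big_cons.
exact: continuous_rvD.
Qed.

Lemma continuous_sumR {R : realType} n (J : finType) (f : J -> 'rV[R]_n -> R) :
  (forall i, continuous (f i)) -> continuous (fun x => \sum_i f i x).
Proof.
move=> cf; elim: (index_enum _) => [|i r IH].
  rewrite (_ : (fun x => _) = fun=> 0); last by apply/funext => x; rewrite big_nil.
  by move=> x; exact: (@cvg_cst _ _ _ (nbhs x) (nbhs_filter x)).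
rewrite (_ : (fun x => _) = fun x => f i x + \sum_(i <- r) f i x); last first.
  by apply/funext => x; rewrite big_cons.
move=> x; apply: (@cvgD _ _ _ (nbhs x) (nbhs_filter x)); [exact: cf|exact: IH].
Qed.

(** * Slices in the first coordinate *)

Section slices.
Context {R : realType} {n : nat}.
Local Notation cons := (@rv_cons R n).
Implicit Types (psi : 'rV[R]_n.+1 -> R) (y : 'rV[R]_n) (s t : R).

Lemma rv_cons_uncons (x : 'rV[R]_n.+1) : cons (rv_uncons x) = x.
Proof.
apply/rowP => i; rewrite /rv_cons mxE /=; case: (unliftP ord0 i) => [j ->|->] //=.
by rewrite mxE.
Qed.

Lemma cons_line0 s t y : cons (s + t, y) = cons (s, y) + t *: delta_mx ord0 ord0.
Proof.
apply/rowP => i; rewrite !mxE /=; case: (unliftP ord0 i) => [j|] -> /=.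
  by rewrite mulr0 addr0.
by rewrite mulr1.
Qed.

Lemma cons_lineS s t y i : cons (s, y + t *: delta_mx ord0 i) = cons (s, y) + t *: delta_mx ord0 (lift ord0 i).
Proof.
apply/rowP => j; rewrite !mxE /=; case: (unliftP ord0 j) => [k|] -> /=.
  by rewrite !mxE (inj_eq lift_inj).
by rewrite mulr0 addr0.
Qed.

Lemma cons_sum s y : cons (s, y) =
  s *: delta_mx ord0 ord0 + \sum_i y ord0 i *: delta_mx ord0 (lift ord0 i).
Proof.
apply/rowP => j; rewrite !mxE summxE; case: (unliftP ord0 j) => [k|] -> /=.
  rewrite mulr0 add0r (bigD1 k)//= big1 ?addr0; last first.
    by move=> i ik; rewrite !mxE (inj_eq lift_inj) (eq_sym k) (negPf ik) /= mulr0.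
  by rewrite !mxE !eqxx mulr1.
by rewrite mulr1 big1 ?addr0// => i _; rewrite !mxE andbF mulr0.
Qed.

Lemma continuous_cons_r s : continuous (fun y => cons (s, y)).
Proof.
rewrite (_ : (fun y => _) = fun y => s *: delta_mx ord0 ord0 +
   \sum_i y ord0 i *: delta_mx ord0 (lift ord0 i)); last by apply/funext => z; exact: cons_sum.
apply: continuous_rvD; first by move=> x; exact: (@cvg_cst _ _ _ (nbhs x) (nbhs_filter x)).
by apply: continuous_rv_sum => i; exact: continuous_coord_scale.
Qed.

Lemma continuous_cons_l y : continuous (fun s : R => cons (s, y)).
Proof.
move=> t; rewrite (_ : (fun s : R => _) = fun s : R => s *: delta_mx ord0 ord0 +
   \sum_i y ord0 i *: delta_mx ord0 (lift ord0 i)); last by apply/funext => z; exact: cons_sum.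
apply: cvgD; last exact: cvg_cst.
by apply: cvgZr_tmp; exact: cvg_id.
Qed.

Lemma slice_is_derive psi s y i : Ck 1 psi ->
  is_derive y (delta_mx ord0 i) (fun y => psi (cons (s, y))) (partial (lift ord0 i) psi (cons (s, y))).
Proof.
move=> Cp; apply/is_derive_line0.
rewrite (_ : (fun t => _) = fun t => psi (cons (s, y) + t *: delta_mx ord0 (lift ord0 i))); last first.
  by apply/funext => t; rewrite cons_lineS.
by apply/is_derive_line0; exact: (Ck_is_derive _ _ Cp).
Qed.

Lemma slice_Ck psi s : Ck 1 psi -> Ck 1 (fun y => psi (cons (s, y))).
Proof.
move=> Cp; have cc (f : 'rV[R]_n.+1 -> R) : continuous f -> continuous (fun y => f (cons (s, y))).
  by move=> cf y; apply: continuous_comp; [exact: continuous_cons_r|exact: cf].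
apply: (Ck_S (df := fun i y => partial (lift ord0 i) psi (cons (s, y)))).
- by apply: cc; exact: (Ck_continuous Cp).
- by move=> i y; exact: slice_is_derive.
- by move=> i; split=> //; apply: cc; exact: (Ck_continuous (Ck_partial _ Cp)).
Qed.

Lemma cons_norm_r s y : `|y| <= `|cons (s, y)|.
Proof.
rewrite [leLHS]mx_normrE; apply/bigmax_leP; split => // -[i j] _ /=.
have := ler_rv_norm (cons (s, y)) (lift ord0 j); rewrite mxE liftK /=.
by rewrite [i]ord1.
Qed.

Lemma cons_norm_l s y : `|s| <= `|cons (s, y)|.
Proof. by have := ler_rv_norm (cons (s, y)) ord0; rewrite mxE unlift_none. Qed.

Lemma slice_bsupp psi s : bsupp psi -> bsupp (fun y => psi (cons (s, y))).
Proof. by move=> [M HM]; exists M => y My; rewrite HM// (lt_le_trans My (cons_norm_r _ _)). Qed.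

Lemma slice_grad psi s y : Ck 1 psi ->
  enorm (grad (fun y => psi (cons (s, y))) y) <= enorm (grad psi (cons (s, y))).
Proof.
move=> Cp; rewrite ler_wsqrtr// /dotv big_ord_recl /= ler_wpDl ?sqr_ge0 -?expr2 ?sqr_ge0//.
apply: ler_sum => i _; rewrite !mxE; have d := slice_is_derive s y i Cp.
by rewrite /partial (@derive_val _ _ _ _ _ _ _ d).
Qed.

Lemma I_cons (f : 'rV[R]_n.+1 -> R) : L1 (lebesgue_rv n.+1) setT f ->
  L1 (@lebesgue_measure R \x lebesgue_rv n)%E setT (fun p => f (cons p)) /\
  I (@lebesgue_measure R \x lebesgue_rv n)%E setT (fun p => f (cons p)) = I (lebesgue_rv n.+1) setT f.
Proof.
move=> Lf; have mc := @measurable_rv_cons R n; have mf := L1_meas Lf.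
have L : L1 (@lebesgue_measure R \x lebesgue_rv n)%E setT (fun p => f (cons p)).
  apply/integrableP; split; first by apply/measurable_EFinP; exact: measurableT_comp.
  have /integrableP[_] := Lf; apply: le_lt_trans.
  rewrite [leRHS](@ge0_integral_pushforward _ _ _ _ _ _ mc)//.
  by apply: measurableT_comp => //; exact/measurable_EFinP.
split=> //; rewrite !IE /Rintegral; congr fine.
by rewrite [RHS](@integral_pushforward _ _ _ _ _ _ mc)//; exact/measurable_EFinP.
Qed.

Lemma L1_line (f : R -> R) M : continuous f -> (forall t, M < `|t| -> f t = 0) ->
  L1 (@lebesgue_measure R) setT f.
Proof.
move=> cf f0; have L : L1 (@lebesgue_measure R) `[- M, M] f.
  apply: continuous_compact_integrable; first exact: segment_compact.
  exact: continuous_subspaceT.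
rewrite /L1 integrable_mkcond// in L.
apply: eq_integrable L => // t _; rewrite patchE; case: ifPn => //.
rewrite notin_setE /= in_itv/= => /negP; rewrite -ler_norml -ltNge => /f0 -> //.
Qed.

Lemma slice_L1 (f : 'rV[R]_n.+1 -> R) y : continuous f -> bsupp f ->
  L1 (@lebesgue_measure R) setT (fun t => f (cons (t, y))).
Proof.
move=> cf [M HM]; apply: (@L1_line _ M).
  by move=> t; apply: continuous_comp; [exact: continuous_cons_l|exact: cf].
by move=> t Mt; rewrite HM// (lt_le_trans Mt (cons_norm_l _ _)).
Qed.

(** The fundamental theorem of calculus along a line in the first direction, started at a point
    where psi vanishes. *)
Lemma slice_sup psi s y : Ck 1 psi -> bsupp psi ->
  `|psi (cons (s, y))| <= I (@lebesgue_measure R) setT (fun t => `|partial ord0 psi (cons (t, y))|).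
Proof.
move=> Cp bp; have [M HM] := bp.
pose df t := partial ord0 psi (cons (t, y)).
have cdf : continuous df.
  by move=> t; apply: continuous_comp; [exact: continuous_cons_l|exact: (Ck_continuous (Ck_partial ord0 Cp))].
have dF t : is_derive t 1 (fun t : R => psi (cons (t, y))) (df t).
  have E : (fun t : R => psi (cons (t, y))) = fun t => psi (cons (0, y) + t *: delta_mx ord0 ord0).
    by apply/funext => r; rewrite -cons_line0 add0r.
  rewrite E; apply/is_derive_line; rewrite -cons_line0 add0r; exact: (Ck_is_derive _ _ Cp).
have cF : continuous (fun t : R => psi (cons (t, y))).
  by move=> t; apply: continuous_comp; [exact: continuous_cons_l|exact: (Ck_continuous Cp)].
(* To the left of s and beyond the support of psi. *)
pose a := Num.min (s - 1) (- (`|M| + 1)).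
have as' : a < s by rewrite /a gt_min ltrBlDr ltrDl ltr01.
have a0 : psi (cons (a, y)) = 0.
  apply: HM; apply: lt_le_trans (cons_norm_l a y).
  have : a <= - (`|M| + 1) by rewrite /a ge_min lexx orbT.
  by have := ler_norm M; have := normr_ge0 M; rewrite -[`|a|]normrN; have := ler_norm (- a); lra.
have Ldf : L1 (@lebesgue_measure R) setT df.
  apply: slice_L1; first exact: (Ck_continuous (Ck_partial ord0 Cp)).
  exact: bsupp_partial.
have dF' : derivable_oo_LRcontinuous (fun t : R => psi (cons (t, y))) a s.
  split; first by move=> t _; have [] := dF t.
    exact: cvg_at_right_filter (cF a).
  exact: cvg_at_left_filter (cF s).
have F'f : {in `]a, s[, derive1 (fun t : R => psi (cons (t, y))) =1 df}.
  by move=> t _; rewrite derive1E (@derive_val _ _ _ _ _ _ _ (dF t)).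
have E : I (@lebesgue_measure R) `[a, s] df = psi (cons (s, y)).
  rewrite IE /Rintegral (continuous_FTC2 as' (continuous_subspaceT cdf) dF' F'f).
  by rewrite a0 sube0.
have mI : measurable (`[a, s] : set (measurableTypeR R)) by exact: measurable_itv.
have Ln := L1_norm Ldf.
have LI : L1 (@lebesgue_measure R) `[a, s] df by exact: integrableS Ldf.
have h1 := I_norm mI LI; rewrite E in h1; apply: (le_trans h1); rewrite -lee_fin -!EFin_I//; last exact: L1_norm.
apply: ge0_subset_integral => //.
by apply/measurable_EFinP; exact: L1_meas Ln.
Qed.

End slices.

(** * The endpoint Sobolev inequality by induction on the dimension *)

Section gagliardo_nirenberg.
Context {R : realType}.

(* Tested against an arbitrary weight, the endpoint Sobolev inequality also makes sense for n = 1. *)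
Definition gn_ineq n := forall (psi f : 'rV[R]_n -> R), Ck 1 psi -> bsupp psi ->
  (forall x, 0 <= f x) -> L1 (lebesgue_rv n) setT f ->
  L1 (lebesgue_rv n) setT (fun x => f x `^ n%:R^-1 * `|psi x|) /\
  I (lebesgue_rv n) setT (fun x => f x `^ n%:R^-1 * `|psi x|) <=
    I (lebesgue_rv n) setT f `^ n%:R^-1 * I (lebesgue_rv n) setT (fun x => enorm (grad psi x)).

Lemma bsupp_norm n (f : 'rV[R]_n -> R) : bsupp f -> bsupp (fun x => `|f x|).
Proof. by move=> [M H]; exists M => x /H ->; rewrite normr0. Qed.

Lemma continuous_enorm_grad n (psi : 'rV[R]_n -> R) : Ck 1 psi -> continuous (fun x => enorm (grad psi x)).
Proof.
move=> Cp; have H : continuous (fun x : 'rV[R]_n => dotv (grad psi x) (grad psi x)).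
  rewrite /dotv; apply: continuous_sumR.
  move=> i; rewrite (_ : (fun x => _) = fun x => partial i psi x * partial i psi x); last first.
    by apply/funext => y; rewrite mxE.
  by move=> x; apply: (@continuousM _ _ (partial i psi) (partial i psi)); exact: (Ck_continuous (Ck_partial i Cp)).
move=> x; apply: (@continuous_comp _ _ _ (fun x => dotv (grad psi x) (grad psi x)) Num.sqrt).
  exact: H.
exact: sqrt_continuous.
Qed.

Lemma bsupp_enorm_grad n (psi : 'rV[R]_n -> R) : bsupp psi -> bsupp (fun x => enorm (grad psi x)).
Proof.
move=> bp; have /choice[M HM] : forall i, exists M, forall x, M < `|x| -> partial i psi x = 0.
  by move=> i; exact: bsupp_partial.
exists (\big[Num.max/0]_i M i) => x Mx; rewrite (_ : grad psi x = 0) ?enorm0//.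
apply/rowP => i; rewrite !mxE HM// (le_lt_trans _ Mx)//; exact: le_bigmax.
Qed.

Lemma L1_enorm_grad n (psi : 'rV[R]_n -> R) : Ck 1 psi -> bsupp psi ->
  L1 (lebesgue_rv n) setT (fun x => enorm (grad psi x)).
Proof. by move=> Cp bp; apply: L1_bsupp; [exact: continuous_enorm_grad|exact: bsupp_enorm_grad]. Qed.

Lemma powR_le1D (t p : R) : 0 <= t -> 0 <= p -> p <= 1 -> t `^ p <= 1 + t.
Proof.
move=> t0 p0 p1; have [t1|/ltW t1] := leP t 1.
  apply: (@le_trans _ _ (1 `^ p)); last by rewrite powR1 lerDl.
  by apply: ge0_ler_powR => //; rewrite nnegrE.
apply: (@le_trans _ _ (t `^ 1)); first exact: ler_powR.
by rewrite powRr1// lerDr.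
Qed.

Lemma gn_L1 n p (psi f : 'rV[R]_n -> R) : 0 <= p -> p <= 1 -> continuous psi -> bsupp psi ->
  (forall x, 0 <= f x) -> L1 (lebesgue_rv n) setT f ->
  L1 (lebesgue_rv n) setT (fun x => f x `^ p * `|psi x|).
Proof.
move=> p0 p1 cp bp f0 Lf; have [C C0 HC] := bsupp_bounded cp bp.
apply: (L1_le measurableT (g := fun x => `|psi x| + C * f x)).
- apply: measurable_funM; first exact: (measurableT_comp (measurable_powR p) (L1_meas Lf)).
  by apply: measurableT_comp => //; exact: continuous_rv_measurable.
- by apply: (L1D measurableT); [exact: (L1_norm (L1_bsupp cp bp))|exact: (L1Z measurableT)].
- move=> x _; rewrite ger0_norm ?mulr_ge0 ?powR_ge0//.
  apply: (le_trans (ler_wpM2r (normr_ge0 _) (powR_le1D (f0 x) p0 p1))).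
  by rewrite mulrDl mul1r lerD2l mulrC ler_wpM2r.
Qed.

Section step.
Context {n : nat} (psi : 'rV[R]_n.+1 -> R).
Hypotheses (Cp : Ck 1 psi) (bp : bsupp psi).
Let M (y : 'rV[R]_n) := I (@lebesgue_measure R) setT (fun t => `|partial ord0 psi (rv_cons (t, y))|).

Let cd : continuous (fun x => `|partial ord0 psi x|).
Proof. move=> x; apply: (@continuous_comp _ _ _ (partial ord0 psi) Num.norm); last exact: norm_continuous.
exact: (Ck_continuous (Ck_partial ord0 Cp)). Qed.

Let bd : bsupp (fun x => `|partial ord0 psi x|).
Proof. by apply: bsupp_norm; exact: bsupp_partial. Qed.

Let Ld : L1 (lebesgue_rv n.+1) setT (fun x => `|partial ord0 psi x|).
Proof. exact: (L1_bsupp cd bd). Qed.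

(** M majorises |psi| on every line in the first direction and does not depend on the first
    coordinate; so it can serve as the weight in all slices simultaneously. *)
Lemma gn_maximal : [/\ forall y, 0 <= M y, L1 (lebesgue_rv n) setT M,
  I (lebesgue_rv n) setT M <= I (lebesgue_rv n.+1) setT (fun x => enorm (grad psi x)) &
  forall s y, `|psi (rv_cons (s, y))| <= M y].
Proof.
have [Lc Ec] := I_cons Ld.
have [LM EM] := I_fubini2 Lc (fun y => slice_L1 y cd bd).
split.
- by move=> y; apply: I_ge0.
- exact: LM.
- rewrite /M -EM Ec; apply: (I_le measurableT Ld (L1_enorm_grad Cp bp)) => x _.
  by have := coord_le_enorm (grad psi x) ord0; rewrite mxE.
- by move=> s y; exact: slice_sup.
Qed.

End step.

(** [lebesgue_rv 0] is a Dirac mass, so M reduces to one number, which bounds |psi| everywhere. *)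
Lemma gn_ineq1 : gn_ineq 1.
Proof.
move=> psi f Cp bp f0 Lf; have [M0 LM IM HM] := gn_maximal Cp bp.
split; first by apply: gn_L1 => //; [rewrite invr1|exact: (Ck_continuous Cp)].
have E x : f x `^ 1%:R^-1 = f x by rewrite invr1 powRr1.
have IM0 : I (lebesgue_rv 0) setT (fun y : 'rV[R]_0 => I lebesgue_measure setT (fun t : R => `|partial ord0 psi (rv_cons (t, y))|)) =
   I lebesgue_measure setT (fun t : R => `|partial ord0 psi (rv_cons (t, 0))|).
  rewrite [LHS]IE /Rintegral [X in fine X](integral_dirac _ measurableT) ?diracE ?mem_set ?mul1e//.
    by apply/measurable_EFinP; exact: L1_meas LM.
rewrite IM0 in IM.
have c0 : 0 <= I (lebesgue_rv 1) setT (fun x => enorm (grad psi x)).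
  by apply: I_ge0 => x _; exact: enorm_ge0.
rewrite invr1 powRr1; last by apply: I_ge0.
rewrite mulrC -(I_Z measurableT _ Lf).
under [X in I _ _ X <= _]eq_fun do rewrite powRr1//.
apply: (I_le measurableT _ (L1Z measurableT _ Lf)).
  by have := @gn_L1 1 1 psi f ler01 (lexx 1) (Ck_continuous Cp) bp f0 Lf; under eq_fun do rewrite powRr1//.
move=> x _; rewrite mulrC ler_wpM2r//; apply: le_trans IM.
have := HM (rv_uncons x).1 (rv_uncons x).2; rewrite -surjective_pairing rv_cons_uncons.
by rewrite (_ : (rv_uncons x).2 = 0) //; exact: thinmx0.
Qed.

(** Let p = 1/(n+1). In each slice the induction hypothesis with weight M bounds the integral of
    |psi|^(1 + p), because |psi| <= M; integrated over the slices, this is at most Ng^(1 + p).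
    Hoelder's inequality with the conjugate exponents n + 2 and 1 + p = (n + 2)/(n + 1) then brings
    in the weight f. *)
Lemma gn_ineqS n : gn_ineq n.+1 -> gn_ineq n.+2.
Proof.
move=> IH psi f Cp bp f0 Lf; have [M0 LM IM HM] := gn_maximal Cp bp.
move: M0 LM IM HM; set M := fun y : 'rV[R]_n.+1 => _ => M0 LM IM HM.
pose p : R := n.+1%:R^-1; pose Ng := I (lebesgue_rv n.+2) setT (fun x => enorm (grad psi x)).
have p0 : 0 < p by rewrite invr_gt0.
have p1 : p <= 1 by rewrite invf_le1// ler1n.
have Ng0 : 0 <= Ng by apply: I_ge0 => x _; exact: enorm_ge0.
have cp := Ck_continuous Cp.
have IM0 : 0 <= I (lebesgue_rv n.+1) setT M by apply: I_ge0 => y _; exact: M0.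
have LG := L1_enorm_grad Cp bp.
have [LGc EGc] := I_cons LG.
have sG s : L1 (lebesgue_rv n.+1) setT (fun y => enorm (grad psi (rv_cons (s, y)))).
  apply: L1_bsupp; last exact: (slice_bsupp s (bsupp_enorm_grad bp)).
  move=> y; apply: (@continuous_comp _ _ _ (fun y => rv_cons (s, y)) (fun x => enorm (grad psi x))).
    exact: continuous_cons_r.
  exact: continuous_enorm_grad.
have [LGs EGs] := I_fubini1 LGc sG.
(* This is |psi|^(1 + p), written like the integrand of the induction hypothesis with M replaced by
   |psi|. *)
pose W x := `|psi x| `^ p * `|psi x|.
have Lpsi := L1_norm (L1_bsupp cp bp).
have LW : L1 (lebesgue_rv n.+2) setT W by apply: gn_L1 => //; exact: ltW.
have [LWc EWc] := I_cons LW.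
have sW s : L1 (lebesgue_rv n.+1) setT (fun y => W (rv_cons (s, y))).
  have csl : continuous (fun y => psi (rv_cons (s, y))) := Ck_continuous (slice_Ck s Cp).
  have bsl := slice_bsupp s bp.
  apply: (gn_L1 (ltW p0) p1 csl bsl) => //; exact: (L1_norm (L1_bsupp csl bsl)).
have [LWs EWs] := I_fubini1 LWc sW.
have IW : I (lebesgue_rv n.+2) setT W <= Ng `^ p * Ng.
  rewrite -EWc EWs {2}/Ng -EGc EGs -(I_Z measurableT _ LGs).
  apply: (I_le measurableT LWs (L1Z measurableT _ LGs)) => s _.
  have [L1s Is] := IH _ M (slice_Ck s Cp) (slice_bsupp s bp) M0 LM.
  apply: (@le_trans _ _ (I (lebesgue_rv n.+1) setT (fun y => M y `^ n.+1%:R^-1 * `|psi (rv_cons (s, y))|))).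
    apply: (I_le measurableT (sW s) L1s) => y _; apply: ler_wpM2r => //.
    by apply: (ge0_ler_powR (ltW p0)); rewrite ?nnegrE ?M0//; exact: HM.
  apply: (le_trans Is); apply: ler_pM; rewrite ?powR_ge0//.
  - by apply: I_ge0 => y _; exact: enorm_ge0.
  - by apply: (ge0_ler_powR (ltW p0)); rewrite ?nnegrE.
  - apply: (I_le measurableT (L1_enorm_grad (slice_Ck s Cp) (slice_bsupp s bp)) (sG s)) => y _.
    exact: slice_grad.
have r0 : 0 < n.+2%:R :> R by [].
have q0 : 0 < 1 + p by rewrite addr_gt0.
have rq : (n.+2%:R : R)^-1 + (1 + p)^-1 = 1.
  rewrite /p -(natr1 n.+1); have : 0 < n.+1%:R :> R by [].
  by move: (n.+1%:R : R) => k k0; field; rewrite !gt_eqF// addr_gt0.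
have fE x : (f x `^ n.+2%:R^-1) `^ n.+2%:R = f x by rewrite -powRrM mulVf// powRr1.
have WE x : `|psi x| `^ (1 + p) = W x.
  rewrite /W addrC; have [->|z0] := eqVneq `|psi x| 0; first by rewrite mulr0 powR0// gt_eqF// addr_gt0.
  by rewrite powRD ?z0 ?implybT// powRr1.
have mF : measurable_fun setT (fun x => f x `^ n.+2%:R^-1).
  exact: (measurableT_comp (measurable_powR _) (L1_meas Lf)).
have [L H] := @I_hoelder _ _ _ (lebesgue_rv n.+2) setT n.+2%:R (1 + p) (fun x => f x `^ n.+2%:R^-1) (fun x => `|psi x|)
   measurableT r0 q0 rq mF (L1_meas Lpsi) (fun x => powR_ge0 _ _) (fun x => normr_ge0 _)
   (L1_eq measurableT (fun x _ => esym (fE x)) Lf) (L1_eq measurableT (fun x _ => esym (WE x)) LW).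
split; first exact: L.
apply: (le_trans H); rewrite (funext fE) (funext WE) ler_wpM2l ?powR_ge0//.
apply: (@le_trans _ _ ((Ng `^ p * Ng) `^ (1 + p)^-1)).
  apply: ge0_ler_powR; rewrite ?nnegrE ?invr_ge0 ?(ltW q0)//; last by rewrite mulr_ge0// powR_ge0.
  by apply: I_ge0 => x _; rewrite mulr_ge0// powR_ge0.
have -> : Ng `^ p * Ng = Ng `^ (1 + p).
  have [->|z0] := eqVneq Ng 0; first by rewrite mulr0 powR0// gt_eqF// addr_gt0.
  by rewrite addrC powRD ?z0 ?implybT// powRr1.
by rewrite -powRrM mulfV ?gt_eqF// powRr1.
Qed.

Theorem gagliardo_nirenberg n : gn_ineq n.+1.
Proof. by elim: n => [|n IH]; [exact: gn_ineq1|exact: gn_ineqS]. Qed.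

End gagliardo_nirenberg.

(** * Stampacchia's lemma *)

Section stampacchia.
Context {R : realType}.

(** Along the levels k0 + d (1 - 2^(- j)) the values decay at least like r^j, where r^del = 1/2: the
    exponent 1 + del compensates the shrinking gaps between the levels, and the smallness condition
    is what the induction step requires. *)
Lemma stampacchia (mu : R -> R) (k0 d K del : R) : 0 < d -> 0 < del -> 0 <= K ->
  (forall k, 0 <= mu k) ->
  (forall k h : R, k0 <= k -> k < h -> h <= k0 + d -> (h - k) * mu h <= K * mu k `^ (1 + del)) ->
  (forall k h : R, k <= h -> mu h <= mu k) ->
  K * (2 / 2^-1 `^ del^-1) * mu k0 `^ del <= d -> mu (k0 + d) = 0.
Proof.
move=> d0 del0 K0 mu0 H mono small.
pose r : R := 2^-1 `^ del^-1.
have r0 : 0 < r by rewrite powR_gt0.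
have rd : r `^ del = 2^-1 by rewrite /r -powRrM mulVf ?gt_eqF// powRr1.
have r1 : r < 1.
  have e1 : 1 = 1 `^ del^-1 :> R by rewrite powR1.
  rewrite /r [ltRHS]e1; apply: gt0_ltr_powR; rewrite ?invr_gt0// ?nnegrE//.
  by rewrite invf_lt1// ltr1n.
pose k j := k0 + d * (1 - 2^-1 ^+ j).
have kk j : k j < k j.+1.
  rewrite ltrD2l ltr_pM2l// ltrD2l ltrN2 exprS gtr_pMl ?exprn_gt0//.
  by rewrite invf_lt1// ltr1n.
have kd j : k j <= k0 + d.
  by rewrite lerD2l ler_piMr ?ltW// gerBl exprn_ge0.
have k0j j : k0 <= k j.
  by rewrite lerDl (mulr_ge0 (ltW d0))// subr_ge0 exprn_ile1 ?invr_ge0// invf_le1// ler1n.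
have bound j : mu (k j) <= mu k0 * r ^+ j.
  elim: j => [|j IH]; first by rewrite /k !expr0 subrr mulr0 addr0 mulr1.
  have := H (k j) (k j.+1) (k0j j) (kk j) (kd _).
  have -> : k j.+1 - k j = d * 2^-1 ^+ j.+1 by rewrite /k exprS; field.
  have p0 : 0 < d * 2^-1 ^+ j.+1 by rewrite mulr_gt0// exprn_gt0.
  rewrite -ler_pdivlMl// => /le_trans; apply.
  have mr0 : 0 <= mu k0 * r ^+ j by rewrite mulr_ge0// exprn_ge0// ltW.
  have -> : mu k0 * r ^+ j.+1 = (d * 2^-1 ^+ j.+1)^-1 * (d * 2^-1 ^+ j.+1 * (mu k0 * r ^+ j.+1)).
    by rewrite (mulKf (lt0r_neq0 p0)).
  rewrite ler_pM2l ?invr_gt0//.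
  apply: (@le_trans _ _ (K * (mu k0 * r ^+ j) `^ (1 + del))).
    by apply: ler_wpM2l => //; apply: ge0_ler_powR; rewrite ?nnegrE// addr_ge0// ltW.
  rewrite powRD ?(gt_eqF (addr_gt0 ltr01 del0))// powRr1// powRM// ?exprn_ge0 ?(ltW r0)//.
  have -> : (r ^+ j) `^ del = 2^-1 ^+ j.
    by rewrite -powR_mulrn ?(ltW r0)// -powRrM mulrC powRrM rd powR_mulrn// invr_ge0.
  have E : K * (mu k0 * r ^+ j * (mu k0 `^ del * 2^-1 ^+ j)) =
      (K * (2 / r) * mu k0 `^ del) * (2^-1 ^+ j.+1 * (mu k0 * r ^+ j.+1)).
    by rewrite !exprS; field; rewrite gt_eqF.
  rewrite E -[leRHS]mulrA; apply: ler_wpM2r => //.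
  by rewrite !mulr_ge0// ?exprn_ge0// ?invr_ge0// ltW.
apply/eqP; rewrite eq_le mu0 andbT.
have c : mu k0 * r ^+ j @[j --> \oo] --> (0 : R).
  rewrite -[X in _ --> X](mulr0 (mu k0)); apply: cvgM; first exact: cvg_cst.
  by apply: cvg_expr; rewrite ger0_norm// ltW.
apply: (cvgr_to_ge c); apply: nearW => j; exact: le_trans (mono _ _ (kd j)) (bound j).
Qed.

End stampacchia.

(** * Powers as instances of Phi *)

Section power_function.
Context {R : realType} (s : R).
Hypothesis s1 : 1 < s.
Let phis (t : R) := t `^ (s - 2).

(** The case l = m = s, for which [NPhi] is |t|^s / s. It provides |psi|^s as a C^1 function of psi
    together with its gradient, as Sobolev's inequality demands. *)
Lemma admissible_powR : admissible s s phis.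
Proof.
have E (t : R) : 0 < t -> t * phis t = t `^ (s - 1).
  move=> t0; rewrite /phis -[X in X * _]powRr1 ?ltW// -powRD ?(gt_eqF t0) ?implybT//.
  by congr (_ `^ _); lra.
have d (t : R) : 0 < t -> is_derive t 1 phis ((s - 2) * t `^ (s - 2 - 1)).
  by move=> t0; exact: is_derive1_powR.
split => //.
- by move=> t t0; rewrite powR_gt0.
- move=> t t0; split; first by have [] := d t t0.
  have c : {for t, continuous (fun t : R => (s - 2) * t `^ (s - 2 - 1))}.
    by apply: (@continuousM _ _ (fun=> s - 2)); [exact: cvg_cst|exact: continuous_powR_pos].
  rewrite /continuous_at; apply: cvg_trans.
    apply: near_eq_cvg; near=> x.
    have x0 : 0 < x by near: x; exact: lt_nbhsr.
    by rewrite derive1E (@derive_val _ _ _ _ _ _ _ (d x x0)).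
  by rewrite derive1E (@derive_val _ _ _ _ _ _ _ (d t t0)).
- split.
    have s10 : 0 < s - 1 by rewrite subr_gt0.
    apply: cvg_trans (powR_cvg0 s10); apply: near_eq_cvg.
    by near=> t; rewrite E//; near: t; exact: nbhs_right_gt.
  move=> a b a0 ab; have b0 := lt_trans a0 ab; rewrite (E a a0) (E b b0).
  by apply: gt0_ltr_powR; rewrite ?nnegrE ?subr_gt0// ltW.
- move=> t t0.
  have -> : derive1 (fun s0 => s0 * phis s0) t = (s - 1) * phis t.
    rewrite derive1E.
    have := @is_deriveM _ _ id phis t 1 1 ((s - 2) * t `^ (s - 2 - 1)) (is_derive_id _ _) (d t t0).
    move=> dd; rewrite (@derive_val _ _ _ _ _ _ _ dd).
    rewrite /GRing.scale /= mulr1 mulrCA.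
    have -> : t * t `^ (s - 2 - 1) = phis t.
      by rewrite /phis -[X in X * _]powRr1 ?ltW// -powRD ?(gt_eqF t0) ?implybT//; congr (_ `^ _); lra.
    by rewrite /=; lra.
  by rewrite mulfK ?lexx// gt_eqF// powR_gt0.
Unshelve. all: by end_near.
Qed.

Lemma hphi_powR t : `|hphi phis t| = `|t| `^ (s - 1).
Proof.
rewrite /hphi normrM; have [->|t0] := eqVneq t 0.
  by rewrite normr0 mul0r powR0// gt_eqF// subr_gt0.
have n0 : 0 < `|t| by rewrite normr_gt0.
rewrite [X in _ * X]ger0_norm ?powR_ge0// /phis -[X in X * _]powRr1// -powRD ?(gt_eqF n0) ?implybT//.
by congr (_ `^ _); lra.
Qed.

Lemma NPhi_powR t : s * NPhi phis t = `|t| `^ s.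
Proof.
have adm := admissible_powR; have s0 : 0 < s := lt_trans ltr01 s1.
rewrite -(NPhi_norm adm); have n0 : 0 <= `|t| by [].
have -> : s * NPhi phis `|t| = `|t| * hphi phis `|t|.
  by apply/eqP; rewrite eq_le (NPhi_th_low adm n0) (NPhi_th_up adm n0).
rewrite -[hphi _ _]ger0_norm ?(hphi_ge0 adm)// hphi_powR normr_id.
rewrite -[X in X * _]powRr1// -powRD; first by congr (_ `^ _); lra.
by rewrite addrC subrK gt_eqF.
Qed.

End power_function.

Lemma sobolev_arith {R : realType} (s X Z a b c : R) : 0 < s -> 0 <= X -> 0 <= s * Z -> 0 < c ->
  a + b + c = 1 -> s^-1 * X <= X `^ a * X `^ b * Z -> X `^ c <= s * Z.
Proof.
move=> s0 X0 Z0 c0 e H; have [->|Xp] := eqVneq X 0; first by rewrite powR0// gt_eqF.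
have Xp' : 0 < X by rewrite lt_neqAle eq_sym Xp.
rewrite -(ler_pM2l (powR_gt0 (a + b) Xp')) -powRD ?Xp ?implybT// e powRr1//.
rewrite powRD ?Xp ?implybT//; move: H; rewrite ler_pdivrMl// => /le_trans; apply.
by apply: eq_ler; ring.
Qed.

(** * Sobolev's inequality for C^1 functions of bounded support *)

Section sobolev.
Context {R : realType} {n : nat} (l : R).
Hypothesis l1 : 1 < l.
Hypothesis lN : l < n.+1%:R.
Let ls := sobolev_exp n.+1 l.
Local Notation leb := (@lebesgue_rv R n.+1).

Lemma sobolev_exp_gt : l < ls.
Proof.
rewrite /ls /sobolev_exp ltr_pdivlMr ?subr_gt0// mulrC ltr_pM2r ?(lt_trans ltr01)//.
by rewrite gtrBl (lt_trans ltr01).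
Qed.

Lemma sobolev_exp_inv : ls^-1 = l^-1 - n.+1%:R^-1.
Proof.
have l0 := lt_trans ltr01 l1; have N0 : 0 < n.+1%:R :> R by [].
have d0 : 0 < n.+1%:R - l by rewrite subr_gt0.
by rewrite /ls /sobolev_exp; move: d0 N0; move: (n.+1%:R : R) => k d0 N0; field; rewrite !gt_eqF.
Qed.

Let ls0 : 0 < ls. Proof. exact: lt_trans (lt_trans ltr01 l1) sobolev_exp_gt. Qed.

Lemma L1_powR_bsupp (f : 'rV[R]_n.+1 -> R) (p : R) : 1 <= p -> continuous f -> bsupp f ->
  L1 leb setT (fun x => `|f x| `^ p).
Proof.
move=> p1 cf bf; have [C C0 HC] := bsupp_bounded cf bf.
apply: (L1_le measurableT (g := fun x => C `^ (p - 1) * `|f x|)).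
- apply: (measurableT_comp (measurable_powR p)); apply: measurableT_comp => //.
  exact: continuous_rv_measurable.
- by apply: (L1Z measurableT); exact: (L1_norm (L1_bsupp cf bf)).
- move=> x _; rewrite ger0_norm ?powR_ge0//.
  have -> : `|f x| `^ p = `|f x| `^ (p - 1) * `|f x|.
    have [->|f0] := eqVneq `|f x| 0; first by rewrite mulr0 powR0// gt_eqF// (lt_le_trans ltr01).
    rewrite -[X in _ * X]powRr1// -powRD ?f0 ?implybT//; congr (_ `^ _); lra.
  apply: ler_wpM2r => //; apply: ge0_ler_powR; rewrite ?nnegrE ?subr_ge0//.
Qed.

(** The endpoint inequality for |psi|^s / s with weight |psi|^ls, followed by Hoelder's inequality
    for |psi|^(s - 1) |grad psi|. The exponent s satisfies both (s - 1) l / (l - 1) = ls and s + ls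
    / (n + 1) = ls, so only powers of the integral of |psi|^ls occur. *)
Lemma sobolev_C1 (psi : 'rV[R]_n.+1 -> R) : Ck 1 psi -> bsupp psi ->
  I leb setT (fun x => `|psi x| `^ ls) `^ ls^-1 <=
  (1 + ls * (l - 1) / l) * I leb setT (fun x => enorm (grad psi x) `^ l) `^ l^-1.
Proof.
move=> Cp bp; have cp := Ck_continuous Cp.
have l0 := lt_trans ltr01 l1; set s := 1 + ls * (l - 1) / l.
have s1 : 1 < s by rewrite /s ltrDl divr_gt0// mulr_gt0// subr_gt0.
have s0 : 0 < s := lt_trans ltr01 s1.
have adm := admissible_powR s1; set phis := fun t : R => _ in adm.
pose P := NPhi phis.
have CP : Ck 1 (fun x => P (psi x)) := C1_comp (is_derive_NPhi adm) (continuous_hphi adm) Cp.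
have bP : bsupp (fun x => P (psi x)).
  by have [M HM] := bp; exists M => x /HM ->; rewrite /P NPhi0.
have ls1 : 1 <= ls by rewrite ltW// (lt_trans l1 sobolev_exp_gt).
have LX : L1 leb setT (fun x => `|psi x| `^ ls) by exact: L1_powR_bsupp.
have LY : L1 leb setT (fun x => enorm (grad psi x) `^ l).
  have := @L1_powR_bsupp (fun x => enorm (grad psi x)) l (ltW l1) (continuous_enorm_grad Cp) (bsupp_enorm_grad bp).
  by apply: (L1_eq measurableT) => x _; rewrite ger0_norm ?enorm_ge0.
set X := I leb setT (fun x => `|psi x| `^ ls); set Y := I _ _ _.
have X0 : 0 <= X by apply: I_ge0 => x _; exact: powR_ge0.
have [_ H1] := gagliardo_nirenberg CP bP (fun x => powR_ge0 `|psi x| ls) LX.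
have N0 : 0 < n.+1%:R :> R by [].
have EX : I leb setT (fun x => (`|psi x| `^ ls) `^ n.+1%:R^-1 * `|P (psi x)|) = s^-1 * X.
  rewrite -(I_Z measurableT _ LX); apply: I_eq => x _.
  rewrite [X in _ * X]ger0_norm ?(NPhi_ge0 adm)// -powRrM.
  have -> : P (psi x) = s^-1 * `|psi x| `^ s by rewrite -(NPhi_powR s1) mulKf// gt_eqF.
  rewrite mulrCA -powRD; last by rewrite gt_eqF// addr_gt0// mulr_gt0// invr_gt0.
  congr (_ * _ `^ _); rewrite /s.
  have e1 : ls * (l^-1 - n.+1%:R^-1) = 1 by rewrite -sobolev_exp_inv mulfV// gt_eqF.
  have e2 : ls * (l - 1) / l = ls - ls * l^-1 by field; rewrite gt_eqF.
  by rewrite e2; move: e1; move: (n.+1%:R^-1 : R) => k e1; lra.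
pose q := l / (l - 1).
have q0 : 0 < q by rewrite divr_gt0// subr_gt0.
have ql : q^-1 + l^-1 = 1 by rewrite /q; field; rewrite !gt_eqF// subr_gt0.
have mF : measurable_fun setT (fun x => `|psi x| `^ (s - 1)).
  apply: (measurableT_comp (measurable_powR _)); apply: measurableT_comp => //.
  exact: continuous_rv_measurable.
have mG : measurable_fun setT (fun x => enorm (grad psi x)).
  exact: L1_meas (L1_enorm_grad Cp bp).
have Eq x : (`|psi x| `^ (s - 1)) `^ q = `|psi x| `^ ls.
  rewrite -powRrM; congr (_ `^ _); rewrite /s /q; field.
  by rewrite !gt_eqF// subr_gt0.
have [_ H2] := I_hoelder measurableT q0 l0 ql mF mG (fun x => powR_ge0 _ _) (fun x => enorm_ge0 _)
  (L1_eq measurableT (fun x _ => esym (Eq x)) LX) LY.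
rewrite (funext Eq) in H2.
have EG : I leb setT (fun x => enorm (grad (fun x => P (psi x)) x)) =
    I leb setT (fun x => `|psi x| `^ (s - 1) * enorm (grad psi x)).
  apply: I_eq => x _; rewrite (grad_comp Cp (is_derive_NPhi adm (psi x))) enormZ.
  by rewrite -(hphi_powR s1).
rewrite EX EG in H1.
have H3 := le_trans H1 (ler_wpM2l (powR_ge0 X n.+1%:R^-1) H2).
rewrite -/X -/Y mulrA in H3.
apply: (sobolev_arith s0 X0 _ _ _ H3).
- by rewrite mulr_ge0 ?powR_ge0// ltW.
- by rewrite invr_gt0.
- by rewrite sobolev_exp_inv [LHS]addrC addrA subrK addrC.
Qed.

End sobolev.

(** * Embeddings of W0 *)

Section embedding.
Context {R : realType} {n : nat} (Om : set 'rV[R]_n.+1) (l m : R) (phi : R -> R).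
Hypothesis adm : admissible l m phi.
Hypothesis dom : open Om /\ bounded_set Om.
Local Notation P := (NPhi phi).
Local Notation leb := (@lebesgue_rv R n.+1).
Local Notation W0 := (W0 Om phi).
Implicit Types (u v : 'rV[R]_n.+1 -> R) (G H : 'rV[R]_n.+1 -> 'rV[R]_n.+1).

Let oO : open Om. Proof. by case: dom. Qed.
Let bO : bounded_set Om. Proof. by case: dom. Qed.
Let mO : measurable Om. Proof. exact: open_rv_measurable. Qed.

Lemma NPhi_dominates p tau t : 0 <= p -> p <= l -> 0 < tau -> 0 <= t ->
  t `^ p <= tau `^ p * (1 + P t / P tau).
Proof.
move=> p0 pl tau0 t0; have Pt0 : 0 < P tau by rewrite (NPhi_gt0 adm)// gt_eqF.
have q0 : 0 <= P t / P tau by rewrite divr_ge0// ?(ltW Pt0)// (NPhi_ge0 adm).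
have [tt|/ltW tt] := leP t tau.
  apply: (@le_trans _ _ (tau `^ p)); last by rewrite ler_peMr ?powR_ge0// lerDl.
  by apply: ge0_ler_powR; rewrite ?nnegrE// ltW.
have lam1 : 1 <= t / tau by rewrite ler_pdivlMr// mul1r.
have -> : t = (t / tau) * tau by rewrite divfK// gt_eqF.
rewrite powRM ?(ltW tau0)//; last by rewrite (le_trans ler01).
rewrite mulrC ler_pM2l ?powR_gt0//; apply: (@le_trans _ _ ((t / tau) `^ l)); first exact: ler_powR.
have := NPhi_scale_low adm tau lam1; rewrite -ler_pdivlMr// => /le_trans; apply.
by rewrite lerDr.
Qed.

Lemma L1_NPhi_powR p v : 0 <= p -> p <= l -> measurable_fun Om v ->
  (forall x, 0 <= v x) -> L1 leb Om (fun x => P (v x)) -> L1 leb Om (fun x => v x `^ p).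
Proof.
move=> p0 pl mv v0 Lv; have L := L1D mO (L1_cst dom 1) (L1Z mO (P 1)^-1 Lv).
apply: (L1_le mO (meas_powR p mv) L) => x _; rewrite ger0_norm ?powR_ge0//.
by have := NPhi_dominates p0 pl ltr01 (v0 x); rewrite powR1 mul1r (mulrC (P (v x))).
Qed.

(** In t^p <= tau^p (1 + P t / P tau) the number tau is chosen so that tau^p (V + 1) = e, with V the
    measure of Om, and the modular is required to be below P tau. *)
Lemma NPhi_small p e : 0 < p -> p <= l -> 0 < e -> exists2 d, 0 < d & forall v,
  measurable_fun Om v -> (forall x, 0 <= v x) -> L1 leb Om (fun x => P (v x)) ->
  I leb Om (fun x => P (v x)) < d -> I leb Om (fun x => v x `^ p) < e.
Proof.
move=> p0 pl e0; pose V := I leb Om (fun=> 1).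
have V0 : 0 <= V by apply: I_ge0.
have V1 : 0 < V + 1 by rewrite ltr_wpDl.
pose tau := (e / (V + 1)) `^ p^-1.
have tau0 : 0 < tau by rewrite powR_gt0// divr_gt0.
have Pt0 : 0 < P tau by rewrite (NPhi_gt0 adm)// gt_eqF.
have taup : tau `^ p = e / (V + 1) by rewrite /tau -powRrM mulVf ?gt_eqF// powRr1// ltW// divr_gt0.
exists (P tau) => // v mv v0 Lv Iv.
have L := L1Z mO (tau `^ p) (L1D mO (L1_cst dom 1) (L1Z mO (P tau)^-1 Lv)).
apply: (@le_lt_trans _ _ (tau `^ p * (V + (P tau)^-1 * I leb Om (fun x => P (v x))))).
  rewrite -(I_Z mO _ Lv) /V -(I_D mO (L1_cst dom 1) (L1Z mO (P tau)^-1 Lv)).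
  rewrite -(I_Z mO _ (L1D mO (L1_cst dom 1) (L1Z mO (P tau)^-1 Lv))).
  apply: (I_le mO (L1_NPhi_powR (ltW p0) pl mv v0 Lv) L) => x _.
  by have := NPhi_dominates (ltW p0) pl tau0 (v0 x); rewrite (mulrC (P (v x))).
rewrite taup mulrAC ltr_pdivrMr// ltr_pM2l//.
by rewrite ltrD2l ltr_pdivrMl// mulr1.
Qed.

Lemma W0_L1 u G : W0 u G -> L1 leb Om u /\ L1 leb Om (fun x => enorm (G x)).
Proof.
move=> W; have l1 := ltW (l_gt1 adm); have mu := W0_meas W.
have mE := vmeas_enorm (W0_vmeas W).
have mn : measurable_fun Om (fun x => `|u x|) by exact: measurableT_comp.
have Ln : L1 leb Om (fun x => P `|u x|).
  by apply: (L1_eq mO _ (W0_L1u adm dom W)) => x _; rewrite (NPhi_norm adm).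
split.
  apply: (L1_le mO mu (L1_NPhi_powR ler01 l1 mn (fun x => normr_ge0 _) Ln)) => x _.
  by rewrite powRr1.
have := L1_NPhi_powR ler01 l1 mE (fun x => enorm_ge0 _) (W0_L1G adm dom W).
by apply: (L1_eq mO) => x _; rewrite powRr1// enorm_ge0.
Qed.

Lemma meas_bool_restrict (c : 'rV[R]_n.+1 -> bool) : measurable_fun Om (fun x => (c x)%:R : R) ->
  [/\ L1 leb Om (fun x => (c x)%:R),
     L1 leb setT ((fun x => (c x)%:R : R) \_ Om) &
     I leb setT ((fun x => (c x)%:R : R) \_ Om) = I leb Om (fun x => (c x)%:R)].
Proof.
move=> mc; have L : L1 leb Om (fun x => (c x)%:R).
  by apply: (L1_bounded (C := 1)) => // x _; rewrite ger0_norm// lern1 leq_b1.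
have out x : ~ Om x -> ((fun x => (c x)%:R : R) \_ Om) x = 0.
  by move=> nx; rewrite patchE memNset.
have ins x : Om x -> ((fun x => (c x)%:R : R) \_ Om) x = (c x)%:R.
  by move=> ix; rewrite patchE mem_set.
split=> //; first by apply/(L1_restrict mO out); apply: (L1_eq mO _ L) => x /ins ->.
by rewrite -(I_restrict out); apply: I_eq => x /ins.
Qed.

(** The endpoint inequality with the indicator of the set c as weight, extended from test functions
    by density in L^1. *)
Lemma W0_isoperimetric u G (c : 'rV[R]_n.+1 -> bool) : W0 u G ->
  measurable_fun Om (fun x => (c x)%:R : R) ->
  I leb Om (fun x => (c x)%:R * `|u x|) <=
    I leb Om (fun x => (c x)%:R) `^ n.+1%:R^-1 * I leb Om (fun x => enorm (G x)).
Proof.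
move=> W mc; have [Lc LcT Ec] := meas_bool_restrict mc.
have [Lu LG] := W0_L1 W; have [mu mG Wa] := W.
have l1 := ltW (l_gt1 adm).
set k := _ `^ _; have k0 : 0 <= k by exact: powR_ge0.
have cu v : L1 leb Om v -> L1 leb Om (fun x => (c x)%:R * `|v x|).
  move=> Lv; apply: (L1_le mO _ (L1_norm Lv)).
    by apply: measurable_funM => //; apply: measurableT_comp => //; exact: L1_meas Lv.
  by move=> x _; rewrite normrM normr_id ler_piMl// ger0_norm// lern1 leq_b1.
apply/ler_addgt0Pr => e e0.
have e1 : 0 < e / (k + 1) by rewrite divr_gt0// ltr_wpDl.
have [d d0 Hd] := NPhi_small ltr01 l1 e1.
have [psi [tp Lp Ip]] := Wa d d0; have Wp := W0_test phi tp.
have [Lpsi Lgp] := W0_L1 Wp.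
have Wd := W0B adm dom W Wp; have [Ld Lgd] := W0_L1 Wd.
have LPd := W0_L1u adm dom Wd; have LPg := W0_L1G adm dom Wd.
rewrite (I_D mO LPd LPg) in Ip.
have i1 : 0 <= I leb Om (fun x => P (u x - psi x)) by apply: I_ge0 => x _; exact: (NPhi_ge0 adm).
have i2 : 0 <= I leb Om (fun x => P (enorm (G x - grad psi x))) by apply: I_ge0 => x _; exact: (NPhi_ge0 adm).
have E1 : I leb Om (fun x => `|u x - psi x|) < e / (k + 1).
  have mn : measurable_fun Om (fun x => `|u x - psi x|) by apply: measurableT_comp => //; exact: L1_meas Ld.
  have Ln : L1 leb Om (fun x => P `|u x - psi x|).
    by apply: (L1_eq mO _ LPd) => x _; rewrite (NPhi_norm adm).
  have := Hd _ mn (fun x => normr_ge0 _) Ln.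
  have -> : (fun x => P `|u x - psi x|) = (fun x => P (u x - psi x)).
    by apply/funext => x; rewrite (NPhi_norm adm).
  have -> : (fun x => `|u x - psi x| `^ 1) = (fun x => `|u x - psi x|).
    by apply/funext => x; rewrite powRr1.
  by apply; lra.
have E2 : I leb Om (fun x => enorm (G x - grad psi x)) < e / (k + 1).
  have := Hd _ (vmeas_enorm (W0_vmeas Wd)) (fun x => enorm_ge0 _) LPg.
  have -> : (fun x => enorm (G x - grad psi x) `^ 1) = (fun x => enorm (G x - grad psi x)).
    by apply/funext => x; rewrite powRr1// enorm_ge0.
  by apply; lra.
have Cp : Ck 1 psi by exact: test_Ck _ tp.
have bp := test_bsupp tp.
have c0 x : 0 <= ((fun x => (c x)%:R : R) \_ Om) x by rewrite patchE; case: ifP.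
have [Lgn Hgn] := gagliardo_nirenberg Cp bp c0 LcT.
have Hpsi : I leb Om (fun x => (c x)%:R * `|psi x|) <= k * I leb Om (fun x => enorm (grad psi x)).
  have -> : I leb Om (fun x => enorm (grad psi x)) = I leb setT (fun x => enorm (grad psi x)).
    apply: I_restrict => x nx; rewrite (_ : grad psi x = 0) ?enorm0//.
    by apply/rowP => i; rewrite !mxE (test_partial_out i tp nx).
  rewrite /k -Ec; apply: le_trans Hgn; apply: eq_ler.
  rewrite -(I_restrict (Om := Om)); last by move=> x nx; rewrite (test_out tp nx) normr0 mulr0.
  apply: I_eq => x Ox; rewrite patchE mem_set//; case: (c x) => /=; first by rewrite powR1.
  by rewrite powR0// gt_eqF.
have T1 : I leb Om (fun x => (c x)%:R * `|u x|) <=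
    I leb Om (fun x => (c x)%:R * `|psi x|) + I leb Om (fun x => `|u x - psi x|).
  rewrite -(I_D mO (cu _ Lpsi) (L1_norm Ld)).
  apply: (I_le mO (cu _ Lu) (L1D mO (cu _ Lpsi) (L1_norm Ld))) => x _.
  have h1 : `|u x| <= `|psi x| + `|u x - psi x|.
    by have := ler_normD (psi x) (u x - psi x); rewrite addrC subrK.
  by case: (c x); rewrite ?mul1r// !mul0r add0r.
have T2 : I leb Om (fun x => enorm (grad psi x)) <= I leb Om (fun x => enorm (G x)) +
    I leb Om (fun x => enorm (G x - grad psi x)).
  rewrite -(I_D mO LG Lgd); apply: (I_le mO Lgp (L1D mO LG Lgd)) => x _.
  by have := enormD (G x) (grad psi x - G x); rewrite addrC subrK (enormBC (grad psi x)).
have kk : k * (e / (k + 1)) + e / (k + 1) = e.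
  by rewrite -{2}[e / (k + 1)]mul1r -mulrDl mulrC divfK// gt_eqF// ltr_wpDl.
apply: (le_trans T1); apply: (@le_trans _ _ (k * (I leb Om (fun x => enorm (G x)) + e / (k + 1)) + e / (k + 1))).
  apply: lerD; last exact: ltW.
  apply: (le_trans Hpsi); apply: ler_wpM2l => //; apply: (le_trans T2); rewrite lerD2l; exact: ltW.
by rewrite mulrDr -addrA kk.
Qed.

Hypothesis lN : l < n.+1%:R.
Local Notation ls := (sobolev_exp n.+1 l).

Lemma W0_sobolev : exists2 C, 0 < C & forall u G, W0 u G ->
  L1 leb Om (fun x => `|u x| `^ ls) /\
  I leb Om (fun x => `|u x| `^ ls) `^ ls^-1 <= C * I leb Om (fun x => enorm (G x) `^ l) `^ l^-1.
Proof.
have l1 := l_gt1 adm; have l0 := lt_trans ltr01 l1.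
have ls0 : 0 < ls := lt_trans l0 (sobolev_exp_gt l1 lN).
pose s := 1 + ls * (l - 1) / l.
have s0 : 0 < s by rewrite /s addr_gt0// divr_gt0// mulr_gt0// subr_gt0.
exists (s * (2 `^ l * 2) `^ l^-1) => [|u G W]; first by rewrite mulr_gt0// powR_gt0// mulr_gt0// powR_gt0.
have mE := vmeas_enorm (W0_vmeas W).
have LPG := W0_L1G adm dom W.
have LG := L1_NPhi_powR (ltW l0) (lexx l) mE (fun x => enorm_ge0 _) LPG.
have mus : measurable_fun Om (fun x => `|u x| `^ ls).
  by apply: meas_powR; apply: measurableT_comp => //; exact: W0_meas W.
set Y := I leb Om (fun x => enorm (G x) `^ l).
have Y0 : 0 <= Y by apply: I_ge0 => x _; exact: powR_ge0.
have [psi [tp Lp Ip aep]] := W0_seq adm dom W.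
have key e : 0 < e -> L1 leb Om (fun x => `|u x| `^ ls) /\
    I leb Om (fun x => `|u x| `^ ls) <= (s * (2 `^ l * (Y + e)) `^ l^-1) `^ ls.
  move=> e0; have [d d0 Hd] := NPhi_small l0 (lexx l) e0.
  move/cvgrPdist_lt : Ip => /(_ _ d0)[K _ HK].
  pose v k := psi (k + K)%N.
  have tv k : test_fun Om (v k) by exact: tp.
  have Wv k : W0 (v k) (grad (v k)) by exact: W0_test.
  have Wd k := W0B adm dom W (Wv k).
  have Ig k : I leb Om (fun x => enorm (grad (v k) x) `^ l) <= 2 `^ l * (Y + e).
    have LPd := W0_L1G adm dom (Wd k); have LPu := W0_L1u adm dom (Wd k).
    have small : I leb Om (fun x => enorm (G x - grad (v k) x) `^ l) < e.
      apply: (Hd _ (vmeas_enorm (W0_vmeas (Wd k))) (fun x => enorm_ge0 _) LPd).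
      have := HK (k + K)%N (leq_addl _ _); rewrite /= sub0r normrN => /(le_lt_trans (ler_norm _)).
      apply: le_lt_trans; rewrite (I_D mO LPu LPd) lerDr; apply: I_ge0 => x _; exact: (NPhi_ge0 adm).
    have Ld := L1_NPhi_powR (ltW l0) (lexx l) (vmeas_enorm (W0_vmeas (Wd k))) (fun x => enorm_ge0 _) LPd.
    have Lg := L1_NPhi_powR (ltW l0) (lexx l) (vmeas_enorm (W0_vmeas (Wv k))) (fun x => enorm_ge0 _) (W0_L1G adm dom (Wv k)).
    have p2 : 0 < 2 `^ l :> R by rewrite powR_gt0.
    apply: (@le_trans _ _ (2 `^ l * (Y + I leb Om (fun x => enorm (G x - grad (v k) x) `^ l)))); last first.
      by rewrite ler_pM2l// lerD2l ltW.
    rewrite -(I_D mO LG Ld) -(I_Z mO _ (L1D mO LG Ld)).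
    apply: (I_le mO Lg (L1Z mO _ (L1D mO LG Ld))) => x _.
    have tri : enorm (grad (v k) x) <= enorm (G x) + enorm (G x - grad (v k) x).
      by have := enormD (G x) (grad (v k) x - G x); rewrite addrC subrK (enormBC (grad _ x)).
    set a := enorm (G x) in tri *; set b := enorm (_ - _) in tri *.
    have a0 : 0 <= a by exact: enorm_ge0. have b0 : 0 <= b by exact: enorm_ge0.
    pose M := Num.max a b; have M0 : 0 <= M by rewrite le_max a0.
    apply: (@le_trans _ _ ((2 * M) `^ l)).
      apply: ge0_ler_powR; rewrite ?nnegrE ?(ltW l0) ?enorm_ge0 ?mulr_ge0//.
      apply: (le_trans tri); rewrite mulr_natl mulr2n; apply: lerD; by rewrite le_max lexx ?orbT.
    rewrite powRM// ler_pM2l// /M; have [_|_] := leP a b; by rewrite ?lerDl ?lerDr powR_ge0.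
  have Cv k : Ck 1 (v k) by exact: test_Ck _ (tv _).
  have bv k : bsupp (v k) by exact: test_bsupp (tv _).
  have out k x : ~ Om x -> `|v k x| `^ ls = 0.
    by move=> nx; rewrite (test_out (tv _) nx) normr0 powR0// gt_eqF.
  have Lv k : L1 leb Om (fun x => `|v k x| `^ ls).
    apply/(L1_restrict mO (out k)); apply: (L1_powR_bsupp _ (Ck_continuous (Cv k)) (bv k)).
    by rewrite ltW// (lt_trans l1 (sobolev_exp_gt l1 lN)).
  have Iv k : I leb Om (fun x => `|v k x| `^ ls) <= (s * (2 `^ l * (Y + e)) `^ l^-1) `^ ls.
    have X0 : 0 <= I leb Om (fun x => `|v k x| `^ ls) by apply: I_ge0 => x _; exact: powR_ge0.
    have := sobolev_C1 l1 lN (Cv k) (bv k).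
    rewrite -(I_restrict (out k)) -(I_restrict (Om := Om)); last first.
      move=> x nx; rewrite (_ : grad (v k) x = 0) ?enorm0 ?powR0 ?gt_eqF//.
      by apply/rowP => i; rewrite !mxE (test_partial_out i (tv _) nx).
    rewrite -/s => H.
    have H2 : I leb Om (fun x => `|v k x| `^ ls) `^ ls^-1 <= s * (2 `^ l * (Y + e)) `^ l^-1.
      apply: (le_trans H); rewrite ler_pM2l//; apply: ge0_ler_powR; rewrite ?nnegrE ?invr_ge0 ?(ltW l0)//.
        by apply: I_ge0 => x _; exact: powR_ge0.
      by rewrite mulr_ge0 ?powR_ge0// addr_ge0// ltW.
    have := @ge0_ler_powR _ ls (ltW ls0) _ _ _ _ H2; rewrite ?nnegrE ?powR_ge0 => /(_ isT).
    rewrite -powRrM mulVf ?gt_eqF// powRr1//; apply.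
    by rewrite mulr_ge0 ?powR_ge0// ltW.
  have ae : aeD leb Om (fun x => `|v k x| `^ ls @[k --> \oo] --> `|u x| `^ ls).
    apply: aeDS aep => x _ [c _].
    have c1 : `|v k x| @[k --> \oo] --> `|u x|.
      apply: cvg_norm; rewrite /v; rewrite -(cvg_shiftn K (fun k => psi k x)) in c; exact: c.
    have [u0|u0] := eqVneq (u x) 0; last first.
      have n0 : 0 < `|u x| by rewrite normr_gt0.
      have cc := @continuous_powR_pos R ls _ n0.
      exact: (continuous_cvg _ cc c1).
    rewrite u0 normr0 in c1 *; rewrite powR0 ?gt_eqF//.
    apply/cvgrPdist_lt => r r0; have rr : 0 < r `^ ls^-1 by rewrite powR_gt0.
    move/cvgrPdist_lt : c1 => /(_ _ rr); apply: filterS => k.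
    rewrite !sub0r !normrN normr_id => h1; rewrite ger0_norm ?powR_ge0//.
    have := @gt0_ltr_powR _ ls ls0 _ _ _ _ h1; rewrite ?nnegrE ?powR_ge0 => /(_ (normr_ge0 _) isT).
    by rewrite -powRrM mulVf ?gt_eqF// powRr1// ltW.
  by apply: (I_fatou mO Lv _ mus Iv ae) => k; apply: aeDT => x _; exact: powR_ge0.
have [L _] := key 1 ltr01; split; first exact: L.
set X := I _ _ _; have X0 : 0 <= X by apply: I_ge0 => x _; exact: powR_ge0.
(* The approximation error is taken equal to Y, whence the factor 2 in the constant. If Y = 0, then
   u = 0 by Poincare's inequality. *)
have [Ye|Yp] := eqVneq Y 0.
  have lsi : 0 < ls^-1 by rewrite invr_gt0.
  suff -> : X = 0 by rewrite powR0 ?gt_eqF// mulr_ge0 ?powR_ge0// mulr_ge0 ?powR_ge0// ltW.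
  have zG : aeD leb Om (fun x => P (enorm (G x)) = 0).
    have G0 : aeD leb Om (fun x => 0 <= enorm (G x) `^ l) by apply: aeDT => x _; exact: powR_ge0.
    apply: aeDS (I_eq0 mO LG G0 (eq_ler Ye)) => x _ /eqP; rewrite powR_eq0 => /andP[/eqP -> _].
    exact: NPhi0.
  have [C C0 HC] := poincare adm dom (ord0 : 'I_n.+1).
  have := HC _ _ W; rewrite (_ : I leb Om (fun x => P (enorm (G x))) = 0); last first.
    by rewrite -(I_0 leb Om); apply: (I_ae mO (L1_meas LPG)).
  rewrite mulr0 => Iu; have Pu0 : aeD leb Om (fun x => 0 <= P (u x)) by apply: aeDT => x _; exact: (NPhi_ge0 adm).
  have zu := I_eq0 mO (W0_L1u adm dom W) Pu0 Iu.
  rewrite /X -(I_0 leb Om); apply: (I_ae mO (L1_meas L)); first exact: measurable_cst.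
  apply: aeDS zu => x _ Pu; have [->|u0] := eqVneq (u x) 0; first by rewrite normr0 powR0// gt_eqF.
  by have := NPhi_gt0 adm u0; rewrite Pu ltxx.
have Yp' : 0 < Y by rewrite lt_neqAle eq_sym Yp.
have [_ H] := key Y Yp'.
have := @ge0_ler_powR _ ls^-1 (_ : 0 <= ls^-1) _ _ _ _ H.
rewrite invr_ge0 (ltW ls0) => /(_ isT); rewrite !nnegrE powR_ge0 => /(_ X0 isT).
rewrite -powRrM mulfV ?gt_eqF// powRr1; last by rewrite mulr_ge0 ?powR_ge0// ltW.
move=> /le_trans; apply; apply: eq_ler.
have -> : 2 `^ l * (Y + Y) = 2 `^ l * 2 * Y by ring.
by rewrite powRM ?mulrA// mulr_ge0// powR_ge0.
Qed.

End embedding.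

(** * Boundedness *)

(** Solves an energy inequality for Y. Sobolev's inequality turns x^l B into at most Y / 2, which is
    absorbed; of the two remaining terms, the larger one determines the bound for Y^(1/l). *)
Lemma degiorgi_arith {R : realType} (l A C2 CS Y x mu th k B : R) :
  1 < l -> 0 <= A -> 0 < C2 -> 0 < CS -> 0 <= Y -> 0 <= x -> 0 <= mu -> 1 <= k ->
  0 <= B -> x <= CS * Y `^ l^-1 ->
  Y <= C2 * (A * (x * mu `^ th) + x `^ l * B + (1 + k `^ l) * mu) ->
  C2 * CS `^ l * B <= 2^-1 ->
  Y `^ l^-1 <= (4 * C2 * A * CS) `^ (l - 1)^-1 * mu `^ (th / (l - 1)) +
     (8 * C2) `^ l^-1 * k * mu `^ l^-1.
Proof.
move=> l1 A0 C20 CS0 Y0 x0 mu0 k1 B0 xY H small.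
have l0 := lt_trans ltr01 l1; have k0 := le_trans ler01 k1.
set y := Y `^ l^-1 in xY *; have y0 : 0 <= y by exact: powR_ge0.
have Yy : Y = y `^ l by rewrite /y -powRrM mulVf ?gt_eqF// powRr1.
have xl : x `^ l <= CS `^ l * Y.
  rewrite Yy -powRM ?(ltW CS0)//; apply: ge0_ler_powR; rewrite ?nnegrE ?(ltW l0)//.
  by rewrite mulr_ge0// ltW.
have p0 := powR_ge0 mu th.
have kl : 1 + k `^ l <= 2 * k `^ l.
  have e1 : 1 = 1 `^ l :> R by rewrite powR1.
  have : 1 <= k `^ l by rewrite [leLHS]e1; apply: ge0_ler_powR; rewrite ?nnegrE ?(ltW l0).
  lra.
have H2 : Y <= 2 * C2 * A * CS * (y * mu `^ th) + 4 * C2 * (k `^ l * mu).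
  have h1 : C2 * (x `^ l * B) <= 2^-1 * Y.
    apply: (@le_trans _ _ (C2 * CS `^ l * B * Y)); last exact: ler_wpM2r.
    have := ler_wpM2r B0 xl => /(ler_wpM2l (ltW C20)) /le_trans; apply.
    by apply: eq_ler; ring.
  have h2 : A * (x * mu `^ th) <= A * (CS * y * mu `^ th).
    by apply: ler_wpM2l => //; apply: ler_wpM2r.
  have h3 : (1 + k `^ l) * mu <= 2 * k `^ l * mu by exact: ler_wpM2r.
  have := ler_wpM2l (ltW C20) h2; have := ler_wpM2l (ltW C20) h3.
  move: H h1; rewrite !mulrDr.
  move: (x `^ l) (mu `^ th) (k `^ l) => q1 q2 q3.
  have -> : 2 * C2 * A * CS * (y * q2) = 2 * (C2 * (A * (CS * y * q2))) by ring.
  have -> : 4 * C2 * (q3 * mu) = 2 * (C2 * (2 * q3 * mu)) by ring.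
  by move: (C2 * (A * (x * q2))) (C2 * (q1 * B)) (C2 * ((1 + q3) * mu)) (C2 * (A * (CS * y * q2))) (C2 * (2 * q3 * mu)) => *; lra.
have t1 := powR_ge0 (4 * C2 * A * CS) (l - 1)^-1.
have t2 := powR_ge0 (8 * C2) l^-1.
have q1 := powR_ge0 mu (th / (l - 1)); have q2 := powR_ge0 mu l^-1.
have l10 : 0 < l - 1 by rewrite subr_gt0.
have li : 0 <= l^-1 by rewrite invr_ge0 ltW.
have [c1|/ltW c1] := leP (4 * C2 * (k `^ l * mu)) (2 * C2 * A * CS * (y * mu `^ th)).
  apply: (@le_trans _ _ ((4 * C2 * A * CS) `^ (l - 1)^-1 * mu `^ (th / (l - 1)))); last first.
    by rewrite lerDl !mulr_ge0.
  have [->|yp] := eqVneq y 0; first by rewrite mulr_ge0.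
  have yp' : 0 < y by rewrite lt_neqAle eq_sym yp.
  have H3 : y `^ (l - 1) <= 4 * C2 * A * CS * mu `^ th.
    rewrite -(ler_pM2r yp') -{2}[y]powRr1// -powRD ?yp ?implybT// subrK -Yy.
    apply: (le_trans H2); move: c1; move: (mu `^ th) => q.
    have -> : 4 * C2 * A * CS * q * y = 2 * (2 * C2 * A * CS * (y * q)) by ring.
    by move: (2 * C2 * A * CS * (y * q)) (4 * C2 * _) => *; lra.
  have := @ge0_ler_powR _ (l - 1)^-1 (_ : 0 <= _) _ _ _ _ H3.
  rewrite invr_ge0 (ltW l10) => /(_ isT); rewrite !nnegrE powR_ge0 => /(_ isT).
  rewrite -powRrM mulfV ?gt_eqF// powRr1// powRM ?powR_ge0//; last by rewrite !mulr_ge0// ltW.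
  by rewrite -powRrM; apply; rewrite !mulr_ge0// ltW.
apply: (@le_trans _ _ ((8 * C2) `^ l^-1 * k * mu `^ l^-1)); last by rewrite lerDr !mulr_ge0.
have H3 : Y <= 8 * C2 * k `^ l * mu.
  apply: (le_trans H2); move: c1; move: (2 * C2 * A * CS * _) => a.
  have -> : 8 * C2 * k `^ l * mu = 2 * (4 * C2 * (k `^ l * mu)) by ring.
  by move: (4 * C2 * _) => b; lra.
have e0 : 0 <= 8 * C2 by rewrite mulr_ge0// ltW.
have := @ge0_ler_powR _ l^-1 li _ _ _ _ H3; rewrite !nnegrE => /(_ Y0) H4.
apply: (le_trans (H4 _)); first by apply: mulr_ge0 => //; apply: mulr_ge0 => //; exact: powR_ge0.
by rewrite (powRM _ (mulr_ge0 e0 (powR_ge0 k l)) mu0) (powRM _ e0 (powR_ge0 k l)) -powRrM mulfV ?gt_eqF// powRr1.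
Qed.

Section boundedness.
Context {R : realType} {n : nat} (Om : set 'rV[R]_n.+1) (l m : R) (phi : R -> R).
Hypothesis adm : admissible l m phi.
Hypothesis dom : open Om /\ bounded_set Om.
Local Notation P := (NPhi phi).
Local Notation leb := (@lebesgue_rv R n.+1).
Local Notation W0 := (W0 Om phi).
Hypothesis lN : l < n.+1%:R.
Local Notation ls := (sobolev_exp n.+1 l).

Let oO : open Om. Proof. by case: dom. Qed.
Let bO : bounded_set Om. Proof. by case: dom. Qed.
Let mO : measurable Om. Proof. exact: open_rv_measurable. Qed.

Theorem W0_bounded (u a : 'rV[R]_n.+1 -> R) G (q C1 : R) : W0 u G -> aeD leb Om (fun x => 0 <= u x) ->
  n.+1%:R / l < q -> measurable_fun Om a -> (forall x, 0 <= a x) ->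
  L1 leb Om (fun x => a x `^ q) -> 0 <= C1 ->
  (forall k, 1 <= k -> L1 leb Om (fun x => a x * Num.max (u x - k) 0) /\
     I leb Om (fun x => (k < u x)%R%:R * P (enorm (G x))) <=
     I leb Om (fun x => a x * Num.max (u x - k) 0) + C1 * I leb Om (fun x => (k < u x)%R%:R * `|u x| `^ l)) ->
  exists M, aeD leb Om (fun x => u x <= M).
Proof.
move=> W u0 qN ma a0 La C10 energy.
have l1 := l_gt1 adm; have l0 := lt_trans ltr01 l1.
have lls := sobolev_exp_gt l1 lN; have ls0 : 0 < ls := lt_trans l0 lls.
have lsi := sobolev_exp_inv l1 lN.
have N0 : 0 < n.+1%:R :> R by [].
have q0 : 0 < q by apply: lt_trans qN; rewrite divr_gt0.
have [CS CS0 HS] := W0_sobolev adm dom lN.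
have mu_ := W0_meas W; have mG := W0_vmeas W.
have P1 : 0 < P 1 by rewrite (NPhi_gt0 adm)// oner_eq0.
pose mu k := I leb Om (fun x => (k < u x)%R%:R : R).
have mc k : measurable_fun Om (fun x => (k < u x)%R%:R : R).
  apply: measurableT_comp => //; apply: measurable_fun_ltr => //; exact: measurable_cst.
have Lc k : L1 leb Om (fun x => (k < u x)%R%:R : R).
  by apply: (L1_bounded (C := 1)) => // x _; rewrite ger0_norm// lern1 leq_b1.
have mu0 k : 0 <= mu k by apply: I_ge0.
have mono k h : k <= h -> mu h <= mu k.
  move=> kh; apply: (I_le mO (Lc h) (Lc k)) => x _; rewrite ler_nat.
  by case: ltP => // hx; rewrite (le_lt_trans kh hx).
(* Hoelder's inequality for a in L^q and the truncation in L^ls leaves this power of the measure of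
   the level set. The condition q > N / l, with N the dimension, is equivalent to th / (l - 1) > 1 /
   ls. *)
pose th := 1 - ls^-1 - q^-1.
have qi : q^-1 < l / n.+1%:R.
  by rewrite -[ltRHS]invrK invf_div ltf_pV2 ?posrE// divr_gt0.
have th0 : 0 < th / (l - 1) - ls^-1.
  have l10 : 0 < l - 1 by rewrite subr_gt0.
  rewrite subr_gt0 ltr_pdivlMr// /th.
  have e : ls^-1 * l = 1 - l / n.+1%:R by rewrite lsi mulrBl mulVf ?gt_eqF// mulrC.
  by move: e qi; move: (ls^-1) (q^-1) (l / _) => s r t e; rewrite mulrBr e; lra.
pose al := 1 - l / ls.
have al0 : 0 < al by rewrite subr_gt0 ltr_pdivrMr// mul1r.
have p0 : 0 < 1 - ls^-1 by rewrite subr_gt0 invf_lt1// (lt_trans l1).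
have thp : 0 < th.
  have l10 : 0 < l - 1 by rewrite subr_gt0.
  have : 0 < th / (l - 1) by apply: lt_trans th0 _ => //; rewrite gtrBl invr_gt0.
  by rewrite pmulr_lgt0// invr_gt0.
pose p := (1 - ls^-1)^-1.
have pp0 : 0 < p by rewrite invr_gt0.
have pq : p < q.
  rewrite -[ltRHS]invrK ltf_pV2 ?posrE ?invr_gt0//.
  by move: thp; rewrite /th; lra.
have hold1 k (z : 'rV[R]_n.+1 -> R) r s : 0 < r -> 0 < s -> r^-1 + s^-1 = 1 -> measurable_fun Om z -> (forall x, 0 <= z x) ->
    L1 leb Om (fun x => z x `^ r) ->
    L1 leb Om (fun x => z x * (k < u x)%R%:R) /\
    I leb Om (fun x => z x * (k < u x)%R%:R) <= I leb Om (fun x => z x `^ r) `^ r^-1 * mu k `^ s^-1.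
  move=> r0 s0 rs mz z0 Lz.
  have E x : ((k < u x)%R%:R : R) `^ s = (k < u x)%R%:R.
    by case: (k < u x)%R; rewrite ?powR1// powR0// gt_eqF.
  have := @I_hoelder _ _ _ leb Om r s z (fun x => (k < u x)%R%:R) mO r0 s0 rs mz (mc k) z0 (fun x => ler0n _ _) Lz.
  by rewrite (funext E) => /(_ (Lc k)).
pose A := I leb Om (fun x => a x `^ q) `^ q^-1.
have A0 : 0 <= A by exact: powR_ge0.
pose z k x := Num.max (u x - k) 0.
have Wz k : 0 <= k -> W0 (z k) (fun x => (k < u x)%R%:R *: G x) by move=> k0; exact: (W0_trunc adm dom k0 W).
have z0 k x : 0 <= z k x by rewrite le_max lexx orbT.
have zc k x : z k x * (k < u x)%R%:R = z k x.
  rewrite /z; case: (ltP k (u x)) => h; first by rewrite mulr1.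
  by rewrite mulr0 (max_idPr _)// subr_le0.
pose X k := I leb Om (fun x => z k x `^ ls) `^ ls^-1.
pose Y k := I leb Om (fun x => (k < u x)%R%:R * enorm (G x) `^ l).
have EY k : (fun x => (k < u x)%R%:R * enorm (G x) `^ l) = fun x => enorm ((k < u x)%R%:R *: G x) `^ l.
  apply/funext => x; case: (k < u x)%R; first by rewrite mul1r scale1r.
  by rewrite mul0r scale0r enorm0 powR0// gt_eqF.
have Ezn k : (fun x => `|z k x| `^ ls) = fun x => z k x `^ ls.
  by apply/funext => x; rewrite ger0_norm.
have LG := L1_NPhi_powR adm dom (ltW l0) (lexx l) (vmeas_enorm mG) (fun x => enorm_ge0 _) (W0_L1G adm dom W).
have LY k : L1 leb Om (fun x => (k < u x)%R%:R * enorm (G x) `^ l).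
  apply: (L1_le mO (measurable_funM (mc k) (L1_meas LG)) LG) => x _.
  by rewrite ger0_norm ?mulr_ge0 ?powR_ge0// ler_piMl ?powR_ge0// lern1 leq_b1.
have sob k : 0 <= k -> L1 leb Om (fun x => z k x `^ ls) /\ X k <= CS * Y k `^ l^-1.
  by move=> k0; have := HS _ _ (Wz k k0); rewrite Ezn -EY.
have X0 k : 0 <= X k by exact: powR_ge0.
have Y0 k : 0 <= Y k by apply: I_ge0 => x _; rewrite mulr_ge0 ?powR_ge0.
have mz k : 0 <= k -> measurable_fun Om (z k) by move=> k0; exact: W0_meas (Wz k k0).
have exps : p^-1 + ls^-1 = 1 by rewrite /p invrK subrK.
(* Two applications of Hoelder's inequality, which amount to one with the three exponents q, ls and
   1 / th. *)
have Iaz k : 0 <= k -> I leb Om (fun x => a x * z k x) <= A * (X k * mu k `^ th).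
  move=> k0; have [Lz _] := sob k k0.
  pose b x := a x * (k < u x)%R%:R.
  have mb : measurable_fun Om b by exact: measurable_funM.
  have b0 x : 0 <= b x by rewrite mulr_ge0.
  have r0 : 0 < q / p by rewrite divr_gt0.
  have s0 : 0 < 1 - p / q by rewrite subr_gt0 ltr_pdivrMr// mul1r.
  have map : measurable_fun Om (fun x => a x `^ p) by exact: meas_powR.
  have Eap x : (a x `^ p) `^ (q / p) = a x `^ q by rewrite -powRrM mulrC divfK// gt_eqF.
  have rs : (q / p)^-1 + ((1 - p / q)^-1)^-1 = 1 by rewrite invrK invf_div addrC subrK.
  have si0 : 0 < (1 - p / q)^-1 by rewrite invr_gt0.
  have La' : L1 leb Om (fun x => (a x `^ p) `^ (q / p)) by rewrite (funext Eap).
  have [Lb Hb] := hold1 k (fun x => a x `^ p) _ _ r0 si0 rs map (fun x => powR_ge0 _ _) La'.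
  rewrite (funext Eap) invf_div invrK in Hb.
  have Eb : (fun x => a x `^ p * (k < u x)%R%:R) = fun x => b x `^ p.
    apply/funext => x; rewrite /b; case: (k < u x)%R; first by rewrite !mulr1.
    by rewrite !mulr0 powR0// gt_eqF.
  rewrite Eb in Lb Hb.
  have [Lbz Hbz] := I_hoelder mO pp0 ls0 exps mb (mz k k0) b0 (z0 k) Lb Lz.
  have -> : (fun x => a x * z k x) = fun x => b x * z k x.
    by apply/funext => x; rewrite /b -mulrA (mulrC _%:R) zc.
  have Ap : I leb Om (fun x => b x `^ p) `^ p^-1 <= A * mu k `^ th.
    have pi0 : 0 <= p^-1 by rewrite invr_ge0 ltW.
    have := @ge0_ler_powR _ p^-1 pi0 _ _ _ _ Hb.
    rewrite !nnegrE => H; apply: (le_trans (H _ _)).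
    - by apply: I_ge0 => x _; exact: powR_ge0.
    - by rewrite mulr_ge0 ?powR_ge0.
    rewrite (powRM _ (powR_ge0 _ _) (powR_ge0 _ _)) -!powRrM; apply: eq_ler; congr (_ `^ _ * _ `^ _).
      by field; rewrite !gt_eqF.
    by rewrite mulrBl mul1r (mulrAC p) (mulfV (lt0r_neq0 pp0)) mul1r /th /p invrK.
  apply: (le_trans Hbz); apply: (@le_trans _ _ (A * mu k `^ th * X k)).
    exact: (ler_wpM2r (X0 k) Ap).
  by apply: eq_ler; ring.
have Izl k : 0 <= k -> L1 leb Om (fun x => z k x `^ l) /\ I leb Om (fun x => z k x `^ l) <= X k `^ l * mu k `^ al.
  move=> k0; have [Lz _] := sob k k0.
  have r0 : 0 < ls / l by rewrite divr_gt0.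
  have si0 : 0 < al^-1 by rewrite invr_gt0.
  have rs : (ls / l)^-1 + al^-1^-1 = 1 by rewrite invrK invf_div /al addrC subrK.
  have Ez x : (z k x `^ l) `^ (ls / l) = z k x `^ ls by rewrite -powRrM mulrC divfK// gt_eqF.
  have Lz' : L1 leb Om (fun x => (z k x `^ l) `^ (ls / l)) by rewrite (funext Ez).
  have := hold1 k (fun x => z k x `^ l) _ _ r0 si0 rs (meas_powR l (mz k k0)) (fun x => powR_ge0 _ _) Lz'.
  have -> : (fun x => z k x `^ l * (k < u x)%R%:R) = fun x => z k x `^ l.
    apply/funext => x; rewrite /z; case: (ltP k (u x)) => h; first by rewrite mulr1.
    by rewrite mulr0 (max_idPr _) ?subr_le0// powR0// gt_eqF.
  rewrite (funext Ez) invf_div invrK => -[L1z H]; split => //; apply: (le_trans H).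
  by rewrite (_ : X k `^ l = I leb Om (fun x => z k x `^ ls) `^ (l / ls))// /X -powRrM mulrC.
pose D := 2 `^ l * (1 + C1) + 1.
have p2 : 0 < 2 `^ l :> R by rewrite powR_gt0.
have D1 : 1 <= D by rewrite lerDr mulr_ge0 ?(ltW p2)// addr_ge0.
pose C2 := ((P 1)^-1 + 1) * D.
have C20 : 0 < C2 by rewrite mulr_gt0 ?(lt_le_trans ltr01 D1)// addr_gt0// invr_gt0.
have caccioppoli k : 1 <= k -> Y k <= C2 * (A * (X k * mu k `^ th) + X k `^ l * mu k `^ al + (1 + k `^ l) * mu k).
  move=> k1; have k0 : 0 <= k := le_trans ler01 k1.
  have [Laz En] := energy k k1.
  have [Lzl Hzl] := Izl k k0; have Haz := Iaz k k0.
  have LPG := W0_L1G adm dom W.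
  have LcP : L1 leb Om (fun x => (k < u x)%R%:R * P (enorm (G x))).
    apply: (L1_le mO (measurable_funM (mc k) (L1_meas LPG)) LPG) => x _.
    by rewrite ger0_norm ?mulr_ge0 ?(NPhi_ge0 adm)// ler_piMl ?(NPhi_ge0 adm)// lern1 leq_b1.
  have Yle : Y k <= (P 1)^-1 * I leb Om (fun x => (k < u x)%R%:R * P (enorm (G x))) + mu k.
    rewrite /mu -(I_Z mO _ LcP) -(I_D mO (L1Z mO _ LcP) (Lc k)).
    apply: (I_le mO (LY k) (L1D mO (L1Z mO _ LcP) (Lc k))) => x _.
    have := NPhi_dominates adm (ltW l0) (lexx l) ltr01 (enorm_ge0 (G x)); rewrite powR1 mul1r => H.
    case: (k < u x)%R; last by rewrite !mul0r mulr0 addr0.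
    by rewrite !mul1r [leRHS]addrC (mulrC (P 1)^-1).
  have ul : I leb Om (fun x => (k < u x)%R%:R * `|u x| `^ l) <= 2 `^ l * (I leb Om (fun x => z k x `^ l) + k `^ l * mu k).
    have Lr := L1Z mO (2 `^ l) (L1D mO Lzl (L1Z mO (k `^ l) (Lc k))).
    rewrite /mu -(I_Z mO _ (Lc k)) -(I_D mO Lzl (L1Z mO (k `^ l) (Lc k))) -(I_Z mO _ (L1D mO Lzl (L1Z mO (k `^ l) (Lc k)))).
    have Ll : L1 leb Om (fun x => (k < u x)%R%:R * `|u x| `^ l).
      have mn : measurable_fun Om (fun x => `|u x|) by exact: measurableT_comp.
      have Ln : L1 leb Om (fun x => P `|u x|).
        by apply: (L1_eq mO _ (W0_L1u adm dom W)) => x _; rewrite (NPhi_norm adm).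
      have L2 := L1_NPhi_powR adm dom (ltW l0) (lexx l) mn (fun x => normr_ge0 _) Ln.
      apply: (L1_le mO (measurable_funM (mc k) (L1_meas L2)) L2) => x _.
      by rewrite ger0_norm ?mulr_ge0 ?powR_ge0// ler_piMl ?powR_ge0// lern1 leq_b1.
    apply: (I_le mO Ll Lr) => x _; rewrite /z; case: (ltP k (u x)) => h; last first.
      by rewrite mul0r mulr0 addr0 mulr_ge0 ?powR_ge0.
    rewrite mul1r mulr1 (max_idPl _) ?subr_ge0 ?(ltW h)//.
    have uk : 0 <= u x - k by rewrite subr_ge0 ltW.
    rewrite ger0_norm; last by rewrite (le_trans k0)// ltW.
    pose M := Num.max (u x - k) k; have M0 : 0 <= M by rewrite le_max k0 orbT.
    apply: (@le_trans _ _ ((2 * M) `^ l)).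
      apply: ge0_ler_powR; rewrite ?nnegrE ?(ltW l0) ?mulr_ge0// ?(le_trans k0 (ltW h))//.
      rewrite -[leLHS](subrK k) mulr_natl mulr2n; apply: lerD; by rewrite le_max lexx ?orbT.
    rewrite powRM// ler_pM2l// /M; have [_|_] := leP (u x - k) k; by rewrite ?lerDl ?lerDr powR_ge0.
  move: En Yle ul Haz Hzl; rewrite -/(z k).
  set e1 := I _ _ _; set e2 := I leb Om (fun x => a x * _); set e3 := I leb Om (fun x => _ * `|u x| `^ l).
  set e4 := I leb Om (fun x => z k x `^ l).
  move: (A * _) (X k `^ l * _) (mu0 k) (powR_ge0 k l) (Y k); rewrite /C2.
  move: (mu k) (k `^ l) => t kl sA sX t0 kl0 y En Yle ul Haz Hzl.
  have Pi : 0 <= (P 1)^-1 by rewrite invr_ge0 ltW.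
  have e40 : 0 <= e4 by apply: I_ge0 => x _; exact: powR_ge0.
  have e20 : 0 <= e2 by apply: I_ge0 => x _; exact: mulr_ge0 (a0 x) (z0 k x).
  have sX0 := le_trans e40 Hzl; have sA0 := le_trans e20 Haz.
  have klt : 0 <= kl * t by exact: mulr_ge0.
  have E1 : e1 <= D * (sA + sX + (1 + kl) * t).
    apply: (le_trans En); have b1 : C1 * e3 <= C1 * (2 `^ l * (sX + kl * t)).
      apply: ler_wpM2l => //; apply: (le_trans ul); rewrite ler_pM2l//; exact: lerD.
    have b2 : sA <= D * sA by rewrite ler_peMl.
    have b3 : C1 * (2 `^ l * (sX + kl * t)) <= D * (sX + kl * t).
      rewrite mulrA; apply: ler_wpM2r; first exact: addr_ge0.
      by rewrite /D; move: C10 p2; move: (2 `^ l) => w; nra.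
    have b4 : 0 <= D * t by rewrite mulr_ge0// (le_trans ler01).
    have -> : D * (sA + sX + (1 + kl) * t) = D * sA + D * (sX + kl * t) + D * t by ring.
    by move: b1 b2 b3 b4 Haz; move: (C1 * e3) (D * sA) (C1 * _) (D * (_ + _)) (D * t) => *; lra.
  apply: (le_trans Yle).
  apply: (@le_trans _ _ ((P 1)^-1 * (D * (sA + sX + (1 + kl) * t)) + t)).
    by rewrite lerD2r; exact: ler_wpM2l.
  rewrite (_ : _ * D * _ = (P 1)^-1 * (D * (sA + sX + (1 + kl) * t)) + D * (sA + sX + (1 + kl) * t)); last by ring.
  rewrite lerD2l; apply: (@le_trans _ _ (sA + sX + (1 + kl) * t)).
    by rewrite mulrDl mul1r; move: sA0 sX0 klt; lra.
  by rewrite ler_peMl// addr_ge0 ?addr_ge0// mulr_ge0// addr_ge0.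
pose K1 := (4 * C2 * A * CS) `^ (l - 1)^-1; pose K2 := (8 * C2) `^ l^-1.
have K10 : 0 <= K1 by exact: powR_ge0. have K20 : 0 <= K2 by exact: powR_ge0.
pose d1 := th / (l - 1) - ls^-1; pose d2 := (n.+1%:R : R)^-1.
(* The gains over the exponent 1 in the decay of the level sets: d1 comes from the datum a, and d2 =
   1/l - 1/ls from the terms proportional to the measure. *)
pose del := Num.min d1 d2.
have d20 : 0 < d2 by rewrite invr_gt0.
have del0 : 0 < del by rewrite lt_min th0 d20.
pose cd := 2 / 2^-1 `^ del^-1 : R.
have cd0 : 0 < cd by rewrite divr_gt0// powR_gt0.
pose KK := 2 * CS * (K1 + K2).
have KK0 : 0 <= KK by rewrite !mulr_ge0 ?addr_ge0// ltW.
(* s1 makes the absorbed term of [degiorgi_arith] at most one half, and s2 is the smallness asked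
   for by [stampacchia]. *)
pose s1 := (2^-1 / (C2 * CS `^ l)) `^ al^-1; pose s2 := (2 * KK * cd + 1)^-1 `^ del^-1.
have CSl : 0 < C2 * CS `^ l by rewrite mulr_gt0// powR_gt0.
have s10 : 0 < s1 by rewrite powR_gt0// divr_gt0.
have KKc : 0 <= 2 * KK * cd by rewrite mulr_ge0 ?(ltW cd0)// mulr_ge0.
have KK1 : 0 < 2 * KK * cd + 1 by rewrite ltr_wpDl.
have s20 : 0 < s2 by rewrite powR_gt0// invr_gt0.
pose eta := Num.min 1 (Num.min s1 s2).
have eta0 : 0 < eta by rewrite !lt_min ltr01 s10 s20.
have [Lu _] := W0_L1 adm dom W.
(* By Chebyshev's inequality the set where u > k0 has measure at most eta. *)
pose k0 := Num.max 1 (I leb Om (fun x => `|u x|) / eta).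
have k01 : 1 <= k0 by rewrite le_max lexx.
have mu_eta : mu k0 <= eta.
  have kp : 0 < k0 := lt_le_trans ltr01 k01.
  rewrite -(ler_pM2l kp); apply: (@le_trans _ _ (I leb Om (fun x => `|u x|))).
    rewrite /mu -(I_Z mO _ (Lc k0)); apply: (I_le mO (L1Z mO _ (Lc k0)) (L1_norm Lu)) => x _.
    case: (ltP k0 (u x)) => h; last by rewrite mulr0.
    by rewrite mulr1 (le_trans (ltW h))// ler_norm.
  by rewrite -ler_pdivrMr// /k0 le_max lexx orbT.
have small k : k0 <= k -> [/\ mu k <= 1, C2 * CS `^ l * mu k `^ al <= 2^-1 & mu k <= s2].
  move=> kk; have me : mu k <= eta := le_trans (mono _ _ kk) mu_eta.
  have := me; rewrite !le_min => /and3P[m1 m2 m3]; split => //.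
  rewrite mulrC -ler_pdivlMr//.
  have := @ge0_ler_powR _ al (ltW al0) _ _ _ _ m2; rewrite !nnegrE => /(_ (mu0 k) (ltW s10)) /le_trans; apply.
  by rewrite /s1 -powRrM mulVf ?gt_eqF// powRr1// divr_ge0// ltW.
exists (k0 + k0).
suff : mu (k0 + k0) = 0.
  move=> m0; have c0 : aeD leb Om (fun x => 0 <= ((k0 + k0 < u x)%R%:R : R)) by apply: aeDT.
  apply: aeDS (I_eq0 mO (Lc (k0 + k0)) c0 (eq_ler m0)) => x _.
  by case: ltP => // _ /eqP; rewrite oner_eq0.
have kp : 0 < k0 := lt_le_trans ltr01 k01.
(* Between the levels k0 and 2 k0 the factor k is at most 2 k0. With d = k0 both sides of the
   smallness condition are proportional to k0, so eta could be fixed before k0. *)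
apply: (@stampacchia _ mu k0 k0 (KK * (2 * k0)) del) => //.
- by rewrite mulr_ge0// mulr_ge0// ltW.
- move=> k h kk kh hk.
  have k1 : 1 <= k := le_trans k01 kk; have kpos : 0 <= k := le_trans ler01 k1.
  have [m1 m2 _] := small k kk.
  have [Lz HX] := sob k kpos.
  have Hy := degiorgi_arith l1 A0 C20 CS0 (Y0 k) (X0 k) (mu0 k) k1 (powR_ge0 _ _) HX (caccioppoli k k1) m2.
  have si0 : 0 < p by [].
  have [Lz1 Iz] : L1 leb Om (z k) /\ I leb Om (z k) <= X k * mu k `^ p^-1.
    have rs : ls^-1 + p^-1 = 1 by rewrite addrC.
    have := hold1 k (z k) _ _ ls0 si0 rs (mz k kpos) (z0 k) Lz.
    have -> // : (fun x => z k x * (k < u x)%R%:R) = z k by apply/funext => x; rewrite zc.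
  have step : (h - k) * mu h <= I leb Om (z k).
    rewrite /mu -(I_Z mO _ (Lc h)); apply: (I_le mO (L1Z mO _ (Lc h)) Lz1) => x _.
    case: (ltP h (u x)) => hx; last by rewrite mulr0 z0.
    by rewrite mulr1 /z le_max lerD2r ltW.
  apply: (le_trans step); apply: (le_trans Iz).
  apply: (@le_trans _ _ (CS * (K1 * mu k `^ (th / (l - 1)) + K2 * k * mu k `^ l^-1) * mu k `^ p^-1)).
    apply: ler_wpM2r; first exact: powR_ge0.
    by apply: (le_trans HX); rewrite ler_pM2l.
  have pinv : p^-1 = 1 - ls^-1 by rewrite /p invrK.
  have [m00|mp] := eqVneq (mu k) 0.
    by rewrite m00 !(powR0 (x := p^-1)) ?invr_eq0 ?gt_eqF// mulr0 mulr_ge0 ?powR_ge0// mulr_ge0// mulr_ge0// ltW.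
  have mp' : 0 < mu k <= 1 by rewrite m1 andbT lt_neqAle eq_sym mp mu0.
  have f1 : mu k `^ (th / (l - 1)) * mu k `^ p^-1 <= mu k `^ (1 + del).
    rewrite -powRD ?mp ?implybT//; apply: ger_powR => //.
    have : del <= d1 by rewrite ge_min lexx.
    by rewrite pinv /d1; lra.
  have f2 : mu k `^ l^-1 * mu k `^ p^-1 <= mu k `^ (1 + del).
    rewrite -powRD ?mp ?implybT//; apply: ger_powR => //.
    have : del <= d2 by rewrite ge_min lexx orbT.
    by rewrite pinv lsi /d2; move: (del) (n.+1%:R^-1 : R) => dl dd hd; lra.
  have k2 : k <= 2 * k0 by rewrite mulr_natl mulr2n (le_trans (ltW kh)).
  have k21 : 1 <= 2 * k0 := le_trans k1 k2.
  have g1 : K1 * (mu k `^ (th / (l - 1)) * mu k `^ p^-1) <= K1 * (2 * k0 * mu k `^ (1 + del)).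
    apply: ler_wpM2l => //; apply: (le_trans f1); rewrite ler_peMl ?powR_ge0//.
  have g2 : K2 * (k * (mu k `^ l^-1 * mu k `^ p^-1)) <= K2 * (2 * k0 * mu k `^ (1 + del)).
    by apply: ler_wpM2l => //; apply: ler_pM; rewrite ?mulr_ge0 ?powR_ge0.
  have -> : CS * (K1 * mu k `^ (th / (l - 1)) + K2 * k * mu k `^ l^-1) * mu k `^ p^-1 =
     CS * (K1 * (mu k `^ (th / (l - 1)) * mu k `^ p^-1) + K2 * (k * (mu k `^ l^-1 * mu k `^ p^-1))) by ring.
  apply: (@le_trans _ _ (CS * (K1 * (2 * k0 * mu k `^ (1 + del)) + K2 * (2 * k0 * mu k `^ (1 + del))))).
    by rewrite ler_pM2l//; exact: lerD.
  rewrite (_ : CS * _ = CS * (K1 + K2) * (2 * k0) * mu k `^ (1 + del)); last by ring.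
  apply: ler_wpM2r; first exact: powR_ge0.
  apply: ler_wpM2r; first by rewrite (le_trans ler01).
  by rewrite /KK -mulrA ler_peMl ?mulr_ge0 ?addr_ge0 ?ler1n// ltW.
- have [_ _ m3] := small k0 (lexx _).
  have m4 : mu k0 `^ del <= (2 * KK * cd + 1)^-1.
    have := @ge0_ler_powR _ del (ltW del0) _ _ _ _ m3; rewrite !nnegrE => /(_ (mu0 _) (ltW s20)) /le_trans; apply.
    by rewrite /s2 -powRrM mulVf ?gt_eqF// powRr1// invr_ge0 ltW.
  rewrite -/cd (_ : KK * (2 * k0) * cd = k0 * (2 * KK * cd)); last by ring.
  rewrite -(mulrA k0) ler_piMr ?(ltW kp)//.
  apply: (@le_trans _ _ (2 * KK * cd * (2 * KK * cd + 1)^-1)).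
    by apply: ler_wpM2l.
  by rewrite ler_pdivrMr// mul1r lerDl.
Qed.

End boundedness.

(** * Positivity of supersolutions *)

Section paraboloid.
Context {R : realType} {n : nat}.
Implicit Types (x z : 'rV[R]_n).

Definition sqdist z x : R := dotv (x - z) (x - z).

Lemma sqdistE z x : sqdist z x = enorm (x - z) ^+ 2.
Proof. by rewrite enorm_sqr. Qed.

Lemma sqdist_sum z x : sqdist z x = \sum_i (x ord0 i - z ord0 i) * (x ord0 i - z ord0 i).
Proof. by apply: eq_bigr => i _; rewrite !mxE. Qed.

Lemma Ck_sqdist k z : Ck k (sqdist z).
Proof.
rewrite (_ : sqdist z = fun x => \sum_i (x ord0 i - z ord0 i) * (x ord0 i - z ord0 i)); last first.
  by apply/funext => x; exact: sqdist_sum.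
apply: Ck_sum => i; have C : Ck k (fun x : 'rV[R]_n => x ord0 i - z ord0 i).
  by apply: Ck_B; [exact: Ck_coord|exact: Ck_cst].
exact: Ck_M.
Qed.

Lemma is_derive_sqdist z x i : is_derive x (delta_mx ord0 i) (sqdist z) (2 * (x ord0 i - z ord0 i)).
Proof.
apply/is_derive_line0.
have E : (fun t : R => sqdist z (x + t *: delta_mx ord0 i)) =
    fun t : R => sqdist z x + (2 * (x ord0 i - z ord0 i)) * t + t * t.
  apply/funext => t; rewrite /sqdist addrAC.
  have <- : dotv (x - z) (delta_mx ord0 i) = x ord0 i - z ord0 i.
    rewrite /dotv (bigD1 i)//= big1 ?addr0; last by move=> j ji; rewrite !mxE (negPf ji) andbF mulr0.
    by rewrite !mxE !eqxx mulr1.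
  move: (x - z) => y; rewrite dotvDl (dotvDr _ _ y) (dotvDr _ _ (t *: _)) !dotvZl !dotvZr (dotvC (delta_mx _ _) y).
  have -> : dotv (delta_mx ord0 i) (delta_mx ord0 i : 'rV[R]_n) = 1.
    rewrite /dotv (bigD1 i)//= big1 ?addr0; last by move=> j ji; rewrite !mxE (negPf ji) andbF mulr0.
    by rewrite !mxE !eqxx mulr1.
  by ring.
rewrite E; set b := 2 * _.
have d1 : is_derive (0 : R) 1 (fun t : R => sqdist z x + b * t) b.
  rewrite -[X in is_derive _ _ _ X]add0r; apply: is_deriveD.
  rewrite -[X in is_derive _ _ _ X]mulr1; exact: is_deriveZ.
have d2 : is_derive (0 : R) 1 (fun t : R => t * t) 0.
  have := @is_deriveM _ _ id id (0 : R) 1 1 1 (is_derive_id _ _) (is_derive_id _ _).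
  by rewrite !scale0r addr0.
rewrite -[X in is_derive _ _ _ X]addr0; exact: is_deriveD.
Qed.

Lemma grad_sqdist z x : grad (sqdist z) x = 2 *: (x - z).
Proof.
by apply/rowP => i; rewrite !mxE /partial (@derive_val _ _ _ _ _ _ _ (is_derive_sqdist z x i)).
Qed.

Definition eball z (r : R) := [set x | enorm (x - z) <= r].

Lemma eball_sqdist z r : 0 <= r -> eball z r = [set x | sqdist z x <= r ^+ 2].
Proof.
move=> r0; apply/seteqP; split=> x /=; rewrite sqdistE.
  by move=> h; rewrite lerXn2r// nnegrE ?enorm_ge0.
by rewrite ler_sqr ?nnegrE ?enorm_ge0.
Qed.

Lemma norm_le_enorm x : `|x| <= enorm x.
Proof.
rewrite [leLHS]mx_normrE; apply/bigmax_leP; split=> [|[i j] _]; first exact: enorm_ge0.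
by rewrite [i]ord1; exact: coord_le_enorm.
Qed.

Lemma compact_eball z r : compact (eball z r).
Proof.
have [r0|r0] := leP 0 r; last first.
  rewrite (_ : eball z r = set0); first exact: compact0.
  by apply/seteqP; split=> x //= h; have := le_lt_trans h r0; rewrite ltNge enorm_ge0.
apply: bounded_closed_compact.
  exists (r + `|z|); split; first exact: num_real.
  move=> M rM x xz; apply: le_trans (ltW rM).
  rewrite -[x](subrK z); apply: (le_trans (ler_normD _ _)); rewrite lerD2r.
  exact: le_trans (norm_le_enorm _) xz.
rewrite eball_sqdist//; apply: (@preimage_closed _ _ (sqdist z) [set t | t <= r ^+ 2]).
  by move=> x _; exact: (Ck_continuous (Ck_sqdist 0 z)).
exact: closed_le.
Qed.

End paraboloid.

Lemma integral_sections d1 d2 (T1 : measurableType d1) (T2 : measurableType d2) (R : realType)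
    (m1 : {sigma_finite_measure set T1 -> \bar R}) (m2 : {sigma_finite_measure set T2 -> \bar R})
    (E : set (T1 * T2)) : measurable E ->
  (\int[m1]_x m2 (xsection E x) = \int[m2]_y m1 (ysection E y))%E.
Proof.
move=> mE; have := indic_fubini_tonelli m1 m2 mE.
by rewrite indic_fubini_tonelli_FE// indic_fubini_tonelli_GE.
Qed.

(** The measure of E computed in two ways: its x-sections, integrated over S, are bounded below, and
    its y-sections, nonempty over D only, are bounded above. *)
Lemma sections_averaging d (T : measurableType d) (R : realType)
    (mu : {sigma_finite_measure set T -> \bar R}) (E : set (T * T)) (D S : set T) (a b : R) :
  measurable E -> measurable D -> measurable S -> 0 <= a -> 0 <= b ->
  (forall x, S x -> (a%:E <= mu (xsection E x))%E) ->
  (forall y, D y -> (mu (ysection E y) <= b%:E)%E) ->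
  (forall y, ~ D y -> ysection E y = set0) ->
  (a%:E * mu S <= b%:E * mu D)%E.
Proof.
move=> mE mD mS a0 b0 HS HD HD'.
apply: (@le_trans _ _ (\int[mu]_x mu (xsection E x))%E).
  rewrite -(setIT S) -integral_indic// -ge0_integralZl//; last exact/measurable_EFinP.
  apply: ge0_le_integral => //.
  - by move=> x _; rewrite mule_ge0// lee_fin.
  - by apply/measurable_EFinP; apply: measurable_funM.
  - exact: measurable_fun_xsection.
  - move=> x _ /=; rewrite indicE; have [xS|xS] := boolP (x \in S); last by rewrite mule0.
    by rewrite mule1; exact: HS (set_mem xS).
rewrite (integral_sections _ _ mE) -(setIT D) -integral_indic// -ge0_integralZl//; last exact/measurable_EFinP.
apply: ge0_le_integral => //.
- exact: measurable_fun_ysection.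
- by apply/measurable_EFinP; apply: measurable_funM.
- move=> y _ /=; rewrite indicE; have [yD|yD] := boolP (y \in D).
    by rewrite mule1; exact: HD (set_mem yD).
  by rewrite HD' ?measure0 ?mule0// => Dy; move: yD; rewrite (mem_set Dy).
Qed.

(** * De Giorgi's method for supersolutions *)

Section cap.
Context {R : realType} {n : nat} (Om : set 'rV[R]_n.+1) (l m : R) (phi : R -> R).
Hypothesis adm : admissible l m phi.
Hypothesis dom : open Om /\ bounded_set Om.
Local Notation h := (hphi phi).
Local Notation P := (NPhi phi).
Local Notation leb := (@lebesgue_rv R n.+1).
Local Notation W0 := (W0 Om phi).
Local Notation A := (Afield phi).
Implicit Types (w v : 'rV[R]_n.+1 -> R) (G H : 'rV[R]_n.+1 -> 'rV[R]_n.+1).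

Let oO : open Om. Proof. by case: dom. Qed.
Let bO : bounded_set Om. Proof. by case: dom. Qed.
Let mO : measurable Om. Proof. exact: open_rv_measurable. Qed.

Definition supersolution w G := [/\ W0 w G, aeD leb Om (fun x => 0 <= w x) &
  forall psi H, W0 psi H -> aeD leb Om (fun x => 0 <= psi x) ->
    0 <= I leb Om (fun x => dotv (A (G x)) (H x))].

Lemma ws_supersolution w G f : ws Om phi w G f -> aeD leb Om (fun x => 0 <= f x) -> supersolution w G.
Proof.
move=> E f0; have w0 := ws_ge0 adm dom ord0 E f0; case: E => W E; split=> // psi H Wp p0.
have [_ L ->] := E _ _ Wp; apply: (I_ge0_ae mO L).
by apply: aeDS2 f0 p0 => x _ a b; exact: mulr_ge0.
Qed.

Lemma meas_lt w v : measurable_fun Om w -> measurable_fun Om v ->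
  measurable_fun Om (fun x => (w x < v x)%R%:R : R).
Proof. by move=> mw mv; apply: measurableT_comp => //; exact: measurable_fun_ltr. Qed.

Lemma L1_bool (c : 'rV[R]_n.+1 -> bool) : measurable_fun Om (fun x => (c x)%:R : R) ->
  L1 leb Om (fun x => (c x)%:R : R).
Proof. by move=> mc; have [] := meas_bool_restrict dom mc. Qed.

Lemma L1_boolM (c : 'rV[R]_n.+1 -> bool) f : measurable_fun Om (fun x => (c x)%:R : R) ->
  L1 leb Om f -> L1 leb Om (fun x => (c x)%:R * f x).
Proof.
move=> mc Lf; apply: (L1_le mO (measurable_funM mc (L1_meas Lf)) (L1_norm Lf)) => x _.
by rewrite normrM ler_piMl// ger0_norm// lern1 leq_b1.
Qed.

(* Testing with (v - k - w)^+ only, a supersolution lies in a De Giorgi class with exponent 1. *)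
Lemma super_degiorgi w G v k tau (K : set 'rV[R]_n.+1) : supersolution w G ->
  smooth v -> compact K -> K `<=` Om -> (forall x, ~ K x -> v x <= k) -> 0 < tau ->
  (forall x, K x -> enorm (grad v x) <= tau) ->
  let c x := (w x < v x - k)%R in
  L1 leb Om (fun x => (c x)%:R : R) /\
  exists z Z, [/\ W0 z Z, aeD leb Om (fun x => 0 <= z x /\ (c x -> z x = v x - k - w x)) &
   I leb Om (fun x => enorm (Z x)) <= 5 * tau * I leb Om (fun x => (c x)%:R)].
Proof.
move=> [W w0 sup] sv cK KO vk tau0 tK c.
have Wv := W0_trunc_smooth adm dom sv cK KO vk.
have Wd := W0B adm dom Wv W.
have Wz := W0_trunc adm dom (lexx 0) Wd.
set d := fun x => _ - w x in Wd Wz; set Q := fun x => _ - G x in Wd Wz.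
set z := fun x => Num.max _ 0 in Wz; set Z := fun x => _ *: _ in Wz.
have mv : measurable_fun Om v.
  by apply: continuous_rv_measurable; apply: (Ck_continuous (k := 0%N)); exact: (smoothP _).1.
have mw := W0_meas W.
have mc : measurable_fun Om (fun x => (c x)%:R : R).
  by apply: meas_lt => //; apply: measurable_funB => //; exact: measurable_cst.
have Lc := L1_bool mc.
have cd : aeD leb Om (fun x => c x = (0 < d x)%R /\ (c x -> K x)).
  apply: aeDS w0 => x _ w0; split.
    rewrite /c /d subr_gt0 lt_max; case: (ltP (w x) (v x - k)) => //= _.
    by apply/esym/negbTE; rewrite -leNgt.
  move=> cx; apply: contrapT => nK; move: cx; rewrite /c ltNge (le_trans _ w0)//.
  by rewrite subr_le0; exact: vk.
split=> //; exists z, Z; split=> //.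
  apply: aeDS2 cd w0 => x _ [cd _] w0; split; first by rewrite /z le_max lexx orbT.
  move=> cx; have := cx; rewrite cd => dx; rewrite /z subr0 (max_idPl (ltW dx)) /d.
  rewrite (max_idPl _)//; rewrite /c in cx; exact: le_trans w0 (ltW cx).
have LG := W0_L1G adm dom W; have mG := W0_vmeas W; have mE := vmeas_enorm mG.
have [_ LE] := W0_L1 adm dom W; have [_ LZ] := W0_L1 adm dom Wz.
have LhG : L1 leb Om (fun x => h (enorm (G x)) * enorm (G x)).
  by apply: (L1_hphi adm dom mE mE _ _ LG LG) => x; exact: enorm_ge0.
have LchG := L1_boolM mc LhG.
have h2 : 0 < h (2 * tau) by rewrite (hphi_gt0 adm)// mulr_gt0.
set mu := I leb Om (fun x => (c x)%:R).
have E1 : I leb Om (fun x => (c x)%:R * (h (enorm (G x)) * enorm (G x))) <= 2 * tau * h (2 * tau) * mu.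
  have z0 : aeD leb Om (fun x => 0 <= z x) by apply: aeDT => x _; rewrite /z le_max lexx orbT.
  have S := sup _ _ Wz z0; have LA := W0_LA adm dom W Wz.
  have L2 := L1D mO (L1Z mO (- 2^-1) LchG) (L1Z mO (tau * h (2 * tau)) Lc).
  have : I leb Om (fun x => dotv (A (G x)) (Z x)) <=
     I leb Om (fun x => - 2^-1 * ((c x)%:R * (h (enorm (G x)) * enorm (G x))) + tau * h (2 * tau) * (c x)%:R).
    apply: (I_le_ae mO LA L2); apply: aeDS2 cd w0 => x _ [cd cK'] w0.
    rewrite /Z dotvZr -cd; case cx : (c x); last by rewrite !mul0r !mulr0 addr0.
    have Kx := cK' cx; rewrite !mul1r mulr1 /Q.
    have -> : (k < v x)%R.
      by rewrite -subr_gt0; move: cx; rewrite /c; exact: le_lt_trans.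
    rewrite scale1r dotvBr (Afield_self phi (G x)).
    have b1 : dotv (A (G x)) (grad v x) <= h (enorm (G x)) * tau.
      apply: (le_trans (ler_norm _)); apply: (le_trans (Afield_bound adm _ _)).
      by apply: ler_wpM2l; [rewrite (hphi_ge0 adm)// enorm_ge0|exact: tK].
    (* Either |G| <= 2 tau, and h is monotone, or tau < |G| / 2, and half of the term h|G| |G|
       absorbs it. *)
    have b2 : h (enorm (G x)) * tau <= 2^-1 * (h (enorm (G x)) * enorm (G x)) + tau * h (2 * tau).
      have s0 := enorm_ge0 (G x); have hs0 := hphi_ge0 adm s0.
      have [st|ts] := leP (enorm (G x)) (2 * tau).
        have := hphi_le adm st => hh.
        have : 0 <= 2^-1 * (h (enorm (G x)) * enorm (G x)) by rewrite mulr_ge0// mulr_ge0.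
        by have := ler_wpM2l (ltW tau0) hh; move: (h (enorm _)) (2^-1 * _) (h (2 * _)) => p q r; lra.
      have : h (enorm (G x)) * tau <= h (enorm (G x)) * (2^-1 * enorm (G x)).
        by apply: ler_wpM2l => //; move: ts; lra.
      have : 0 <= tau * h (2 * tau) by rewrite mulr_ge0// ltW.
      by move=> a b; apply: (le_trans b); rewrite mulrCA lerDl.
    by move: b1 b2; rewrite (mulrC (enorm (G x))); move: (dotv _ _) (h _ * tau) (h _ * enorm _) (tau * h _) => p q r s; lra.
  rewrite (I_D mO (L1Z mO _ LchG) (L1Z mO _ Lc)) (I_Z mO _ LchG) (I_Z mO _ Lc) -/mu => H1.
  have := le_trans S H1; move: (I leb Om _) => e.
  have -> : 2 * tau * h (2 * tau) * mu = 2 * (tau * h (2 * tau) * mu) by ring.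
  by move: (tau * h _ * mu) => f; lra.
(* Where |G| > 2 tau one has |G| <= h|G| |G| / h(2 tau), so h(2 tau) cancels against the bound [E1].
   The constant 5 = 1 + 2 + 2 collects the gradient of v, the part |G| <= 2 tau and this last
   part. *)
have Lt := L1D mO (L1Z mO (3 * tau) Lc) (L1Z mO (h (2 * tau))^-1 LchG).
apply: (@le_trans _ _ (I leb Om (fun x => 3 * tau * (c x)%:R + (h (2 * tau))^-1 * ((c x)%:R * (h (enorm (G x)) * enorm (G x)))))).
  apply: (I_le_ae mO LZ Lt); apply: aeDS cd => x _ [cd cK'].
  rewrite /Z -cd; case cx : (c x); last by rewrite scale0r enorm0 mulr0 mul0r mulr0 addr0.
  have Kx := cK' cx; rewrite scale1r mulr1 mul1r /Q.
  apply: (le_trans (enormB _ _)).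
  have b1 : enorm ((k < v x)%R%:R *: grad v x) <= tau.
    by case: ltP => _; rewrite ?scale1r ?scale0r ?enorm0 ?(ltW tau0)//; exact: tK.
  have s0 := enorm_ge0 (G x); have hs0 := hphi_ge0 adm s0.
  have b2 : enorm (G x) <= 2 * tau + (h (2 * tau))^-1 * (h (enorm (G x)) * enorm (G x)).
    have [st|ts] := leP (enorm (G x)) (2 * tau).
      by apply: (le_trans st); rewrite lerDl; apply: mulr_ge0; [rewrite invr_ge0 ltW|exact: mulr_ge0].
    rewrite mulrA ler_wpDl ?mulr_ge0 ?(ltW tau0)// ler_peMl// mulrC ler_pdivlMr// mul1r.
    exact: (hphi_le adm (ltW ts)).
  by move: b1 b2; move: (enorm _) (enorm _) (_^-1 * _) => p q r; lra.
rewrite (I_D mO (L1Z mO _ Lc) (L1Z mO _ LchG)) (I_Z mO _ LchG) (I_Z mO _ Lc) -/mu.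
have : (h (2 * tau))^-1 * I leb Om (fun x => (c x)%:R * (h (enorm (G x)) * enorm (G x))) <= 2 * tau * mu.
  by rewrite mulrC ler_pdivrMr// mulrAC.
by move: (_^-1 * _) => e; lra.
Qed.

(** The factor in the smallness condition of [stampacchia] for del = 1/(n+1). *)
Definition cap_const : R := 2 / 2^-1 `^ (n.+1%:R^-1)^-1.

Lemma cap_const_gt0 : 0 < cap_const.
Proof. by rewrite divr_gt0// powR_gt0. Qed.

Lemma meas_ball_lt w x0 r c0 : 0 < r -> measurable_fun Om w ->
  measurable_fun Om (fun x => ((enorm (x - x0) <= r) && (w x < c0))%R%:R : R).
Proof.
move=> r0 mw; rewrite (_ : (fun x => _) = fun x => (enorm (x - x0) <= r)%R%:R * (w x < c0)%R%:R); last first.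
  by apply/funext => x; rewrite -natrM mulnb.
apply: measurable_funM; last by apply: meas_lt => //; exact: measurable_cst.
have -> : (fun x => (enorm (x - x0) <= r)%R%:R : R) = fun x => (sqdist x0 x <= r ^+ 2)%R%:R.
  by apply/funext => x; rewrite sqdistE ler_sqr ?nnegrE ?enorm_ge0 ?(ltW r0).
apply: measurableT_comp => //; apply: measurable_fun_ler; last exact: measurable_cst.
apply: continuous_rv_measurable; exact: (Ck_continuous (Ck_sqdist 0 x0)).
Qed.

(** The test paraboloid c0 (1 - |x - x0|^2 / r^2) has gradient at most tau = 2 c0 / r in the ball.
    [super_degiorgi] and the isoperimetric inequality give the decay that [stampacchia] asks for,
    with d = c0 / 2, so w >= v - c0 / 2; on the half ball v >= 3 c0 / 4. The number 20 solves 5 tau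
    cap_const (r / (20 cap_const)) = c0 / 2. *)
Lemma cap_lemma w G x0 r c0 : supersolution w G -> 0 < r -> 0 < c0 -> eball x0 r `<=` Om ->
  I leb Om (fun x => ((enorm (x - x0) <= r) && (w x < c0))%R%:R) <= (r / (20 * cap_const)) ^+ n.+1 ->
  aeD leb Om (fun x => enorm (x - x0) <= r / 2 -> c0 / 4 <= w x).
Proof.
move=> sup r0 c00 BO small.
have [W w0 _] := sup; have mw := W0_meas W; have K0 := cap_const_gt0.
have r2 : 0 < r ^+ 2 by rewrite exprn_gt0.
pose v x : R := c0 * (1 - sqdist x0 x / r ^+ 2).
pose tau := 2 * c0 / r; have tau0 : 0 < tau by rewrite divr_gt0// mulr_gt0.
have Cv k : Ck k v.
  apply: Ck_Z; apply: Ck_B; first exact: Ck_cst.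
  by apply: Ck_M; [exact: Ck_sqdist|exact: Ck_cst].
have sv : smooth v by apply/smoothP.
have mv : measurable_fun Om v by apply: continuous_rv_measurable; exact: (Ck_continuous (Cv 0%N)).
have vK x : ~ eball x0 r x -> v x <= 0.
  rewrite (eball_sqdist _ (ltW r0)) => /negP; rewrite -ltNge => h.
  by rewrite /v pmulr_rle0// subr_le0 ler_pdivlMr// mul1r ltW.
have vc x : v x <= c0.
  rewrite /v ler_piMr ?(ltW c00)// gerBl divr_ge0 ?(ltW r2)// dotv_ge0//.
have gv x : eball x0 r x -> enorm (grad v x) <= tau.
  move=> xr; have -> : grad v x = (- (2 * c0 / r ^+ 2)) *: (x - x0).
    rewrite /v (_ : (fun x => _) = fun x => c0 + (- (c0 / r ^+ 2)) * sqdist x0 x); last first.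
      by apply/funext => y; field; rewrite gt_eqF.
    rewrite gradD ?gradZ; [|exact: Ck_sqdist|exact: Ck_cst|by apply: Ck_Z; exact: Ck_sqdist].
    have -> : grad (fun=> c0) x = 0 by apply/rowP => i; rewrite !mxE partial_cst.
    by rewrite add0r grad_sqdist scalerA; congr (_ *: _); field; rewrite gt_eqF.
  rewrite enormZ normrN ger0_norm; last by rewrite divr_ge0 ?(ltW r2)// mulr_ge0// ltW.
  have -> : tau = 2 * c0 / r ^+ 2 * r by rewrite /tau; field; rewrite gt_eqF.
  by rewrite ler_wpM2l// divr_ge0 ?(ltW r2)// mulr_ge0// ltW.
pose mu k := I leb Om (fun x => (w x < v x - k)%R%:R).
have D k (k0 : 0 <= k) : _ := super_degiorgi sup sv (@compact_eball _ _ x0 r) BO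
  (fun x nx => le_trans (vK x nx) k0) tau0 gv.
have mb k : measurable_fun Om (fun x => (w x < v x - k)%R%:R : R).
  by apply: meas_lt => //; apply: measurable_funB => //; exact: measurable_cst.
have mu0 k : 0 <= mu k by apply: I_ge0.
have mono k j : k <= j -> mu j <= mu k.
  move=> kj; apply: (I_le mO (L1_bool (mb j)) (L1_bool (mb k))) => x _.
  have [wj|_] := ltP (w x) (v x - j); last exact: ler0n.
  by rewrite (_ : w x < v x - k)//; move: wj kj; lra.
have step k j : 0 <= k -> k < j -> (j - k) * mu j <= 5 * tau * mu k `^ (1 + n.+1%:R^-1).
  move=> k0 kj; have [Lc [z [Z [Wz zc EZ]]]] := D k k0.
  have iso := W0_isoperimetric adm dom Wz (mb k).
  have [Lz _] := W0_L1 adm dom Wz.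
  rewrite powRD; last by rewrite gt_eqF ?implybT.
  rewrite powRr1// (_ : 5 * tau * _ = mu k `^ n.+1%:R^-1 * (5 * tau * mu k)); last ring.
  apply: le_trans (_ : I leb Om (fun x => (w x < v x - k)%R%:R * `|z x|) <= _); last first.
    by apply: (le_trans iso); apply: ler_wpM2l; [exact: powR_ge0|exact: EZ].
  rewrite -(I_Z mO _ (L1_bool (mb j))).
  apply: (I_le_ae mO (L1Z mO _ (L1_bool (mb j))) (L1_boolM (mb k) (L1_norm Lz))).
  apply: aeDS zc => x _ [z0 zE]; have [wj|_] := ltP (w x) (v x - j); last first.
    by rewrite mulr0 mulr_ge0.
  have wk : w x < v x - k by move: kj wj; lra.
  by rewrite wk mulr1 mul1r (zE wk) ger0_norm; move: kj wj; lra.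
have m0 : mu 0 <= (r / (20 * cap_const)) ^+ n.+1.
  apply: le_trans small.
  have mB : measurable_fun Om (fun x => ((enorm (x - x0) <= r) && (w x < c0))%R%:R : R).
    exact: meas_ball_lt.
  apply: (I_le_ae mO (L1_bool (mb 0)) (L1_bool mB)); apply: aeDS w0 => x _ w0.
  rewrite ler_nat subr0; case: ltP => // wv.
  have -> : enorm (x - x0) <= r.
    by apply: contrapT => /vK v0; move: (le_lt_trans w0 (lt_le_trans wv v0)); rewrite ltxx.
  by rewrite (lt_le_trans wv (vc x)).
have c2 : 0 < c0 / 2 by rewrite divr_gt0.
have N0 : 0 < n.+1%:R^-1 :> R by rewrite invr_gt0.
have S : mu (0 + c0 / 2) = 0.
  apply: (@stampacchia _ mu 0 (c0 / 2) (5 * tau) n.+1%:R^-1) => //.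
    by rewrite mulr_ge0// ltW.
    by move=> k j k0 kj _; exact: step.
  rewrite -/cap_const.
  have : mu 0 `^ n.+1%:R^-1 <= r / (20 * cap_const).
    have rK0 : 0 <= r / (20 * cap_const) by rewrite divr_ge0 ?mulr_ge0 ?ltW.
    have := ge0_ler_powR (ltW N0) _ _ m0; rewrite !nnegrE => /(_ (mu0 0) (exprn_ge0 _ rK0)).
    by rewrite -powR_mulrn// -powRrM divff ?powRr1.
  move=> H; have : 5 * tau * cap_const * mu 0 `^ n.+1%:R^-1 <= 5 * tau * cap_const * (r / (20 * cap_const)).
    apply: ler_wpM2l => //; apply: mulr_ge0; last exact: ltW.
    by apply: mulr_ge0 => //; exact: ltW.
  move/le_trans; apply; apply: eq_ler; rewrite /tau; field.
  by rewrite !gt_eqF.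
have Z := I_eq0 mO (L1_bool (mb (c0 / 2))) (aeDT _ (fun x _ => ler0n _ _)) _.
move: S; rewrite add0r => /eq_ler/Z; apply: aeDS => x _ /eqP; rewrite pnatr_eq0 eqb0 -leNgt.
move=> wv xr; apply: le_trans wv; rewrite /v.
have : sqdist x0 x / r ^+ 2 <= 4^-1.
  rewrite ler_pdivrMr// sqdistE; have -> : 4^-1 * r ^+ 2 = (r / 2) ^+ 2 by field.
  by rewrite ler_sqr ?nnegrE ?enorm_ge0// divr_ge0// ltW.
by move=> h; have := ler_wpM2l (ltW c00) h; lra.
Qed.

Lemma compact_margin (K U : set 'rV[R]_n.+1) : compact K -> open U -> K `<=` U ->
  exists2 r : R, 0 < r & forall x y, K x -> enorm (y - x) <= r -> U y.
Proof.
move=> cK oU KU.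
have H := (compact_near_coveringP K).1 cK R (0^'+) (fun r x => forall y, enorm (y - x) <= r -> U y) _.
have : \forall r \near (0 : R)^'+, K `<=` [set x | forall y, enorm (y - x) <= r -> U y].
  apply: H => x Kx; have /nbhs_ballP[e /= e0 eU] : nbhs x U by apply: open_nbhs_nbhs; split => //; exact: KU.
  have e2 : 0 < e / 2 by rewrite divr_gt0.
  exists (ball x (e / 2), [set r | r < e / 2]) => /=.
    by split; [exact: nbhsx_ballx|exact: nbhs_right_lt].
  move=> [y r] /= [xy re] z zy; apply: eU; rewrite (splitr e); apply: (@ball_triangle _ _ y) => //.
  rewrite -ball_normE /= distrC; apply: le_lt_trans re; apply: le_trans zy; exact: norm_le_enorm.
move=> N; have := nbhs_right_gt (0 : R) => P0.
have [r [r0 Hr]] := @filter_ex _ _ _ _ (filterI P0 N).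
by exists r => // x y Kx; exact: Hr.
Qed.

(** Counts the pairs of points of S and D at distance at most r in two ways. It is used by
    contraposition, to find a point of S near which D is sparse. *)
Lemma averaging (D S : set 'rV[R]_n.+1) (r e : R) : measurable D -> measurable S -> 0 <= e -> 0 < r ->
  (forall x, S x -> (e%:E <= leb [set y | D y /\ (enorm (y - x) <= r)%R])%E) ->
  (e%:E * leb S <= ((2 * r) ^+ n.+1)%:E * leb D)%E.
Proof.
move=> mD mS e0 r0 H.
pose E := [set p : 'rV[R]_n.+1 * 'rV[R]_n.+1 | S p.1 /\ D p.2 /\ enorm (p.2 - p.1) <= r].
have mE : measurable E.
  rewrite (_ : E = (S `*` D) `&` [set p : 'rV[R]_n.+1 * 'rV[R]_n.+1 | \sum_i (p.2 ord0 i - p.1 ord0 i) * (p.2 ord0 i - p.1 ord0 i) <= r ^+ 2]); last first.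
    apply/seteqP; split=> -[x y] /= [].
      by move=> Sx [Dy xy]; split=> //; rewrite -sqdist_sum sqdistE ler_sqr ?nnegrE ?enorm_ge0 ?(ltW r0).
    by move=> [Sx Dy]; rewrite -sqdist_sum sqdistE ler_sqr ?nnegrE ?enorm_ge0 ?(ltW r0).
  apply: measurableI; first exact: measurableX.
  rewrite -[X in measurable X]setTI; apply: (measurable_fun_le measurableT); last exact: measurable_cst.
  apply: measurable_sum => i; apply: measurable_funM; apply: measurable_funB;
    by apply: (measurableT_comp (@measurable_rv_coord R n.+1 i)).
apply: (sections_averaging mE) => //; first by rewrite exprn_ge0// mulr_ge0// ltW.
  move=> x Sx; have := H x Sx; rewrite (_ : [set y | _] = xsection E x)//.
  apply/seteqP; split=> y /=; rewrite /xsection/= inE /E /=; first by move=> [? ?].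
  by case=> _ [].
  move=> y Dy.
(* The ball about y is enclosed in a cube of side 2 r, whose measure is explicit. *)
pose A i : set (measurableTypeR R) := [set` `[y ord0 i - r, y ord0 i + r]].
have mA i : measurable (A i) by exact: measurable_itv.
have mB := measurable_rv_box mA.
apply: (@le_trans _ _ (leb [set x : 'rV[R]_n.+1 | forall i, A i (x ord0 i)])).
  apply: le_measure; [by rewrite inE; exact: measurable_ysection|by rewrite inE|].
  move=> x; rewrite /ysection/= inE /E/= => -[_ [_ xy]] i.
  rewrite /A /= in_itv/=; have := le_trans (coord_le_enorm (y - x) i) xy.
  by rewrite !mxE ler_norml => /andP[a b]; apply/andP; split; move: a b; lra.
rewrite lebesgue_rv_box//= (eq_bigr (fun=> (2 * r)%:E)); last first.
  move=> i _; rewrite lebesgue_measure_itv/= lte_fin ifT; last lra.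
  by rewrite -EFinB; congr (_%:E); ring.
by rewrite prodEFin prodr_const card_ord.
  move=> y nD; apply/seteqP; split=> x //=; rewrite /ysection/= inE /E/=; tauto.
Qed.

Lemma I_bool_measure (c : 'rV[R]_n.+1 -> bool) : measurable_fun Om (fun x => (c x)%:R : R) ->
  measurable [set x | Om x /\ c x] /\
  (I leb Om (fun x => (c x)%:R))%:E = leb [set x | Om x /\ c x].
Proof.
move=> mc; have mS : measurable [set x | Om x /\ c x].
  rewrite (_ : [set x | _] = Om `&` (fun x => (c x)%:R : R) @^-1` [set 1]); first exact: mc.
  apply/seteqP; split=> x /= [Ox]; first by move=> ->.
  by case: (c x) => // /eqP; rewrite eq_sym oner_eq0.
split=> //; rewrite -(EFin_I mO (L1_bool mc)) -[X in leb X]setIT -integral_indic// integral_mkcond.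
apply: eq_integral => x _; rewrite patchE indicE.
have [Ox|nOx] := boolP (x \in Om).
  have -> : (x \in [set x | Om x /\ c x]) = c x; last by [].
  by apply/idP/idP => [/set_mem[]//|cx]; apply/mem_set; split => //; exact: set_mem.
have -> // : (x \in [set x | Om x /\ c x]) = false.
by apply/negbTE; apply: contra nOx => /set_mem[Ox _]; exact: mem_set.
Qed.

Lemma W0_test_L1 w G e : W0 w G -> 0 < e -> exists psi, [/\ test_fun Om psi,
  L1 leb Om (fun x => `|w x - psi x|) & I leb Om (fun x => `|w x - psi x|) < e].
Proof.
move=> W e0; have [d d0 Hd] := NPhi_small adm dom ltr01 (ltW (l_gt1 adm)) e0.
have [mw mG /(_ _ d0)[psi [tp Lp Ip]]] := W; exists psi.
have Wd := W0B adm dom W (W0_test phi tp); have [Ld _] := W0_L1 adm dom Wd.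
split=> //; first exact: L1_norm.
have LP := W0_L1u adm dom Wd.
have mn : measurable_fun Om (fun x => `|w x - psi x|) by exact: L1_meas (L1_norm Ld).
have LPn : L1 leb Om (fun x => P `|w x - psi x|).
  by apply: (L1_eq mO _ LP) => x _; rewrite (NPhi_norm adm).
rewrite (_ : I _ _ _ = I leb Om (fun x => `|w x - psi x| `^ 1)); last first.
  by apply: I_eq => x _; rewrite powRr1.
apply: (Hd _ mn _ LPn) => //; apply: le_lt_trans Ip; apply: (I_le mO LPn Lp) => x _.
by rewrite (NPhi_norm adm) /modu lerDl (NPhi_ge0 adm).
Qed.

(** The factor 4 leaves room for the levels c, 2 c and 3 c of [positive_ball]. *)
Lemma ge0_ae0_level w : measurable_fun Om w -> aeD leb Om (fun x => 0 <= w x) ->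
  ~ aeD leb Om (fun x => w x = 0) ->
  exists2 c : R, 0 < c & 0 < I leb Om (fun x => (4 * c < w x)%R%:R).
Proof.
move=> mw w0 nw; apply: contrapT => H; apply: nw.
have A0 k : aeD leb Om (fun x => w x <= 4 * k.+1%:R^-1).
  have mc : measurable_fun Om (fun x => (4 * k.+1%:R^-1 < w x)%R%:R : R).
    by apply: meas_lt => //; exact: measurable_cst.
  have := I_eq0 mO (L1_bool mc) (aeDT _ (fun x _ => ler0n _ _)).
  move=> /(_ _)/wrap[]; last by apply: aeDS => x _ /eqP; rewrite pnatr_eq0 eqb0 -leNgt.
  rewrite leNgt; apply/negP => I0; apply: H; exists k.+1%:R^-1 => //.
apply: aeDS2 w0 (aeD_nat A0) => x _ w0 H0; apply/eqP; rewrite eq_le w0 andbT.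
apply/ler_addgt0Pr => e e0; rewrite add0r.
have e4 : 0 < e / 4 by rewrite divr_gt0.
have [k _ Hk] := near_infty_natSinv_lt (PosNum e4).
have := Hk k (leqnn k) => /= hk; apply: le_trans (H0 k) _; move: hk; move: (_^-1) => t; lra.
Qed.

(** A test function psi close to w in L^1 stands in for w: every point where psi > 3 c is the centre
    of a ball of a fixed radius r on which psi > 2 c, by compactness. On such a ball w < c happens
    only where psi and w differ by more than c, which is rare on average. *)
Lemma positive_ball w G : supersolution w G -> ~ aeD leb Om (fun x => w x = 0) ->
  exists x0 (r c : R), [/\ 0 < r, 0 < c, eball x0 r `<=` Om &
    aeD leb Om (fun x => enorm (x - x0) <= r -> c <= w x)].
Proof.
move=> sup nw; have [W w0 _] := sup; have mw := W0_meas W.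
have [c c0] := ge0_ae0_level mw w0 nw; set s := I _ _ _ => s0.
(* The measure that [cap_lemma] tolerates in a ball of radius 1; for radius r it is eps r^N. *)
pose N := n.+1; pose eps := (1 / (20 * cap_const)) ^+ N; have K0 := cap_const_gt0.
have eps0 : 0 < eps by rewrite exprn_gt0// divr_gt0// mulr_gt0.
have p0 : 0 < 2 ^+ N :> R by rewrite exprn_gt0.
(* If no ball were suitable, (2^N + eps) times the L^1 distance of w and psi would be at least eps c
   s; eta makes that product smaller than half of it. *)
pose eta := eps * s * c / (2 * (2 ^+ N + eps)).
have eta0 : 0 < eta by rewrite divr_gt0 ?mulr_gt0 ?addr_gt0.
have [psi [tp Ld Id]] := W0_test_L1 W eta0.
have cp := Ck_continuous (test_Ck 0 tp); have mp : measurable_fun Om psi := test_meas tp.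
have [sp [K [cK KO Kp]]] := tp.
have c2 : 0 < 2 * c by rewrite mulr_gt0.
have UO : [set x | 2 * c < psi x] `<=` Om.
  by move=> x /= xc; apply: contrapT => /(test_out tp) p00; move: xc; rewrite p00 ltNge ltW.
have cS : compact [set x | 3 * c <= psi x].
  apply: (@subclosed_compact _ _ K) => //.
    by apply: (@preimage_closed _ _ psi [set t | 3 * c <= t]) => [x _|]; [exact: cp|exact: closed_ge].
  move=> x /= xc; apply: contrapT => /Kp p00; move: xc c0; rewrite p00; lra.
have oU : open [set x | 2 * c < psi x].
  by apply: (@open_comp _ _ psi [set t | 2 * c < t]) => [x _|]; [exact: cp|exact: open_gt].
have [|r r0 Hr] := compact_margin cS oU; first by move=> x /=; move: c0; lra.
have mD : measurable_fun Om (fun x => ((w x < c) && (2 * c < psi x))%R%:R : R).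
  rewrite (_ : (fun x => _) = fun x => (w x < c)%R%:R * (2 * c < psi x)%R%:R); last first.
    by apply/funext => x; rewrite -natrM mulnb.
  by apply: measurable_funM; apply: meas_lt => //; exact: measurable_cst.
have mS : measurable_fun Om (fun x => (3 * c < psi x)%R%:R : R) by apply: meas_lt => //; exact: measurable_cst.
have m4 : measurable_fun Om (fun x => (4 * c < w x)%R%:R : R) by apply: meas_lt => //; exact: measurable_cst.
have [mDs ED] := I_bool_measure mD; have [mSs ES] := I_bool_measure mS.
set D := [set x | _] in mDs ED; set S := [set x | _] in mSs ES.
move: ED ES; set iD := I _ _ _; set iS := I _ _ _ => ED ES.
have bD : c * iD <= I leb Om (fun x => `|w x - psi x|).
  rewrite /iD -(I_Z mO _ (L1_bool mD)); apply: (I_le mO (L1Z mO _ (L1_bool mD)) Ld) => x _.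
  case: andP => [[a b]|_]; last by rewrite mulr0.
  by rewrite mulr1 distrC ger0_norm; move: a b c0; lra.
have bS : c * s <= c * iS + I leb Om (fun x => `|w x - psi x|).
  rewrite /iS /s -!I_Z//; try exact: L1_bool.
  rewrite -I_D//; last exact: (L1Z mO _ (L1_bool mS)).
  apply: (I_le mO (L1Z mO _ (L1_bool m4)) (L1D mO (L1Z mO _ (L1_bool mS)) Ld)) => x _.
  have n0 := normr_ge0 (w x - psi x).
  case: (ltP (4 * c)) => a; last by rewrite mulr0 addr_ge0// mulr_ge0// ltW.
  case: (ltP (3 * c)) => b; first by rewrite !mulr1 lerDl.
  by rewrite mulr1 mulr0 add0r ger0_norm; move: a b c0; lra.
(* Otherwise averaging bounds eps times the measure of S by 2^N times that of D. But D is small and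
   S not much smaller than s, because psi approximates w in L^1. *)
have [x [Sx smallx]] : exists x, S x /\ (leb [set y | D y /\ (enorm (y - x) <= r)%R] < (eps * r ^+ N)%:E)%E.
  apply: contrapT => Hn.
  have A0 := @averaging D S r (eps * r ^+ N) mDs mSs (ltW (mulr_gt0 eps0 (exprn_gt0 _ r0))) r0 _.
  have : (forall x, S x -> ((eps * r ^+ N)%:E <= leb [set y | D y /\ (enorm (y - x) <= r)%R])%E).
    by move=> x Sx; rewrite leNgt; apply/negP => h; apply: Hn; exists x.
  move=> /A0; rewrite -ES -ED -!EFinM lee_fin exprMn => H.
  have rN : 0 < r ^+ N by exact: exprn_gt0.
  have : eps * iS <= 2 ^+ N * iD.
    rewrite -(ler_pM2r rN); move: H; rewrite -/N; move: (r ^+ N) (2 ^+ N) => q p; lra.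
  move=> H1; have : eps * (c * s) <= (2 ^+ N + eps) * I leb Om (fun x => `|w x - psi x|).
    apply: (le_trans (ler_wpM2l (ltW eps0) bS)).
    have := ler_wpM2l (ltW p0) bD; have := ler_wpM2r (ltW c0) H1.
    by move: (I _ _ _) (2 ^+ N) => i p; lra.
  have := ltr_pM2l (addr_gt0 p0 eps0); move=> /(_ (I leb Om (fun x => `|w x - psi x|)) eta).
  rewrite Id; have -> : (2 ^+ N + eps) * eta = eps * (c * s) / 2.
    by rewrite /eta; field; rewrite gt_eqF// addr_gt0.
  have : 0 < eps * (c * s) by rewrite !mulr_gt0.
  by move: (_ * I _ _ _) (eps * (c * s)) => i j j0 h1 h2; have := le_lt_trans h2 h1; lra.
have Br : eball x r `<=` [set x | 2 * c < psi x].
  by move=> y; apply: Hr => /=; case: Sx => _ /ltW.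
exists x, (r / 2), (c / 4); split; [by rewrite divr_gt0|by rewrite divr_gt0| |].
  move=> y /= xy; apply: UO; apply: Br; apply: (le_trans xy).
  by rewrite ler_pdivrMr// ler_peMr ?(ltW r0)// ler1n.
have mB : measurable_fun Om (fun y => ((enorm (y - x) <= r) && (w y < c))%R%:R : R).
  exact: meas_ball_lt.
have [_ EB] := I_bool_measure mB.
apply: (cap_lemma sup r0 c0); first exact: subset_trans Br UO.
rewrite -lee_fin EB; apply: ltW; rewrite (_ : (r / _) ^+ _ = eps * r ^+ N); last first.
  by rewrite /eps -exprMn; congr (_ ^+ _); rewrite mul1r mulrC.
rewrite (_ : [set x | _] = [set y | D y /\ enorm (y - x) <= r])//.
apply/seteqP; split=> y /=.
  by move=> [Oy /andP[xy wc]]; split=> //; rewrite /D/=; split => //; rewrite wc; exact: Br.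
by move=> [[Oy /andP[wc _]] xy]; split => //; rewrite xy wc.
Qed.

End cap.

(** * Barriers *)

Lemma is_derive_expRZ {R : realType} (a b s : R) :
  is_derive s 1 (fun t : R => b * expR (a * t)) (a * (b * expR (a * s))).
Proof.
have d1 : is_derive s 1 (fun t : R => a * t) a.
  rewrite -[X in is_derive _ _ _ X]mulr1; exact: is_deriveZ.
have d2 : is_derive s 1 (expR \o (fun t : R => a * t)) (expR (a * s) * a).
  exact: is_derive1_comp.
have -> : a * (b * expR (a * s)) = b *: (expR (a * s) * a) by rewrite /GRing.scale/=; ring.
exact: is_deriveZ.
Qed.

Lemma is_derive_continuous {R : realType} (f : R -> R) (s a : R) :
  is_derive s 1 f a -> {for s, continuous f}.
Proof. by move=> [d _]; apply: differentiable_continuous; apply/derivable1_diffP. Qed.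

Lemma continuous_bounded_on {R : realType} n (Om : set 'rV[R]_n) (f : 'rV[R]_n -> R) :
  bounded_set Om -> continuous f -> exists2 C, 0 <= C & forall x, Om x -> `|f x| <= C.
Proof.
move=> [M [_ HM]] cf.
have cK : compact [set x : 'rV[R]_n | `|x| <= `|M| + 1].
  apply: bounded_closed_compact; first exact: rv_ball_bounded.
  rewrite (_ : mkset _ = (fun x : 'rV[R]_n => `|x|) @^-1` [set y : R | y <= `|M| + 1])//.
  by apply: preimage_closed => [x _|]; [exact: norm_continuous|exact: closed_le].
have /compact_bounded[B [_ HB]] := continuous_compact (continuous_subspaceT cf) cK.
have := HB (`|B| + 1) _; rewrite (le_lt_trans (ler_norm _)) ?ltrDl// => /(_ isT) H.
exists (`|B| + 1) => [|x Ox]; first by rewrite addr_ge0.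
by apply: H; exists x => //=; apply: HM => //; rewrite (le_lt_trans (ler_norm _)) ?ltrDl.
Qed.

Section profile.
Context {R : realType} (l m : R) (phi : R -> R).
Hypothesis adm : admissible l m phi.
Variables (c lam : R).
Hypotheses (c0 : 0 < c) (lam0 : 0 < lam).

(* The field of the barrier [c * expR (- lam |x|^2)] is [- bar_field |x|^2 *: x]. *)
Definition bar_slope (s : R) : R := 2 * c * lam * expR (- lam * s).
Definition bar_norm (s : R) : R := bar_slope s * Num.sqrt s.
Definition bar_field (s : R) : R := phi (bar_norm s) * bar_slope s.
Definition bar_field' (s : R) : R :=
  bar_slope s * (derive1 phi (bar_norm s) * (bar_norm s * ((2 * s)^-1 - lam)) - lam * phi (bar_norm s)).

Lemma bar_slope_gt0 s : 0 < bar_slope s.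
Proof. by rewrite !mulr_gt0// expR_gt0. Qed.

Lemma bar_norm_gt0 s : 0 < s -> 0 < bar_norm s.
Proof. by move=> s0; rewrite mulr_gt0 ?bar_slope_gt0// sqrtr_gt0. Qed.

Lemma is_derive_bar_slope (s : R) : is_derive s 1 bar_slope (- lam * bar_slope s).
Proof. exact: is_derive_expRZ. Qed.

Lemma is_derive_bar_norm (s : R) : 0 < s -> is_derive s 1 bar_norm (bar_norm s * ((2 * s)^-1 - lam)).
Proof.
move=> s0; have := @is_deriveM _ _ bar_slope Num.sqrt s 1 _ _ (is_derive_bar_slope s) (is_derive1_sqrt s0).
congr (is_derive _ _ _ _); rewrite /GRing.scale/= /bar_norm.
have q0 : Num.sqrt s != 0 by rewrite gt_eqF// sqrtr_gt0.
have := sqr_sqrtr (ltW s0); move: (bar_slope s) (Num.sqrt s) q0 => q t t0 <-; field.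
exact: t0.
Qed.

Lemma is_derive_bar_field (s : R) : 0 < s -> is_derive s 1 bar_field (bar_field' s).
Proof.
move=> s0; have [_ C1 _ _ _] := adm; have n0 := bar_norm_gt0 s0.
have dp : is_derive (bar_norm s) 1 phi (derive1 phi (bar_norm s)).
  by rewrite derive1E; apply: DeriveDef => //; exact: (C1 _ n0).1.
have d1 := @is_derive1_comp _ phi bar_norm s _ _ dp (is_derive_bar_norm s0).
have := @is_deriveM _ _ (phi \o bar_norm) bar_slope s 1 _ _ d1 (is_derive_bar_slope s).
by congr (is_derive _ _ _ _); rewrite /GRing.scale/= /bar_field'; ring.
Qed.

Lemma continuous_bar_field' (s : R) : 0 < s -> {for s, continuous bar_field'}.
Proof.
move=> s0; have [_ C1 _ _ _] := adm; have n0 := bar_norm_gt0 s0.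
have cs := is_derive_continuous (is_derive_bar_slope s).
have cn := is_derive_continuous (is_derive_bar_norm s0).
have cp : {for bar_norm s, continuous phi}.
  by apply: differentiable_continuous; apply/derivable1_diffP; exact: (C1 _ n0).1.
have cd := (C1 _ n0).2.
apply: cvgM; first exact: cs.
apply: cvgB; last first.
  by apply: cvgM; [exact: cvg_cst|exact: (continuous_comp cn cp)].
apply: cvgM; first exact: (continuous_comp cn cd).
apply: cvgM; first exact: cn.
apply: cvgB; last exact: cvg_cst.
apply: cvgV; first by rewrite gt_eqF// mulr_gt0.
by apply: cvgM; [exact: cvg_cst|exact: cvg_id].
Qed.

(** The left side is the divergence in dimension N + 1 of the field g(|y|^2) y at |y|^2 = s, with g
    the function [bar_field]. The lower growth bound of [phi] and the size of lam let the negative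
    part prevail. *)
Lemma bar_field_div (N s : R) : 0 <= N -> 0 < s -> N <= (l - 1) * (2 * lam * s - 1) ->
  (N + 1) * bar_field s + 2 * s * bar_field' s <= 0.
Proof.
move=> N0 s0 H; have [p0 C1 _ l1 lm] := adm; have n0 := bar_norm_gt0 s0.
have := lm _ n0; have pp := p0 _ n0; have q0 := bar_slope_gt0 s.
set t := bar_norm s in n0 pp *.
have -> : derive1 (fun s => s * phi s) t = phi t + t * derive1 phi t.
  rewrite derive1E; have dp : is_derive t 1 phi (derive1 phi t).
    by rewrite derive1E; apply: DeriveDef => //; exact: (C1 _ n0).1.
  have d := @is_deriveM _ _ id phi t 1 _ _ (is_derive_id t 1) dp.
  by rewrite (@derive_val _ _ _ _ _ _ _ d) /GRing.scale/=; ring.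
rewrite ler_pdivlMr// => /andP[low _].
rewrite /bar_field /bar_field' -/t.
have -> : (N + 1) * (phi t * bar_slope s) + 2 * s * (bar_slope s *
    (derive1 phi t * (t * ((2 * s)^-1 - lam)) - lam * phi t)) =
    bar_slope s * ((N + 1) * phi t + t * derive1 phi t * (1 - 2 * lam * s) - 2 * lam * s * phi t).
  by field; rewrite gt_eqF.
rewrite pmulr_rle0//; have k0 : 0 <= 2 * lam * s - 1.
  by rewrite -(@pmulr_rge0 _ (l - 1)) ?subr_gt0//; exact: le_trans H.
have := ler_wpM2r k0 low; have := ler_wpM2r (ltW pp) H.
move: (2 * lam * s) (t * derive1 phi t) (phi t) => k X p; nra.
Qed.

End profile.

(** * Comparison of supersolutions with barriers *)

Section barrier.
Context {R : realType} {n : nat} (Om : set 'rV[R]_n.+1) (l m : R) (phi : R -> R).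
Hypothesis adm : admissible l m phi.
Hypothesis dom : open Om /\ bounded_set Om.
Local Notation h := (hphi phi).
Local Notation P := (NPhi phi).
Local Notation leb := (@lebesgue_rv R n.+1).
Local Notation W0 := (W0 Om phi).
Local Notation A := (Afield phi).
Implicit Types (w v f : 'rV[R]_n.+1 -> R) (G H : 'rV[R]_n.+1 -> 'rV[R]_n.+1).

Let oO : open Om. Proof. by case: dom. Qed.
Let bO : bounded_set Om. Proof. by case: dom. Qed.
Let mO : measurable Om. Proof. exact: open_rv_measurable. Qed.

Lemma L1_boundedM f v C : measurable_fun Om f -> (forall x, Om x -> `|f x| <= C) ->
  L1 leb Om v -> L1 leb Om (fun x => f x * v x) /\
  `|I leb Om (fun x => f x * v x)| <= C * I leb Om (fun x => `|v x|).
Proof.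
move=> mf fC Lv; have Ln := L1_norm Lv.
have b x : Om x -> `|f x * v x| <= C * `|v x| by move=> Ox; rewrite normrM ler_wpM2r//; exact: fC.
have L : L1 leb Om (fun x => f x * v x).
  by apply: (L1_le mO (measurable_funM mf (L1_meas Lv)) (L1Z mO C Ln)).
split=> //; apply: (le_trans (I_norm mO L)); rewrite -(I_Z mO _ Ln).
by apply: (I_le mO (L1_norm L) (L1Z mO _ Ln)).
Qed.

Lemma W0_test_L1_grad u G e : W0 u G -> 0 < e -> exists psi, [/\ test_fun Om psi,
  I leb Om (fun x => `|u x - psi x|) < e & I leb Om (fun x => enorm (G x - grad psi x)) < e].
Proof.
move=> W e0; have [d d0 Hd] := NPhi_small adm dom ltr01 (ltW (l_gt1 adm)) e0.
have [mw mG /(_ _ d0)[psi [tp Lp Ip]]] := W; exists psi; split=> //.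
  have Wd := W0B adm dom W (W0_test phi tp); have LP := W0_L1u adm dom Wd.
  have LPn : L1 leb Om (fun x => P `|u x - psi x|).
    by apply: (L1_eq mO _ LP) => x _; rewrite (NPhi_norm adm).
  rewrite (_ : I _ _ _ = I leb Om (fun x => `|u x - psi x| `^ 1)); last first.
    by apply: I_eq => x _; rewrite powRr1.
  apply: Hd => //; first exact: (L1_meas (L1_norm (W0_L1 adm dom Wd).1)).
  apply: le_lt_trans Ip; apply: (I_le mO LPn Lp) => x _.
  by rewrite (NPhi_norm adm) /modu lerDl (NPhi_ge0 adm).
have Wd := W0B adm dom W (W0_test phi tp); have LP := W0_L1G adm dom Wd.
rewrite (_ : I _ _ _ = I leb Om (fun x => enorm (G x - grad psi x) `^ 1)); last first.
  by apply: I_eq => x _; rewrite powRr1 ?enorm_ge0.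
apply: Hd => //.
- exact: vmeas_enorm (W0_vmeas Wd).
- by move=> x; exact: enorm_ge0.
- apply: le_lt_trans Ip; apply: (I_le mO LP Lp) => x _.
  by rewrite /modu lerDr (NPhi_ge0 adm).
Qed.

(** By density: f and its derivative are bounded on Om, so both sides are continuous for the L^1
    convergence of u and of G. *)
Lemma W0_by_parts f u G i : Ck 1 f -> W0 u G ->
  [/\ L1 leb Om (fun x => f x * G x ord0 i), L1 leb Om (fun x => partial i f x * u x) &
      I leb Om (fun x => f x * G x ord0 i) = - I leb Om (fun x => partial i f x * u x)].
Proof.
move=> Cf W; have cf := Ck_continuous Cf; have cdf := Ck_continuous (Ck_partial i Cf).
have [C C0 HC] := continuous_bounded_on bO cf; have [D D0 HD] := continuous_bounded_on bO cdf.
have mf : measurable_fun Om f := continuous_rv_measurable cf.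
have mdf : measurable_fun Om (partial i f) := continuous_rv_measurable cdf.
have [Lu LG] := W0_L1 adm dom W.
have Lc v H : W0 v H -> L1 leb Om (fun x => H x ord0 i).
  move=> Wv; apply: (L1_le mO (W0_vmeas Wv i) (W0_L1 adm dom Wv).2) => x _; exact: coord_le_enorm.
have [La _] := L1_boundedM mf HC (Lc _ _ W); have [Lb _] := L1_boundedM mdf HD Lu.
split=> //; apply/eqP; rewrite -subr_eq0 opprK -normr_le0.
apply/ler_addgt0Pr => e e0; rewrite add0r.
have e1 : 0 < e / (C + D + 1) by rewrite divr_gt0// ltr_wpDl// addr_ge0.
have [psi [tp Iu IG]] := W0_test_L1_grad W e1.
have Wd := W0B adm dom W (W0_test phi tp).
have [Ld1 Ed1] := L1_boundedM mf HC (Lc _ _ Wd).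
have [Ld2 Ed2] := L1_boundedM mdf HD (W0_L1 adm dom Wd).1.
have [Lp1 Lp2 Ep] := int_by_parts i mO Cf tp.
have -> : I leb Om (fun x => f x * G x ord0 i) + I leb Om (fun x => partial i f x * u x) =
    I leb Om (fun x => f x * (G x - grad psi x) ord0 i) + I leb Om (fun x => partial i f x * (u x - psi x)).
  have -> : I leb Om (fun x => f x * (G x - grad psi x) ord0 i) =
     I leb Om (fun x => f x * G x ord0 i - f x * partial i psi x).
    by apply: I_eq => x _; rewrite !mxE mulrBr.
  have -> : I leb Om (fun x => partial i f x * (u x - psi x)) =
     I leb Om (fun x => partial i f x * u x - partial i f x * psi x).
    by apply: I_eq => x _; rewrite mulrBr.
  by rewrite (I_B mO La Lp1) (I_B mO Lb Lp2) Ep; ring.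
apply: (le_trans (ler_normD _ _)); apply: (le_trans (lerD Ed1 Ed2)).
have H1 : I leb Om (fun x => `|(G x - grad psi x) ord0 i|) <= e / (C + D + 1).
  apply: le_trans (ltW IG); apply: (I_le mO (L1_norm (Lc _ _ Wd)) (W0_L1 adm dom Wd).2) => x _.
  exact: coord_le_enorm.
apply: (le_trans (lerD (ler_wpM2l C0 H1) (ler_wpM2l D0 (ltW Iu)))).
rewrite -mulrDl mulrA ler_pdivrMr ?ltr_wpDl ?addr_ge0// mulrC ler_wpM2l ?(ltW e0)//.
by rewrite lerDl.
Qed.

Lemma W0_grad0 z Z : W0 z Z -> aeD leb Om (fun x => P (enorm (Z x)) = 0) -> aeD leb Om (fun x => z x = 0).
Proof.
move=> Wz Z0; have [C C0 HC] := poincare adm dom ord0.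
have := HC _ _ Wz; have LQ := W0_L1G adm dom Wz; have Lz := W0_L1u adm dom Wz.
have -> : I leb Om (fun x => P (enorm (Z x))) = 0.
  rewrite -(I_0 leb Om); apply: (I_ae mO (L1_meas LQ)) => //.
rewrite mulr0 => Iz.
have Pz0 : aeD leb Om (fun x => 0 <= P (z x)) by apply: aeDT => x _; exact: (NPhi_ge0 adm).
apply: aeDS (I_eq0 mO Lz Pz0 Iz) => x _ Pz; apply/eqP; apply: contrapT => /negP z0.
by have := NPhi_gt0 adm z0; rewrite Pz ltxx.
Qed.

Section one_barrier.
Variables (z0 : 'rV[R]_n.+1) (r c lam : R).
Hypotheses (r0 : 0 < r) (c0 : 0 < c) (lam0 : 0 < lam).
Hypothesis lam_big : n%:R <= (l - 1) * (2 * lam * r ^+ 2 - 1).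
Local Notation g := (bar_field phi c lam).
Local Notation g' := (bar_field' phi c lam).
Local Notation s := (sqdist z0).

(* [g] is singular at 0: [cutoff] is positive, and equals [s] outside the ball of radius r,
   the only region where the supersolution has not yet been bounded below. *)
Let cutoff x := s x + pos_approx 1 (r ^+ 2 - s x).
Let F i x := - g (cutoff x) * (x ord0 i - z0 ord0 i).

Let Cs k : Ck k s. Proof. exact: Ck_sqdist. Qed.
Let Crs k : Ck k (fun x => r ^+ 2 - s x).
Proof. by apply: Ck_B; [exact: Ck_cst|exact: Cs]. Qed.
Let Ccut : Ck 1 cutoff.
Proof. by apply: Ck_D; [exact: Cs|exact: (pos_approx_Ck ltr01 (Crs 1))]. Qed.

Let cut_gt0 x : 0 < cutoff x.
Proof.
rewrite /cutoff; have := dotv_ge0 (x - z0); rewrite -/(s x) le_eqVlt => /orP[/eqP <-|sx].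
  rewrite subr0 add0r /pos_approx /flat_exp exprn_gt0// horner1 mul1r mulr_gt0 ?exprn_gt0// expR_gt0//.
by rewrite ltr_wpDr//; have /andP[] := pos_approx_bound (r ^+ 2 - s x) (@ltr01 R).
Qed.

Let cut_out x : r ^+ 2 <= s x -> cutoff x = s x.
Proof. by move=> h; rewrite /cutoff pos_approx_le0 ?addr0// subr_le0. Qed.

Let d_cut x i : r ^+ 2 <= s x -> partial i cutoff x = 2 * (x ord0 i - z0 ord0 i).
Proof.
move=> h; rewrite /cutoff partialD; [|exact: Cs|exact: (pos_approx_Ck ltr01 (Crs 1))].
rewrite (partial_comp i (Crs 1) (is_derive_pos_approx (r ^+ 2 - s x) ltr01)).
rewrite pos_approx'_le0 ?subr_le0// mul0r addr0.
by rewrite /partial (@derive_val _ _ _ _ _ _ _ (is_derive_sqdist z0 x i)).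
Qed.

Let d_gcut x i : is_derive x (delta_mx ord0 i) (fun x => g (cutoff x)) (g' (cutoff x) * partial i cutoff x).
Proof.
apply: (@is_derive_comp _ _ cutoff g); first exact: (Ck_is_derive _ _ Ccut).
exact: (is_derive_bar_field adm).
Qed.

Let Cgcut : Ck 1 (fun x => g (cutoff x)).
Proof.
apply: (Ck_S (df := fun i x => g' (cutoff x) * partial i cutoff x)).
- move=> x; apply: (@continuous_comp _ _ _ cutoff g); first exact: (Ck_continuous Ccut).
  exact: (is_derive_continuous (is_derive_bar_field adm c0 lam0 (cut_gt0 x))).
- by move=> i x; exact: d_gcut.
- move=> i; split => // x; apply: (@continuousM _ _ (fun x => g' (cutoff x)) (partial i cutoff));
    last exact: (Ck_continuous (Ck_partial i Ccut)).
  apply: (@continuous_comp _ _ _ cutoff g'); first exact: (Ck_continuous Ccut).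
  exact: (continuous_bar_field' adm).
Qed.

Let Ccoord k i : Ck k (fun x : 'rV[R]_n.+1 => x ord0 i - z0 ord0 i).
Proof. by apply: Ck_B; [exact: Ck_coord|exact: Ck_cst]. Qed.

Let CF i : Ck 1 (F i).
Proof.
rewrite (_ : F i = fun x => (-1) * (g (cutoff x) * (x ord0 i - z0 ord0 i))); last first.
  by apply/funext => x; rewrite /F; ring.
exact: (Ck_Z (-1) (Ck_M Cgcut (Ccoord 1 i))).
Qed.

(** Where the cutoff is inactive, this sum is minus the expression of [bar_field_div]: the barrier
    is a subsolution there. *)
Let divF x : r ^+ 2 <= s x -> 0 <= \sum_i partial i (F i) x.
Proof.
move=> h; have s0 : 0 < s x by rewrite (lt_le_trans _ h)// exprn_gt0.
have -> : \sum_i partial i (F i) x = - ((n%:R + 1) * g (s x) + 2 * s x * g' (s x)).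
  have E i : partial i (F i) x = - (2 * g' (s x)) * ((x ord0 i - z0 ord0 i) * (x ord0 i - z0 ord0 i)) - g (s x).
    rewrite (_ : F i = fun x => (-1) * (g (cutoff x) * (x ord0 i - z0 ord0 i))); last first.
      by apply/funext => y; rewrite /F; ring.
    rewrite (partialZ _ _ _ (Ck_M Cgcut (Ccoord 1 i))) (partialM _ _ Cgcut (Ccoord 1 i)).
    rewrite {2}/partial (@derive_val _ _ _ _ _ _ _ (d_gcut x i)) d_cut// cut_out//.
    have d : is_derive x (delta_mx ord0 i) (fun y : 'rV[R]_n.+1 => y ord0 i - z0 ord0 i) (1 - 0).
      apply: is_deriveB; have := is_derive_coord x (delta_mx ord0 i) i.
      by rewrite mxE !eqxx.
    by rewrite /partial (@derive_val _ _ _ _ _ _ _ d); ring.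
  rewrite (eq_bigr _ (fun i _ => E i)) sumrB -mulr_sumr -sqdist_sum sumr_const card_ord -mulr_natl -natr1.
  by ring.
rewrite oppr_ge0; apply: (bar_field_div adm c0 lam0) => //.
apply: (le_trans lam_big); rewrite ler_wpM2l// ?subr_ge0 ?(ltW (l_gt1 adm))//.
by rewrite lerD2r ler_wpM2l// mulr_ge0// ltW.
Qed.

Definition bar (rho : R) x : R := c * (expR (- lam * s x) - expR (- lam * rho ^+ 2)).

Lemma smooth_bar rho : smooth (bar rho).
Proof.
apply/smoothP => k.
rewrite (_ : bar rho = fun x => (fun j (t : R) => (- lam) ^+ j * (c * expR (- lam * t))) 0%N (s x) - c * expR (- lam * rho ^+ 2)).
  apply: Ck_B; last exact: Ck_cst.
  apply: (@Ck_comp _ _ _ (fun j (t : R) => (- lam) ^+ j * (c * expR (- lam * t)))); last exact: Cs.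
  move=> j t; have := is_derive_expRZ (- lam) ((- lam) ^+ j * c) t.
  have -> : - lam * ((- lam) ^+ j * c * expR (- lam * t)) = (- lam) ^+ j.+1 * (c * expR (- lam * t)).
    by rewrite exprS; ring.
  by congr (is_derive _ _ _ _); apply/funext => x; rewrite mulrA.
by apply/funext => x; rewrite /bar expr0 mul1r mulrBr.
Qed.

Lemma grad_bar rho x : grad (bar rho) x = - bar_slope c lam (s x) *: (x - z0).
Proof.
apply/rowP => i; rewrite !mxE /partial.
have d1 := is_derive_expRZ (- lam) c (s x).
have d2 := @is_derive_comp _ _ s _ x _ _ _ (is_derive_sqdist z0 x i) d1.
have d3 : is_derive x (delta_mx ord0 i) (fun x => c * expR (- lam * s x) - c * expR (- lam * rho ^+ 2)) (- lam * (c * expR (- lam * s x)) * (2 * (x ord0 i - z0 ord0 i)) - 0).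
  exact: is_deriveB.
rewrite (_ : bar rho = (fun x => c * expR (- lam * s x) - c * expR (- lam * rho ^+ 2))); last first.
  by apply/funext => y; rewrite /bar mulrBr.
by rewrite (@derive_val _ _ _ _ _ _ _ d3) /bar_slope; ring.
Qed.

Lemma Afield_bar rho x : r ^+ 2 <= s x -> A (grad (bar rho) x) = \row_i F i x.
Proof.
move=> h; rewrite grad_bar /Afield enormZ normrN gtr0_norm ?bar_slope_gt0//.
rewrite scalerA; apply/rowP => i; rewrite !mxE /F cut_out// /bar_field /bar_norm -/(enorm _) /sqdist.
by rewrite -/(enorm (x - z0)); ring.
Qed.

(** The test function is the positive part of the difference of the truncated barrier and w. It
    vanishes inside the ball of radius r and where the barrier is not positive; elsewhere A(grad
    bar) is the C^1 field F, whose integral has a sign after integration by parts. Then [Mono]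
    forces the gradient of the test function to vanish. *)
Lemma bar_compare w G rho : supersolution Om phi w G -> r <= rho -> eball z0 rho `<=` Om ->
  aeD leb Om (fun x => enorm (x - z0) <= r -> c <= w x) ->
  aeD leb Om (fun x => bar rho x <= w x).
Proof.
move=> [W w0 sup] rr BO wc.
have rho0 : 0 < rho := lt_le_trans r0 rr.
have vK x : ~ eball z0 rho x -> bar rho x <= 0.
  rewrite (eball_sqdist _ (ltW rho0)) => /negP; rewrite -ltNge => H.
  rewrite /bar pmulr_rle0// subr_le0 ler_expR !mulNr lerN2 ler_wpM2l ?(ltW lam0)//; exact: ltW.
have vc x : bar rho x <= c.
  rewrite /bar ler_piMr ?(ltW c0)// lerBlDr (le_trans (_ : _ <= 1))// ?lerDl ?expR_ge0//.
  by rewrite -expR0 ler_expR mulNr oppr_le0 mulr_ge0 ?(ltW lam0) ?dotv_ge0.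
have Wv := W0_trunc_smooth adm dom (smooth_bar rho) (@compact_eball _ _ z0 rho) BO vK.
have Wd := W0B adm dom Wv W.
have Wz := W0_trunc adm dom (lexx 0) Wd.
set d := fun x => _ - w x in Wd Wz; set Q := fun x => _ - G x in Wd Wz.
set z := fun x => Num.max _ 0 in Wz; set Z := fun x => _ *: _ in Wz.
have zp : aeD leb Om (fun x => (0 < d x)%R -> 0 < bar rho x /\ r ^+ 2 <= s x).
  apply: aeDS2 w0 wc => x _ w0 wc dx.
  have b0 : 0 < bar rho x.
    rewrite ltNge; apply/negP => b0; move: dx; rewrite /d subr0 (max_idPr b0) sub0r oppr_gt0.
    by rewrite ltNge w0.
  split=> //.
  rewrite leNgt; apply/negP => sr; have : enorm (x - z0) <= r.
    by rewrite -ler_sqr ?nnegrE ?enorm_ge0 ?(ltW r0)// -sqdistE ltW.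
  move=> /wc cw; move: dx; rewrite /d subr0 (max_idPl (ltW b0)) subr_gt0.
  by rewrite ltNge (le_trans (vc x) cw).
have z00 : aeD leb Om (fun x => 0 <= z x) by apply: aeDT => x _; rewrite /z le_max lexx orbT.
have S := sup _ _ Wz z00; have LA := W0_LA adm dom W Wz.
have P1 i := W0_by_parts i (CF i) Wz.
have LF : L1 leb Om (fun x => \sum_i F i x * Z x ord0 i) by apply: (L1_sum mO) => i; have [] := P1 i.
have LD : L1 leb Om (fun x => \sum_i partial i (F i) x * z x) by apply: (L1_sum mO) => i; have [] := P1 i.
have IF : I leb Om (fun x => \sum_i F i x * Z x ord0 i) <= 0.
  rewrite (I_sum mO); last by move=> i; have [] := P1 i.
  rewrite (eq_bigr (fun i => - I leb Om (fun x => partial i (F i) x * z x))); last by move=> i _; have [] := P1 i.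
  rewrite sumrN -(I_sum mO); last by move=> i; have [] := P1 i.
  rewrite oppr_le0; apply: (I_ge0_ae mO LD); apply: aeDS zp => x _ zp.
  rewrite -mulr_suml /z subr0; have [d0|d0] := leP (d x) 0; first by rewrite mulr0.
  by rewrite mulr_ge0 ?(ltW d0)//; apply: divF; case: (zp d0).
have AF : aeD leb Om (fun x => \sum_i F i x * Z x ord0 i - dotv (A (G x)) (Z x) =
    (0 < d x)%R%:R * Mono phi (grad (bar rho) x) (G x)).
  apply: aeDS zp => x _ zp; rewrite /Z; case d0 : (0 < d x)%R; last first.
    rewrite scale0r mul0r big1 ?sub0r; last by move=> i _; rewrite mxE mulr0.
    by rewrite -(scale0r (0 : 'rV[R]_n.+1)) dotvZr mul0r oppr0.
  have [b0 rs] := zp d0; rewrite b0 !scale1r mul1r /Mono dotvBl (Afield_bar _ rs); congr (_ - _).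
  by apply: eq_bigr => i _; rewrite !mxE.
have LM := L1B mO LF LA.
have LN : I leb Om (fun x => \sum_i F i x * Z x ord0 i - dotv (A (G x)) (Z x)) <= 0.
  by rewrite (I_B mO LF LA) subr_le0; exact: le_trans IF S.
have Z0 : aeD leb Om (fun x => P (enorm (Z x)) = 0).
  have N0 : aeD leb Om (fun x => 0 <= \sum_i F i x * Z x ord0 i - dotv (A (G x)) (Z x)).
    by apply: aeDS AF => x _ ->; rewrite mulr_ge0// (Mono_ge0 adm).
  apply: aeDS3 AF zp (I_eq0 mO LM N0 LN) => x _ -> zp; rewrite /Z.
  case d0 : (0 < d x)%R => M1; last by rewrite scale0r enorm0 (NPhi0 phi).
  have [b0 _] := zp d0; move: M1; rewrite b0 mul1r !scale1r => M0; apply: (Mono_eq0 adm); rewrite M0//.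
apply: aeDS (W0_grad0 Wz Z0) => x _; rewrite /z subr0 => zx.
rewrite leNgt; apply/negP => wv; have : 0 < Num.max (d x) 0; last by rewrite zx ltxx.
by rewrite lt_max /d subr0 subr_gt0 lt_max wv.
Qed.

(** From 1 + y <= exp y and rho^2 - t^2 >= rho (rho - t), where t <= rho is the distance to the
    centre. *)
Lemma bar_ge rho x : 0 <= rho -> enorm (x - z0) <= rho ->
  c * lam * expR (- lam * rho ^+ 2) * rho * (rho - enorm (x - z0)) <= bar rho x.
Proof.
move=> rho0 xr; rewrite /bar sqdistE; set t := enorm _ in xr *; have t0 : 0 <= t := enorm_ge0 _.
rewrite -!mulrA; apply: ler_wpM2l; first exact: ltW.
have -> : expR (- lam * t ^+ 2) = expR (- lam * rho ^+ 2) * expR (lam * (rho ^+ 2 - t ^+ 2)).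
  by rewrite -expRD; congr expR; ring.
have := expR_ge1Dx (lam * (rho ^+ 2 - t ^+ 2)); have E0 := expR_gt0 (- lam * rho ^+ 2).
move=> /(ler_wpM2l (ltW E0)); move: (expR _) (expR _) E0 => p q q0 H.
have : 0 <= q * lam * (t * (rho - t)).
  by apply: mulr_ge0; [exact: (mulr_ge0 (ltW q0) (ltW lam0))|rewrite mulr_ge0 ?subr_ge0].
by move: H; lra.
Qed.

End one_barrier.

(** Uniformity is the point: lam is determined by r, and the linear lower bound keeps one constant
    for all centres z and all radii between r and Rm. *)
Lemma barrier w G r Rm c : supersolution Om phi w G -> 0 < r -> 0 < Rm -> 0 < c ->
  exists2 kap : R, 0 < kap & forall z rho, r <= rho -> rho <= Rm -> eball z rho `<=` Om ->
    aeD leb Om (fun x => enorm (x - z) <= r -> c <= w x) ->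
    aeD leb Om (fun x => enorm (x - z) <= rho -> kap * (rho - enorm (x - z)) <= w x).
Proof.
move=> sup r0 R0 c0; have l1 := l_gt1 adm.
have r2 : 0 < r ^+ 2 by rewrite exprn_gt0.
have nl : 0 <= n%:R / (l - 1) by rewrite divr_ge0// subr_ge0 ltW.
(* The value that makes [lam_big] an equality. *)
pose lam := (1 + n%:R / (l - 1)) / (2 * r ^+ 2).
have lam0 : 0 < lam by rewrite divr_gt0 ?mulr_gt0// ltr_pwDl.
have big : n%:R <= (l - 1) * (2 * lam * r ^+ 2 - 1).
  have -> : 2 * lam * r ^+ 2 = 1 + n%:R / (l - 1).
    by rewrite /lam; field; rewrite gt_eqF ?subr_gt0// gt_eqF.
  by apply: eq_ler; field; rewrite gt_eqF// subr_gt0.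
exists (c * lam * expR (- lam * Rm ^+ 2) * r); 
  first by apply: mulr_gt0 => //; apply: mulr_gt0; [exact: mulr_gt0|exact: expR_gt0].
move=> z rho rr rR BO wc.
have B := bar_compare r0 c0 lam0 big sup rr BO wc.
apply: aeDS B => x _ B xr; apply: le_trans B; have rho0 := le_trans (ltW r0) rr.
apply: (le_trans _ (bar_ge c0 lam0 rho0 xr)).
apply: ler_wpM2r; first by rewrite subr_ge0.
have k0 := ltW (mulr_gt0 c0 lam0).
apply: ler_pM => //; [exact: (mulr_ge0 k0 (expR_ge0 _))|exact: ltW|apply: ler_wpM2l => //].
by rewrite ler_expR !mulNr lerN2 ler_wpM2l ?(ltW lam0)// lerXn2r// nnegrE ltW.
Qed.

End barrier.

(** * Lower bound by the distance to the boundary *)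

Section calculus.
Context {R : realType}.

Lemma derive_bound (F dF : R -> R) (C t : R) :
  (forall x : R, `|x| <= `|t| -> is_derive x 1 F (dF x) /\ `|dF x| <= C) ->
  `|F t - F 0| <= C * `|t|.
Proof.
move=> H.
have K (a b : R) : a <= b -> (forall x, a <= x <= b -> `|x| <= `|t|) -> `|F b - F a| <= C * (b - a).
  move=> ab Hx; have dC (x : R) : is_derive x 1 (fun x : R => C * x) C.
    by rewrite -[X in is_derive _ _ _ X]mulr1; exact: is_deriveZ.
  have := @ge0_incr_cc _ (fun x => C * x - F x) (fun x => C - dF x) a b ab _.
  have := @ge0_incr_cc _ (fun x => C * x + F x) (fun x => C + dF x) a b ab _.
  move=> H1 H2; have {}H1 : C * a + F a <= C * b + F b.
    apply: H1 => x xab; have [d1 d2] := H x (Hx x xab); split; first exact: is_deriveD.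
    by move: d2; rewrite ler_norml; lra.
  have {}H2 : C * a - F a <= C * b - F b.
    apply: H2 => x xab; have [d1 d2] := H x (Hx x xab); split; first exact: is_deriveB.
    by move: d2; rewrite ler_norml; lra.
  by rewrite ler_norml; move: H1 H2; lra.
have [t0|t0] := leP 0 t.
  have := K 0 t t0 _; rewrite subr0 (ger0_norm t0); apply=> x /andP[x0 xt].
  by rewrite !ger0_norm.
have := K t 0 (ltW t0) _; rewrite distrC sub0r (ltr0_norm t0); apply=> x /andP[tx x0].
by rewrite ler0_norm ?lerN2.
Qed.

Lemma derive2_bound (F dF ddF : R -> R) (C t : R) : 0 <= C ->
  (forall x : R, `|x| <= `|t| -> is_derive x 1 F (dF x) /\ is_derive x 1 dF (ddF x) /\ `|ddF x| <= C) ->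
  `|F t - F 0 - t * dF 0| <= C * `|t| ^+ 2.
Proof.
move=> C0 H.
have := @derive_bound (fun x => F x - dF 0 * x) (fun x => dF x - dF 0) (C * `|t|) t _.
rewrite mulr0 subr0 expr2 mulrA (mulrC t) addrAC; apply=> x xt; split.
  apply: is_deriveB; first by have [] := H x xt.
  by rewrite -[X in is_derive _ _ _ X]mulr1; exact: is_deriveZ.
apply: le_trans (_ : C * `|x| <= _); last exact: ler_wpM2l.
apply: (@derive_bound dF ddF) => y yx; have [_ [d1 d2]] := H y (le_trans yx xt).
by split.
Qed.

Section taylor.
Context {n : nat}.
Variables (g : 'rV[R]_n -> R) (M C : R).
Hypothesis sg : smooth g.
Hypothesis C0 : 0 <= C.
Hypothesis bg : forall i j x, `|x| <= M -> `|partial i (partial j g) x| <= C.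
Variables (p v : 'rV[R]_n).
(** The displacement v is followed along the coordinate axes one at a time. On each edge of this
    path g is a function of one variable, so the Taylor bound needs partial derivatives only; [seg]
    keeps the path in the ball where they are bounded. *)
Let V (s : seq 'I_n) := \sum_(k <- s) v ord0 k *: (delta_mx ord0 k : 'rV[R]_n).
Let S (s : seq 'I_n) := \sum_(k <- s) `|v ord0 k|.

Let Cg k : Ck k g. Proof. exact: (smoothP g).1. Qed.

Let S_ge0 s : 0 <= S s. Proof. by apply: sumr_ge0. Qed.

Let norm_delta k : `|delta_mx ord0 k : 'rV[R]_n| <= 1.
Proof.
rewrite [leLHS]mx_normrE; apply/bigmax_leP; split => // -[i j] _ /=.
by rewrite mxE; case: (_ && _); rewrite ?normr1 ?normr0 ?ler01.
Qed.

Let V_S s : `|V s| <= S s.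
Proof.
apply: (le_trans (ler_norm_sum _ _ _)); apply: ler_sum => k _.
by rewrite normrZ ler_piMr.
Qed.

Let line_derive f k (a : 'rV[R]_n) (t : R) : Ck 1 f ->
  is_derive t 1 (fun t : R => f (a + t *: delta_mx ord0 k)) (partial k f (a + t *: delta_mx ord0 k)).
Proof. by move=> Cf; apply/is_derive_line; exact: (Ck_is_derive _ _ Cf). Qed.

Let seg s k (t : R) : `|p| + S (k :: s) <= M -> `|t| <= `|v ord0 k| ->
  `|p + V s + t *: (delta_mx ord0 k : 'rV[R]_n)| <= M.
Proof.
move=> pM tv; apply: le_trans pM; apply: (le_trans (ler_normD _ _)).
rewrite /S big_cons (addrC `|v _ _|) addrA; apply: lerD.
  by apply: (le_trans (ler_normD _ _)); rewrite lerD2l; exact: V_S.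
by rewrite normrZ (le_trans _ tv)// ler_piMr.
Qed.

Let V_cons k s : p + V (k :: s) = p + V s + v ord0 k *: (delta_mx ord0 k : 'rV[R]_n).
Proof. by rewrite /V big_cons addrCA addrC -addrA. Qed.

Let S_cons k s : S (k :: s) = `|v ord0 k| + S s. Proof. by rewrite /S big_cons. Qed.

Let first_order j s : `|p| + S s <= M -> `|partial j g (p + V s) - partial j g p| <= C * S s.
Proof.
elim: s => [|k s IH] pM; first by rewrite /V /S !big_nil addr0 subrr normr0 mulr0.
have pM' : `|p| + S s <= M by apply: le_trans pM; rewrite S_cons lerD2l lerDr.
have := @derive_bound (fun t => partial j g (p + V s + t *: delta_mx ord0 k))
  (fun t => partial k (partial j g) (p + V s + t *: delta_mx ord0 k)) C (v ord0 k) _.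
rewrite scale0r addr0 -V_cons => H.
have {}H : `|partial j g (p + V (k :: s)) - partial j g (p + V s)| <= C * `|v ord0 k|.
  apply: H => x xv; split; last by apply: bg; exact: seg.
  by apply: line_derive; exact: (Ck_partial j (Cg 2)).
rewrite S_cons mulrDr; apply: le_trans (lerD H (IH pM')).
by rewrite (le_trans _ (ler_normD _ _))// addrA subrK.
Qed.

Let second_order s : `|p| + S s <= M ->
  `|g (p + V s) - g p - \sum_(k <- s) v ord0 k * partial k g p| <= C * S s ^+ 2.
Proof.
elim: s => [|k s IH] pM; first by rewrite /V /S !big_nil addr0 !subrr normr0 expr0n mulr0.
have pM' : `|p| + S s <= M by apply: le_trans pM; rewrite S_cons lerD2l lerDr.
have := @derive2_bound (fun t => g (p + V s + t *: delta_mx ord0 k))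
  (fun t => partial k g (p + V s + t *: delta_mx ord0 k))
  (fun t => partial k (partial k g) (p + V s + t *: delta_mx ord0 k)) C (v ord0 k) C0 _.
rewrite scale0r addr0 -V_cons => H.
have {}H : `|g (p + V (k :: s)) - g (p + V s) - v ord0 k * partial k g (p + V s)| <= C * `|v ord0 k| ^+ 2.
  apply: H => x xv; split; first by apply: line_derive; exact: (Cg 1).
  by split; [apply: line_derive; exact: (Ck_partial k (Cg 2))|apply: bg; exact: seg].
have H1 := first_order k pM'; have H2 := IH pM'.
have {}H1 := ler_wpM2l (normr_ge0 (v ord0 k)) H1; rewrite -normrM in H1.
rewrite big_cons S_cons; have S0 := S_ge0 s; have v0 := normr_ge0 (v ord0 k).
have X : 0 <= C * (`|v ord0 k| * S s) by rewrite !mulr_ge0.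
apply: (@le_trans _ _ (C * `|v ord0 k| ^+ 2 + `|v ord0 k| * (C * S s) + C * S s ^+ 2)).
  apply: le_trans (lerD (lerD H H1) H2).
  apply: le_trans (lerD (ler_normD _ _) (lexx _)); apply: le_trans (ler_normD _ _).
  by rewrite le_eqVlt; apply/orP; left; apply/eqP; congr Num.norm; ring.
by move: X; nra.
Qed.

Lemma taylor2 : `|p| + n%:R * enorm v <= M ->
  `|g (p + v) - g p - dotv (grad g p) v| <= C * (n%:R * enorm v) ^+ 2.
Proof.
move=> pM; have Sn : S (index_enum 'I_n) <= n%:R * enorm v.
  apply: (@le_trans _ _ (\sum_(k < n) enorm v)).
    by apply: ler_sum => k _; exact: coord_le_enorm.
  by rewrite sumr_const card_ord mulr_natl.
have eV : p + v = p + V (index_enum 'I_n) by congr (p + _); exact: row_sum_delta.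
have pM' : `|p| + S (index_enum 'I_n) <= M by apply: le_trans pM; rewrite lerD2l.
have := second_order pM'; rewrite -eV.
have -> : \sum_k v ord0 k * partial k g p = dotv (grad g p) v.
  by apply: eq_bigr => k _; rewrite mxE mulrC.
move/le_trans; apply; apply: ler_wpM2l => //.
by rewrite lerXn2r ?nnegrE ?mulr_ge0 ?enorm_ge0.
Qed.

End taylor.
End calculus.

(** * Countable families and rational approximation *)

Section countable.

Lemma aeD_count d (T : measurableType d) (R : realType) (mu : {measure set T -> \bar R})
    (D : set T) (J : countType) (P : J -> T -> Prop) :
  (forall j, aeD mu D (P j)) -> aeD mu D (fun x => forall j, P j x).
Proof.
move=> H; have H' k : aeD mu D (fun x => if unpickle k is Some j then P j x else True).
  by case: unpickle => [j|]; [exact: H|exact: aeDT].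
by apply: aeDS (aeD_nat H') => x _ Hx j; have := Hx (pickle j); rewrite pickleK.
Qed.

Context {R : realType} {n : nat}.
Implicit Types (x z : 'rV[R]_n).

Definition ratv (q : 'rV[rat]_n) : 'rV[R]_n := map_mx ratr q.

Lemma ratv_dense z (e : R) : 0 < e -> exists q, enorm (ratv q - z) < e.
Proof.
move=> e0; have d0 : 0 < e / n.+1%:R by rewrite divr_gt0.
have /choice[f Hf] : forall i : 'I_n, exists q : rat, `|ratr q - z ord0 i| <= e / n.+1%:R.
  move=> i; have lt : z ord0 i < z ord0 i + e / n.+1%:R by rewrite ltrDl.
  have [q] := rat_in_itvoo lt; rewrite in_itv /= => /andP[q1 q2]; exists q.
  by rewrite ger0_norm; move: q1 q2; move: (e / _) => t; lra.
exists (\row_i f i); apply: le_lt_trans (enorm_le_sum _) _.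
apply: (@le_lt_trans _ _ (\sum_(i < n) (e / n.+1%:R))).
  by apply: ler_sum => i _; rewrite !mxE.
rewrite big_const_ord iter_addr_0 -[(e / _) *+ n]mulr_natl mulrCA gtr_pMr//.
by rewrite ltr_pdivrMr// mul1r ltr_nat.
Qed.

Lemma nbhs_enorm x (A : set 'rV[R]_n) :
  nbhs x A <-> exists2 e : R, 0 < e & forall y, enorm (y - x) < e -> A y.
Proof.
split=> [/nbhs_ballP[e /= e0 eA]|[e e0 eA]].
  exists e => // y yx; apply: eA; rewrite -ball_normE /= distrC.
  exact: le_lt_trans (norm_le_enorm _) yx.
apply: (@filterS _ _ _ [set y | sqdist x y < e ^+ 2]).
  move=> y /=; rewrite sqdistE ltr_sqr ?nnegrE ?enorm_ge0 ?(ltW e0)//; exact: eA.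
apply: open_nbhs_nbhs; split; last by rewrite /= sqdistE subrr enorm0 expr0n exprn_gt0.
apply: (@open_comp _ _ (sqdist x) [set t | t < e ^+ 2]); last exact: open_lt.
by move=> y _; exact: (Ck_continuous (Ck_sqdist 0 x)).
Qed.

Lemma enorm_triangle x y z : enorm (x - z) <= enorm (x - y) + enorm (y - z).
Proof. by rewrite (le_trans _ (enormD _ _))// addrA subrK. Qed.

End countable.

(** * Propagation of positivity *)

Section spread.
Context {R : realType} {n : nat} (Om : set 'rV[R]_n.+1) (l m : R) (phi : R -> R).
Hypothesis adm : admissible l m phi.
Hypothesis dom : open Om /\ bounded_set Om.
Local Notation leb := (@lebesgue_rv R n.+1).
Variables (w : 'rV[R]_n.+1 -> R) (G : 'rV[R]_n.+1 -> 'rV[R]_n.+1).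
Hypothesis sup : supersolution Om phi w G.
Implicit Types (x y z u : 'rV[R]_n.+1).

Let oO : open Om. Proof. by case: dom. Qed.
Let bO : bounded_set Om. Proof. by case: dom. Qed.

Definition pos_at x := exists r c : R, [/\ 0 < r, 0 < c, eball x r `<=` Om &
  aeD leb Om (fun y => enorm (y - x) <= r -> c <= w y)].

(** The ball of radius 3 rho / 4 about y lies in Om and contains the ball of radius rho / 4 about x;
    there the distance to y is at most rho / 2, so the barrier is at least kap rho / 4. *)
Lemma pos_at_spread x (rho : R) y : 0 < rho -> eball x rho `<=` Om -> pos_at y ->
  enorm (y - x) < rho / 4 -> pos_at x.
Proof.
move=> rho0 BO [r [c [r0 c0 _ wc]]] yx.
pose r1 := Num.min r (rho / 2); have r10 : 0 < r1 by rewrite lt_min r0 divr_gt0.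
have R0 : 0 < 3 * rho / 4 by rewrite divr_gt0// mulr_gt0.
have [kap k0 Hk] := barrier adm dom sup r10 R0 c0.
have := Hk y (3 * rho / 4) _ (lexx _) _ _.
have -> : r1 <= 3 * rho / 4 by rewrite ge_min; apply/orP; right; move: rho0; lra.
move=> /(_ isT) H; exists (rho / 4), (kap * (rho / 4)); split.
- by rewrite divr_gt0.
- by rewrite mulr_gt0// divr_gt0.
- by move=> u ux; apply: BO; apply: le_trans ux _; move: rho0; lra.
have {}H : aeD leb Om (fun x => enorm (x - y) <= 3 * rho / 4 -> kap * (3 * rho / 4 - enorm (x - y)) <= w x).
  apply: H; first move=> u /= uy.
    apply: BO => /=; apply: (le_trans (enorm_triangle u y x)); rewrite /eball/= in uy; move: uy yx; lra.
  by apply: aeDS wc => u _ H ur; apply: H; apply: le_trans ur _; rewrite ge_min lexx.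
apply: aeDS H => u _ H ux; have uy : enorm (u - y) <= rho / 2.
  by apply: (le_trans (enorm_triangle u x y)); rewrite (enormBC x); move: ux yx; lra.
apply: le_trans (H _); last by move: uy rho0; lra.
by rewrite ler_wpM2l ?(ltW k0)//; move: uy; lra.
Qed.

(** The set of these points is open, and it is closed in Om because a point of its closure has
    points of the set arbitrarily near, from which [pos_at_spread] reaches it. *)
Lemma pos_at_all : connected Om -> (exists x, pos_at x) -> forall x, Om x -> pos_at x.
Proof.
move=> cO [x1 p1].
have PO x : pos_at x -> Om x.
  by move=> [r [c [r0 _ BO _]]]; apply: BO; rewrite /eball/= subrr enorm0 ltW.
suff -> : Om = [set x | pos_at x] by [].
apply/esym/cO; first by exists x1.
  exists [set x | pos_at x]; last by apply/seteqP; split=> x /=; [move=> p; split=> //; exact: PO|case].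
  rewrite openE => x [r [c [r0 c0 BO wc]]]; apply/nbhs_enorm; exists (r / 2); first by rewrite divr_gt0.
  have le y u : enorm (y - x) < r / 2 -> enorm (u - y) <= r / 2 -> enorm (u - x) <= r.
    by move=> yx uy; apply: (le_trans (enorm_triangle u y x)); move: yx uy; lra.
  move=> y yx; exists (r / 2), c; split=> //; first by rewrite divr_gt0.
    by move=> u uy; apply: BO; exact: le yx uy.
  by apply: aeDS wc => u _ H uy; apply: H; exact: le yx uy.
exists (closure [set x | pos_at x]); first exact: closed_closure.
apply/seteqP; split=> x /=; first by move=> p; split; [exact: PO|exact: subset_closure].
move=> [Ox cx]; have /nbhs_enorm[e e0 He] : nbhs x Om by apply: open_nbhs_nbhs.
have e2 : 0 < e / 2 by rewrite divr_gt0.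
have N : nbhs x [set y | enorm (y - x) < e / 2 / 4].
  by apply/nbhs_enorm; exists (e / 2 / 4) => //; rewrite divr_gt0.
have [y [py yx]] := cx _ N; apply: (@pos_at_spread x (e / 2) y) => //.
by move=> u ux; apply: He; apply: le_lt_trans ux _; move: e0; lra.
Qed.

Hypothesis pos : forall x, Om x -> pos_at x.

Lemma compact_inside (d : R) : 0 < d -> compact [set z | forall u, enorm (u - z) < d -> Om u].
Proof.
move=> d0; apply: bounded_closed_compact.
  have [M [Mr HM]] := bO; exists M; split=> // K MK z Hz; apply: (HM K MK); apply: Hz.
  by rewrite subrr enorm0.
rewrite -[X in closed X]setCK; apply: open_closedC.
rewrite openE => z /= /existsNP[u /not_implyP[uz nu]]; apply/nbhs_enorm.
exists (d - enorm (u - z)); first by rewrite subr_gt0.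
move=> y yz /(_ u) H; apply: nu; apply: H; apply: (le_lt_trans (enorm_triangle u z y)).
by rewrite (enormBC z); move: yz; lra.
Qed.

(** The points whose ball of radius d lies in Om form a compact set. One number t serves both as
    radius and as lower bound: the property weakens as t decreases, so finitely many neighbourhoods
    can be combined. *)
Lemma pos_uniform (d : R) : 0 < d -> exists2 t : R, 0 < t /\ t <= d & forall z,
  (forall u, enorm (u - z) < d -> Om u) -> aeD leb Om (fun x => enorm (x - z) <= t -> t <= w x).
Proof.
move=> d0; have cK := compact_inside d0; set K := [set z | _] in cK.
have H : \forall t \near (0 : R)^'+, K `<=` [set z | aeD leb Om (fun x => enorm (x - z) <= t -> t <= w x)].
  apply: ((compact_near_coveringP K).1 cK R (0^'+) (fun t z => aeD leb Om (fun x => enorm (x - z) <= t -> t <= w x)) _).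
  move=> z Kz; have Oz : Om z by apply: Kz; rewrite subrr enorm0.
  have [r [c [r0 c0 _ wc]]] := pos Oz; have r2 : 0 < r / 2 by rewrite divr_gt0.
  exists ([set y | enorm (y - z) < r / 2], [set t | t < Num.min (r / 2) c]) => /=.
    split; first by apply/nbhs_enorm; exists (r / 2).
    by apply: nbhs_right_lt; rewrite lt_min r2.
  move=> [y t] /= [yz]; rewrite lt_min => /andP[tr tc].
  apply: aeDS wc => u _ H uy; apply: (le_trans (ltW tc)); apply: H.
  by apply: (le_trans (enorm_triangle u y z)); move: uy yz tr; lra.
have P0 := nbhs_right_gt (0 : R); have Pd := nbhs_right_lt d0.
have [t [t0 [td Ht]]] := @filter_ex _ _ _ _ (filterI P0 (filterI Pd H)).
by exists t; [split=> //; exact: ltW|move=> z Kz; exact: Ht].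
Qed.

(** [pos_uniform] provides one starting radius and bound for all centres, hence one constant kap. A
    single exceptional set serves all balls, because each is approximated from inside by balls with
    rational centre and radius. *)
Lemma pos_balls (d Rm : R) : 0 < d -> 0 < Rm -> exists2 kap : R, 0 < kap &
  aeD leb Om (fun x => forall z rho, 2 * d <= rho -> rho <= Rm ->
    (forall u, enorm (u - z) < rho -> Om u) -> kap * (rho - enorm (x - z)) <= w x).
Proof.
move=> d0 R0; have [t [t0 td] Ht] := pos_uniform d0.
have [kap k0 Hk] := barrier adm dom sup t0 R0 t0.
exists kap => //; have [_ w0 _] := sup.
have E (j : 'rV[rat]_n.+1 * rat) : aeD leb Om (fun x => let z := ratv j.1 in let rho := ratr j.2 in
    d <= rho -> rho <= Rm -> eball z rho `<=` Om -> enorm (x - z) <= rho ->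
    kap * (rho - enorm (x - z)) <= w x).
  have [/= H|/= nH] := pselect (d <= ratr j.2 /\ ratr j.2 <= Rm /\ eball (ratv j.1) (ratr j.2) `<=` Om); last first.
    by apply: aeDT => x _ a b c; exfalso; exact: nH.
  have [a [b c]] := H; apply: aeDS (Hk (ratv j.1) (ratr j.2) (le_trans td a) b c _).
    by move=> x _ Hx _ _ _; exact: Hx.
  apply: Ht => u uz; apply: c; apply: le_trans (ltW uz) a.
apply: aeDS2 (aeD_count E) w0 => x Ox H w0 z rho dr rR BO.
apply/ler_addgt0Pr => e e0.
(* The rational ball loses at most 3 e1 in rho - |x - z|, which costs at most e; the bound d / 3
   keeps its radius at least d. *)
pose e1 := Num.min (d / 3) (e / (3 * kap)).
have e10 : 0 < e1 by rewrite lt_min !divr_gt0// mulr_gt0.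
have e1d : e1 <= d / 3 by rewrite ge_min lexx.
have e1e : kap * (3 * e1) <= e.
  by rewrite mulrCA mulrA -ler_pdivlMl ?mulr_gt0// mulrC ge_min lexx orbT.
have [q Hq] := ratv_dense z e10.
have lt : rho - 2 * e1 < rho - e1 by move: e10; lra.
have [s] := rat_in_itvoo lt; rewrite in_itv/= => /andP[s1 s2].
have := H (q, s) => /=; have xz := enorm_triangle x z (ratv q); have xz' := enorm_triangle x (ratv q) z.
rewrite (enormBC z) in xz.
have [xs|xs] := leP (enorm (x - ratv q)) (ratr s); last first.
  move=> _; apply: (@le_trans _ _ (kap * (3 * e1))).
    by rewrite ler_wpM2l ?(ltW k0)//; move: xz Hq s1 xs; lra.
  by rewrite (le_trans e1e)// lerDr.
move=> /(_ _ _ _ isT) H1; have {}H1 : kap * (ratr s - enorm (x - ratv q)) <= w x.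
  apply: H1.
  - by move: s1 e1d d0 dr; lra.
  - by move: s2 e10 rR; lra.
  - move=> u; rewrite /eball/= => us; apply: BO; apply: (le_lt_trans (enorm_triangle u (ratv q) z)).
    by move: us Hq s2; lra.
apply: (@le_trans _ _ (kap * (ratr s - enorm (x - ratv q)) + kap * (3 * e1))); last exact: lerD.
rewrite -mulrDr ler_wpM2l ?(ltW k0)//; move: xz Hq s1; lra.
Qed.

End spread.

(** * Interior balls at a smooth boundary *)

Section boundary.
Context {R : realType} {n : nat} (Om : set 'rV[R]_n.+1).
Hypothesis oO : open Om.
Hypothesis bO : bounded_set Om.
Implicit Types (x y z u : 'rV[R]_n.+1).
Local Notation dist := (dist_frontier Om).

Lemma dotv_ord (i : 'I_n.+1) x y :
  dotv x y = x ord0 i * y ord0 i + dotv (col' i x) (col' i y).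
Proof.
rewrite /dotv (bigD1_ord i)//=; congr (_ + _).
by apply: eq_bigr => k _; rewrite !mxE.
Qed.

Lemma enorm_col' (i : 'I_n.+1) x : enorm (col' i x) <= enorm x.
Proof. by rewrite ler_wsqrtr// (dotv_ord i x) lerDr -expr2 sqr_ge0. Qed.

Lemma dist_le x y : frontier Om y -> dist x <= enorm (x - y).
Proof.
move=> fy; apply: ge_inf; last by exists y.
by exists 0 => _ [z _ <-]; exact: enorm_ge0.
Qed.

Lemma dist_ge0 x : 0 <= dist x.
Proof.
have [[y fy]|nf] := pselect (frontier Om !=set0).
  by apply: lb_le_inf; [exists (enorm (x - y)), y|move=> _ [z _ <-]; exact: enorm_ge0].
(* The infimum of the empty set is 0 by convention. *)
rewrite /dist_frontier (_ : [set _ | _ in _] = set0) ?inf0//.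
by apply/seteqP; split=> t //= [y fy]; exfalso; apply: nf; exists y.
Qed.

Lemma enorm_le_norm m' (x : 'rV[R]_m') : enorm x <= m'%:R * `|x|.
Proof.
apply: (le_trans (enorm_le_sum x)); apply: (@le_trans _ _ (\sum_(k < m') `|x|)).
  by apply: ler_sum => k _; exact: ler_rv_norm.
by rewrite sumr_const card_ord mulr_natl.
Qed.

Lemma dist_bounded : exists2 D, 0 <= D & forall x, Om x -> dist x <= D.
Proof.
have [[y fy]|nf] := pselect (frontier Om !=set0); last first.
  exists 0 => // x _; rewrite /dist_frontier (_ : [set _ | _ in _] = set0) ?inf0//.
  by apply/seteqP; split=> t //= [y fy]; exfalso; apply: nf; exists y.
have [M [_ HM]] := bO; exists (n.+1%:R * (`|M| + 1) + enorm y) => [|x Ox].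
  by rewrite addr_ge0 ?enorm_ge0// mulr_ge0// addr_ge0.
apply: (le_trans (dist_le x fy)); apply: (le_trans (enormB x y)); rewrite lerD2r.
apply: (le_trans (enorm_le_norm x)); rewrite ler_wpM2l//.
by apply: HM => //; rewrite (le_lt_trans (ler_norm _))// ltrDl.
Qed.

Lemma compact_closure : compact (closure Om).
Proof.
apply: bounded_closed_compact; last exact: closed_closure.
have [M [Mr HM]] := bO; exists M; split=> // K MK; have cK := @closed_le R K.
have cN : closed [set x : 'rV[R]_n.+1 | `|x| <= K].
  by apply: (@preimage_closed _ _ (fun x : 'rV[R]_n.+1 => `|x|)) cK => x _; exact: norm_continuous.
suff : closure Om `<=` [set x : 'rV[R]_n.+1 | `|x| <= K] by [].
by rewrite [X in _ `<=` X]((closure_id _).1 cN); apply: closureS; exact: (HM K MK).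
Qed.

Section graph.
Variables (x0 : 'rV[R]_n.+1) (r : R) (i : 'I_n.+1) (b : bool) (g : 'rV[R]_n -> R).
Hypothesis fx0 : frontier Om x0.
Hypothesis r0 : 0 < r.
Hypothesis sg : smooth g.
Hypothesis HOm : forall x, enorm (x - x0) < r ->
  (Om x <-> g (col' i x) < (-1) ^+ b * x ord0 i).
Local Notation sgn := ((-1) ^+ b : R).
Local Notation e_i := (delta_mx ord0 i : 'rV[R]_n.+1).

Definition height x := sgn * x ord0 i - g (col' i x).

Let sgn2 : sgn * sgn = 1. Proof. by rewrite -expr2 sqrr_sign. Qed.

Let Om_height x : enorm (x - x0) < r -> (Om x <-> 0 < height x).
Proof. by move=> /HOm; rewrite subr_gt0. Qed.

Let col'_e : col' i e_i = 0.
Proof. by apply/rowP => k; rewrite !mxE eqxx (negPf (_ : lift i k != i))// eq_sym neq_lift. Qed.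

Let e_ii : e_i ord0 i = 1. Proof. by rewrite mxE !eqxx. Qed.

Let col'_line x t : col' i (x + t *: e_i) = col' i x.
Proof. by rewrite linearD linearZ /= col'_e scaler0 addr0. Qed.

Let height_line x t : height (x + (t * sgn) *: e_i) = height x + t.
Proof.
rewrite /height col'_line !mxE !eqxx mulr1.
have -> : sgn * (x ord0 i + t * sgn) = sgn * x ord0 i + t * (sgn * sgn) by ring.
by rewrite sgn2; ring.
Qed.

Lemma continuous_col' : continuous (fun x : 'rV[R]_n.+1 => col' i x : 'rV[R]_n).
Proof.
have -> : (fun x : 'rV[R]_n.+1 => col' i x : 'rV[R]_n) = fun x => \sum_k x ord0 (lift i k) *: (delta_mx ord0 k : 'rV[R]_n).
  apply/funext => x; rewrite [LHS]row_sum_delta; apply: eq_bigr => k _; by rewrite mxE.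
by apply: continuous_rv_sum => k; exact: continuous_coord_scale.
Qed.

Lemma continuous_height : continuous height.
Proof.
have cg : continuous g := Ck_continuous ((smoothP g).1 sg 0%N).
have c1 : continuous (fun x : 'rV[R]_n.+1 => sgn * x ord0 i).
  by apply: (Ck_continuous (k := 0%N)); apply: Ck_Z; exact: Ck_coord.
move=> x; apply: (@cvgB _ _ _ (nbhs x) (nbhs_filter x)); first exact: c1.
apply: (@continuous_comp _ _ _ (fun x : 'rV[R]_n.+1 => col' i x : 'rV[R]_n) g); [exact: continuous_col'|exact: cg].
Qed.

Lemma height_frontier : height x0 = 0.
Proof.
have [cx nx] := fx0; rewrite (interior_id Om).1// in nx.
have z0 : enorm (x0 - x0) < r by rewrite subrr enorm0.
apply/eqP; rewrite eq_le; apply/andP; split.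
  by rewrite leNgt; apply/negP => h0; apply: nx; apply/(Om_height z0).
rewrite leNgt; apply/negP => h0.
have N1 : nbhs x0 [set x | height x < 0].
  apply: open_nbhs_nbhs; split=> //; apply: (@open_comp _ _ height [set t | t < 0]); last exact: open_lt.
  by move=> x _; exact: continuous_height.
have N2 : nbhs x0 [set x | enorm (x - x0) < r] by apply/nbhs_enorm; exists r.
have [x [Ox [/= hx xr]]] := cx _ (filterI N1 N2).
by have := (Om_height xr).1 Ox; rewrite ltNge ltW.
Qed.

(** The point of the graph vertically below x, at distance [height x], belongs to the frontier. *)
Lemma dist_height x : Om x -> enorm (x - x0) < r / 2 -> height x < r / 2 -> dist x <= height x.
Proof.
move=> Ox xr hr; have xr' : enorm (x - x0) < r by move: xr r0; lra.
have h0 := (Om_height xr').1 Ox.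
pose y := x + (- height x * sgn) *: e_i.
have ye : enorm (x - y) = height x.
  rewrite /y opprD addrA subrr add0r enormN enormZ normrM normrN normr_sign mulr1 (ger0_norm (ltW h0)).
  by rewrite /enorm (dotv_ord i) col'_e e_ii /dotv big1 ?addr0 ?mulr1 ?sqrtr1 ?mulr1// => k _; rewrite mxE mul0r.
apply: (@le_trans _ _ (enorm (x - y))); last by rewrite ye.
apply: dist_le.
have yr : enorm (y - x0) < r.
  by apply: (le_lt_trans (enorm_triangle y x x0)); rewrite (enormBC y) ye; move: xr hr; lra.
have hy : height y = 0 by rewrite /y height_line; ring.
split; last by move/interior_subset => /(Om_height yr).1; rewrite hy ltxx.
(* Points slightly above y have positive height and lie in Om, so y is in the closure. *)
move=> B NB; have NB' : nbhs y (B `&` [set u | enorm (u - x0) < r]).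
  apply: filterI => //; apply/nbhs_enorm; exists (r - enorm (y - x0)); first by rewrite subr_gt0.
  by move=> u uy /=; apply: (le_lt_trans (enorm_triangle u y x0)); move: uy; lra.
have NL := nbhs_line (sgn *: e_i) NB'.
have NP : \forall t \near (0 : R)^'+, (B `&` [set u | enorm (u - x0) < r]) (y + t *: (sgn *: e_i)).
  exact: (cvg_at_right_filter (f := id) cvg_id NL).
have [t [t0 [Bt rt]]] := @filter_ex _ _ _ _ (filterI (nbhs_right_gt (0 : R)) NP).
exists (y + t *: (sgn *: e_i)); split=> //; apply/(Om_height rt).
by rewrite scalerA height_line hy add0r.
Qed.

(** For x near x0 the ball touches the graph at the point y below x, and its centre lies on the
    inner normal through y. The second-order Taylor bound of g keeps a ball of sufficiently small
    radius above the graph; x lies in it at a depth comparable to its height, which majorises the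
    distance to the frontier. *)
Lemma boundary_balls : exists s d Rm c1 : R, [/\ 0 < s, 0 < d, 0 < Rm, 0 < c1 &
  forall x, Om x -> enorm (x - x0) < s -> exists z rho,
   [/\ 2 * d <= rho, rho <= Rm, forall u, enorm (u - z) < rho -> Om u &
       c1 * dist x <= rho - enorm (x - z)]].
Proof.
have Cg k : Ck k g := (smoothP g).1 sg k.
pose N : R := n%:R; have N0 : 0 <= N by [].
pose M := `|col' i x0 : 'rV[R]_n| + r + N * r.
have bM : bounded_set [set p : 'rV[R]_n | `|p| <= M] by exact: rv_ball_bounded.
have /choice[Lf HLf] : forall k, exists C, forall p, `|p| <= M -> `|partial k g p| <= C.
  move=> k; have [C C0 HC] := continuous_bounded_on bM (Ck_continuous (Ck_partial k (Cg 1%N))).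
  by exists C.
have /choice[Cf HCf] : forall k : 'I_n * 'I_n, exists C, forall p, `|p| <= M -> `|partial k.1 (partial k.2 g) p| <= C.
  move=> k; have [C C0 HC] := continuous_bounded_on bM (Ck_continuous (Ck_partial k.1 (Ck_partial k.2 (Cg 2%N)))).
  by exists C.
pose L := \sum_k `|Lf k|; have L0 : 0 <= L by apply: sumr_ge0.
pose C := \sum_k `|Cf k|; have C0 : 0 <= C by apply: sumr_ge0.
have HC k j p : `|p| <= M -> `|partial k (partial j g) p| <= C.
  move=> pM; apply: (le_trans (HCf (k, j) p pM)); apply: (le_trans (ler_norm _)).
  by rewrite /C (bigD1 (k, j))//= lerDl sumr_ge0.
have HL p : `|p| <= M -> enorm (grad g p) <= L.
  move=> pM; apply: (le_trans (enorm_le_sum _)); apply: ler_sum => k _.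
  by rewrite mxE; apply: (le_trans (HLf k p pM)); exact: ler_norm.
pose Nm := 1 + L; have Nm1 : 1 <= Nm by rewrite lerDl.
have Nm0 : 0 < Nm := lt_le_trans ltr01 Nm1.
pose T := C * N ^+ 2; have T0 : 0 <= T by rewrite mulr_ge0// exprn_ge0.
(* The first bound makes the quadratic Taylor remainder smaller than the linear term; the second
   keeps the ball inside the region where Om is given by the graph. *)
pose p0 := Num.min (1 / (2 * (T + 1))) (r / (4 * Nm)).
have p00 : 0 < p0 by rewrite lt_min !divr_gt0// mulr_gt0// ltr_wpDl.
have p0T : T * (2 * p0) < 1.
  have : p0 <= 1 / (2 * (T + 1)) by rewrite ge_min lexx.
  rewrite ler_pdivlMr ?mulr_gt0 ?ltr_wpDl//; move: p00; nra.
have p0r : 2 * p0 * Nm <= r / 2.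
  have : p0 <= r / (4 * Nm) by rewrite ge_min lexx orbT.
  rewrite ler_pdivlMr ?mulr_gt0//; lra.
have Nh : nbhs x0 [set x | `|height x| < Num.min (r / 8) p0].
  apply: open_nbhs_nbhs; split; last by rewrite /= height_frontier normr0 lt_min p00 divr_gt0.
  apply: (@open_comp _ _ (fun x => `|height x|) [set t | t < Num.min (r / 8) p0]); last exact: open_lt.
  by move=> x _; apply: (@continuous_comp _ _ _ height (fun t : R => `|t|)); [exact: continuous_height|exact: norm_continuous].
have [s1 s10 Hs1] := (nbhs_enorm _ _).1 Nh.
exists (Num.min s1 (r / 8)), (p0 / 2), (p0 * Nm), (2 * Nm)^-1; split.
- by rewrite lt_min s10 divr_gt0.
- by rewrite divr_gt0.
- by rewrite mulr_gt0.
- by rewrite invr_gt0 mulr_gt0.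
move=> x Ox; rewrite lt_min => /andP[xs1 xr8].
have := Hs1 x xs1 => /=; rewrite lt_min => /andP[tr tp].
have xr : enorm (x - x0) < r by move: xr8 r0; lra.
have t0 := (Om_height xr).1 Ox.
rewrite gtr0_norm// in tr tp; set t := height x in tr tp t0.
have dx : dist x <= t by apply: dist_height => //; [move: xr8 r0; lra|move: tr r0; rewrite -/t; lra].
pose p : 'rV[R]_n := col' i x.
have pM : `|p| <= `|col' i x0 : 'rV[R]_n| + r.
  rewrite -[p](subrK (col' i x0)); apply: (le_trans (ler_normD _ _)).
  rewrite addrC lerD2l -linearB /=; apply: (le_trans (norm_le_enorm _)).
  exact: le_trans (enorm_col' _ _) (ltW xr).
have pM' : `|p| <= M by rewrite (le_trans pM)// lerDl mulr_ge0// ltW.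
(* The inner normal, not normalised: its vertical component is a unit, which simplifies its product
   with x - y, and its length is between 1 and Nm. *)
pose nu : 'rV[R]_n.+1 := \row_j (if unlift i j is Some k then - grad g p ord0 k else sgn).
have nui : nu ord0 i = sgn by rewrite mxE unlift_none.
have nuc : col' i nu = - grad g p by apply/rowP => k; rewrite !mxE liftK mxE.
have nu2 : enorm nu ^+ 2 = 1 + enorm (grad g p) ^+ 2.
  by rewrite !enorm_sqr (dotv_ord i) nui nuc sgn2 dotvNl dotvNr opprK.
have nu0 := enorm_ge0 nu; have g0 := enorm_ge0 (grad g p); have gL := HL p pM'.
have nu1 : 1 <= enorm nu.
  by rewrite -(@ler_sqr _ 1) ?nnegrE// expr1n nu2 lerDl sqr_ge0.
have nuN : enorm nu <= Nm.
  rewrite -ler_sqr ?nnegrE ?(ltW Nm0)// nu2 /Nm; move: gL g0 L0; move: (enorm _) => e; nra.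
(* y is the point of the graph below x; the sphere of radius rho about z passes through y. *)
pose y := x - (t * sgn) *: e_i; pose z := y + p0 *: nu; pose rho := p0 * enorm nu.
have rho0 : 0 < rho by rewrite mulr_gt0// (lt_le_trans ltr01).
have rhor : rho <= p0 * Nm by rewrite ler_wpM2l// ltW.
have ee : enorm e_i = 1.
  by rewrite /enorm (dotv_ord i) col'_e e_ii /dotv big1 ?addr0 ?mulr1 ?sqrtr1// => k _; rewrite mxE mul0r.
have xy : enorm (x - y) = t.
  by rewrite /y opprB addrC subrK enormZ normrM normr_sign mulr1 (gtr0_norm t0) ee mulr1.
have cy : col' i y = p by rewrite /y -scaleNr col'_line.
have gy : sgn * y ord0 i = g p.
  have := height_line x (- t); rewrite mulNr scaleNr -/y -/t subrr /height cy => /eqP.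
  by rewrite subr_eq0 => /eqP.
have enu : dotv e_i nu = sgn.
  by rewrite (dotv_ord i) e_ii nui mul1r col'_e /dotv big1 ?addr0// => k _; rewrite mxE mul0r.
exists z, rho; split.
- by rewrite mulrC divfK// /rho ler_pMr.
- exact: rhor.
- move=> u uz; have [v Ev] : exists v, v = u - y by exists (u - y).
  have vz : u - z = v - p0 *: nu by rewrite /z Ev opprD addrA.
  (* The inequality |u - z| < rho, expanded about the boundary point y. *)
  have v2 : enorm v ^+ 2 < 2 * p0 * dotv v nu.
    have : enorm (u - z) ^+ 2 < rho ^+ 2 by rewrite ltr_sqr ?nnegrE ?enorm_ge0// ltW.
    rewrite vz !enorm_sqr dotvBl !dotvBr !dotvZr !dotvZl (dotvC nu v) /rho exprMn enorm_sqr.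
    by move: (dotv _ _) (dotv _ _) (dotv _ _) => c1 c2 c3; nra.
  have vn : enorm v <= r.
    have : enorm v <= enorm (u - z) + enorm (p0 *: nu) by rewrite vz (le_trans _ (enormD _ _))// subrK.
    rewrite enormZ (gtr0_norm p00) -/rho; move: uz rhor p0r r0; lra.
  have ur : enorm (u - x0) < r.
    have := enorm_triangle u y x0; have := enorm_triangle y x x0; rewrite (enormBC y x) xy -Ev.
    have : enorm v <= enorm (u - z) + enorm (p0 *: nu) by rewrite vz (le_trans _ (enormD _ _))// subrK.
    rewrite enormZ (gtr0_norm p00) -/rho; move: uz rhor p0r r0 tr xr8; lra.
  apply/(HOm ur); pose q : 'rV[R]_n := col' i v.
  have qv : enorm q <= enorm v by exact: enorm_col'.
  have uq : col' i u = p + q by rewrite /q Ev linearB /= cy addrC subrK.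
  have pq : `|p| + N * enorm q <= M.
    by apply: lerD => //; apply: ler_wpM2l => //; exact: le_trans qv vn.
  have := taylor2 sg C0 HC pq; rewrite -/N => Ty.
  have {}Ty : g (p + q) - g p - dotv (grad g p) q <= T * enorm v ^+ 2.
    apply: (le_trans (ler_norm _)); apply: (le_trans Ty); rewrite /T exprMn mulrA ler_wpM2l//.
    by rewrite ler_sqr ?nnegrE ?enorm_ge0.
  have vnu : dotv v nu = sgn * v ord0 i - dotv (grad g p) q.
    by rewrite (dotv_ord i) nui nuc dotvNr (dotvC _ (grad _ _)) mulrC.
  have su : sgn * u ord0 i = sgn * v ord0 i + g p by rewrite -gy Ev !mxE; ring.
  rewrite uq su; have v0 : 0 <= enorm v ^+ 2 by rewrite sqr_ge0.
  have strict : T * enorm v ^+ 2 < dotv v nu.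
    have : 0 < dotv v nu by have := le_lt_trans v0 v2; rewrite pmulr_rgt0// mulr_gt0.
    have := ler_wpM2l T0 (ltW v2).
    move: p0T; move: (dotv v nu) (enorm v ^+ 2) => c1 c2; nra.
  by move: Ty strict; rewrite vnu; lra.
(* The product of x - y with nu is t, so rho^2 - D^2 = 2 t p0 - t^2 >= t p0; dividing by rho + D <=
   2 p0 Nm gives the depth, and the constant 1 / (2 Nm). *)
- have D2 : enorm (x - z) ^+ 2 = t ^+ 2 - 2 * t * p0 + rho ^+ 2.
    have -> : x - z = (t * sgn) *: e_i - p0 *: nu.
      by rewrite /z /y opprD addrA opprB addrCA subrr addr0.
    rewrite enorm_sqr dotvBl !dotvBr !dotvZr !dotvZl (dotvC nu) enu.
    have -> : dotv e_i e_i = 1 by rewrite -enorm_sqr ee expr1n.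
    rewrite /rho exprMn (enorm_sqr nu).
    have -> : t * sgn * (t * sgn * 1) - p0 * (t * sgn * sgn) - (t * sgn * (p0 * sgn) - p0 * (p0 * dotv nu nu)) =
      t ^+ 2 * (sgn * sgn) - 2 * t * p0 * (sgn * sgn) + p0 ^+ 2 * dotv nu nu by ring.
    by rewrite sgn2 !mulr1.
  have D0 := enorm_ge0 (x - z); set D := enorm (x - z) in D2 D0 *.
  have Dr : D <= rho.
    rewrite -ler_sqr ?nnegrE ?(ltW rho0)// D2; move: tp t0 p00; nra.
  apply: (@le_trans _ _ ((2 * Nm)^-1 * t)); first by rewrite ler_wpM2l// invr_ge0 mulr_ge0// ltW.
  rewrite ler_pdivrMl ?mulr_gt0//.
  have : t * p0 <= (rho - D) * (rho + D) by rewrite -subr_sqr D2; move: tp t0; nra.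
  have : (rho - D) * (rho + D) <= (rho - D) * (2 * (p0 * Nm)).
    by apply: ler_wpM2l; [rewrite subr_ge0|move: Dr rhor; lra].
  move=> h1 h2; rewrite -(ler_pM2r p00); apply: (le_trans h2); apply: (le_trans h1).
  by rewrite le_eqVlt; apply/orP; left; apply/eqP; ring.
Qed.

End graph.

Lemma Om_balls x0 : Om x0 -> exists s d Rm c1 : R, [/\ 0 < s, 0 < d, 0 < Rm, 0 < c1 &
  forall x, Om x -> enorm (x - x0) < s -> exists z rho,
   [/\ 2 * d <= rho, rho <= Rm, forall u, enorm (u - z) < rho -> Om u &
       c1 * dist x <= rho - enorm (x - z)]].
Proof.
move=> Ox0; have [e e0 He] : exists2 e : R, 0 < e & forall u, enorm (u - x0) < e -> Om u.
  by apply/nbhs_enorm; apply: open_nbhs_nbhs.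
have [D D0 HD] := dist_bounded.
exists (e / 2), (e / 2), e, (e / 2 / (D + 1)); split => //; try by rewrite !divr_gt0// ltr_wpDl.
move=> x Ox xe; exists x0, e; split=> //; first by rewrite mulrC divfK.
apply: (@le_trans _ _ (e / 2)); last by move: xe; lra.
rewrite -mulrA ler_piMr ?divr_ge0 ?(ltW e0)// mulrC ler_pdivrMr ?ltr_wpDl// mul1r.
by rewrite (le_trans (HD _ Ox))// lerDl.
Qed.

Hypothesis sb : smooth_boundary Om.

Lemma closure_balls x0 : closure Om x0 -> exists s d Rm c1 : R, [/\ 0 < s, 0 < d, 0 < Rm, 0 < c1 &
  forall x, Om x -> enorm (x - x0) < s -> exists z rho,
   [/\ 2 * d <= rho, rho <= Rm, forall u, enorm (u - z) < rho -> Om u &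
       c1 * dist x <= rho - enorm (x - z)]].
Proof.
move=> cx; have [Ox|nO] := pselect (Om x0); first exact: Om_balls.
have fx : frontier Om x0 by split=> //; rewrite (interior_id Om).1.
have [r [i [b [g [r0 sg H]]]]] := sb fx.
exact: (boundary_balls fx r0 sg H).
Qed.

Context (l m : R) (phi : R -> R).
Hypothesis adm : admissible l m phi.
Local Notation leb := (@lebesgue_rv R n.+1).

(** Near each point of the closure, interior balls and [pos_balls] give the bound. Again one number
    t is both the radius and the constant, so compactness of the closure makes it uniform. *)
Lemma hopf (w : 'rV[R]_n.+1 -> R) (G : 'rV[R]_n.+1 -> 'rV[R]_n.+1) :
  connected Om -> supersolution Om phi w G -> ~ aeD leb Om (fun x => w x = 0) ->
  exists2 C : R, 0 < C & aeD leb Om (fun x => C * dist x <= w x).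
Proof.
move=> cO sup nw; have dom : open Om /\ bounded_set Om by [].
have [x1 [r1 [c1 [r10 c10 B1 W1]]]] := positive_ball adm dom sup nw.
have pos := pos_at_all adm dom sup cO (ex_intro _ x1 (ex_intro _ r1 (ex_intro _ c1 (And4 r10 c10 B1 W1)))).
pose Q (t : R) x := aeD leb Om (fun u => enorm (u - x) <= t -> t * dist u <= w u).
have cK := compact_closure.
have H : \forall t \near (0 : R)^'+, closure Om `<=` [set x | Q t x].
  apply: ((compact_near_coveringP (closure Om)).1 cK R (0^'+) Q _) => x0 cx.
  have [s [d [Rm [c [s0 d0 R0 c0 Hb]]]]] := closure_balls cx.
  have [kap k0 Hk] := pos_balls adm dom sup pos d0 R0.
  have s2 : 0 < s / 2 by rewrite divr_gt0.
  exists ([set y | enorm (y - x0) < s / 2], [set t | t < Num.min (s / 2) (kap * c)]) => /=.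
    split; first by apply/nbhs_enorm; exists (s / 2).
    by apply: nbhs_right_lt; rewrite lt_min s2 mulr_gt0.
  move=> [y t] /= [yx]; rewrite lt_min => /andP[ts tk].
  apply: aeDS Hk => u Ou Hu uy.
  have us : enorm (u - x0) < s.
    by apply: (le_lt_trans (enorm_triangle u y x0)); move: uy ts yx; lra.
  have [z [rho [a1 a2 a3 a4]]] := Hb u Ou us.
  apply: le_trans (Hu z rho a1 a2 a3); apply: (@le_trans _ _ (kap * (c * dist u))).
    by rewrite mulrA ler_wpM2r ?dist_ge0// ltW.
  by rewrite ler_wpM2l// ltW.
have [t [t0 Ht]] := @filter_ex _ _ _ _ (filterI (nbhs_right_gt (0 : R)) H).
exists t => //.
(* Rational points of the closure suffice as centres, so that countably many exceptional sets are
   united. *)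
have E (q : 'rV[rat]_n.+1) : aeD leb Om (fun u => closure Om (ratv q) -> enorm (u - ratv q) <= t -> t * dist u <= w u).
  have [cq|nq] := pselect (closure Om (ratv q : 'rV[R]_n.+1)); last by apply: aeDT.
  by apply: aeDS (Ht _ cq) => u _ Hu _; exact: Hu.
apply: aeDS (aeD_count E) => u Ou Hu.
have [e e0 He] : exists2 e : R, 0 < e & forall y, enorm (y - u) < e -> Om y.
  by apply/nbhs_enorm; apply: open_nbhs_nbhs.
have et : 0 < Num.min e t by rewrite lt_min e0.
have [q Hq] := ratv_dense u et.
have := Hq; rewrite lt_min => /andP[qe qt]; apply: (Hu q); first by apply: subset_closure; exact: He.
by rewrite enormBC ltW.
Qed.

End boundary.

(** * Luxemburg norms *)

Section luxemburg.
Context {R : realType} {n : nat} (Om : set 'rV[R]_n).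
Hypothesis mO : measurable Om.
Local Notation leb := (@lebesgue_rv R n).
Implicit Types (u v f : 'rV[R]_n -> R) (Psi : R -> R).

Lemma L1_integral_lty f : measurable_fun Om f -> (forall x, 0 <= f x) ->
  (\int[leb]_(x in Om) (f x)%:E < +oo)%E -> L1 leb Om f.
Proof.
move=> mf f0 fin; apply/integrableP; split; first exact/measurable_EFinP.
by under eq_integral => x _ do rewrite /= ger0_norm//.
Qed.

Lemma luxemburg_ge0 Psi u : (0 <= luxemburg Om Psi u)%E.
Proof. by apply: le_ereal_inf_tmp => _ [l [l0 _] <-]; rewrite lee_fin ltW. Qed.

Lemma luxemburg_le Psi u (lam : R) : 0 < lam -> L1 leb Om (fun x => Psi (u x / lam)) ->
  I leb Om (fun x => Psi (u x / lam)) <= 1 -> (luxemburg Om Psi u <= lam%:E)%E.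
Proof.
by move=> l0 L I1; apply: ereal_inf_lbound; exists lam => //; split => //; rewrite (EFin_I mO L) lee_fin.
Qed.

Lemma luxemburg_lt Psi u (y : \bar R) : measurable_fun Om u ->
  (forall c, 0 < c -> measurable_fun Om (fun x => Psi (u x / c))) -> (forall t, 0 <= Psi t) ->
  (luxemburg Om Psi u < y)%E -> exists2 lam : R, 0 < lam /\ (lam%:E < y)%E &
    L1 leb Om (fun x => Psi (u x / lam)) /\ I leb Om (fun x => Psi (u x / lam)) <= 1.
Proof.
move=> mu mP P0 /ereal_inf_lt[_ [lam [l0 Il] <-] ly]; exists lam => //.
have L : L1 leb Om (fun x => Psi (u x / lam)).
  by apply: L1_integral_lty => //; [exact: mP|exact: le_lt_trans Il (ltry _)].
by split=> //; rewrite -lee_fin -(EFin_I mO L).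
Qed.

End luxemburg.

(** * Equivalence of modular and norm closures *)

Section W10.
Context {R : realType} {n : nat} (Om : set 'rV[R]_n.+1) (l m : R) (phi : R -> R).
Hypothesis adm : admissible l m phi.
Hypothesis dom : open Om /\ bounded_set Om.
Local Notation N := n.+1.
Local Notation P := (NPhi phi).
Local Notation leb := (@lebesgue_rv R N).
Local Notation W0 := (W0 Om phi).
Implicit Types (u v : 'rV[R]_N -> R) (G : 'rV[R]_N -> 'rV[R]_N).

Let mO : measurable Om. Proof. exact: open_rv_measurable dom.1. Qed.
Let l0 : 0 < l. Proof. exact: lt_trans ltr01 (l_gt1 adm). Qed.
Let m0 : 0 < m. Proof. exact: lt_le_trans l0 (lm_le adm). Qed.

Let mPd v c : measurable_fun Om v -> measurable_fun Om (fun x => P (v x / c)).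
Proof. by move=> mv; apply: (meas_NPhi adm); apply: measurable_funM => //; exact: measurable_cst. Qed.

(** Below 1, the norm and the modular control each other through the powers m and l;
    [luxemburg_modular] is the opposite direction. *)
Lemma luxemburg_small v (e : R) : 0 < e -> e <= 1 -> measurable_fun Om v ->
  L1 leb Om (fun x => P (v x)) -> I leb Om (fun x => P (v x)) <= e `^ m ->
  (luxemburg Om P v <= e%:E)%E.
Proof.
move=> e0 e1 mv L Ie; have i1 : 1 <= e^-1 by rewrite -invr1 lef_pV2// posrE.
have b x : P (v x / e) <= e^-1 `^ m * P (v x) by rewrite mulrC; exact: (NPhi_scale_up adm).
have L' : L1 leb Om (fun x => P (v x / e)).
  apply: (L1_le mO (mPd _ mv) (L1Z mO (e^-1 `^ m) L)) => x _.
  by rewrite ger0_norm ?(NPhi_ge0 adm).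
apply: luxemburg_le => //.
apply: (le_trans (I_le mO L' (L1Z mO (e^-1 `^ m) L) (fun x _ => b x))).
rewrite (I_Z mO _ L); apply: (le_trans (ler_wpM2l (powR_ge0 _ _) Ie)).
by rewrite -powRM ?invr_ge0 ?(ltW e0)// mulVf ?gt_eqF// powR1.
Qed.

Lemma luxemburg_fin v : measurable_fun Om v -> L1 leb Om (fun x => P (v x)) ->
  (luxemburg Om P v < +oo)%E.
Proof.
move=> mv L; set i := I leb Om (fun x => P (v x)).
have i0 : 0 <= i by apply: I_ge0 => x _; exact: (NPhi_ge0 adm).
have k0 : 0 < i + 1 by rewrite ltr_wpDl.
have b x : P (v x / (i + 1)) <= (i + 1)^-1 * P (v x).
  rewrite mulrC; apply: (le_trans (NPhi_contract adm _ _ _)).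
  - by rewrite invr_ge0 ltW.
  - by rewrite invf_le1// lerDr.
  - rewrite ler_wpM2r ?(NPhi_ge0 adm)//; apply: powR_contract; last exact: ltW (l_gt1 adm).
    by rewrite invr_ge0 (ltW k0)/= invf_le1// lerDr.
have L' : L1 leb Om (fun x => P (v x / (i + 1))).
  apply: (L1_le mO (mPd _ mv) (L1Z mO (i + 1)^-1 L)) => x _.
  by rewrite ger0_norm ?(NPhi_ge0 adm).
apply: le_lt_trans (ltry (i + 1)); apply: luxemburg_le => //.
apply: (le_trans (I_le mO L' (L1Z mO (i + 1)^-1 L) (fun x _ => b x))).
by rewrite (I_Z mO _ L) -/i ler_pdivrMl// mulr1 lerDl.
Qed.

Lemma luxemburg_modular v (e : R) : e <= 1 -> measurable_fun Om v ->
  (luxemburg Om P v < e%:E)%E ->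
  L1 leb Om (fun x => P (v x)) /\ I leb Om (fun x => P (v x)) <= e `^ l.
Proof.
move=> e1 mv /(luxemburg_lt mO mv (fun c _ => mPd c mv) (NPhi_ge0 adm))[k [k0 ke] [L I1]].
rewrite lte_fin in ke; have kk1 := le_trans (ltW ke) e1.
have b x : P (v x) <= k `^ l * P (v x / k).
  have := NPhi_contract adm (v x / k) (ltW k0) kk1.
  by rewrite mulrC divfK// gt_eqF.
have L' : L1 leb Om (fun x => P (v x)).
  apply: (L1_le mO (meas_NPhi adm mv) (L1Z mO (k `^ l) L)) => x _.
  by rewrite ger0_norm ?(NPhi_ge0 adm).
split=> //; apply: (le_trans (I_le mO L' (L1Z mO (k `^ l) L) (fun x _ => b x))).
rewrite (I_Z mO _ L); apply: (@le_trans _ _ (k `^ l)).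
  by rewrite ler_piMr// powR_ge0.
by apply: ge0_ler_powR; rewrite ?nnegrE ?(ltW k0) ?(ltW l0) ?(ltW ke)// (le_trans (ltW k0)) ?ltW.
Qed.

Lemma NPhi_enorm_sum (x : 'rV[R]_N) :
  P (enorm x) <= (2 `^ m) ^+ N * \sum_i P (x ord0 i).
Proof.
have K1 : 1 <= 2 `^ m :> R.
  by rewrite -[X in X <= _](powRr0 2); apply: ler_powR; [rewrite ler1n|exact: ltW].
have K0 := le_trans ler01 K1.
apply: (@le_trans _ _ (P (\sum_i `|x ord0 i|))).
  by apply: (NPhi_le adm); [exact: enorm_ge0|exact: enorm_le_sum].
have H (s : seq 'I_N) : P (\sum_(i <- s) `|x ord0 i|) <= (2 `^ m) ^+ size s * \sum_(i <- s) P (x ord0 i).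
  elim: s => [|i s IH]; first by rewrite !big_nil (NPhi0 phi) mulr0.
  rewrite !big_cons /= exprS -mulrA; apply: (le_trans (NPhi_add adm _ _)).
  apply: ler_wpM2l => //; rewrite mulrDr; apply: lerD => //.
  by rewrite (NPhi_norm adm) ler_peMl ?(NPhi_ge0 adm)// exprn_ege1.
by have := H (enum 'I_N); rewrite size_enum_ord !big_enum.
Qed.

Lemma W0_W10 u G : W0 u G -> W10 Om P u G.
Proof.
move=> W; have coordL v H i : W0 v H -> measurable_fun Om (fun x => H x ord0 i) /\ L1 leb Om (fun x => P (H x ord0 i)) /\
   I leb Om (fun x => P (H x ord0 i)) <= I leb Om (fun x => P (enorm (H x))).
  move=> Wv; have mH := W0_vmeas Wv i; have LH := W0_L1G adm dom Wv.
  have b x : P (H x ord0 i) <= P (enorm (H x)).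
    by apply: (NPhi_le_norm adm); rewrite (ger0_norm (enorm_ge0 _)); exact: coord_le_enorm.
  have L : L1 leb Om (fun x => P (H x ord0 i)).
    by apply: (L1_le mO (meas_NPhi adm mH) LH) => x _; rewrite ger0_norm ?(NPhi_ge0 adm).
  by split=> //; split=> //; exact: (I_le mO L LH).
split.
  split; first by split; [exact: W0_meas W|apply: luxemburg_fin (W0_meas W) (W0_L1u adm dom W)].
    by move=> i; have [a [b _]] := coordL _ _ i W; split=> //; exact: luxemburg_fin.
  move=> i psi tp; have [_ _ E] := W0_by_parts adm dom i (test_Ck 1 tp) W.
  rewrite -!IE; have -> : I leb Om (fun x => u x * partial i psi x) = I leb Om (fun x => partial i psi x * u x).
    by apply: I_eq => x _; rewrite mulrC.
  have -> : I leb Om (fun x => G x ord0 i * psi x) = I leb Om (fun x => psi x * G x ord0 i).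
    by apply: I_eq => x _; rewrite mulrC.
  by rewrite E opprK.
(* N + 1 norms are added; the denominator N + 2 makes the final inequality strict. *)
move=> e e0; pose d := Num.min 1 (e / N.+2%:R).
have d0 : 0 < d by rewrite lt_min ltr01 divr_gt0.
have d1 : d <= 1 by rewrite ge_min lexx.
have [_ _ /(_ _ (powR_gt0 m d0))[psi [tp Lp Ip]]] := W.
exists psi => //; have Wd := W0B adm dom W (W0_test phi tp).
have Lu := W0_L1u adm dom Wd; have LG := W0_L1G adm dom Wd.
have Iu : I leb Om (fun x => P (u x - psi x)) <= d `^ m.
  apply: le_trans (ltW Ip); apply: (I_le mO Lu Lp) => x _; by rewrite /modu lerDl (NPhi_ge0 adm).
have IG : I leb Om (fun x => P (enorm (G x - grad psi x))) <= d `^ m.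
  apply: le_trans (ltW Ip); apply: (I_le mO LG Lp) => x _; by rewrite /modu lerDr (NPhi_ge0 adm).
apply: (@le_lt_trans _ _ (d%:E + \sum_(i < N) d%:E)%E).
  apply: leeD; first exact: (luxemburg_small d0 d1 (W0_meas Wd) Lu Iu).
  apply: lee_sum => i _; have [a [b c]] := coordL _ _ i Wd.
  exact: (luxemburg_small d0 d1 a b (le_trans c IG)).
rewrite sumEFin -EFinD lte_fin sumr_const card_ord -mulrS.
apply: (@le_lt_trans _ _ (e / N.+2%:R *+ N.+1)); first by rewrite lerMn2r ge_min lexx orbT.
by rewrite -[_ *+ N.+1]mulr_natl mulrCA gtr_pMr// ltr_pdivrMr// mul1r ltr_nat.
Qed.

Lemma W10_W0 u G : W10 Om P u G -> W0 u G.
Proof.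
move=> [[[mu _] oG _] H]; have mG : vmeas Om G by move=> i; case: (oG i).
split=> // e e0.
pose K := (2 `^ m) ^+ N * N%:R + 1 : R.
have K1 : 0 < K by rewrite ltr_wpDl// mulr_ge0// exprn_ge0// powR_ge0.
pose d := Num.min 1 (e / (2 * K)).
have d0 : 0 < d by rewrite lt_min ltr01 divr_gt0// mulr_gt0.
have d1 : d <= 1 by rewrite ge_min lexx.
have [psi tp Hn] := H d d0; exists psi.
have s0 : (0 <= \sum_(i < N) luxemburg Om P (fun x => ((G x - grad psi x) ord0 i)%R))%E.
  by apply: sume_ge0 => i _; exact: luxemburg_ge0.
have mup : measurable_fun Om (fun x => u x - psi x).
  by apply: measurable_funB => //; exact: test_meas tp.
have mGp : vmeas Om (fun x => G x - grad psi x) by apply: vmeasB => //; exact: test_vmeas tp.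
have [Lu Iu] : L1 leb Om (fun x => P (u x - psi x)) /\ I leb Om (fun x => P (u x - psi x)) <= d `^ l.
  apply: luxemburg_modular => //; apply: le_lt_trans Hn; exact: leeDl.
have HG i : L1 leb Om (fun x => P ((G x - grad psi x) ord0 i)) /\
    I leb Om (fun x => P ((G x - grad psi x) ord0 i)) <= d `^ l.
  apply: (luxemburg_modular d1 (mGp i)).
  apply: le_lt_trans Hn; rewrite /W1_norm (bigD1 i)//= addeCA.
  by apply: leeDl; apply: adde_ge0; [exact: luxemburg_ge0|apply: sume_ge0 => j _; exact: luxemburg_ge0].
have LS : L1 leb Om (fun x => \sum_i P ((G x - grad psi x) ord0 i)) by apply: (L1_sum mO) => i; case: (HG i).
have LR := L1D mO Lu (L1Z mO ((2 `^ m) ^+ N) LS).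
have b x : modu phi (fun x => u x - psi x) (fun x => G x - grad psi x) x <=
    P (u x - psi x) + (2 `^ m) ^+ N * \sum_i P ((G x - grad psi x) ord0 i).
  by rewrite /modu lerD2l; exact: NPhi_enorm_sum.
have L : L1 leb Om (modu phi (fun x => u x - psi x) (fun x => G x - grad psi x)).
  apply: (L1_le mO (meas_modu adm mup mGp) LR) => x _.
  by rewrite ger0_norm ?(modu_ge0 adm).
split=> //; apply: (le_lt_trans (I_le mO L LR (fun x _ => b x))).
rewrite (I_D mO Lu (L1Z mO _ LS)) (I_Z mO _ LS) (I_sum mO); last by move=> i; case: (HG i).
have S1 : \sum_i I leb Om (fun x => P ((G x - grad psi x) ord0 i)) <= N%:R * d.
  rewrite mulr_natl -[X in _ *+ X](card_ord N) -sumr_const; apply: ler_sum => i _.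
  apply: (le_trans (HG i).2); apply: powR_contract; last exact: ltW (l_gt1 adm).
  by rewrite (ltW d0) d1.
have S2 : I leb Om (fun x => P (u x - psi x)) <= d.
  apply: (le_trans Iu); apply: powR_contract; last exact: ltW (l_gt1 adm).
  by rewrite (ltW d0) d1.
have q0 : 0 <= (2 `^ m) ^+ N :> R by rewrite exprn_ge0// powR_ge0.
apply: (le_lt_trans (lerD S2 (ler_wpM2l q0 S1))).
rewrite mulrA -[X in X + _]mul1r -mulrDl addrC -/K.
have : d <= e / (2 * K) by rewrite ge_min lexx orbT.
move=> /(ler_wpM2l (ltW K1)) /le_lt_trans; apply.
rewrite (_ : K * (e / (2 * K)) = e / 2); last by field; rewrite gt_eqF.
by move: e0; lra.
Qed.

End W10.

(** * Existence *)

Section distance.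
Context {R : realType} {n : nat} (Om : set 'rV[R]_n.+1).
Hypothesis oO : open Om.
Hypothesis bO : bounded_set Om.
Hypothesis Om0 : Om !=set0.
Local Notation dist := (dist_frontier Om).
Implicit Types (x y : 'rV[R]_n.+1).

(** With an empty frontier the distance would be the default infimum 0. In that case Om is compact
    and open, so a fixed translation step never leaves it, against boundedness. *)
Lemma frontier_nonempty : frontier Om !=set0.
Proof.
apply: contrapT => nf; have cO : closure Om `<=` Om.
  by move=> x cx; apply: contrapT => nx; apply: nf; exists x; split=> // /interior_subset.
have cK := compact_closure bO.
have [r r0 Hr] := compact_margin cK oO cO; have [x Ox] := Om0.
have step k : Om (x + (k%:R * r) *: delta_mx ord0 ord0).
  elim: k => [|k IH]; first by rewrite mul0r scale0r addr0.
  apply: (Hr _ _ (@subset_closure _ Om _ IH)).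
  rewrite -natr1 mulrDl mul1r scalerDl addrA [_ + r *: _]addrC addrK enormZ gtr0_norm//.
  rewrite /enorm /dotv (bigD1 ord0)//= big1 ?addr0 ?mxE ?eqxx ?mulr1 ?sqrtr1 ?mulr1//.
  by move=> i i0; rewrite !mxE (negPf i0) mulr0.
have [M M0 HM] := bounded_coord bO.
pose k := (Num.truncn ((M + `|x ord0 ord0|) / r)).+1.
have := HM _ ord0 (step k); rewrite !mxE !eqxx mulr1 => /(le_trans (ler_norm _)).
have : (M + `|x ord0 ord0|) / r < k%:R by exact: truncnS_gt.
by rewrite ltr_pdivrMr//; have := ler_norm (- x ord0 ord0); rewrite normrN; lra.
Qed.

Lemma dist_lb x c : (forall y, frontier Om y -> c <= enorm (x - y)) -> c <= dist x.
Proof.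
move=> H; have [y fy] := frontier_nonempty.
by apply: lb_le_inf; [exists (enorm (x - y)), y|move=> _ [z fz <-]; exact: H].
Qed.

Lemma dist_gt0 x : Om x -> 0 < dist x.
Proof.
move=> Ox; have /nbhs_enorm[e e0 He] : nbhs x Om by apply: open_nbhs_nbhs.
apply: (lt_le_trans e0); apply: dist_lb => y [_ ny]; rewrite leNgt; apply/negP => xy.
by apply: ny; rewrite (interior_id Om).1//; apply: He; rewrite enormBC.
Qed.

Lemma dist_lip x y : dist x <= dist y + enorm (x - y).
Proof.
rewrite -lerBlDr; apply: dist_lb => z fz; rewrite lerBlDr addrC.
exact: le_trans (dist_le x fz) (enorm_triangle x y z).
Qed.

Lemma continuous_dist : continuous dist.
Proof.
move=> x; apply/(@cvgrPdist_lt _ _ _ (nbhs x) (nbhs_filter x)) => e e0; apply/nbhs_enorm; exists e => // y yx.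
by rewrite ltr_norml; have := dist_lip x y; have := dist_lip y x; rewrite (enormBC x y); move: yx; lra.
Qed.

End distance.

(** * Data in the dual space, lower solution, existence and boundedness *)

Section data.
Context {R : realType} {n : nat} (Om : set 'rV[R]_n.+1) (l m : R) (phi : R -> R).
Hypothesis adm : admissible l m phi.
Hypothesis dom : open Om /\ bounded_set Om.
Local Notation h := (hphi phi).
Local Notation P := (NPhi phi).
Local Notation Pc := (complementary (NPhi phi)).
Local Notation leb := (@lebesgue_rv R n.+1).
Local Notation W0 := (W0 Om phi).
Local Notation dist := (dist_frontier Om).
Implicit Types (u w a b f kap : 'rV[R]_n.+1 -> R) (G : 'rV[R]_n.+1 -> 'rV[R]_n.+1).

Let oO : open Om. Proof. by case: dom. Qed.
Let bO : bounded_set Om. Proof. by case: dom. Qed.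
Let mO : measurable Om. Proof. exact: open_rv_measurable. Qed.
Let l1 : 1 < l. Proof. exact: (l_gt1 adm). Qed.

Lemma dualwZ kap c : 0 <= c -> dualw Om phi kap -> dualw Om phi (fun x => c * kap x).
Proof.
move=> c0 [mk D]; split=> [|e e0]; first by apply: measurable_funM => //; exact: measurable_cst.
have c1 : 0 < c + 1 by rewrite ltr_wpDl.
have [g Lg Hg] := D _ (divr_gt0 e0 c1); exists (fun x => c * g x); first exact: (L1Z mO).
apply: aeDS Hg => x _ [k0 H]; split; first exact: mulr_ge0.
move=> s; rewrite -mulrA; apply: (le_trans (ler_wpM2l c0 (H s))); rewrite mulrDr lerD2r.
rewrite mulrA ler_wpM2r ?(NPhi_ge0 adm)// mulrA ler_pdivrMr// mulrC ler_wpM2l ?(ltW e0)//.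
by rewrite lerDl.
Qed.

(** [complementary] is nondecreasing in |t|, and monotone functions are measurable; its continuity
    is not established. *)
Lemma meas_complementary f : measurable_fun Om f -> measurable_fun Om (fun x => Pc (f x)).
Proof.
move=> mf; pose c (t : R) := Pc (Num.max t 0).
have mc : measurable_fun setT c.
  apply: nondecreasing_measurable => // s t st; apply: (complementary_le adm).
  have p (r : R) : 0 <= Num.max r 0 by rewrite le_max lexx orbT.
  by rewrite !(ger0_norm (p _)) ge_max p andbT le_max st.
rewrite (_ : (fun x => _) = c \o (fun x => `|f x|)); last first.
  apply/funext => x /=; rewrite /c (max_idPl _)//; apply/eqP; rewrite eq_le.
  by rewrite !(complementary_le adm)// normr_id.
by apply: measurableT_comp => //; exact: measurableT_comp.
Qed.

Lemma dualw_orlicz kap : orlicz Om Pc kap -> aeD leb Om (fun x => 0 <= kap x) -> dualw Om phi kap.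
Proof.
move=> [mk fin] k0.
have [||lam [lam0 _] [L _]] := luxemburg_lt mO mk _ _ fin.
- by move=> c _; apply: meas_complementary; apply: measurable_funM => //; exact: measurable_cst.
- exact: (complementary_ge0 adm).
(* Young's inequality is applied to K kap and s / K. As K >= 1 and K >= 1 / e, the term in s is at
   most e P s; as K >= 1 / lam, the other term is a dilation of kap / lam by K lam >= 1. *)
split=> // e e0; pose K := 1 + e^-1 + lam^-1.
have ei : 0 < e^-1 by rewrite invr_gt0.
have li : 0 < lam^-1 by rewrite invr_gt0.
have K1 : 1 <= K by rewrite /K -addrA lerDl addr_ge0// ltW.
have K0 := lt_le_trans ltr01 K1.
have Ke : K^-1 <= e by rewrite -[leRHS]invrK lef_pV2 ?posrE// /K; move: ei li; lra.
have Kl : 1 <= K * lam.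
  have : lam^-1 * lam <= K * lam by rewrite ler_wpM2r ?(ltW lam0)// /K; move: ei li; lra.
  by rewrite mulVf// gt_eqF.
exists (fun x => (K * lam) `^ (l / (l - 1)) * Pc (kap x / lam)); first exact: (L1Z mO).
apply: aeDS k0 => x _ k0; split=> // s.
have Y := @complementary_young _ _ _ _ adm (K * kap x) (`|s| / K) (divr_ge0 (normr_ge0 _) (ltW K0)).
rewrite ger0_norm ?mulr_ge0 ?(ltW K0)// in Y.
have E1 : K * kap x * (`|s| / K) = kap x * `|s| by field; rewrite gt_eqF.
rewrite E1 in Y; apply: (le_trans Y); rewrite addrC; apply: lerD.
  rewrite mulrC; apply: (le_trans (NPhi_contract adm _ _ _)).
  - by rewrite invr_ge0 ltW.
  - by rewrite invf_le1.
  - rewrite (NPhi_norm adm) ler_wpM2r ?(NPhi_ge0 adm)//; apply: le_trans Ke; apply: powR_contract; last exact: ltW.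
    by rewrite invr_ge0 (ltW K0)/= invf_le1.
have -> : K * kap x = (K * lam) * (kap x / lam) by field; rewrite gt_eqF.
exact: (complementary_scale adm).
Qed.

(** The case gam = 0, b = 1 of [dualw_powR] for u = 0, where 0 to the power 0 is 1. *)
Lemma dualw_cst : dualw Om phi (fun=> 1).
Proof.
have L1P : L1 leb Om (fun x => (1 : R) `^ (l / (l - 0 - 1))) by exact: (L1_cst dom).
have LP0 : L1 leb Om (fun x => P 0) by exact: (L1_cst dom).
have := dualw_powR adm dom (gam := 0) (b := fun=> 1) (u := fun=> 0) (lexx 0) _ _ _ L1P _ _ LP0.
rewrite subr_gt0 l1 => /(_ isT) D; have {}D := D (measurable_cst _) (aeDT _ (fun _ _ => ler01)) (measurable_cst _) (aeDT _ (fun _ _ => lexx _)).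
rewrite (_ : (fun=> 1) = fun x : 'rV[R]_n.+1 => 1 * 0 `^ 0 :> R)//.
by apply/funext => x; rewrite powRr0 mulr1.
Qed.

Hypothesis cO : connected Om.
Hypothesis Om0 : Om !=set0.
Hypothesis sb : smooth_boundary Om.

(* Tested with the truncated paraboloids of rational centres and radii. *)
Lemma ae0_of_orthogonal f : measurable_fun Om f -> aeD leb Om (fun x => 0 <= f x) ->
  (forall psi H, W0 psi H -> L1 leb Om (fun x => f x * psi x) /\ I leb Om (fun x => f x * psi x) = 0) ->
  aeD leb Om (fun x => f x = 0).
Proof.
move=> mf f0 orth.
have E (j : 'rV[rat]_n.+1 * rat) : aeD leb Om (fun x => 0 < ratr j.2 :> R -> eball (ratv j.1) (ratr j.2) `<=` Om ->
    enorm (x - ratv j.1) < ratr j.2 -> f x = 0).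
  have [H|nH] := pselect (0 < ratr j.2 :> R /\ eball (ratv j.1) (ratr j.2) `<=` Om); last first.
    by apply: aeDT => x _ a b; exfalso; exact: nH.
  have [r0 BO] := H; set z := ratv j.1 in BO *; set r := ratr j.2 in r0 BO *.
  pose v x := r ^+ 2 - sqdist z x.
  have sv : smooth v by apply/smoothP => k; apply: Ck_B; [exact: Ck_cst|exact: Ck_sqdist].
  have vK x : ~ eball z r x -> v x <= 0.
    by rewrite (eball_sqdist _ (ltW r0)) => /negP; rewrite -ltNge subr_le0 => /ltW.
  have [L I0] := orth _ _ (W0_trunc_smooth adm dom sv (@compact_eball _ _ z r) BO vK).
  have p0 : aeD leb Om (fun x => 0 <= f x * Num.max (v x - 0) 0).
    by apply: aeDS f0 => x _ f0; rewrite mulr_ge0// le_max lexx orbT.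
  apply: aeDS (I_eq0 mO L p0 (eq_ler I0)) => x _ e _ _ xr; move/eqP: e; rewrite mulf_eq0 => /orP[/eqP//|].
  by rewrite subr0 gt_eqF// lt_max subr_gt0 sqdistE ltr_sqr ?nnegrE ?enorm_ge0 ?(ltW r0)// xr.
apply: aeDS (aeD_count E) => x Ox Hx.
have /nbhs_enorm[e e0 He] : nbhs x Om by apply: open_nbhs_nbhs.
have e4 : 0 < e / 4 by rewrite divr_gt0.
have [q Hq] := ratv_dense x e4.
have lt : e / 4 < e / 2 by move: e0; lra.
have [s] := rat_in_itvoo lt; rewrite in_itv/= => /andP[s1 s2].
apply: (Hx (q, s)) => /=; first exact: lt_trans s1.
  move=> y; rewrite /eball/= => ys; apply: He; apply: (le_lt_trans (enorm_triangle y (ratv q) x)).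
  by move: ys Hq s2 e0; lra.
by rewrite enormBC; exact: lt_trans s1.
Qed.

(** The datum min(a, 1) max(w, 1)^(- alpha) is bounded by 1, so w exists before any lower bound is
    known; afterwards it lies below a w^(- alpha), which makes w a starting point for the
    iteration. *)
Lemma lower_solution alpha a : 0 < alpha -> measurable_fun Om a ->
  aeD leb Om (fun x => 0 <= a x) -> ~ aeD leb Om (fun x => a x = 0) ->
  exists w Gw fw, [/\ ws Om phi w Gw fw, aeD leb Om (fun x => 0 < w x),
    aeD leb Om (fun x => fw x <= a x * w x `^ (- alpha)) &
    exists2 C : R, 0 < C & aeD leb Om (fun x => C * dist x <= w x)].
Proof.
move=> al ma a0 na; pose a1 x := Num.min (a x) 1.
have ma1 : measurable_fun Om a1 by apply: measurable_minr => //; exact: measurable_cst.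
have a10 : aeD leb Om (fun x => 0 <= a1 x) by apply: aeDS a0 => x _ a0; rewrite le_min a0 ler01.
have D1 : dualw Om phi (fun x => a1 x * 1 `^ (- alpha) + 0).
  apply: (dualw_le _ _ dualw_cst).
    by apply: measurable_funD => //; apply: measurable_funM => //; exact: measurable_cst.
  by apply: aeDS a10 => x _ a0'; rewrite powR1 mulr1 addr0 a0' ge_min lexx orbT.
have [|w [Gw Ew]] := exist_ws adm dom ord0 (r := fun=> 0) (w := fun=> 1) al ma1 (measurable_cst _) (measurable_cst _) _ D1.
  by apply: aeDS a10 => x _ a0'; split.
have f0 : aeD leb Om (fun x => 0 <= a1 x * Num.max (w x) 1 `^ (- alpha) + 0).
  by apply: aeDS a10 => x _ a0'; rewrite addr0 mulr_ge0// powR_ge0.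
have sup := ws_supersolution adm dom Ew f0; have [Ww w0 _] := sup.
(* If w vanished, so would its gradient, and the equation would make min(a, 1) orthogonal to W0,
   hence zero, and a as well. *)
have nw : ~ aeD leb Om (fun x => w x = 0).
  move=> w00; apply: na; have [_ EQ] := Ew; have [LA Lf EQw] := EQ _ _ Ww.
  have I0 : I leb Om (fun x => dotv (Afield phi (Gw x)) (Gw x)) <= 0.
    rewrite EQw; apply: eq_ler; rewrite -[RHS](I_0 leb Om); apply: (I_ae mO (L1_meas Lf)) => //.
    by apply: aeDS w00 => x _ ->; rewrite mulr0.
  have A0 : aeD leb Om (fun x => 0 <= dotv (Afield phi (Gw x)) (Gw x)).
    by apply: aeDT => x _; rewrite Afield_self mulr_ge0 ?(hphi_ge0 adm) ?enorm_ge0.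
  have G0 : aeD leb Om (fun x => enorm (Gw x) = 0).
    apply: aeDS (I_eq0 mO LA A0 I0) => x _; rewrite Afield_self => /eqP; rewrite mulf_eq0 => /orP[/eqP//|h0].
    apply/eqP; rewrite eq_le enorm_ge0 andbT leNgt; apply/negP => /(hphi_gt0 adm).
    by rewrite (eqP h0) ltxx.
  have : aeD leb Om (fun x => a1 x = 0).
    apply: ae0_of_orthogonal => // psi H Wp; have [L2 L3 EQ2] := EQ _ _ Wp.
    have E1 : aeD leb Om (fun x => (a1 x * Num.max (w x) 1 `^ (- alpha) + 0) * psi x = a1 x * psi x).
      by apply: aeDS w00 => x _ ->; rewrite (max_idPr ler01) powR1 mulr1 addr0.
    have m1 : measurable_fun Om (fun x => a1 x * psi x) by apply: measurable_funM => //; exact: W0_meas Wp.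
    split; first exact: (L1_eq_ae mO m1 E1 L3).
    rewrite -(I_ae mO (L1_meas L3) m1 E1) -EQ2 -[RHS](I_0 leb Om); apply: (I_ae mO (L1_meas L2)) => //.
    by apply: aeDS G0 => x _ /enorm_eq0 ->; rewrite /Afield scaler0 -(scale0r (0 : 'rV[R]_n.+1)) dotvZl mul0r.
  by apply: aeDS => x _; rewrite /a1; case: (ltP (a x) 1) => // _ /eqP; rewrite oner_eq0.
have [C C0 HC] := hopf oO bO sb adm cO sup nw.
have wp : aeD leb Om (fun x => 0 < w x).
  by apply: aeDS HC => x Ox; apply: lt_le_trans; rewrite mulr_gt0// dist_gt0.
exists w, Gw, (fun x => a1 x * Num.max (w x) 1 `^ (- alpha) + 0); split; [exact: Ew|exact: wp| |by exists C].
apply: aeDS2 a0 wp => x _ a0' wp; rewrite addr0; apply: ler_pM.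
- by rewrite le_min a0' ler01.
- exact: powR_ge0.
- by rewrite ge_min lexx.
- rewrite !powRN lef_pV2 ?posrE ?powR_gt0 ?lt_max ?wp//.
  by apply: ge0_ler_powR; rewrite ?nnegrE ?le_max ?(ltW wp) ?(ltW al) ?lexx.
Qed.

Lemma existence alpha gam a b : 0 < alpha -> 0 <= gam -> gam < l - 1 ->
  measurable_fun Om b -> aeD leb Om (fun x => 0 <= a x) -> aeD leb Om (fun x => 0 <= b x) ->
  ~ aeD leb Om (fun x => a x = 0) ->
  orlicz Om Pc (fun x => a x * dist x `^ (- alpha)) ->
  L1 leb Om (fun x => b x `^ (l / (l - gam - 1))) ->
  [/\ measurable_fun Om a, dualw Om phi a & exists u G C,
    [/\ ws Om phi u G (fun x => a x * u x `^ (- alpha) + b x * u x `^ gam),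
      aeD leb Om (fun x => 0 < u x), 0 < C & aeD leb Om (fun x => C * dist x <= u x)]].
Proof.
move=> al g0 gl mb a0 b0 na oa Lb.
have md : measurable_fun Om dist by apply: continuous_rv_measurable; exact: continuous_dist.
(* Measurability is given for a d^(- alpha); multiplication by d^alpha recovers a, because d > 0 on
   Om. *)
have ma : measurable_fun Om a.
  apply: (eq_measurable_fun (fun x => a x * dist x `^ (- alpha) * dist x `^ alpha)).
    move=> x /set_mem Ox; have d0 := dist_gt0 oO bO Om0 Ox.
    by rewrite -mulrA -powRD ?(gt_eqF d0) ?implybT// addNr powRr0 mulr1.
  by apply: measurable_funM; [case: oa|exact: meas_powR].
have k0 : aeD leb Om (fun x => 0 <= a x * dist x `^ (- alpha)).
  by apply: aeDS a0 => x _ a0; rewrite mulr_ge0// powR_ge0.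
have dk := dualw_orlicz oa k0; have [D D0 HD] := dist_bounded bO.
(* As d is bounded on Om, a is at most a constant times a d^(- alpha). *)
have da : dualw Om phi a.
  apply: (dualw_le ma _ (dualwZ (powR_ge0 D alpha) dk)); apply: aeDS a0 => x Ox a0'.
  have d0 := dist_gt0 oO bO Om0 Ox; rewrite a0'/= mulrCA ler_peMr//.
  rewrite powRN -(ler_pM2r (powR_gt0 alpha d0)) mul1r divfK ?gt_eqF ?powR_gt0//.
  by apply: ge0_ler_powR; rewrite ?nnegrE ?(ltW al) ?(ltW d0) ?HD.
split=> //; have [w [Gw [fw [Ew wp fle [C C0 HC]]]]] := lower_solution al ma a0 na.
have mw := W0_meas (ws_W0 Ew).
have dkw : dualw Om phi (fun x => a x * w x `^ (- alpha)).
  apply: (dualw_le _ _ (dualwZ (powR_ge0 C (- alpha)) dk)).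
    by apply: measurable_funM => //; exact: meas_powR.
  apply: aeDS3 a0 HC wp => x Ox a0' HC wp; rewrite mulr_ge0 ?powR_ge0//= mulrCA ler_wpM2l//.
  have d0 := dist_gt0 oO bO Om0 Ox; rewrite -powRM ?(ltW C0) ?(ltW d0)//.
  rewrite !powRN lef_pV2 ?posrE ?powR_gt0 ?mulr_gt0//.
  by apply: ge0_ler_powR; rewrite ?nnegrE ?(ltW al) ?(ltW wp)// mulr_ge0 ?ltW.
have abw : aeD leb Om (fun x => [/\ 0 <= a x, 0 <= b x & 0 < w x]).
  by apply: aeDS3 a0 b0 wp.
have [u [G [Eu wu]]] := singular_solution adm dom ord0 al g0 gl ma mb abw Lb Ew fle dkw.
exists u, G, C; split=> //; first by apply: aeDS2 wp wu => x _; exact: lt_le_trans.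
by apply: aeDS2 HC wu => x _; exact: le_trans.
Qed.

Lemma solution_bounded alpha gam a b u G (q B : R) : l < n.+1%:R ->
  0 < alpha -> 0 <= gam -> gam < l - 1 ->
  aeD leb Om (fun x => 0 <= a x) -> measurable_fun Om a -> dualw Om phi a ->
  n.+1%:R / l < q -> L1 leb Om (fun x => `|a x| `^ q) ->
  aeD leb Om (fun x => `|b x| <= B) -> aeD leb Om (fun x => 0 < u x) ->
  ws Om phi u G (fun x => a x * u x `^ (- alpha) + b x * u x `^ gam) ->
  exists M, aeD leb Om (fun x => u x <= M).
Proof.
move=> lN al g0 gl a0 ma da qN La bB up [W EQ].
have u0 : aeD leb Om (fun x => 0 <= u x) by apply: aeDS up => x _; exact: ltW.
have mu := W0_meas W; have mG := W0_vmeas W; have mE := vmeas_enorm mG.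
have LPu := W0_L1u adm dom W; have LPG := W0_L1G adm dom W.
have LhG : L1 leb Om (fun x => h (enorm (G x)) * enorm (G x)).
  by apply: (L1_hphi adm dom mE mE _ _ LPG LPG) => x; exact: enorm_ge0.
have Lul : L1 leb Om (fun x => `|u x| `^ l).
  apply: (L1_NPhi_powR adm dom (le_trans ler01 (ltW l1)) (lexx l)) => //.
    exact: measurableT_comp.
  by apply: (L1_eq mO _ LPu) => x _; rewrite (NPhi_norm adm).
apply: (W0_bounded (a := fun x => `|a x|) (C1 := `|B|) adm dom lN W u0 qN) => //.
  exact: measurableT_comp.
move=> k k1; have k0 := le_trans ler01 k1.
have Wz := W0_trunc adm dom k0 W; set z := fun x => Num.max _ 0 in Wz *.
have mb : measurable_fun Om (fun x => (k < u x)%R%:R : R).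
  by apply: meas_lt => //; exact: measurable_cst.
have Laz : L1 leb Om (fun x => `|a x| * z x).
  apply: (dualw_L1 dom da (W0_L1u adm dom Wz)).
    by apply: measurable_funM; [exact: measurableT_comp|exact: W0_meas Wz].
  by apply: aeDS a0 => x _ a0; rewrite normrM normr_id (ger0_norm a0).
split=> //; have [LA Lf E] := EQ _ _ Wz.
have LcG := L1_boolM dom mb LPG; have Lcu := L1_boolM dom mb Lul.
apply: (@le_trans _ _ (I leb Om (fun x => dotv (Afield phi (G x)) ((k < u x)%R%:R *: G x)))).
  apply: (I_le mO LcG LA) => x _; rewrite dotvZr Afield_self; apply: ler_wpM2l => //.
  apply: le_trans (NPhi_th_low adm (enorm_ge0 _)); rewrite ler_peMl ?(NPhi_ge0 adm)//; exact: ltW.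
rewrite E -(I_Z mO _ Lcu) -(I_D mO Laz (L1Z mO _ Lcu)).
apply: (I_le_ae mO Lf (L1D mO Laz (L1Z mO _ Lcu))).
apply: aeDS3 a0 bB up => x _ a0' bB up; rewrite /z.
have [uk|ku] := leP (u x) k.
  rewrite (max_idPr _) ?subr_le0// !mulr0 add0r !mul0r mulr0//.
rewrite (max_idPl _) ?subr_ge0 ?(ltW ku)// mul1r mulrDl.
have u1 : 1 <= u x := le_trans k1 (ltW ku); have d0 : 0 <= u x - k by rewrite subr_ge0 ltW.
apply: lerD.
  rewrite ger0_norm// ler_wpM2r// ler_piMr// powRN invf_le1 ?powR_gt0//.
  by rewrite -[X in X <= _](powRr0 (u x)); apply: ler_powR => //; exact: ltW.
(* As u >= 1 and gam + 1 < l, the product u^gam (u - k) is at most u^l. *)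
rewrite (gtr0_norm up); apply: (@le_trans _ _ (`|B| * u x `^ gam * u x)).
  apply: (@le_trans _ _ (`|B| * u x `^ gam * (u x - k))).
    rewrite ler_wpM2r// ler_wpM2r ?powR_ge0// (le_trans (ler_norm _))// (le_trans bB)//.
    exact: ler_norm.
  by rewrite ler_wpM2l ?mulr_ge0 ?powR_ge0// gerBl.
rewrite -mulrA ler_wpM2l// -[X in _ * X]powRr1 ?(ltW up)// -powRD ?(gt_eqF up) ?implybT//.
by apply: ler_powR => //; move: gl; lra.
Qed.

End data.

(** * Translation of the L^p hypotheses *)

Section lebesgue_spaces.
Context {R : realType} {n : nat} (Om : set 'rV[R]_n).
Local Notation leb := (@lebesgue_rv R n).
Implicit Types (f u b : 'rV[R]_n -> R).

Lemma Lp_space_L1 f (p : R) : 0 < p -> Lp_space Om p%:E f -> L1 leb Om (fun x => `|f x| `^ p).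
Proof.
move=> p0 [mf fin]; apply: L1_integral_lty.
- by apply: meas_powR; exact: measurableT_comp.
- by move=> x; exact: powR_ge0.
move: fin; rewrite /finite_norm => /(poweR_lty p); rewrite poweR_Lnorm ?gt_eqF// => /(le_lt_trans _); apply.
rewrite [leLHS]integral_mkcond le_eqVlt; apply/orP; left; apply/eqP.
apply: (@eq_integral _ _ _ leb setT) => x _; rewrite patchE /= patchE.
by case: ifPn => _ //; rewrite normr0 powR0// gt_eqF.
Qed.

Lemma Linfty_bound f : Lp_space Om +oo f -> exists B, aeD leb Om (fun x => `|f x| <= B).
Proof.
move=> [_ fin]; move: fin; rewrite /finite_norm Lnorm.unlock; case: ifPn => [_ fin|/negP nT].
  have H := ess_sup_ge leb (abse \o (EFin \o f \_ Om)); set y := ess_sup _ _ in fin H.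
  exists (fine y); apply: filterS H => x Hx Ox; move: Hx; rewrite /= patchE mem_set//.
  by move: fin; case: y => [r| |]//= _; rewrite lee_fin.
(* In the default branch of the norm the whole space is a null set, so every bound holds almost
   everywhere. *)
exists 0; exists setT; split=> //; apply/eqP; rewrite eq_le measure_ge0 andbT leNgt; exact/negP.
Qed.

Lemma Linfty_of_bound u M : measurable_fun Om u -> aeD leb Om (fun x => 0 <= u x) ->
  aeD leb Om (fun x => u x <= M) -> Lp_space Om +oo u.
Proof.
move=> mu u0 uM; split=> //; rewrite /finite_norm Lnorm.unlock; case: ifPn => // _.
apply: le_lt_trans (ltry `|M|); apply/ess_supP.
have H := aeDI u0 uM; rewrite /aeD in H; move: H; apply: filterS => x uM'; rewrite /= patchE; case: ifPn => [/set_mem Ox|_]; last first.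
  by rewrite lee_fin normr0.
by have [a b] := uM' Ox; rewrite lee_fin ger0_norm// (le_trans b)// ler_norm.
Qed.

End lebesgue_spaces.

Theorem theorem2p2 (R : realType) (N : nat) (Omega : set 'rV[R]_N)
    (alpha gamma l m sigma : R) (phi : R -> R) (a b : 'rV[R]_N -> R)
    (hN : (2 <= N)%N)
    (hOmega : bounded_domain Omega)
    (hbd : smooth_boundary Omega)
    (halpha : 0 < alpha)
    (phi_gt0 : forall t : R, 0 < t -> 0 < phi t)
    (phi_C1 : forall t : R, 0 < t ->
       derivable phi t 1 /\ {for t, continuous (derive1 phi)})
    (phi_0 : t * phi t @[t --> 0^'+] --> (0 : R))
    (phi_oo : t * phi t @[t --> +oo] --> +oo)
    (phi_incr : forall s t : R, 0 < s -> s < t -> s * phi s < t * phi t)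
    (hl : 1 < l < N%:R)
    (hm : 1 < m < N%:R)
    (phi_lm : forall t : R, 0 < t ->
       l - 1 <= derive1 (fun s => s * phi s) t / phi t <= m - 1)
    (hgamma : 0 <= gamma < l - 1)
    (a_ge0 : {ae lebesgue_rv N, forall x, Omega x -> 0 <= a x})
    (a_neq0 : ~ {ae lebesgue_rv N, forall x, Omega x -> a x = 0})
    (a_orlicz : orlicz Omega (complementary (NPhi phi))
       (fun x => a x * dist_frontier Omega x `^ (- alpha)))
    (b_ge0 : {ae lebesgue_rv N, forall x, Omega x -> 0 <= b x})
    (hsigma : l / (l - gamma - 1) < sigma)
    (b_Lsigma : Lp_space Omega sigma%:E b) :
  exists u : 'rV[R]_N -> R,
  [/\ weak_solution Omega phi alpha gamma a b u,
      exists2 C : R, 0 < C & {ae lebesgue_rv N, forall x, Omega x ->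
        C * dist_frontier Omega x <= u x} &
      forall q : R,
        N%:R / l < q <= q_exp N l alpha (alpha + gamma) ->
        Lp_space Omega +oo b ->
        (alpha <= 1 /\ Lp_space Omega q%:E a /\
           Lp_space Omega
             (sobolev_exp N l / (sobolev_exp N l + alpha - 1))%:E a) \/
        (1 < alpha /\ Lp_space Omega q%:E a) ->
        Lp_space Omega +oo u].
Proof.
case: N => [//|n] in Omega a b hN hOmega hbd hl hm a_ge0 a_neq0 a_orlicz b_ge0 b_Lsigma *.
have [oO cO Om0 bO] := hOmega; have dom : open Omega /\ bounded_set Omega by [].
have mO := open_rv_measurable oO.
have /andP[l1 lN] := hl; have /andP[g0 gl] := hgamma.
have adm : admissible l m phi by split.
have p0 : 0 < l / (l - gamma - 1) by apply: divr_gt0; move: l1 gl; lra.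
have s0 := lt_trans p0 hsigma.
have Ls := Lp_space_L1 s0 b_Lsigma; have mb : measurable_fun Omega b by case: b_Lsigma.
have Lb : L1 (lebesgue_rv n.+1) Omega (fun x => b x `^ (l / (l - gamma - 1))).
  apply: (L1_ae mO (meas_powR _ mb) (L1D mO (L1_cst dom 1) Ls)).
  apply: aeDS b_ge0 => x _ b0; rewrite (ger0_norm (powR_ge0 _ _)) (ger0_norm b0).
  (* Om has finite measure, and b^p <= 1 + b^sigma for the smaller exponent p = l / (l - gamma -
     1). *)
  have [b1|/ltW b1] := leP (b x) 1.
    apply: (@le_trans _ _ (1 `^ (l / (l - gamma - 1)))); last by rewrite powR1 lerDl powR_ge0.
    by apply: ge0_ler_powR; rewrite ?nnegrE ?(ltW p0).
  by rewrite ler_wpDl// ler_powR// ltW.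
have [ma da [u [G [C [Eu up C0 HC]]]]] :=
  existence adm dom cO Om0 hbd halpha g0 gl mb a_ge0 b_ge0 a_neq0 a_orlicz Lb.
exists u; split; [|by exists C|].
  exists G; split; [exact: (W0_W10 adm dom (ws_W0 Eu))|exact: up|].
  move=> psi H /(W10_W0 adm dom) Wp lhs rhs; have [_ EQ] := Eu.
  have El : (fun x => dotv (Afield phi (G x)) (H x)) = lhs.
    by apply/funext => x; rewrite /Afield dotvZl.
  have Er : (fun x => (a x * u x `^ (- alpha) + b x * u x `^ gamma) * psi x) = rhs.
    by apply/funext => x; rewrite powRN.
  by have := EQ _ _ Wp; rewrite El Er -!IE.
move=> q /andP[qN _] /Linfty_bound[B HB] Ha.
have q0 : 0 < q by apply: lt_trans qN; rewrite divr_gt0 ?ltr0n// (lt_trans ltr01).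
have La : L1 (lebesgue_rv n.+1) Omega (fun x => `|a x| `^ q).
  by apply: (Lp_space_L1 q0); case: Ha => [[_ []]|[]].
have [M HM] := solution_bounded adm dom lN halpha g0 gl a_ge0 ma da qN La HB up Eu.
apply: Linfty_of_bound HM; first exact: W0_meas (ws_W0 Eu).
by apply: aeDS up => x _; exact: ltW.
Qed.
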